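(* Let $M$ be a factor with a faithful normal semifinite weight $\phi$ and let $\theta$ be a unital normal endomorphism of $M$ which is equimodular with respect to $\phi$. If $$\bigl(\theta(M)\cup(M\cap\theta(M)')\bigr)''=M,$$ then $\theta$ is modularly extendable.
   Context: All Hilbert spaces are separable, all von Neumann algebras have separable predual, and all endomorphisms are $*$-preserving. For a faithful normal semifinite weight $\phi$ on $M$, let $\mathfrak{N}_\phi=\{x\in M:\phi(x^*x)<\infty\}$, let $\mathcal{H}_\phi$ be the GNS Hilbert space with canonical map $\mathfrak{N}_\phi\ni x\mapsto x_\phi\in\mathcal{H}_\phi$, and let $J_\phi$ be the modular conjugation; $M$ is identified with its image in $\mathcal{B}(\mathcal{H}_\phi)$. A unital normal endomorphism $\theta$ of $M$ is equimodular with respect to $\phi$ if $\phi(\theta(x))=\phi(x)$ for all $x\in M^+$ and $u_\theta J_\phi=J_\phi u_\theta$, where $u_\theta\in\mathcal{B}(\mathcal{H}_\phi)$ is the isometry determined by $u_\theta(x_\phi)=(\theta(x))_\phi$ for $x\in\mathfrak{N}_\phi$. A normal unital endomorphism $\theta$ of a factor $M$ is modularly extendable if, for some (equivalently, every) faithful normal semifinite weight $\phi$ on $M$, there exists a normal endomorphism $\widetilde\theta_\phi$ of $\mathcal{B}(\mathcal{H}_\phi)$ with $\widetilde\theta_\phi(xy')=\theta(x)\,J_\phi\theta(J_\phi y'J_\phi)J_\phi$ for all $x\in M$, $y'\in M'$. *)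

(* Defs.v *)
From HB Require Import structures.
From mathcomp Require Import all_boot all_order all_algebra complex.
From mathcomp Require Import all_classical all_reals all_analysis.
Set Implicit Arguments.
Unset Strict Implicit.
Unset Printing Implicit Defensive.
Import Order.TTheory GRing.Theory Num.Theory.
Import numFieldNormedType.Exports.
Local Open Scope classical_set_scope.
Local Open Scope ring_scope.
Local Open Scope complex_scope.

(* Separable complex Hilbert spaces. The inner product is linear in its first
   argument and conjugate-linear in its second. *)
Record hilbert (R : realType) := Hilbert {
  hilbert_car :> completeNormedModType R[i] ;
  dot : {dot hilbert_car for Num.conj} ;
  dot_norm : forall v : hilbert_car, dot v v = `|v| ^+ 2 ;
  hilbert_separable : exists D : set hilbert_car, countable D /\ dense D }.

Section Operators.
Context {R : realType} {H : hilbert R}.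
Implicit Types (x y s t : H -> H) (A D : set (H -> H)).

(* Operators are bare functions H -> H; B(H) is the set of those which are
   linear and continuous. *)
Definition bounded_ops : set (H -> H) := [set x | linear x /\ continuous x].

(* By the Riesz representation theorem the adjoint of an element of
   bounded_ops exists and is unique; adj x is a junk value for other x. *)
Definition adj x : H -> H :=
  xget (fun=> 0) [set y | bounded_ops y /\
                          forall v w : H, dot H (x v) w = dot H v (y w)].

(* The order of R[i] is partial: 0 <= z says that z is real and nonnegative. *)
Definition positive_op x : Prop :=
  bounded_ops x /\ forall v : H, 0 <= dot H (x v) v.

Definition le_op x y : Prop := positive_op (y \- x).

Definition directed_ops D : Prop :=
  D !=set0 /\
  forall x y, D x -> D y -> exists z, [/\ D z, le_op x z & le_op y z].

Definition lub_ops D s : Prop :=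
  (forall x, D x -> le_op x s) /\
  (forall t, (forall x, D x -> le_op x t) -> le_op s t).

Definition commutant A : set (H -> H) :=
  [set x | bounded_ops x /\ forall y, A y -> x \o y = y \o x].

Definition bicommutant A : set (H -> H) := commutant (commutant A).

Definition von_neumann_algebra A : Prop :=
  [/\ A `<=` bounded_ops, (forall x, A x -> A (adj x)) & bicommutant A = A].

Definition von_neumann_factor A : Prop :=
  von_neumann_algebra A /\
  A `&` commutant A = range (fun (a : R[i]) (v : H) => a *: v).

Definition positive_part A : set (H -> H) := A `&` positive_op.

(* A bounded increasing net is represented by its range, a directed set. *)
Definition normal_map A (theta : (H -> H) -> (H -> H)) : Prop :=
  forall D s, D `<=` positive_part A -> directed_ops D -> lub_ops D s ->
    lub_ops (theta @` D) (theta s).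

(* Maps and weights on A are total functions, only constrained (and only
   used) on A, respectively on the positive part of A. *)
Definition normal_endomorphism A (theta : (H -> H) -> (H -> H)) : Prop :=
  [/\ (forall x, A x -> A (theta x)),
      (forall (a : R[i]) x y, A x -> A y ->
         theta ((a \*: x) \+ y) = (a \*: theta x) \+ theta y),
      (forall x y, A x -> A y -> theta (x \o y) = theta x \o theta y),
      (forall x, A x -> theta (adj x) = adj (theta x)) &
      normal_map A theta].

Definition unital (theta : (H -> H) -> (H -> H)) : Prop := theta id = id.

Definition weight A (phi : (H -> H) -> \bar R) : Prop :=
  [/\ (forall x, positive_part A x -> (0 <= phi x)%E),
      (forall x y, positive_part A x -> positive_part A y ->
         phi (x \+ y) = (phi x + phi y)%E) &
      (forall (a : R) x, 0 <= a -> positive_part A x ->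
         phi (a%:C \*: x) = (a%:E * phi x)%E)].

Definition faithful_weight A (phi : (H -> H) -> \bar R) : Prop :=
  forall x, positive_part A x -> phi x = 0%E -> x = (fun=> 0).

Definition normal_weight A (phi : (H -> H) -> \bar R) : Prop :=
  forall D s, D `<=` positive_part A -> directed_ops D -> lub_ops D s ->
    phi s = ereal_sup (phi @` D).

Definition semifinite_weight A (phi : (H -> H) -> \bar R) : Prop :=
  bicommutant [set x | positive_part A x /\ (phi x < +oo)%E] = A.

Definition nsf_weight A (phi : (H -> H) -> \bar R) : Prop :=
  [/\ weight A phi, faithful_weight A phi, normal_weight A phi &
      semifinite_weight A phi].

Definition square_finite A (phi : (H -> H) -> \bar R) : set (H -> H) :=
  [set x | A x /\ (phi (adj x \o x) < +oo)%E].

End Operators.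

Section Modular.
Context {R : realType} {H K : hilbert R}.
Implicit Types (M : set (H -> H)) (phi : (H -> H) -> \bar R).
Implicit Types (Lambda : (H -> H) -> K) (J : K -> K).

(* K is the GNS space of phi, Lambda x is the vector x_phi and rho is the
   action of M on K. These data are unique up to a unitary operator; the
   identity for norms determines the inner products by polarization. *)
Definition gns M phi Lambda (rho : (H -> H) -> (K -> K)) : Prop :=
  [/\ (forall (a : R[i]) x y,
         square_finite M phi x -> square_finite M phi y ->
         Lambda ((a \*: x) \+ y) = a *: Lambda x + Lambda y),
      (forall x, square_finite M phi x ->
         `|Lambda x| ^+ 2 = (fine (phi (adj x \o x)))%:C),
      dense (Lambda @` square_finite M phi) &
      (forall x, M x -> bounded_ops (rho x) /\
         forall y, square_finite M phi y -> rho x (Lambda y) = Lambda (x \o y))].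

(* Unbounded operators on K are given by their graphs. A set G that equals the
   graph of the adjoint of G is a linear subspace, and it is single-valued when
   its domain is dense. *)
Definition positive_selfadjoint (G : set (K * K)) : Prop :=
  [/\ dense [set p.1 | p in G],
      G = [set q | forall p, G p -> dot K p.2 q.1 = dot K p.1 q.2] &
      (forall p, G p -> 0 <= dot K p.2 p.1)].

Definition conjugation J : Prop :=
  [/\ (forall (a : R[i]) (v w : K), J (a *: v + w) = a^* *: J v + J w),
      (forall v : K, `|J v| = `|v|) &
      (forall v : K, J (J v) = v)].

Definition tomita_graph M phi Lambda : set (K * K) :=
  closure [set p | exists x, [/\ square_finite M phi x,
    square_finite M phi (adj x) & p = (Lambda x, Lambda (adj x))]].

(* The polar decomposition S = J Delta^(1/2) of Tomita's closed operator S;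
   G is the graph of Delta^(1/2) = |S|. As J is injective, uniqueness of the
   polar decomposition determines J. *)
Definition modular_conjugation M phi Lambda J : Prop :=
  conjugation J /\
  exists G, positive_selfadjoint G /\
    tomita_graph M phi Lambda = [set (p.1, J p.2) | p in G].

End Modular.

Section Endomorphisms.
Context {R : realType} {H : hilbert R}.
Implicit Types (M : set (H -> H)) (phi : (H -> H) -> \bar R).
Implicit Types (theta : (H -> H) -> (H -> H)).

Definition equimodular M phi theta : Prop :=
  (forall x, positive_part M x -> phi (theta x) = phi x) /\
  exists (K : hilbert R) (Lambda : (H -> H) -> K)
         (rho : (H -> H) -> (K -> K)) (J u : K -> K),
    [/\ gns M phi Lambda rho,
        modular_conjugation M phi Lambda J,
        bounded_ops u /\ (forall v : K, `|u v| = `|v|),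
        (forall x, square_finite M phi x -> u (Lambda x) = Lambda (theta x)) &
        u \o J = J \o u].

(* As M is not assumed to act on the GNS space K, it is identified with its
   image rho @` M; for y' in the commutant of that image, y is the element of
   M identified with J y' J. *)
Definition modularly_extendable_wrt M phi theta : Prop :=
  exists (K : hilbert R) (Lambda : (H -> H) -> K)
         (rho : (H -> H) -> (K -> K)) (J : K -> K)
         (ext : (K -> K) -> (K -> K)),
    [/\ gns M phi Lambda rho,
        modular_conjugation M phi Lambda J,
        normal_endomorphism bounded_ops ext &
        forall y', commutant (rho @` M) y' ->
          exists y, [/\ M y, rho y = J \o y' \o J &
            forall x, M x ->
              ext (rho x \o y') = rho (theta x) \o (J \o rho (theta y) \o J)]].

Definition modularly_extendable M theta : Prop :=
  exists phi, nsf_weight M phi /\ modularly_extendable_wrt M phi theta.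

End Endomorphisms.

(* Main.v *)
Require Import Defs.
From HB Require Import structures.
From mathcomp Require Import all_boot all_order all_algebra complex.
From mathcomp Require Import all_classical all_reals all_analysis.
From mathcomp Require Import ring lra.
Set Implicit Arguments.
Unset Strict Implicit.
Unset Printing Implicit Defensive.
Import Order.TTheory GRing.Theory Num.Theory.
Import numFieldNormedType.Exports.
Local Open Scope classical_set_scope.
Local Open Scope ring_scope.

(* Let W be the space of bounded operators w on the GNS space K such that w rho(x) = rho(theta x) w
   and w J rho(x) J = J rho(theta x) J w for x in M; the isometry u belongs to W. By Tomita's theorem
   J rho(M) J is the commutant of rho(M), so w1^* w2 is in the center of rho(M), hence a scalar, for
   w1 and w2 in W. It follows that every bounded T on K induces a unique operator ext T with
   (ext T) w = w T on the closed span L of the ranges of the elements of W, and ext extends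
   theta and y' |-> J theta(J y' J) J. The projection onto L commutes with rho(theta(M)), with rho of
   the relative commutant of theta(M), and with their conjugates by J. By hypothesis it thus
   commutes with rho(M) and its commutant, so L = K.

   Tomita's theorem is proved in a real Hilbert space, from the bounded operators T = (1 + D)^-1,
   T' = 1 - T and C = D^(1/2) (1 + D)^-1, where D is the modular operator. A right bounded vector eta,
   with right multiplication Q, gives a left bounded vector T eta, with left multiplication X, and
   C Q^* C = T' J X J T + T J X J T'. With t = T - T' and c = 2 C this is the Stein equation
   O - t O t = c Q^* c for O = 2 J X J. If z is the conjugate by J of an operator commuting with the left
   multiplications, then z commutes with these solutions O. Iterating the equation, and solving it
   along orbits of t with the Blaschke factor of t, which replaces the Fourier analysis of the modular
   group, one finds that z commutes with right multiplications.

   That rho is faithful with rho(M) its own bicommutant follows from the abundance of the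
   intertwiners K -> H: on a vector killed by all of them, self-adjoint elements b_n of M could
   tend to 1 while tending strongly to 0 on H, against the normality of phi. *)

(** * Real Hilbert spaces *)

(** Over the reals the conjugation J and the closed operators S and F, which are antilinear, become
    ordinary linear maps with ordinary adjoints and graphs; hence the real Hilbert spaces. Spectral
    theory is replaced by projections onto graphs, by Visser's iteration for square roots, and by
    log-convexity of the norms of iterates. Origin of the Blaschke factor: in a basis of
    eigenvectors of t, with eigenvalues a and b, the solution map A' of the Stein equation
    multiplies a matrix entry by c(a) c(b) / (1 - a b), where c(a)^2 = 1 - a^2, and the Blaschke
    factor B is (a - b) / (1 - a b); the squares of the two add up to 1. One application of A' leads
    from right multiplications to left ones, conjugated by J, and the next one leads back. So z is
    known to commute with odd powers of A', while an even power is wanted. It is reached by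
    approximating one factor A' = (1 - B^2)^(1/2) of A'^2 by polynomials in B^2 = 1 - A'^2, with B
    acting as a contraction on sequences of vectors. *)

Record rhilb (R : realType) := RHilb {
  rh_car :> lmodType R;
  ip : rh_car -> rh_car -> R;
  ipDl : forall u v w, ip (u + v) w = ip u w + ip v w;
  ipZl : forall a u w, ip (a *: u) w = a * ip u w;
  ipC : forall u v, ip u v = ip v u;
  ip_ge0 : forall u, 0 <= ip u u;
  ip_eq0 : forall u, ip u u = 0 -> u = 0;
  ip_complete : forall u : nat -> rh_car,
    (forall e, 0 < e -> exists N, forall m n, (N <= m)%N -> (N <= n)%N ->
       ip (u m - u n) (u m - u n) < e) ->
    exists l, (fun n => ip (u n - l) (u n - l)) @ \oo --> (0 : R) }.
Arguments ip {R r}.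

Section RealHilbert.
Context {R : realType}.
Implicit Types V W : rhilb R.

Lemma cvgR_unique (u : nat -> R) (a b : R) : u @ \oo --> a -> u @ \oo --> b -> a = b.
Proof. by move=> /cvg_lim <- // /cvg_lim <-. Qed.

Definition nrm V (v : V) : R := Num.sqrt (ip v v).

Definition cv V (u : nat -> V) (l : V) : Prop :=
  (fun n => nrm (u n - l)) @ \oo --> (0 : R).

Lemma ipZr V a (u v : V) : ip u (a *: v) = a * ip u v.
Proof. by rewrite ipC ipZl ipC. Qed.

Lemma ipDr V (u v w : V) : ip u (v + w) = ip u v + ip u w.
Proof. by rewrite ipC ipDl !(ipC u). Qed.

Lemma ip0l V (v : V) : ip 0 v = 0.
Proof. by rewrite -(scale0r (0 : V)) ipZl mul0r. Qed.

Lemma ip0r V (v : V) : ip v 0 = 0.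
Proof. by rewrite ipC ip0l. Qed.

Lemma ipNl V (u v : V) : ip (- u) v = - ip u v.
Proof. by rewrite -scaleN1r ipZl mulN1r. Qed.

Lemma ipNr V (u v : V) : ip u (- v) = - ip u v.
Proof. by rewrite ipC ipNl ipC. Qed.

Lemma ipBl V (u v w : V) : ip (u - v) w = ip u w - ip v w.
Proof. by rewrite ipDl ipNl. Qed.

Lemma ipBr V (u v w : V) : ip u (v - w) = ip u v - ip u w.
Proof. by rewrite ipDr ipNr. Qed.

Definition ipE := (ipDl, ipDr, ipNl, ipNr, ipZl, ipZr).

Lemma nrm_ge0 V (v : V) : 0 <= nrm v.
Proof. exact: sqrtr_ge0. Qed.

Lemma nrm_sq V (v : V) : nrm v ^+ 2 = ip v v.
Proof. by rewrite sqr_sqrtr // ip_ge0. Qed.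

Lemma nrm0 V : nrm (0 : V) = 0.
Proof. by rewrite /nrm ip0l sqrtr0. Qed.

Lemma nrm_eq0 V (v : V) : nrm v = 0 -> v = 0.
Proof. by move=> h; apply: ip_eq0; rewrite -nrm_sq h expr0n. Qed.

Lemma nrmZ V a (v : V) : nrm (a *: v) = `|a| * nrm v.
Proof. by rewrite /nrm ipZl ipZr mulrA sqrtrM ?sqr_ge0 // -expr2 sqrtr_sqr. Qed.

Lemma nrmN V (v : V) : nrm (- v) = nrm v.
Proof. by rewrite -scaleN1r nrmZ normrN1 mul1r. Qed.

Lemma nrmB V (u v : V) : nrm (u - v) = nrm (v - u).
Proof. by rewrite -nrmN opprB. Qed.

Lemma le_nrm V W (v : V) (w : W) : ip v v <= ip w w -> nrm v <= nrm w.
Proof. by move=> h; apply: ler_wsqrtr. Qed.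

Lemma ip_cs2 V (u v : V) : ip u v ^+ 2 <= ip u u * ip v v.
Proof.
have [/ip_eq0 ->|v0] := eqVneq (ip v v) 0; first by rewrite !ip0r mulr0 expr0n.
have vp : 0 < ip v v by rewrite lt_def v0 ip_ge0.
have := ip_ge0 (ip v v *: u - ip u v *: v).
rewrite !ipE (ipC v u) => h.
have : 0 <= ip v v * (ip u u * ip v v - ip u v ^+ 2) by apply: le_trans h _; lra.
by rewrite pmulr_rge0 // subr_ge0.
Qed.

Lemma ip_cs V (u v : V) : `|ip u v| <= nrm u * nrm v.
Proof.
rewrite -(ler_pXn2r (n := 2)) ?nnegrE ?mulr_ge0 ?nrm_ge0 //.
by rewrite exprMn !nrm_sq real_normK ?num_real // ip_cs2.
Qed.

Lemma ip_le V (u v : V) : ip u v <= nrm u * nrm v.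
Proof. exact: le_trans (ler_norm _) (ip_cs _ _). Qed.

Lemma nrmD V (u v : V) : nrm (u + v) <= nrm u + nrm v.
Proof.
rewrite -(ler_pXn2r (n := 2)) ?nnegrE ?addr_ge0 ?nrm_ge0 //.
rewrite sqrrD !nrm_sq !ipE (ipC v u); have := ip_le u v; lra.
Qed.

Lemma nrm_tri V (u v w : V) : nrm (u - w) <= nrm (u - v) + nrm (v - w).
Proof. by apply: le_trans (nrmD _ _); rewrite addrA subrK. Qed.

Lemma ip_ext V (u v : V) : (forall w, ip u w = ip v w) -> u = v.
Proof.
by move=> h; apply/eqP; rewrite -subr_eq0; apply/eqP/ip_eq0; rewrite ipBl h subrr.
Qed.

Lemma cvP V (u : nat -> V) l : cv u l <->
  forall e, 0 < e -> exists N, forall n, (N <= n)%N -> nrm (u n - l) < e.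
Proof.
split=> [h e e0|h].
  have /cvgrPdist_lt /(_ e e0) [N _ hN] := h.
  by exists N => n /hN; rewrite sub0r normrN ger0_norm ?nrm_ge0.
apply/cvgrPdist_lt => e /h [N hN]; exists N => // n /= /hN.
by rewrite sub0r normrN ger0_norm ?nrm_ge0.
Qed.

Lemma cv_squeeze V (u : nat -> V) l (f : nat -> R) :
  (forall n, nrm (u n - l) <= f n) -> f @ \oo --> (0 : R) -> cv u l.
Proof.
move=> h hf; apply: (squeeze_cvgr _ (cvg_cst 0) hf).
by near=> n; rewrite nrm_ge0 h.
Unshelve. all: by end_near. Qed.

Lemma cv_cst V (l : V) : cv (fun=> l) l.
Proof. by apply: (@cv_squeeze _ _ _ (fun=> 0)) => [n|]; rewrite ?subrr ?nrm0 //; exact: cvg_cst. Qed.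

Lemma cvD V (u v : nat -> V) l m : cv u l -> cv v m -> cv (fun n => u n + v n) (l + m).
Proof.
move=> hu hv; apply: (@cv_squeeze _ _ _ (fun n => nrm (u n - l) + nrm (v n - m))).
  by move=> n; rewrite opprD addrACA nrmD.
by rewrite -(addr0 0); exact: cvgD hu hv.
Qed.

Lemma cvZ V (u : nat -> V) l a : cv u l -> cv (fun n => a *: u n) (a *: l).
Proof.
move=> hu; apply: (@cv_squeeze _ _ _ (fun n => `|a| * nrm (u n - l))).
  by move=> n; rewrite -scalerBr nrmZ.
by rewrite -(mulr0 `|a|); apply: cvgM hu; exact: cvg_cst.
Qed.

Lemma cvN V (u : nat -> V) l : cv u l -> cv (fun n => - u n) (- l).
Proof.
move=> h; rewrite -scaleN1r; under [fun n => - u n]eq_fun do rewrite -scaleN1r.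
exact: cvZ.
Qed.

Lemma cvB V (u v : nat -> V) l m : cv u l -> cv v m -> cv (fun n => u n - v n) (l - m).
Proof. by move=> hu hv; apply: cvD hu _; exact: cvN. Qed.

Lemma cv_unique V (u : nat -> V) l m : cv u l -> cv u m -> l = m.
Proof.
move=> hl hm; apply/eqP; rewrite -subr_eq0; apply/eqP/nrm_eq0.
have := cvB hm hl; rewrite /cv.
have -> : (fun n => nrm (u n - u n - (m - l))) = fun=> nrm (l - m).
  by apply/funext => n; rewrite subrr sub0r opprB.
by move=> h; apply: cvgR_unique (cvg_cst _) h.
Qed.

Lemma cv_ip V (u : nat -> V) l w : cv u l -> (fun n => ip (u n) w) @ \oo --> ip l w.
Proof.
move=> h; apply/cvgrPdist_lt => e e0.
have e1 : 0 < e / (nrm w + 1) by rewrite divr_gt0 // ltr_wpDl ?nrm_ge0.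
have /cvP /(_ _ e1) [N hN] := h.
exists N => // n /= /hN; rewrite -ipBl ltr_pdivlMr ?ltr_wpDl ?nrm_ge0 // => hh.
apply: le_lt_trans (ip_cs _ _) _; rewrite nrmB; apply: le_lt_trans hh.
by rewrite ler_wpM2l ?nrm_ge0 // lerDl.
Qed.

Lemma cv_nrm V (u : nat -> V) l : cv u l -> (fun n => nrm (u n)) @ \oo --> nrm l.
Proof.
move=> h; apply/cvgrPdist_lt => e e0.
have /cvP /(_ _ e0) [N hN] := h; exists N => // n /= /hN.
apply: le_lt_trans; have := nrmD (u n - l) l; have := nrmD (l - u n) (u n).
rewrite !subrK (nrmB l) ler_norml; lra.
Qed.

Lemma cv_nrm_le V (u : nat -> V) l c : cv u l -> (forall n, nrm (u n) <= c) -> nrm l <= c.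
Proof.
move=> /cv_nrm h hc; rewrite -(cvg_lim _ h)//; apply: limr_le; first by apply/cvg_ex; exists (nrm l).
by near=> n; exact: hc.
Unshelve. all: by end_near. Qed.

Lemma rh_complete V (u : nat -> V) :
  (forall e, 0 < e -> exists N, forall m n, (N <= m)%N -> (N <= n)%N -> nrm (u m - u n) < e) ->
  exists l, cv u l.
Proof.
move=> h; have [|l hl] := ip_complete (u := u).
  move=> e e0; have [|N hN] := h (Num.sqrt e); first by rewrite sqrtr_gt0.
  exists N => m n hm hn; have := hN m n hm hn.
  by rewrite -(ltr_pXn2r (n := 2)) ?nnegrE ?sqrtr_ge0 // sqr_sqrtr ?ip_ge0 // sqr_sqrtr // ltW.
exists l; apply/cvP => e e0.
have /cvgrPdist_lt /(_ (e ^+ 2)) := hl; rewrite exprn_gt0 // => /(_ isT) [N _ hN].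
exists N => n /hN /=; rewrite sub0r normrN ger0_norm ?ip_ge0 // -nrm_sq.
by rewrite ltr_pXn2r ?nnegrE ?nrm_ge0 // ltW.
Qed.

Lemma invS_cvg0 : (fun n => n.+1%:R^-1 : R) @ \oo --> (0 : R).
Proof. exact: (@cvg_harmonic R). Qed.

Definition clos V (S : set V) : set V :=
  [set v | forall e, 0 < e -> exists2 s, S s & nrm (v - s) < e].

Definition lsub V (S : set V) : Prop :=
  S 0 /\ forall a u v, S u -> S v -> S (a *: u + v).

Lemma clos_seq V (S : set V) v : clos S v <-> exists2 u : nat -> V, (forall n, S (u n)) & cv u v.
Proof.
split=> [h|[u hu /cvP h] e /h [N hN]]; last first.
  by exists (u N) => //; rewrite nrmB hN.
have h' n : exists s, S s /\ nrm (v - s) < n.+1%:R^-1.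
  by have [|s Ss hs] := h n.+1%:R^-1; [rewrite invr_gt0|exists s].
have [u hu] := choice h'; exists u => [n|]; first by case: (hu n).
apply: (cv_squeeze (f := fun n => n.+1%:R^-1)) => [n|]; last exact: invS_cvg0.
by rewrite nrmB ltW //; case: (hu n).
Qed.

Lemma sub_clos V (S : set V) : S `<=` clos S.
Proof. by move=> v Sv e e0; exists v => //; rewrite subrr nrm0. Qed.

Lemma clos_mono V (S T : set V) : S `<=` T -> clos S `<=` clos T.
Proof. by move=> h v hv e /hv [s /h Ts hs]; exists s. Qed.

Lemma clos_idem V (S : set V) : clos (clos S) `<=` clos S.
Proof.
move=> v hv e e0; have e2 : 0 < e / 2 by lra.
have [s hs h1] := hv _ e2; have [t St h2] := hs _ e2; exists t => //.
apply: le_lt_trans (nrm_tri v s t) _; lra.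
Qed.

Lemma lsub_clos V (S : set V) : lsub S -> lsub (clos S).
Proof.
move=> [S0 hS]; split; first exact: sub_clos.
move=> a u v /clos_seq [x hx cx] /clos_seq [y hy cy]; apply/clos_seq.
exists (fun n => a *: x n + y n) => [n|]; first exact: hS.
by apply: cvD => //; apply: cvZ.
Qed.

Section Lsub.
Context {V : rhilb R} {S : set V} (hS : lsub S).
Lemma lsub0 : S 0. Proof. by case: hS. Qed.
Lemma lsubD u v : S u -> S v -> S (u + v).
Proof. by move=> Su Sv; rewrite -(scale1r u); apply hS.2. Qed.
Lemma lsubZ a u : S u -> S (a *: u).
Proof. by move=> Su; rewrite -(addr0 (a *: u)); apply hS.2 => //; exact: lsub0. Qed.
Lemma lsubN u : S u -> S (- u).
Proof. by rewrite -scaleN1r; exact: lsubZ. Qed.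
Lemma lsubB u v : S u -> S v -> S (u - v).
Proof. by move=> Su Sv; apply: lsubD => //; exact: lsubN. Qed.
End Lsub.

Lemma projection V (S : set V) : lsub S -> clos S `<=` S ->
  forall v, exists2 p, S p & forall s, S s -> ip (v - p) s = 0.
Proof.
move=> hS cS v.
pose D := [set ip (v - s) (v - s) | s in S].
have D0 : D !=set0 by exists (ip (v - 0) (v - 0)), 0 => //; exact: lsub0.
have lD : has_inf D by split=> //; exists 0 => _ [s _ <-]; exact: ip_ge0.
have inf_le s : S s -> inf D <= ip (v - s) (v - s).
  by move=> Ss; apply: ge_inf; [exact: lD.2|exists s].
have h n : exists s, S s /\ ip (v - s) (v - s) < inf D + n.+1%:R^-1.
  have [|_ [s Ss <-] hs] := @inf_adherent _ D n.+1%:R^-1 _ lD; first by rewrite invr_gt0.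
  by exists s.
have [u hu] := choice h.
have ub m n : ip (u m - u n) (u m - u n) <= 2 * (m.+1%:R^-1 + n.+1%:R^-1).
  have := inf_le (2^-1 *: u m + 2^-1 *: u n).
  have Sm : S (2^-1 *: u m + 2^-1 *: u n).
    by apply: hS.2; [case: (hu m)|apply: lsubZ => //; case: (hu n)].
  move=> /(_ Sm); have [_ h1] := hu m; have [_ h2] := hu n.
  have -> : u m - u n = (v - u n) - (v - u m) by rewrite opprB [RHS]addrC addrA subrK.
  have -> : v - (2^-1 *: u m + 2^-1 *: u n) = 2^-1 *: ((v - u n) + (v - u m)).
    have {1}-> : v = 2^-1 *: v + 2^-1 *: v by rewrite -scalerDl -[LHS]scale1r; congr (_ *: _); lra.
    by rewrite scalerDr !scalerBr opprD addrACA [RHS]addrC.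
  move: (v - u n) (v - u m) (inf D) h1 h2 => x y d h1 h2.
  move: (m.+1%:R^-1) (n.+1%:R^-1) h1 h2 => a b.
  rewrite !ipE (ipC y x); move: (ip x x) (ip x y) (ip y y) => xx xy yy; lra.
have [|p hp] := @rh_complete V u.
  move=> e e0.
  have /cvgrPdist_lt /(_ (e ^+ 2 / 4)) := invS_cvg0; case; first by rewrite divr_gt0 ?exprn_gt0.
  move=> N _ hN; exists N => m n Nm Nn.
  rewrite -(ltr_pXn2r (n := 2)) ?nnegrE ?nrm_ge0 ?ltW // nrm_sq.
  have := hN _ Nm; have := hN _ Nn; rewrite /= !sub0r !normrN !ger0_norm ?invr_ge0 // => h1 h2.
  apply: le_lt_trans (ub m n) _; move: h1 h2.
  move: (m.+1%:R^-1) (n.+1%:R^-1) (e ^+ 2) => a b c; lra.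
have Sp : S p by apply: cS; apply/clos_seq; exists u => // n; case: (hu n).
exists p => // s Ss.
have dp : ip (v - p) (v - p) <= inf D.
  have h1 : (fun n => nrm (v - u n)) @ \oo --> nrm (v - p).
    by apply: cv_nrm; apply: cvB => //; exact: cv_cst.
  have h2 : (fun n => inf D + n.+1%:R^-1) @ \oo --> inf D.
    by rewrite -{2}(addr0 (inf D)); apply: cvgD; [exact: cvg_cst|exact: invS_cvg0].
  have h3 : (fun n => nrm (v - u n) * nrm (v - u n)) @ \oo --> nrm (v - p) * nrm (v - p).
    exact: cvgM.
  rewrite -nrm_sq expr2; apply: ler_cvg_to h3 h2 _.
  by near=> n; rewrite -expr2 nrm_sq ltW //; case: (hu n).
have q t : 0 <= t * t * ip s s - 2 * t * ip (v - p) s.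
  have := inf_le (p + t *: s); rewrite opprD addrA.
  have St : S (p + t *: s) by rewrite addrC; apply: hS.2.
  move=> /(_ St); move: dp; move: (v - p) => x; rewrite !ipE (ipC s x); lra.
apply/eqP; move: q; move: (ip (v - p) s) (ip s s) (ip_ge0 s) => x y y0 q.
(* At this t the quadratic is a negative multiple of x^2; the + 1 keeps the denominator positive
   when s = 0. *)
have := q (x / (y + 1)).
have y1 : 0 < y + 1 by lra.
have -> : x / (y + 1) * (x / (y + 1)) * y - 2 * (x / (y + 1)) * x = - ((y + 2) * (x / (y + 1)) ^+ 2).
  by field; lra.
rewrite oppr_ge0 pmulr_rle0; last lra.
rewrite le_eqVlt ltNge sqr_ge0 orbF sqrf_eq0 mulf_eq0 invr_eq0 (gt_eqF y1) orbF.
by [].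
Unshelve. all: by end_near. Qed.

Lemma dense_orth V (S : set V) : lsub S ->
  (forall v, (forall s, S s -> ip v s = 0) -> v = 0) -> forall v, clos S v.
Proof.
move=> hS h v.
have [p Sp hp] := projection (lsub_clos hS) (@clos_idem _ S) v.
suff -> : v = p by [].
apply/eqP; rewrite -subr_eq0; apply/eqP/h => s Ss; apply: hp; exact: sub_clos.
Qed.

Lemma orth_dense V (S : set V) v : (forall v, clos S v) -> (forall s, S s -> ip v s = 0) -> v = 0.
Proof.
move=> dS h; apply: ip_eq0; have /clos_seq [u hu cu] := dS v.
have := cv_ip (w := v) cu; under eq_fun do rewrite ipC h //.
by move=> hh; apply: cvgR_unique hh (cvg_cst _).
Qed.

End RealHilbert.

(** * Bounded operators, adjoints, growth of iterates *)

Section Operators.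
Context {R : realType}.
Implicit Types V W : rhilb R.

Definition bop V W (f : V -> W) : Prop :=
  (forall a u v, f (a *: u + v) = a *: f u + f v) /\
  exists c, forall v, nrm (f v) <= c * nrm v.

Definition isadj V W (f : V -> W) (g : W -> V) : Prop :=
  forall v w, ip (f v) w = ip v (g w).

Definition symm V (f : V -> V) : Prop := isadj f f.

Lemma bop_bound V W (f : V -> W) : bop f ->
  exists2 c, 0 < c & forall v, nrm (f v) <= c * nrm v.
Proof.
move=> [_ [c hc]]; exists (`|c| + 1); first by rewrite ltr_wpDl.
by move=> v; apply: le_trans (hc v) _; rewrite ler_wpM2r ?nrm_ge0 // ler_wpDr // ler_norm.
Qed.

Section BopTheory.
Context {V W : rhilb R} {f : V -> W} (hf : bop f).
Lemma bopL a u v : f (a *: u + v) = a *: f u + f v. Proof. exact: hf.1. Qed.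
Lemma bopD u v : f (u + v) = f u + f v.
Proof. by have := bopL 1 u v; rewrite !scale1r. Qed.
Lemma bop0 : f 0 = 0.
Proof. by apply: (@addrI _ (f 0)); rewrite -bopD !addr0. Qed.
Lemma bopZ a u : f (a *: u) = a *: f u.
Proof. by have := bopL a u 0; rewrite !addr0 bop0 addr0. Qed.
Lemma bopN u : f (- u) = - f u.
Proof. by rewrite -scaleN1r bopZ scaleN1r. Qed.
Lemma bopB u v : f (u - v) = f u - f v.
Proof. by rewrite bopD bopN. Qed.
Lemma bop_cv (u : nat -> V) l : cv u l -> cv (fun n => f (u n)) (f l).
Proof.
move=> h; have [c _ hc] := bop_bound hf.
apply: (cv_squeeze (f := fun n => c * nrm (u n - l))) => [n|]; first by rewrite -bopB.
by rewrite -(mulr0 c); apply: cvgM h; exact: cvg_cst.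
Qed.
End BopTheory.

Lemma bop_id V : bop (@id V).
Proof. by split=> //; exists 1 => v; rewrite mul1r. Qed.

Lemma bop_comp V W (U : rhilb R) (f : W -> U) (g : V -> W) : bop f -> bop g -> bop (f \o g).
Proof.
move=> hf hg; split=> [a u v|]; first by rewrite /= (bopL hg) (bopL hf).
have [c c0 hc] := bop_bound hf; have [d d0 hd] := bop_bound hg.
by exists (c * d) => v /=; apply: le_trans (hc _) _; rewrite -mulrA ler_wpM2l // ltW.
Qed.

Lemma bop_lin V W (f g : V -> W) a : bop f -> bop g -> bop (fun v => a *: f v + g v).
Proof.
move=> hf hg; split=> [b u v|].
  by rewrite (bopL hf) (bopL hg) !scalerDr !scalerA (mulrC a b) addrACA.
have [c c0 hc] := bop_bound hf; have [d d0 hd] := bop_bound hg.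
exists (`|a| * c + d) => v; apply: le_trans (nrmD _ _) _; rewrite nrmZ mulrDl -mulrA.
by rewrite lerD // ler_wpM2l.
Qed.

Lemma bop_cst0 V W : bop (fun _ : V => 0 : W).
Proof. by split=> [a u v|]; [rewrite scaler0 addr0|exists 0 => v; rewrite nrm0 mul0r]. Qed.

Lemma bop_add V W (f g : V -> W) : bop f -> bop g -> bop (fun v => f v + g v).
Proof.
move=> hf hg; have := bop_lin 1 hf hg.
by rewrite (_ : (fun v => _) = fun v => f v + g v) //; apply/funext => v; rewrite scale1r.
Qed.

Lemma bop_scale V W (f : V -> W) a : bop f -> bop (fun v => a *: f v).
Proof.
move=> hf; have := bop_lin a hf (bop_cst0 V W).
by rewrite (_ : (fun v => _) = fun v => a *: f v) //; apply/funext => v; rewrite addr0.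
Qed.

Lemma bop_sub V W (f g : V -> W) : bop f -> bop g -> bop (fun v => f v - g v).
Proof.
move=> hf hg; have := bop_lin (-1) hg hf.
by rewrite (_ : (fun v => _) = fun v => f v - g v) //; apply/funext => v; rewrite scaleN1r addrC.
Qed.

Lemma bop_iter V (f : V -> V) n : bop f -> bop (iter n f).
Proof. by move=> hf; elim: n => [|n ih]; [exact: bop_id|exact: (bop_comp hf ih)]. Qed.

Lemma bop_eq_dense V W (f g : V -> W) (S : set V) : bop f -> bop g -> (forall v, clos S v) ->
  (forall s, S s -> f s = g s) -> forall v, f v = g v.
Proof.
move=> hf hg dS h v; have /clos_seq [u hu cu] := dS v.
have := bop_cv hg cu; under [fun n => g (u n)]eq_fun => n do rewrite -h //.
by move/(cv_unique (bop_cv hf cu)).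
Qed.

Lemma riesz V (f : V -> R) : (forall a u v, f (a *: u + v) = a * f u + f v) ->
  (exists c, forall v, `|f v| <= c * nrm v) -> exists w, forall v, f v = ip v w.
Proof.
move=> lf [c hc].
have f0 : f 0 = 0 by have := lf 1 0 0; rewrite scale1r addr0 mul1r; lra.
have fZ a u : f (a *: u) = a * f u by rewrite -[a *: u]addr0 lf f0 addr0.
have fD u v : f (u + v) = f u + f v by rewrite -[u]scale1r lf mul1r scale1r.
pose S : set V := [set v | f v = 0].
have hS : lsub S.
  by split; [exact: f0|move=> a u v; rewrite /S /= => fu fv; rewrite lf fu fv mulr0 addr0].
have cS : clos S `<=` S.
  move=> v hv; rewrite /S /=; apply/eqP/negPn/negP => fv.
  have c0 : 0 < `|c| + 1 by rewrite ltr_wpDl.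
  have e0 : 0 < `|f v| / (`|c| + 1) by rewrite divr_gt0 ?normr_gt0.
  have [s fs hs] := hv _ e0.
  have : `|f v| <= c * nrm (v - s).
    have -> : f v = f (v - s) by rewrite -[v in LHS](subrK s) (fD (v - s) s) fs addr0.
    exact: hc.
  move: hs; rewrite ltr_pdivlMr // => h1 h2.
  have : c * nrm (v - s) <= `|c| * nrm (v - s) by rewrite ler_wpM2r ?nrm_ge0 ?ler_norm.
  have := nrm_ge0 (v - s); lra.
have [[v fv]|h] := pselect (exists v, f v <> 0); last first.
  by exists 0 => v; rewrite ip0r; apply/eqP/negPn/negP => /eqP fv; apply: h; exists v.
have [p /= fp hp] := projection hS cS v.
have [w fw hw] : exists2 w, f w <> 0 & forall s, S s -> ip w s = 0.
  by exists (v - p) => //; rewrite -[- p]scaleN1r addrC lf fp mulr0 add0r.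
have w0 : ip w w != 0.
  by apply/eqP => /ip_eq0 ww; apply: fw; rewrite ww f0.
exists ((f w / ip w w) *: w) => u.
have h1 : f (- (f u / f w) *: w + u) = 0.
  by rewrite lf mulNr divfK ?addNr //; exact/eqP.
have := hw _ h1; rewrite !ipE => h2.
have -> : ip u w = f u / f w * ip w w by rewrite (ipC u w); apply/eqP; rewrite -subr_eq0 -h2; apply/eqP; ring.
by field; rewrite w0 andbT; exact/eqP.
Qed.

Lemma adj_bound V W (f : V -> W) g c : 0 <= c -> (forall v, nrm (f v) <= c * nrm v) ->
  isadj f g -> forall w, nrm (g w) <= c * nrm w.
Proof.
move=> c0 hc fg w; have [->|g0] := eqVneq (nrm (g w)) 0; first by rewrite mulr_ge0 ?nrm_ge0.
have gp : 0 < nrm (g w) by rewrite lt_def g0 nrm_ge0.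
rewrite -(ler_pM2l gp) -expr2 nrm_sq -fg; apply: le_trans (ip_le _ _) _.
by rewrite mulrCA mulrA ler_wpM2r ?nrm_ge0 // hc.
Qed.

Lemma adj_exists V W (f : V -> W) : bop f -> exists2 g, bop g & isadj f g.
Proof.
move=> hf; have [c c0 hc] := bop_bound hf.
have h w : exists u, forall v, ip (f v) w = ip v u.
  apply: riesz => [a u v|]; first by rewrite (bopL hf) !ipE.
  exists (c * nrm w) => v; apply: le_trans (ip_cs _ _) _.
  by rewrite mulrAC ler_wpM2r ?nrm_ge0.
have [g hg] := choice h.
have ga : isadj f g by move=> v w; exact: hg.
exists g => //; split=> [a u v|].
  by apply: ip_ext => w; rewrite ipC -ga !ipE !ga !(ipC w).
exists c; exact: adj_bound (ltW c0) hc ga.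
Qed.

Lemma isadjC V W (f : V -> W) g : isadj f g -> isadj g f.
Proof. by move=> h v w; rewrite ipC -h ipC. Qed.

Lemma adj_unique V W (f : V -> W) g h : isadj f g -> isadj f h -> g = h.
Proof. by move=> hg hh; apply/funext => w; apply: ip_ext => v; rewrite !(ipC _ v) -hg hh. Qed.

Lemma adj_comp V W (U : rhilb R) (f : W -> U) (g : V -> W) f' g' :
  isadj f f' -> isadj g g' -> isadj (f \o g) (g' \o f').
Proof. by move=> hf hg v w /=; rewrite hf hg. Qed.

Lemma adj_bop V W (f : V -> W) g : bop f -> isadj f g -> bop g.
Proof. by move=> hf hg; have [h bh hh] := adj_exists hf; rewrite (adj_unique hg hh). Qed.

Lemma symm_dense_range V (f : V -> V) : bop f -> symm f -> (forall v, f v = 0 -> v = 0) ->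
  forall v, clos (range f) v.
Proof.
move=> hf sf inj; apply: dense_orth.
  split; first by exists 0 => //; exact: bop0.
  by move=> a _ _ [u _ <-] [v _ <-]; exists (a *: u + v) => //; exact: bopL.
move=> v h; apply: inj; apply: ip_eq0; rewrite sf; apply: h.
by exists (f v).
Qed.

Lemma clos_image V W (f : V -> W) (S : set V) : bop f -> (forall v, clos S v) ->
  (forall w, clos (range f) w) -> forall w, clos (f @` S) w.
Proof.
move=> hf dS df w; apply: clos_idem; apply: clos_mono (df w) => _ [v _ <-].
have /clos_seq [u hu cu] := dS v; apply/clos_seq; exists (f \o u) => [n|]; last exact: bop_cv.
by exists (u n).
Qed.

Lemma pos_cs V (P : V -> V) : bop P -> symm P -> (forall v, 0 <= ip (P v) v) ->
  forall v w, ip (P v) w ^+ 2 <= ip (P v) v * ip (P w) w.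
Proof.
move=> bP sP pP v w.
have q t : 0 <= t * t * ip (P v) v + 2 * t * ip (P v) w + ip (P w) w.
  by have := pP (t *: v + w); rewrite (bopL bP) !ipE (ipC (P w) v) -sP; lra.
move: (ip (P v) v) (ip (P v) w) (ip (P w) w) (pP v) (pP w) q => a b c a0 c0 q.
have [a00|an] := eqVneq a 0.
  (* With a = 0 the quadratic is affine in t; unless b = 0, it takes the value -1 here. *)
  have := q (- (c + 1) / (2 * b)).
  have [->|b0] := eqVneq b 0; first by rewrite expr0n /= a00 mul0r.
  rewrite a00 mulr0 add0r (_ : 2 * _ * b = - (c + 1)); last by field.
  lra.
have ap : 0 < a by rewrite lt_def an.
have := q (- b / a).
rewrite (_ : _ + _ = (a * c - b ^+ 2) / a); last by field.
by rewrite pmulr_lge0 ?invr_gt0 // subr_ge0.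
Qed.

Lemma pos_nrm V (P : V -> V) k : 0 <= k -> bop P -> symm P -> (forall v, 0 <= ip (P v) v) ->
  (forall v, ip (P v) v <= k * ip v v) -> forall v, ip (P v) (P v) <= k * ip (P v) v.
Proof.
move=> k0 bP sP pP kP v.
have := pos_cs bP sP pP v (P v); have := kP (P v); have := pP v; have := ip_ge0 (P v).
move: (ip (P v) v) (ip (P (P v)) (P v)) (ip (P v) (P v)) => a b c.
rewrite le_eqVlt => /orP [/eqP <-|c0] a0 h1 h2; first exact: mulr_ge0.
have : c * c <= a * (k * c) by rewrite -expr2; apply: le_trans h2 _; rewrite ler_wpM2l.
by rewrite mulrA ler_pM2r // mulrC.
Qed.

Lemma pos_ker V (P : V -> V) v : bop P -> symm P -> (forall v, 0 <= ip (P v) v) ->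
  ip (P v) v = 0 -> P v = 0.
Proof.
move=> bP sP pP h; have := pos_cs bP sP pP v (P v); rewrite h mul0r => h2.
by apply: ip_eq0; apply/eqP; rewrite -sqrf_eq0 eq_le sqr_ge0 andbT.
Qed.

(** The ratios of consecutive terms of a log-convex sequence increase, so a first ratio above c
    would force growth faster than any multiple of c^n. For iterates of a symmetric operator this
    does the work of the spectral radius formula. *)
Lemma logconvex_growth (a : nat -> R) C c : 0 <= c -> (forall n, 0 <= a n) ->
  (forall n, a n.+1 ^+ 2 <= a n * a n.+2) -> (forall n, a n <= C * c ^+ n) -> a 1%N <= c * a 0%N.
Proof.
move=> c0 a0 lc aC; rewrite leNgt; apply/negP => h.
have a00 : 0 < a 0%N.
  rewrite lt_def a0 andbT; apply/eqP => h0; have := lc 0%N; rewrite h0 mul0r => h1.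
  by have : a 1%N ^+ 2 == 0 by [rewrite eq_le h1 sqr_ge0]; rewrite sqrf_eq0 => /eqP h2;
     move: h; rewrite h2 h0 mulr0 ltxx.
pose r := a 1%N / a 0%N.
have cr : c < r by rewrite /r ltr_pdivlMr.
have r0 : 0 < r by apply: le_lt_trans cr.
have step n : 0 < a n /\ r * a n <= a n.+1.
  elim: n => [|n [p ih]]; first by rewrite /r divfK ?gt_eqF.
  have p1 : 0 < a n.+1 by apply: lt_le_trans ih; rewrite mulr_gt0.
  split=> //; rewrite -(ler_pM2l p); apply: le_trans (lc n).
  by rewrite expr2 mulrCA mulrA ler_pM2r.
have grow n : r ^+ n * a 0%N <= a n.
  elim: n => [|n ih]; first by rewrite expr0 mul1r.
  have [_ h2] := step n; apply: le_trans h2; rewrite exprS -mulrA.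
  by rewrite ler_wpM2l // ltW.
have [c00|cn] := eqVneq c 0.
  by have := aC 1%N; rewrite c00 expr1 mulr0 leNgt (step 1%N).1.
have cp : 0 < c by rewrite lt_def cn.
(* Bernoulli's inequality makes (r / c)^n unbounded. *)
pose t := r / c - 1; have t0 : 0 < t by rewrite /t subr_gt0 ltr_pdivlMr ?mul1r.
have bern n : 1 + n%:R * t <= (r / c) ^+ n.
  elim: n => [|n ih]; first by rewrite expr0 mul0r addr0.
  have -> : r / c = 1 + t by rewrite /t; lra.
  rewrite exprS; apply: le_trans (_ : (1 + t) * (1 + n%:R * t) <= _); last first.
    rewrite ler_wpM2l //; first lra.
    by have -> : 1 + t = r / c by rewrite /t; lra.
  rewrite -natr1; have : 0 <= n%:R * t ^+ 2 by rewrite mulr_ge0 // sqr_ge0.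
  lra.
have bd n : (1 + n%:R * t) * a 0%N <= C.
  have cn0 : 0 < c ^+ n by rewrite exprn_gt0.
  rewrite -(ler_pM2r cn0); apply: le_trans (le_trans (grow n) (aC n)).
  rewrite -mulrA mulrC; rewrite [a _ * _]mulrC -mulrA (mulrC (a _)) mulrA.
  rewrite ler_pM2r // mulrC; apply: le_trans (_ : (r / c) ^+ n * c ^+ n <= _).
    by rewrite ler_pM2r.
  by rewrite -exprMn divfK.
have := bd (Num.truncn (`|C| / (t * a 0%N))).+1.
have ta : 0 < t * a 0%N by rewrite mulr_gt0.
have h1 : `|C| / (t * a 0%N) < (Num.truncn (`|C| / (t * a 0%N))).+1%:R by exact: truncnS_gt.
move: h1; rewrite ltr_pdivrMr // => h1 h2; have := ler_norm C.
move: h1 h2; move: (_.+1%:R) => N; lra.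
Qed.

(** By Cauchy-Schwarz the norms of the iterates of a symmetric operator are log-convex. *)
Lemma logconvex_symm V (P : V -> V) v C c : bop P -> symm P -> 0 <= c ->
  (forall n, nrm (iter n P v) <= C * c ^+ n) -> nrm (P v) <= c * nrm v.
Proof.
move=> bP sP c0 h; apply: (@logconvex_growth (fun n => nrm (iter n P v)) C c) => //= n.
  exact: nrm_ge0.
rewrite nrm_sq {1}sP; apply: le_trans (ip_le _ _) _; by rewrite [nrm _ * _]mulrC.
Qed.

End Operators.

(** * Direct sums, extension by density, inverse of 1 + s *)

Section Sums.
Context {R : realType}.

Lemma rcvD (f g : nat -> R) (a b : R) : f @ \oo --> a -> g @ \oo --> b ->
  (fun n => f n + g n) @ \oo --> a + b.
Proof. by move=> h1 h2; exact: cvgD. Qed.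

Lemma rcvM (f g : nat -> R) (a b : R) : f @ \oo --> a -> g @ \oo --> b ->
  (fun n => f n * g n) @ \oo --> a * b.
Proof. by move=> h1 h2; exact: cvgM. Qed.

Lemma rcvZ (f : nat -> R) (a c : R) : f @ \oo --> a -> (fun n => c * f n) @ \oo --> c * a.
Proof. by move=> h; apply: rcvM => //; exact: cvg_cst. Qed.

Lemma rcv_sum I (r : seq I) (f : I -> nat -> R) (a : I -> R) :
  (forall i, f i @ \oo --> a i) ->
  (fun n => \sum_(i <- r) f i n) @ \oo --> \sum_(i <- r) a i.
Proof.
move=> h; elim: r => [|i r ih].
  by rewrite big_nil; under eq_fun do rewrite big_nil; exact: cvg_cst.
by rewrite big_cons; under eq_fun do rewrite big_cons; exact: rcvD.
Qed.

Section ProdH.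
Context (V W : rhilb R).
Let pip (p q : V * W) : R := ip p.1 q.1 + ip p.2 q.2.

Lemma prodH_complete (u : nat -> V * W) :
  (forall e, 0 < e -> exists N, forall m n, (N <= m)%N -> (N <= n)%N ->
     pip (u m - u n) (u m - u n) < e) ->
  exists l, (fun n => pip (u n - l) (u n - l)) @ \oo --> (0 : R).
Proof.
move=> h.
have sq (U : rhilb R) (x : U) e : 0 < e -> ip x x < e ^+ 2 -> nrm x < e.
  by move=> e0; rewrite -nrm_sq ltr_pXn2r ?nnegrE ?nrm_ge0 // ltW.
have [|l1 h1] := @rh_complete _ V (fst \o u).
  move=> e e0; have [|N hN] := h (e ^+ 2); first by rewrite exprn_gt0.
  exists N => m n hm hn; apply: sq => //; apply: le_lt_trans _ (hN m n hm hn).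
  by rewrite lerDl ip_ge0.
have [|l2 h2] := @rh_complete _ W (snd \o u).
  move=> e e0; have [|N hN] := h (e ^+ 2); first by rewrite exprn_gt0.
  exists N => m n hm hn; apply: sq => //; apply: le_lt_trans _ (hN m n hm hn).
  by rewrite lerDr ip_ge0.
exists (l1, l2); rewrite /pip /=.
have := rcvD (rcvM h1 h1) (rcvM h2 h2); rewrite !mulr0 addr0.
by under eq_fun do rewrite -!expr2 !nrm_sq.
Qed.

Definition prodH : rhilb R.
refine (@RHilb R (V * W)%type pip _ _ _ _ _ prodH_complete).
- by move=> u v w; rewrite /pip /= !ipDl addrACA.
- by move=> a u w; rewrite /pip /= !ipZl mulrDr.
- by move=> u v; rewrite /pip !(ipC v.1) (ipC v.2).
- by move=> u; rewrite addr_ge0 ?ip_ge0.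
- move=> [u v]; rewrite /pip /= => h; have := ip_ge0 u; have := ip_ge0 v => h1 h2.
  by congr pair; apply: ip_eq0; lra.
Defined.

Lemma prodHE (p q : prodH) : ip p q = ip p.1 q.1 + ip p.2 q.2. Proof. by []. Qed.

Lemma nrm_fst (p : prodH) : nrm p.1 <= nrm p.
Proof. by apply: le_nrm; rewrite prodHE lerDl ip_ge0. Qed.

Lemma nrm_snd (p : prodH) : nrm p.2 <= nrm p.
Proof. by apply: le_nrm; rewrite prodHE lerDr ip_ge0. Qed.

Lemma nrm_prod (p : prodH) : nrm p <= nrm p.1 + nrm p.2.
Proof.
rewrite -(ler_pXn2r (n := 2)) ?nnegrE ?addr_ge0 ?nrm_ge0 //.
rewrite nrm_sq prodHE sqrrD !nrm_sq; have : 0 <= nrm p.1 * nrm p.2 by rewrite mulr_ge0 ?nrm_ge0.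
by move: (nrm p.1 * nrm p.2) => x; lra.
Qed.

Lemma clos_prod (S : set prodH) (p : prodH) : clos S p <->
  forall e, 0 < e -> exists q, [/\ S q, nrm (p.1 - q.1) < e & nrm (p.2 - q.2) < e].
Proof.
split=> h e e0.
  have [q Sq hq] := h _ e0; exists q; split=> //; apply: le_lt_trans hq.
    exact: (nrm_fst (p - q)).
  exact: (nrm_snd (p - q)).
have e2 : 0 < e / 2 by lra.
have [q [Sq h1 h2]] := h _ e2; exists q => //; apply: le_lt_trans (nrm_prod _) _.
by rewrite /=; lra.
Qed.

Lemma cv_pair (u : nat -> prodH) (l : prodH) :
  cv u l <-> cv (fun n => (u n).1) l.1 /\ cv (fun n => (u n).2) l.2.
Proof.
split=> [h|[h1 h2]].
  split; apply: cv_squeeze h => n; [exact: (nrm_fst (u n - l))|exact: (nrm_snd (u n - l))].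
apply: (cv_squeeze (f := fun n => nrm ((u n).1 - l.1) + nrm ((u n).2 - l.2))) => [n|].
  exact: nrm_prod.
by rewrite -(addr0 0); exact: rcvD h1 h2.
Qed.
End ProdH.

Section FamH.
Context (n : nat) (V : rhilb R).
Let fip (f g : {ffun 'I_n -> V}) : R := \sum_i ip (f i) (g i).

Lemma famH_le (f : {ffun 'I_n -> V}) i : ip (f i) (f i) <= fip f f.
Proof. by rewrite /fip (bigD1 i) //= lerDl sumr_ge0 // => j _; exact: ip_ge0. Qed.

Lemma famH_complete (u : nat -> {ffun 'I_n -> V}) :
  (forall e, 0 < e -> exists N, forall m k, (N <= m)%N -> (N <= k)%N ->
     fip (u m - u k) (u m - u k) < e) ->
  exists l, (fun k => fip (u k - l) (u k - l)) @ \oo --> (0 : R).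
Proof.
move=> h.
have hi i : exists l, cv (fun k => u k i) l.
  apply: rh_complete => e e0; have [|N hN] := h (e ^+ 2); first by rewrite exprn_gt0.
  exists N => m k hm hk; have := hN m k hm hk => hh.
  rewrite -(ltr_pXn2r (n := 2)) ?nnegrE ?nrm_ge0 ?ltW // nrm_sq.
  by apply: le_lt_trans hh; apply: le_trans (famH_le _ i); rewrite !ffunE.
have [l hl] := choice hi; exists [ffun i => l i].
rewrite /fip.
have -> : (fun k => \sum_i ip ((u k - [ffun i => l i]) i) ((u k - [ffun i => l i]) i)) =
  (fun k => \sum_i nrm (u k i - l i) ^+ 2).
  by apply/funext => k; apply: eq_bigr => i _; rewrite !ffunE nrm_sq.
have := @rcv_sum _ (index_enum 'I_n) (fun i k => nrm (u k i - l i) ^+ 2) (fun=> 0).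
rewrite (big1 (index_enum 'I_n)) // => h0; apply: h0 => i.
by rewrite -(mulr0 0); under eq_fun do rewrite expr2; exact: rcvM (hl i) (hl i).
Qed.

Definition famH : rhilb R.
refine (@RHilb R {ffun 'I_n -> V} fip _ _ _ _ _ famH_complete).
- by move=> u v w; rewrite /fip -big_split; apply: eq_bigr => i _; rewrite !ffunE ipDl.
- by move=> a u w; rewrite /fip mulr_sumr; apply: eq_bigr => i _; rewrite !ffunE ipZl.
- by move=> u v; apply: eq_bigr => i _; exact: ipC.
- by move=> u; apply: sumr_ge0 => i _; exact: ip_ge0.
- move=> u h; apply/ffunP => i; rewrite ffunE; apply: ip_eq0; apply/eqP.
  by rewrite eq_le ip_ge0 andbT -h famH_le.
Defined.

Lemma famHE (f g : famH) : ip f g = \sum_i ip ((f : {ffun _}) i) ((g : {ffun _}) i). Proof. by []. Qed.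

Lemma nrm_fam (f : famH) i : nrm ((f : {ffun _}) i) <= nrm f.
Proof. by apply: le_nrm; exact: famH_le. Qed.
End FamH.

Implicit Types V W : rhilb R.

(** Boundedness on the graph makes its closure single-valued and everywhere defined. The last clause
    records that the extension stays in the closure, so that properties of G stable under limits
    pass to it. *)
Lemma bop_extend V W (G : set (prodH V W)) c : 0 <= c -> lsub G ->
  (forall p : prodH V W, G p -> nrm p.2 <= c * nrm p.1) ->
  (forall v, clos [set p.1 | p in G] v) ->
  exists f : V -> W, [/\ bop f, (forall v, nrm (f v) <= c * nrm v),
    (forall p : prodH V W, G p -> f p.1 = p.2) & forall v, clos G (v, f v)].
Proof.
move=> c0 hG bG dG.
have bc (p : prodH V W) : clos G p -> nrm p.2 <= c * nrm p.1.
  move=> /clos_seq [u hu /cv_pair [c1 c2]].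
  apply: ler_cvg_to (cv_nrm c2) (rcvZ (c := c) (cv_nrm c1)) _.
  by near=> n; exact: bG.
have cG := lsub_clos hG.
have fx (v : V) : exists w : W, clos G (v, w).
  have /clos_seq [u hu cu] := dG v.
  have hp n : exists p : prodH V W, G p /\ p.1 = u n by have [p Gp <-] := hu n; exists p.
  have [p hp'] := choice hp.
  have [|w hw] := @rh_complete _ W (fun n => (p n).2).
    move=> e e0; have c1 : 0 < c + 1 by rewrite ltr_wpDl.
    pose d := e / (c + 1) / 2; have d0 : 0 < d by rewrite !divr_gt0.
    have [N hN] := (cvP _ _).1 cu d d0; exists N => m n hm hn.
    have := bG (p m - p n) (lsubB hG (hp' m).1 (hp' n).1).
    rewrite /= (hp' m).2 (hp' n).2 => h; apply: le_lt_trans h _.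
    have h2 : nrm (u m - u n) < d + d.
      by apply: le_lt_trans (nrm_tri _ v _) _; rewrite (nrmB v) ltrD // hN.
    apply: (@le_lt_trans _ _ ((c + 1) * nrm (u m - u n))); first by rewrite ler_wpM2r ?nrm_ge0 ?lerDl.
    by rewrite -ltr_pdivlMl // (lt_le_trans h2) // /d mulrC; lra.
  exists w; apply/clos_seq; exists p; first by move=> n; case: (hp' n).
  apply/cv_pair; split=> //=; rewrite (_ : (fun n => _) = u) //.
  by apply/funext => n; case: (hp' n).
have [f hf] := choice fx.
have uniq v w : clos G (v, w) -> f v = w.
  move=> h; apply/eqP; rewrite -subr_eq0; apply/eqP/nrm_eq0/eqP.
  rewrite eq_le nrm_ge0 andbT; have := bc _ (lsubB cG (hf v) h).
  by rewrite /= subrr nrm0 mulr0.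
exists f; split=> //.
- split; last by exists c => v; exact: (bc _ (hf v)).
  by move=> a u v; apply: uniq; exact: (cG.2 a _ _ (hf u) (hf v)).
- by move=> v; exact: (bc _ (hf v)).
- by move=> [v w] Gp /=; apply: uniq; exact: sub_clos.
Unshelve. all: by end_near. Qed.

Lemma lim_bop V W (x : nat -> V -> W) (l : V -> W) c :
  (forall n, bop (x n)) -> (forall n v, nrm (x n v) <= c * nrm v) ->
  (forall v, cv (fun n => x n v) (l v)) -> bop l.
Proof.
move=> bx cx xl; split; last by exists c => v; apply: cv_nrm_le (xl v) _.
move=> a u v; apply: cv_unique (xl _) _.
under eq_fun do rewrite (bopL (bx _)); apply: cvD => //; exact: cvZ.
Qed.

(** Since |v| <= |v + s v|, the range of 1 + s is closed; a vector x orthogonal to it satisfies <x,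
    x> + <x, s x> = 0 and vanishes. *)
Lemma inv_one_add V (s : V -> V) : bop s -> symm s -> (forall v, 0 <= ip (s v) v) ->
  exists r : V -> V, [/\ bop r, (forall v, r v + s (r v) = v) & forall v, r (v + s v) = v].
Proof.
move=> bs ss ps.
pose f v := v + s v.
have bf : bop f by apply: bop_add => //; exact: bop_id.
have lb v : nrm v <= nrm (f v).
  apply: le_nrm; rewrite /f !ipE (ipC v (s v)); have := ps v; have := ip_ge0 (s v); lra.
have inj u v : f u = f v -> u = v.
  move=> h; apply/eqP; rewrite -subr_eq0; apply/eqP/nrm_eq0/eqP.
  by rewrite eq_le nrm_ge0 andbT (le_trans (lb _)) // (bopB bf) h subrr nrm0.
pose S := range f.
have hS : lsub S.
  split; first by exists 0 => //; exact: (bop0 bf).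
  by move=> a _ _ [u _ <-] [v _ <-]; exists (a *: u + v) => //; exact: (bopL bf).
have cS : clos S `<=` S.
  move=> y /clos_seq [u hu cu].
  have hx n : exists x, f x = u n by have [x _ <-] := hu n; exists x.
  have [x hx'] := choice hx.
  have [|l hl] := @rh_complete _ V x.
    move=> e e0; have e2 : 0 < e / 2 by lra.
    have [N hN] := (cvP _ _).1 cu _ e2; exists N => m n hm hn.
    apply: le_lt_trans (lb _) _; rewrite (bopB bf) !hx'.
    by apply: le_lt_trans (nrm_tri _ y _) _; rewrite (nrmB y); have := hN _ hm; have := hN _ hn; lra.
  exists l => //; apply: cv_unique (bop_cv bf hl) _.
  by rewrite (_ : (fun n => _) = u) //; apply/funext => n; exact: hx'.
have surj v : exists w, f w = v.
  have [p [w _ <-] hp] := projection hS cS v; exists w.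
  have key x : ip x (f x) = 0 -> x = 0.
    rewrite /f ipDr (ipC x (s x)) => h; apply: ip_eq0.
    by have := ps x; have := ip_ge0 x; lra.
  by apply/eqP; rewrite eq_sym -subr_eq0; apply/eqP/key/hp; exists (v - f w).
have [r hr] := choice surj.
have rf v : r (f v) = v by apply: inj; exact: hr.
exists r; split=> //; split; last first.
  by exists 1 => v; rewrite mul1r -[v in leRHS]hr.
by move=> a u v; apply: inj; rewrite (bopL bf) !hr.
Qed.

End Sums.

(** * Bounded transforms of closed operators *)

Section GraphDecomposition.
Context {R : realType}.
Implicit Types V : rhilb R.

Lemma sq_le_mul (x y : R) : 0 <= x -> 0 <= y -> x ^+ 2 <= y * x -> x <= y.
Proof.
rewrite le_eqVlt => /orP [/eqP <- //|x0] y0.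
by rewrite expr2 ler_pM2r.
Qed.

(* For the graph G of a closed operator L: a = (1 + L^* L)^-1, Y = L a,
   Z = Y^* and c = (1 + L L^* )^-1. *)
Record gdec V (G : set (prodH V V)) (a c Y Z : V -> V) : Prop := GDec {
  gd_in1 : forall v, G (a v, Y v);
  gd_orth1 : forall v (g : prodH V V), G g -> ip (v - a v) g.1 = ip (Y v) g.2;
  gd_in2 : forall w, G (Z w, w - c w);
  gd_orth2 : forall w (g : prodH V V), G g -> ip (Z w) g.1 = ip (c w) g.2 }.

(** The projections of (v, 0) and (0, w) onto the closed subspace G are (a v, Y v) and (Z w, w - c
    w). *)
Lemma gdec_exists V (G : set (prodH V V)) : lsub G -> clos G `<=` G ->
  exists a c Y Z, gdec G a c Y Z.
Proof.
move=> hG cG.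
have h1 v : exists p : prodH V V, G p /\ forall g : prodH V V, G g -> ip (v - p.1) g.1 = ip p.2 g.2.
  have [p Gp hp] := projection hG cG ((v, 0) : prodH V V); exists p; split=> // g Gg.
  have := hp g Gg; rewrite prodHE /= sub0r ipNl; lra.
have h2 w : exists p : prodH V V, G p /\ forall g : prodH V V, G g -> ip p.1 g.1 = ip (w - p.2) g.2.
  have [p Gp hp] := projection hG cG ((0, w) : prodH V V); exists p; split=> // g Gg.
  have := hp g Gg; rewrite prodHE /= sub0r ipNl; lra.
have [p hp] := choice h1; have [q hq] := choice h2.
exists (fun v => (p v).1), (fun w => w - (q w).2), (fun v => (p v).2), (fun w => (q w).1).
split.
- by move=> v; have [] := hp v; case: (p v).
- by move=> v g; have [_] := hp v; exact.
- by move=> w; rewrite subKr; have [] := hq w; case: (q w).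
- by move=> w g; have [_] := hq w; exact.
Qed.

Section Theory.
Context {V : rhilb R} {G : set (prodH V V)} {a c Y Z : V -> V}.
Hypothesis (hG : lsub G) (D : gdec G a c Y Z).

(** Uniqueness of the projection onto G; linearity and commutation properties of [a] and [Y] are
    read off by exhibiting candidates for it. *)
Lemma gd_uniq v (x y : V) : G (x, y) ->
  (forall g : prodH V V, G g -> ip (v - x) g.1 = ip y g.2) -> x = a v /\ y = Y v.
Proof.
move=> Gxy h; have Gd := lsubB hG Gxy (gd_in1 D v).
have h1 := h _ Gd; have h2 := gd_orth1 D v Gd; rewrite /= in h1 h2.
have e1 : ip (x - a v) (x - a v) = ip (v - a v) (x - a v) - ip (v - x) (x - a v).
  by rewrite -ipBl; congr ip; rewrite opprB [RHS]addrC addrA subrK.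
have e2 := ipBl y (Y v) (y - Y v).
have s0 := ip_ge0 (x - a v); have t0 := ip_ge0 (y - Y v).
have [h3 h4] : ip (x - a v) (x - a v) = 0 /\ ip (y - Y v) (y - Y v) = 0 by split; lra.
by split; apply/eqP; rewrite -subr_eq0; apply/eqP/ip_eq0.
Qed.

Lemma gd_uniq2 w (x y : V) : G (x, w - y) ->
  (forall g : prodH V V, G g -> ip x g.1 = ip y g.2) -> x = Z w /\ y = c w.
Proof.
move=> Gxy h; have Gd := lsubB hG Gxy (gd_in2 D w).
have h1 := h _ Gd; have h2 := gd_orth2 D w Gd; rewrite /= in h1 h2.
have e : w - y - (w - c w) = c w - y by rewrite opprB addrC addrA subrK.
rewrite e in h1 h2.
have e1 := ipBl x (Z w) (x - Z w); have e2 := ipBl (c w) y (c w - y).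
have s0 := ip_ge0 (x - Z w); have t0 := ip_ge0 (c w - y).
have [h3 h4] : ip (x - Z w) (x - Z w) = 0 /\ ip (c w - y) (c w - y) = 0 by split; lra.
by split; apply/eqP; rewrite 1?[_ == c w]eq_sym -subr_eq0; apply/eqP/ip_eq0.
Qed.

Lemma gd_nrm v : ip (a v) (a v) + ip (Y v) (Y v) = ip v (a v).
Proof. by have := gd_orth1 D v (gd_in1 D v); rewrite /= ipBl => <-; lra. Qed.

Lemma gd_contr v : nrm (a v) <= nrm v.
Proof.
apply: sq_le_mul; rewrite ?nrm_ge0 // nrm_sq; apply: le_trans (ip_le v (a v)).
by rewrite -gd_nrm lerDl ip_ge0.
Qed.

Lemma gd_contrY v : nrm (Y v) <= nrm v.
Proof.
rewrite -(ler_pXn2r (n := 2)) ?nnegrE ?nrm_ge0 //.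
rewrite nrm_sq; apply: (@le_trans _ _ (ip v (a v))); first by rewrite -gd_nrm lerDr ip_ge0.
by apply: le_trans (ip_le _ _) _; rewrite expr2 ler_wpM2l ?nrm_ge0 ?gd_contr.
Qed.

Lemma gd_lin k u v : a (k *: u + v) = k *: a u + a v /\ Y (k *: u + v) = k *: Y u + Y v.
Proof.
have [||-> ->] := @gd_uniq (k *: u + v) (k *: a u + a v) (k *: Y u + Y v).
- exact: (hG.2 k _ _ (gd_in1 D u) (gd_in1 D v)).
- move=> g Gg; have := gd_orth1 D u Gg; have := gd_orth1 D v Gg; rewrite !ipE.
  by move=> h1 h2; rewrite -h1 -h2; ring.
- by [].
Qed.

Lemma gd_bop_a : bop a.
Proof. by split=> [k u v|]; [case: (gd_lin k u v)|exists 1 => v; rewrite mul1r gd_contr]. Qed.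

Lemma gd_bop_Y : bop Y.
Proof. by split=> [k u v|]; [case: (gd_lin k u v)|exists 1 => v; rewrite mul1r gd_contrY]. Qed.

Lemma gd_adj : isadj Y Z.
Proof.
move=> v w; have := gd_orth2 D w (gd_in1 D v); have := gd_orth1 D v (gd_in2 D w).
by rewrite /= !ipE (ipC (Z w)) (ipC (c w)); lra.
Qed.

Lemma gd_bop_Z : bop Z. Proof. exact: adj_bop gd_bop_Y gd_adj. Qed.

Lemma gd_sym_a : symm a.
Proof.
move=> v w; have := gd_orth1 D v (gd_in1 D w); have := gd_orth1 D w (gd_in1 D v).
by rewrite /= !ipE (ipC w) (ipC (a w)) (ipC (Y w)); lra.
Qed.

Lemma gd_sym_c : symm c.
Proof.
move=> v w; have := gd_orth2 D v (gd_in2 D w); have := gd_orth2 D w (gd_in2 D v).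
by rewrite /= !ipE (ipC (c w)) (ipC (c w)) (ipC (Z w)); lra.
Qed.

Lemma gd_YZ w : Y (Z w) = c (w - c w).
Proof.
apply: ip_ext => v; rewrite gd_sym_c gd_adj.
by have := gd_orth2 D v (gd_in2 D w); rewrite /= !(ipC _ (Z w)) !(ipC (w - c w)).
Qed.

Lemma gd_ZY v : Z (Y v) = a (v - a v).
Proof.
by apply: ip_ext => w; rewrite gd_sym_a (isadjC gd_adj); have := gd_orth1 D v (gd_in1 D w).
Qed.

(** The bounded form of g.2 = L g.1, that is L (1 + L^* L)^-1 = (1 + L L^* )^-1 L. *)
Lemma gd_graph (g : prodH V V) : G g -> Y g.1 = c g.2.
Proof.
by move=> Gg; apply: ip_ext => w; rewrite gd_adj gd_sym_c ipC (gd_orth2 D w Gg) ipC.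
Qed.

(** The counterpart of [gd_graph] for the adjoint: the hypothesis says f2 = L^* f1. *)
Lemma gd_adjgraph (f1 f2 : V) : (forall g : prodH V V, G g -> ip g.2 f1 = ip g.1 f2) -> Z f1 = a f2.
Proof.
move=> h; apply: ip_ext => v; rewrite (isadjC gd_adj) gd_sym_a ipC.
by rewrite (h _ (gd_in1 D v)) ipC.
Qed.

Lemma gd_bop_c : bop c.
Proof.
split=> [k u v|]; last first.
  exists 1 => w; rewrite mul1r; apply: sq_le_mul; rewrite ?nrm_ge0 // nrm_sq.
  apply: le_trans (ip_le w (c w)).
  have := gd_orth2 D w (gd_in2 D w); rewrite /= ipBr (ipC w) => h; have := ip_ge0 (Z w); lra.
apply: ip_ext => w; rewrite gd_sym_c !ipE (gd_sym_c u) (gd_sym_c v).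
by [].
Qed.

Lemma gd_Ya v : Y (a v) = c (Y v).
Proof. exact: (gd_graph (gd_in1 D v)). Qed.

Lemma gd_Zc w : Z (c w) = a (Z w).
Proof.
apply: ip_ext => v; rewrite (isadjC gd_adj) gd_sym_c -gd_Ya -(isadjC gd_adj).
by rewrite gd_sym_a.
Qed.

Lemma gd_comm (S T : V -> V) : bop S -> isadj S T ->
  (forall g : prodH V V, G g -> G (S g.1, S g.2)) ->
  (forall g : prodH V V, G g -> G (T g.1, T g.2)) ->
  forall v, a (S v) = S (a v) /\ Y (S v) = S (Y v).
Proof.
move=> bS ST GS GT v.
have [||-> ->] := @gd_uniq (S v) (S (a v)) (S (Y v)) => //.
- exact: GS (gd_in1 D v).
- by move=> g Gg; rewrite -(bopB bS) !ST; exact: (gd_orth1 D v (GT _ Gg)).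
Qed.

Lemma gd_comm_Z (S T : V -> V) : bop S -> isadj S T ->
  (forall g : prodH V V, G g -> G (S g.1, S g.2)) ->
  (forall g : prodH V V, G g -> G (T g.1, T g.2)) ->
  forall v, Z (S v) = S (Z v) /\ c (S v) = S (c v).
Proof.
move=> bS ST GS GT v.
have [||-> ->] := @gd_uniq2 (S v) (S (Z v)) (S (c v)) => //.
- by rewrite -(bopB bS); exact: GS (gd_in2 D v).
- by move=> g Gg; rewrite !ST; exact: (gd_orth2 D v (GT _ Gg)).
Qed.

End Theory.
End GraphDecomposition.

(** * Square roots of contractions *)

Section Visser.
Context {R : realType}.

Lemma real_cauchy (u : nat -> R) :
  (forall e, 0 < e -> exists N, forall m n, (N <= m)%N -> (N <= n)%N -> `|u m - u n| < e) ->
  exists l : R, u @ \oo --> l.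
Proof.
move=> h; apply/cvg_ex/cauchy_cvgP/cauchy_exP => e e0.
have [N hN] := h e e0; exists (u N); exists N => // n /= Nn.
by rewrite /ball /=; exact: hN.
Qed.

Lemma rcv_le N (f g : nat -> R) (a b : R) : f @ \oo --> a -> g @ \oo --> b ->
  (forall n, (N <= n)%N -> f n <= g n) -> a <= b.
Proof. by move=> hf hg h; apply: ler_cvg_to hf hg _; exists N => // n /= /h. Qed.

Lemma rcv_shift (f : nat -> R) (a : R) : f @ \oo --> a -> (fun n => f n.+1) @ \oo --> a.
Proof. by move=> h; rewrite (cvg_shiftS f). Qed.

(** Visser's iteration for the number 1. The iterates are polynomials with nonnegative coefficients,
    so these numbers bound the iterates for a contraction, and their differences bound the
    differences of the iterates. *)
Fixpoint sqrt_coef (m : nat) : R := if m is m'.+1 then 2^-1 * (1 + sqrt_coef m' ^+ 2) else 0.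
Local Notation al := sqrt_coef.

Lemma sqrt_coef_bounds m : 0 <= al m <= 1.
Proof.
elim: m => [|m /andP [h1 h2]] /=; first by rewrite lexx ler01.
have : al m ^+ 2 <= 1 by rewrite expr_le1.
have := sqr_ge0 (al m); move: (al m ^+ 2) => x h3 h4.
by apply/andP; split; lra.
Qed.

Lemma sqrt_coef_step m : al m <= al m.+1.
Proof.
elim: m => [|m ih]; first by rewrite /= expr0n addr0 mulr1 invr_ge0.
rewrite -[leRHS]/(2^-1 * (1 + al m.+1 ^+ 2)) -[leLHS]/(2^-1 * (1 + al m ^+ 2)) ler_pM2l ?invr_gt0 // lerD2l ler_pXn2r ?nnegrE //.
  by have /andP [] := sqrt_coef_bounds m.
by have /andP [] := sqrt_coef_bounds m.+1.
Qed.

Lemma sqrt_coef_mono m k : (m <= k)%N -> al m <= al k.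
Proof.
by move/subnK <-; elim: (k - m)%N => [//|j ih]; apply: le_trans ih _; exact: sqrt_coef_step.
Qed.

Definition sqrt_coef_lim : R := sup (range al).

Lemma sqrt_coef_cvg : al @ \oo --> sqrt_coef_lim.
Proof.
apply: nondecreasing_cvgn; first by move=> m k; exact: sqrt_coef_mono.
by exists 1 => _ [m _ <-]; have /andP [] := sqrt_coef_bounds m.
Qed.

Lemma sqrt_coef_le_lim m : al m <= sqrt_coef_lim.
Proof.
apply: ub_le_sup; last by exists m.
by exists 1 => _ [k _ <-]; have /andP [] := sqrt_coef_bounds k.
Qed.

(** The iteration is run in a space with a complete separating family of seminorms, because it is
    later applied to all sequences of vectors, with the norms of initial segments. *)
Fixpoint visser_seq (W : lmodType R) (H : W -> W) (m : nat) (x : W) : W :=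
  if m is m'.+1 then 2^-1 *: (H x + visser_seq H m' (visser_seq H m' x)) else 0.
Local Notation sq := visser_seq.

Context {W : lmodType R} {I : Type} (n : I -> W -> R) (H : W -> W).
Hypothesis (nD : forall i x y, n i (x + y) <= n i x + n i y).
Hypothesis (nZ : forall i a x, n i (a *: x) = `|a| * n i x).
Hypothesis (nC : forall u : nat -> W,
  (forall i e, 0 < e -> exists N, forall p q, (N <= p)%N -> (N <= q)%N -> n i (u p - u q) < e) ->
  exists l, forall i, (fun m => n i (u m - l)) @ \oo --> (0 : R)).
Hypothesis (nS : forall x, (forall i, n i x = 0) -> x = 0).
Hypothesis (HL : forall a u v, H (a *: u + v) = a *: H u + H v).
Hypothesis (HC : forall i x, n i (H x) <= n i x).

Lemma semi_N i x : n i (- x) = n i x.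
Proof. by rewrite -scaleN1r nZ normrN1 mul1r. Qed.

Lemma semi_ge0 i x : 0 <= n i x.
Proof.
have := nD i x (- x); rewrite subrr semi_N -(scale0r (0 : W)) nZ normr0 mul0r; lra.
Qed.

Lemma visser_lin m a u v : sq H m (a *: u + v) = a *: sq H m u + sq H m v.
Proof.
elim: m a u v => [|m ih] a u v /=; first by rewrite scaler0 addr0.
rewrite HL !ih scalerA mulrC -scalerA -scalerDr; congr (_ *: _).
by rewrite scalerDr addrACA.
Qed.

Lemma visser_seq_comm (T : W -> W) : (forall a u v, T (a *: u + v) = a *: T u + T v) ->
  (forall x, T (H x) = H (T x)) -> forall m x, T (sq H m x) = sq H m (T x).
Proof.
move=> TL TH m x.
have T0 : T 0 = 0 by have := TL (-1) 0 0; rewrite scaler0 addr0 scaleN1r addNr.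
have TZ a u : T (a *: u) = a *: T u by have := TL a u 0; rewrite T0 !addr0.
elim: m x => [|m ih] x //=.
by rewrite TZ -[H x]scale1r TL !scale1r TH !ih.
Qed.

Lemma visserB m u v : sq H m (u - v) = sq H m u - sq H m v.
Proof. by rewrite addrC -scaleN1r visser_lin scaleN1r addrC. Qed.

Lemma visser_bound m i x : n i (sq H m x) <= al m * n i x.
Proof.
elim: m x => [|m ih] x /=; first by rewrite -(scale0r (0 : W)) nZ normr0 !mul0r.
rewrite nZ ger0_norm ?invr_ge0 // -mulrA ler_pM2l ?invr_gt0 //.
apply: le_trans (nD _ _ _) _; rewrite mulrDl mul1r lerD // expr2 -mulrA.
have /andP [h _] := sqrt_coef_bounds m.
by apply: le_trans (ih _) _; rewrite ler_wpM2l.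
Qed.

Lemma visser_le m i x : n i (sq H m x) <= n i x.
Proof.
apply: le_trans (visser_bound _ _ _) _; rewrite ler_piMl ?semi_ge0 //.
by have /andP [] := sqrt_coef_bounds m.
Qed.

Lemma visser_step m i x : n i (sq H m.+1 x - sq H m x) <= (al m.+1 - al m) * n i x.
Proof.
elim: m x => [|m ih] x.
  rewrite subr0; apply: le_trans (visser_bound _ _ _) _.
  by rewrite subr0.
(* This is p^2 - q^2 = p (p - q) + (p - q) q for two successive iterates; the same identity holds
   for the scalars below. *)
have -> : sq H m.+2 x - sq H m.+1 x = 2^-1 *:
   (sq H m.+1 (sq H m.+1 x - sq H m x) + (sq H m.+1 (sq H m x) - sq H m (sq H m x))).
  rewrite visserB addrA subrK -[sq H m.+2 x]/(2^-1 *: (H x + sq H m.+1 (sq H m.+1 x))).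
  rewrite -[in X in _ - X]/(sq H m.+1 x) {2}/visser_seq -/visser_seq -scalerBr; congr (_ *: _).
  by rewrite opprD addrACA subrr add0r.
rewrite nZ ger0_norm ?invr_ge0 //.
have -> : al m.+2 - al m.+1 = 2^-1 * (al m.+1 * (al m.+1 - al m) + (al m.+1 - al m) * al m).
  by rewrite /=; field.
rewrite -mulrA ler_pM2l ?invr_gt0 //; apply: le_trans (nD _ _ _) _.
rewrite mulrDl lerD //.
  apply: le_trans (visser_bound _ _ _) _; rewrite -mulrA ler_wpM2l //.
  by have /andP [] := sqrt_coef_bounds m.+1.
apply: le_trans (ih _) _; rewrite -mulrA ler_wpM2l ?subr_ge0 ?sqrt_coef_step //.
exact: visser_bound.
Qed.

Lemma visser_cauchy m k i x : (m <= k)%N -> n i (sq H k x - sq H m x) <= (al k - al m) * n i x.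
Proof.
move/subnK <-; elim: (k - m)%N => [|j ih].
  by rewrite !subrr mul0r -(scale0r (0 : W)) nZ normr0 mul0r.
rewrite addSn -(subrK (sq H (j + m) x) (sq H (j + m).+1 x)) -addrA.
apply: le_trans (nD _ _ _) _.
have -> : al (j + m).+1 - al m = (al (j + m).+1 - al (j + m)) + (al (j + m) - al m) by lra.
by rewrite mulrDl lerD // visser_step.
Qed.

(* The Visser iteration s := (H + s^2) / 2 converges to a solution of (1 - L)^2 = 1 - H. *)
Record visser (L : W -> W) : Prop := VisserLimit {
  vi_err : forall i x m, n i (L x - sq H m x) <= (sqrt_coef_lim - al m) * n i x;
  vi_le : forall i x, n i (L x) <= n i x;
  vi_fix : forall x, L x = 2^-1 *: (H x + L (L x));
  vi_lin : forall a u v, L (a *: u + v) = a *: L u + L v;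
  vi_comm : forall T : W -> W, (forall a u v, T (a *: u + v) = a *: T u + T v) ->
    (forall i, exists j C, forall x, n i (T x) <= C * n j x) ->
    (forall x, T (H x) = H (T x)) -> forall x, T (L x) = L (T x) }.

Lemma semi_lim0 x (f : I -> nat -> R) : (forall i m, n i x <= f i m) ->
  (forall i, f i @ \oo --> (0 : R)) -> x = 0.
Proof.
move=> h hf; apply: nS => i; apply/eqP; rewrite eq_le semi_ge0 andbT.
by apply: (@rcv_le 0 (fun=> n i x) (f i)) => //; exact: cvg_cst.
Qed.

Lemma visser_gap_cvg x i : (fun m => (sqrt_coef_lim - al m) * n i x) @ \oo --> (0 : R).
Proof.
rewrite -(mul0r (n i x)); apply: cvgM; last exact: cvg_cst.
rewrite -(subrr sqrt_coef_lim); apply: cvgB; [exact: cvg_cst|exact: sqrt_coef_cvg].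
Qed.

Lemma semi_tri i x y z : n i (x - z) <= n i (x - y) + n i (y - z).
Proof. by apply: le_trans (nD _ _ _); rewrite addrA subrK. Qed.

Lemma semi_sym i x y : n i (x - y) = n i (y - x).
Proof. by rewrite -semi_N opprB. Qed.

Lemma visser_exists : exists L, visser L.
Proof.
have hl x : exists l, forall i, (fun m => n i (sq H m x - l)) @ \oo --> (0 : R).
  apply: nC => i e e0.
  have /cvgrPdist_lt /(_ (e / (n i x + 1))) := sqrt_coef_cvg.
  have nx1 : 0 < n i x + 1 by rewrite ltr_wpDl ?semi_ge0.
  case; first by rewrite divr_gt0.
  move=> N _ hN; exists N.
  have key p q : (N <= p)%N -> (p <= q)%N -> n i (sq H q x - sq H p x) < e.
    move=> Np pq; apply: le_lt_trans (visser_cauchy _ _ pq) _.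
    have := hN _ Np; rewrite /= ger0_norm ?subr_ge0 ?sqrt_coef_le_lim // ltr_pdivlMr //.
    apply: le_lt_trans; have lq := sqrt_coef_le_lim q.
    have gp : 0 <= sqrt_coef_lim - al p by rewrite subr_ge0 sqrt_coef_le_lim.
    apply: (@le_trans _ _ ((sqrt_coef_lim - al p) * n i x)).
      by rewrite ler_wpM2r ?semi_ge0 // lerB.
    by rewrite ler_wpM2l // lerDl.
  move=> p q Np Nq; have [pq|qp] := leqP p q; last exact: key (ltnW qp).
  by rewrite semi_sym key.
have [L hL] := choice hl; exists L.
have err i x m : n i (L x - sq H m x) <= (sqrt_coef_lim - al m) * n i x.
  apply: (@rcv_le m (fun=> n i (L x - sq H m x))
    (fun k => n i (sq H k x - L x) + (sqrt_coef_lim - al m) * n i x)).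
  - exact: cvg_cst.
  - rewrite -[X in _ --> X]add0r; apply: cvgD; [exact: hL|exact: cvg_cst].
  move=> k mk; rewrite (semi_sym i _ (L x)).
  apply: le_trans (semi_tri _ _ (sq H k x) _) _; rewrite lerD2l.
  apply: le_trans (visser_cauchy _ _ mk) _.
  by rewrite ler_wpM2r ?semi_ge0 // lerB // sqrt_coef_le_lim.
have le i x : n i (L x) <= n i x.
  apply: (@rcv_le 0 (fun=> n i (L x)) (fun k => n i (sq H k x - L x) + n i x)).
  - exact: cvg_cst.
  - rewrite -[X in _ --> X]add0r; apply: cvgD; [exact: hL|exact: cvg_cst].
  move=> k _; rewrite semi_sym -[X in n i X](subrK (sq H k x)).
  by apply: le_trans (nD _ _ _) _; rewrite lerD2l visser_le.
split => //.
- move=> x; apply/eqP; rewrite -subr_eq0; apply/eqP.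
  apply: (@semi_lim0 _ (fun i m => (sqrt_coef_lim - al m.+1) * n i x +
     2^-1 * ((sqrt_coef_lim - al m) * n i x + (sqrt_coef_lim - al m) * n i (L x)))) => [i m|i].
    apply: le_trans (semi_tri _ _ (sq H m.+1 x) _) _; rewrite lerD ?err //.
    rewrite /= -scalerBr nZ ger0_norm ?invr_ge0 // ler_pM2l ?invr_gt0 //.
    rewrite opprD addrACA subrr add0r.
    apply: le_trans (semi_tri _ _ (sq H m (L x)) _) _; rewrite -visserB lerD //.
      by apply: le_trans (visser_le _ _ _) _; rewrite semi_sym err.
    by rewrite semi_sym err.
  have g0 := visser_gap_cvg x i; have g1 := visser_gap_cvg (L x) i.
  by have := rcvD (rcv_shift g0) (rcvZ (c := 2^-1) (rcvD g0 g1)); rewrite addr0 mulr0 addr0.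
- move=> a u v; apply/eqP; rewrite -subr_eq0; apply/eqP.
  apply: (@semi_lim0 _ (fun i m => (sqrt_coef_lim - al m) * n i (a *: u + v) +
     (`|a| * ((sqrt_coef_lim - al m) * n i u) + (sqrt_coef_lim - al m) * n i v))) => [i m|i].
    apply: le_trans (semi_tri _ _ (sq H m (a *: u + v)) _) _; rewrite lerD ?err //.
    rewrite visser_lin opprD addrACA -scalerBr; apply: le_trans (nD _ _ _) _.
    by rewrite nZ lerD ?ler_wpM2l // semi_sym err.
  rewrite -(addr0 0); apply: rcvD; first exact: visser_gap_cvg.
  rewrite -(addr0 0); apply: rcvD; last exact: visser_gap_cvg.
  by rewrite -(mulr0 `|a|); apply: rcvZ; exact: visser_gap_cvg.
- move=> T TL TC TH x.
  have Tsq := visser_seq_comm TL TH.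
  apply/eqP; rewrite -subr_eq0; apply/eqP.
  have TB u v : T (u - v) = T u - T v by rewrite addrC -scaleN1r TL scaleN1r addrC.
  have hj i : exists jC : I * R, forall x, n i (T x) <= jC.2 * n jC.1 x.
    by have [j [C hC]] := TC i; exists (j, C).
  have [J hJ] := choice hj.
  apply: (@semi_lim0 _ (fun i m => `|(J i).2| * ((sqrt_coef_lim - al m) * n (J i).1 x) +
    (sqrt_coef_lim - al m) * n i (T x))) => [i m|i].
    apply: le_trans (semi_tri _ _ (sq H m (T x)) _) _; rewrite -Tsq -TB lerD //.
      apply: le_trans (hJ i _) _.
      apply: (@le_trans _ _ (`|(J i).2| * n (J i).1 (L x - sq H m x))).
        by rewrite ler_wpM2r ?semi_ge0 ?ler_norm.
      by rewrite ler_wpM2l ?err.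
    by rewrite Tsq semi_sym err.
  rewrite -(addr0 0); apply: rcvD; last exact: visser_gap_cvg.
  by rewrite -(mulr0 `|(J i).2|); apply: rcvZ; exact: visser_gap_cvg.
Qed.

Lemma visser_sq L : visser L -> forall x, (x - L x) - L (x - L x) = x - H x.
Proof.
move=> hL x.
have -> : L (x - L x) = L x - L (L x) by rewrite addrC -scaleN1r (vi_lin hL) scaleN1r addrC.
have -> : H x = L x + L x - L (L x).
  apply/eqP; rewrite eq_sym subr_eq; apply/eqP.
  rewrite {1 2}(vi_fix hL) -scalerDl (_ : 2^-1 + 2^-1 = 1) ?scale1r //; lra.
by rewrite !opprD !opprK !addrA.
Qed.

Lemma visser_cvg L x i : visser L -> (fun m => n i (sq H m x - L x)) @ \oo --> (0 : R).
Proof.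
move=> hL; apply: (squeeze_cvgr _ (cvg_cst 0) (visser_gap_cvg x i)).
by near=> m; rewrite semi_ge0 semi_sym (vi_err hL).
Unshelve. all: by end_near. Qed.

End Visser.

(** * Stein equations and the Blaschke factor *)

Section Sequences.
Context {R : realType} {V : rhilb R}.
Implicit Types f g : nat -> V.

Definition snf N f : famH N V := [ffun m : 'I_N => f m].
Definition sn N f : R := nrm (snf N f).

Lemma sn_sq N f : sn N f ^+ 2 = \sum_(m < N) ip (f m) (f m).
Proof. by rewrite /sn nrm_sq famHE; apply: eq_bigr => i _; rewrite ffunE. Qed.

Lemma snD N f g : sn N (f + g) <= sn N f + sn N g.
Proof.
rewrite /sn (_ : snf N (f + g) = snf N f + snf N g) ?nrmD //.
by apply/ffunP => i; rewrite !ffunE.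
Qed.

Lemma snZ N a f : sn N (a *: f) = `|a| * sn N f.
Proof.
rewrite /sn (_ : snf N (a *: f) = a *: snf N f) ?nrmZ //.
by apply/ffunP => i; rewrite !ffunE.
Qed.

Lemma sn_cs N f g : `|\sum_(m < N) ip (f m) (g m)| <= sn N f * sn N g.
Proof.
have := ip_cs (snf N f) (snf N g); rewrite famHE /sn.
by congr (`|_| <= _); apply: eq_bigr => i _; rewrite !ffunE.
Qed.

Lemma sn_coord k f : nrm (f k) <= sn k.+1 f.
Proof. by have := nrm_fam (snf k.+1 f) ord_max; rewrite ffunE. Qed.

Lemma sn_ge0 N f : 0 <= sn N f. Proof. exact: nrm_ge0. Qed.

Lemma sn_le N M f g : \sum_(m < N) ip (f m) (f m) <= \sum_(m < M) ip (g m) (g m) ->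
  sn N f <= sn M g.
Proof. by rewrite -!sn_sq ler_pXn2r ?nnegrE ?sn_ge0. Qed.

Lemma sn_le_const N f k : 0 <= k -> \sum_(m < N) ip (f m) (f m) <= k ^+ 2 -> sn N f <= k.
Proof. by move=> k0; rewrite -sn_sq ler_pXn2r ?nnegrE ?sn_ge0. Qed.

Lemma sn_sum N f : sn N f <= \sum_(m < N) nrm (f m).
Proof.
have h : 0 <= \sum_(m < N) nrm (f m) by apply: sumr_ge0 => i _; exact: nrm_ge0.
apply: sn_le_const => //; elim: N {h} => [|N ih]; first by rewrite !big_ord0 expr0n.
rewrite !big_ord_recr /= sqrrD -nrm_sq.
have : 0 <= (\sum_(i < N) nrm (f i)) * nrm (f N).
  by rewrite mulr_ge0 ?nrm_ge0 // sumr_ge0 // => i _; exact: nrm_ge0.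
by move: ih; move: (_ * nrm (f N)) => x; lra.
Qed.

Lemma sn_complete (u : nat -> nat -> V) :
  (forall i e, 0 < e -> exists N, forall p q, (N <= p)%N -> (N <= q)%N -> sn i (u p - u q) < e) ->
  exists l, forall i, (fun m => sn i (u m - l)) @ \oo --> (0 : R).
Proof.
move=> h.
have hk k : exists l, cv (fun m => u m k) l.
  apply: rh_complete => e e0; have [N hN] := h k.+1 e e0; exists N => p q Np Nq.
  by apply: le_lt_trans (hN p q Np Nq); exact: (sn_coord k (u p - u q)).
have [l hl] := choice hk; exists l => i.
have hs : (fun m => \sum_(k < i) nrm (u m k - l k)) @ \oo --> (0 : R).
  have := @rcv_sum _ _ (index_enum 'I_i) (fun k m => nrm (u m k - l k)) (fun=> 0).
  by rewrite (big1 (index_enum 'I_i)) // => h0; apply: h0 => k; exact: hl.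
apply: (squeeze_cvgr _ (cvg_cst 0) hs).
by near=> m; rewrite sn_ge0 sn_sum.
Unshelve. all: by end_near. Qed.

Lemma sn_sep f : (forall i, sn i f = 0) -> f = 0.
Proof.
move=> h; apply/funext => k; apply: nrm_eq0; apply/eqP; rewrite eq_le nrm_ge0 andbT.
by rewrite -(h k.+1) sn_coord.
Qed.

Definition shift f : nat -> V := fun n => if n is k.+1 then f k else 0.

Lemma shift_contr N f : sn N (shift f) <= sn N f.
Proof.
case: N => [|N]; first by apply: sn_le; rewrite !big_ord0.
apply: sn_le; rewrite big_ord_recl /= ip0l add0r big_ord_recr /=.
by rewrite lerDl ip_ge0.
Qed.

Lemma shift_lin a f g : shift (a *: f + g) = a *: shift f + shift g.
Proof. by apply/funext => -[|n]; rewrite !fctE //= ?scaler0 ?addr0. Qed.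

End Sequences.

Section EvenOdd.
Context {R : realType} {V : rhilb R} {t c : V -> V}.
Hypotheses (bt : bop t) (bc : bop c) (st : symm t) (sc : symm c).
Hypotheses (tc : forall v, t (c v) = c (t v)) (tc1 : forall v, t (t v) + c (c v) = v).
Hypotheses (cpos : forall v, 0 <= ip (c v) v) (cinj : forall v, c v = 0 -> v = 0).
Implicit Types f g : nat -> V.

Local Ltac vec := let w := fresh "w" in apply: ip_ext => w; rewrite ?(bopD bt, bopN bt, bop0 bt, bopZ bt, bopD bc, bopN bc, bop0 bc, bopZ bc) ?ipE ?ip0l.

Lemma tc_nrm v : ip (t v) (t v) + ip (c v) (c v) = ip v v.
Proof. by rewrite st sc -ipDr tc1. Qed.

Lemma t_contr v : nrm (t v) <= nrm v.
Proof. by apply: le_nrm; rewrite -[leRHS]tc_nrm lerDl ip_ge0. Qed.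

Lemma c_contr v : nrm (c v) <= nrm v.
Proof. by apply: le_nrm; rewrite -[leRHS]tc_nrm lerDr ip_ge0. Qed.

(** One half of the series sum t^m c A c t^m, which formally solves O - t O t = c A c; the factor c
    makes the orbit square-summable. *)
Definition damped_orbit v : nat -> V := fun m => c (iter m t v).

Lemma iter_c m v : iter m t (c v) = c (iter m t v).
Proof. by elim: m => //= m ->; rewrite tc. Qed.

(** Telescoping of |c x|^2 = |x|^2 - |t x|^2 along the orbit. *)
Lemma orb_energy N v : \sum_(m < N) ip (damped_orbit v m) (damped_orbit v m) + ip (iter N t v) (iter N t v) = ip v v.
Proof.
elim: N => [|N ih]; first by rewrite big_ord0 add0r.
rewrite big_ord_recr /= -[RHS]ih -addrA; congr (_ + _).
by rewrite addrC tc_nrm.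
Qed.

Lemma sn_orb N v : sn N (damped_orbit v) <= nrm v.
Proof.
by apply: sn_le_const; rewrite ?nrm_ge0 // nrm_sq -[leRHS](orb_energy N) lerDl ip_ge0.
Qed.

Lemma iter_t_contr m v : nrm (iter m t v) <= nrm v.
Proof. by elim: m => //= m ih; apply: le_trans (t_contr _) ih. Qed.

Lemma iter_t_mono m k v : (m <= k)%N -> nrm (iter k t v) <= nrm (iter m t v).
Proof. by move/subnK <-; rewrite iterD iter_t_contr. Qed.

(** For v = c w the norms decrease while their squares have bounded sums, so n |t^n c w|^2 <= |w|^2;
    the range of c is dense. *)
Lemma iter_t_cvg v : cv (fun n => iter n t v) 0.
Proof.
have hc w n : n%:R * nrm (iter n t (c w)) ^+ 2 <= nrm w ^+ 2.
  apply: (@le_trans _ _ (\sum_(m < n) ip (damped_orbit w m) (damped_orbit w m))).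
    rewrite -[X in X%:R](card_ord n) mulr_natl -sumr_const; apply: ler_sum => i _.
    rewrite -nrm_sq ler_pXn2r ?nnegrE ?nrm_ge0 // /damped_orbit -iter_c iter_t_mono //.
    exact: ltnW.
  by rewrite nrm_sq -[leRHS](orb_energy n) lerDl ip_ge0.
apply/cvP => e e0; have e2 : 0 < e / 2 by lra.
have [_ [w _ <-] hw] := symm_dense_range bc sc cinj v e2.
pose N := (Num.truncn (nrm w ^+ 2 / (e / 2) ^+ 2)).+1.
have hN : nrm w ^+ 2 / (e / 2) ^+ 2 < N%:R by exact: truncnS_gt.
have e22 : 0 < (e / 2) ^+ 2 by rewrite exprn_gt0.
have h1 : nrm (iter N t (c w)) < e / 2.
  rewrite ltNge; apply/negP => h; move: hN; rewrite ltNge => /negP; apply.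
  rewrite ler_pdivlMr //; apply: le_trans (hc w N).
  by rewrite ler_wpM2l // ler_pXn2r ?nnegrE ?nrm_ge0 // ltW.
exists N => n Nn; rewrite subr0; apply: le_lt_trans (iter_t_mono _ Nn) _.
rewrite -(subrK (c w) v) (bopD (bop_iter N bt)).
apply: le_lt_trans (nrmD _ _) _; have := iter_t_contr N (v - c w); lra.
Qed.

(** The difference of the two forms is invariant under t in both arguments, and t^n tends strongly
    to 0. *)
Lemma stein_uniq (D1 D2 : V -> V -> R) k1 k2 :
  (forall x y, `|D1 x y| <= k1 * nrm x * nrm y) -> (forall x y, `|D2 x y| <= k2 * nrm x * nrm y) ->
  (forall x y, D1 x y - D1 (t x) (t y) = D2 x y - D2 (t x) (t y)) -> forall x y, D1 x y = D2 x y.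
Proof.
move=> h1 h2 h x y; apply/eqP; rewrite -subr_eq0 -normr_eq0 eq_le normr_ge0 andbT.
have hn n : D1 x y - D2 x y = D1 (iter n t x) (iter n t y) - D2 (iter n t x) (iter n t y).
  elim: n => // n ->; have := h (iter n t x) (iter n t y); rewrite /=; lra.
apply: (@rcv_le _ 0 (fun=> `|D1 x y - D2 x y|)
  (fun n => (`|k1| + `|k2|) * nrm y * nrm (iter n t x - 0))).
- exact: cvg_cst.
- by rewrite -(mulr0 ((`|k1| + `|k2|) * nrm y)); apply: rcvZ; exact: iter_t_cvg.
move=> n _; rewrite (hn n) subr0; apply: le_trans (ler_normB _ _) _.
have ky k : k * nrm (iter n t x) * nrm (iter n t y) <= `|k| * nrm y * nrm (iter n t x).
  apply: (@le_trans _ _ (`|k| * nrm (iter n t x) * nrm (iter n t y))).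
    by rewrite !ler_wpM2r ?nrm_ge0 ?ler_norm.
  by rewrite mulrAC ler_wpM2r ?nrm_ge0 // ler_wpM2l // iter_t_contr.
rewrite !mulrDl; apply: lerD.
  exact: le_trans (h1 _ _) (ky _).
exact: le_trans (h2 _ _) (ky _).
Qed.

(* The Blaschke factor (t - S) / (1 - t S), with S the shift. *)
Fixpoint blaschke f n : V := if n is k.+1 then t (blaschke f k) + t (f n) - f k else t (f 0%N).

Lemma bl_lin a f g : blaschke (a *: f + g) = a *: blaschke f + blaschke g.
Proof.
apply/funext; elim=> [|n ih]; rewrite !fctE /=; first by rewrite (bopL bt).
move: ih; rewrite !fctE => ->; rewrite !(bopD bt) !(bopZ bt).
by vec; ring.
Qed.

(* The 2 x 2 matrix (t, -c; c, t) is orthogonal, so the Blaschke factor is isometric. *)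
Fixpoint bl_state f n : V := if n is k.+1 then t (bl_state f k) - c (f k) else 0.

Lemma blE f n : blaschke f n = c (bl_state f n) + t (f n).
Proof.
elim: n => [|n ih]; first by rewrite /= (bop0 bc) add0r.
rewrite /= ih -[X in _ - X]tc1; vec.
rewrite !tc; ring.
Qed.

Lemma bl_energy N f : \sum_(m < N) ip (blaschke f m) (blaschke f m) + ip (bl_state f N) (bl_state f N) =
  \sum_(m < N) ip (f m) (f m).
Proof.
elim: N => [|N ih]; first by rewrite !big_ord0 /= ip0l addr0.
rewrite !big_ord_recr -ih /= -!addrA; congr (_ + _); rewrite blE.
move: (bl_state f N) (f N) => s x; rewrite !ipE -(tc_nrm s) -(tc_nrm x).
have e : ip (t s) (c x) = ip (c s) (t x) by rewrite st tc -sc.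
rewrite !(ipC (c x) (t s)) !(ipC (t x) (c s)) e; lra.
Qed.

Lemma bl_contr N f : sn N (blaschke f) <= sn N f.
Proof. by apply: sn_le; rewrite -[leRHS]bl_energy lerDl ip_ge0. Qed.

Lemma bl_shift f : blaschke (shift f) = shift (blaschke f).
Proof.
apply/funext; elim=> [|n ih]; first by rewrite /= (bop0 bt).
rewrite [LHS]/= ih; case: n {ih} => [|n] //=.
by rewrite (bop0 bt) add0r subr0.
Qed.

Definition diag (A : V -> V) f : nat -> V := fun n => A (f n).

Lemma bl_diag A f : bop A -> (forall v, A (t v) = t (A v)) -> blaschke (diag A f) = diag A (blaschke f).
Proof.
move=> bA At; apply/funext; elim=> [|n ih]; rewrite /= /diag; first by rewrite At.
by rewrite ih (bopB bA) (bopD bA) /diag !At.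
Qed.

Lemma diag_lin A a f g : bop A -> diag A (a *: f + g) = a *: diag A f + diag A g.
Proof. by move=> bA; apply/funext => n; rewrite /diag !fctE (bopL bA). Qed.

Lemma diag_contr N A f : (forall v, nrm (A v) <= nrm v) -> sn N (diag A f) <= sn N f.
Proof.
move=> hA; apply: sn_le; apply: ler_sum => i _.
by rewrite -!nrm_sq ler_pXn2r ?nnegrE ?nrm_ge0 // hA.
Qed.

(* These are 1 - t S and t - S; the first one maps [blaschke f] to (t - S) f. *)
Definition shift_op f : nat -> V := f - diag t (shift f).
Definition opM f : nat -> V := diag t f - shift f.

Lemma opE_lin a f g : shift_op (a *: f + g) = a *: shift_op f + shift_op g.
Proof. by rewrite /shift_op shift_lin diag_lin // opprD addrACA scalerBr. Qed.

Lemma opE_bl f : shift_op (blaschke f) = opM f.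
Proof.
apply/funext => -[|n]; rewrite /shift_op /opM /diag !fctE /=; first by rewrite (bop0 bt).
by vec; ring.
Qed.

Lemma opE_comm (T : (nat -> V) -> nat -> V) : (forall a f g, T (a *: f + g) = a *: T f + T g) ->
  (forall f, T (diag t f) = diag t (T f)) -> (forall f, T (shift f) = shift (T f)) ->
  forall f, T (shift_op f) = shift_op (T f).
Proof.
by move=> TL Tt Ts f; rewrite /shift_op addrC -scaleN1r TL scaleN1r addrC Tt Ts.
Qed.

Lemma opE_bound N f : sn N (shift_op f) <= 2 * sn N f.
Proof.
rewrite /shift_op -scaleN1r; apply: le_trans (snD _ _ _) _; rewrite snZ normrN1 mul1r mulr2n mulrDl mul1r.
rewrite lerD //; apply: le_trans (diag_contr _ _ t_contr) (shift_contr _ _).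
Qed.

Definition blaschke2 f := blaschke (blaschke f).
Definition shift2 f := shift (shift f) : nat -> V.

(** Since (1 - t S) B = t - S, this is (1 - t S)^2 - (t - S)^2 = (1 - t^2) (1 - S^2). *)
Lemma opE_main f : shift_op (shift_op (f - blaschke2 f)) = diag c (diag c (f - shift2 f)).
Proof.
have -> : shift_op (f - blaschke2 f) = shift_op f - opM (blaschke f).
  by rewrite addrC -scaleN1r opE_lin scaleN1r addrC opE_bl.
have -> : shift_op (shift_op f - opM (blaschke f)) = shift_op (shift_op f) - shift_op (opM (blaschke f)).
  by rewrite addrC -scaleN1r opE_lin scaleN1r addrC.
have -> : shift_op (opM (blaschke f)) = opM (opM f).
  rewrite -(opE_bl f); apply/funext => n; rewrite /shift_op /opM /diag !fctE.
  case: n => [|[|n]] /=; vec; ring.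
apply/funext => n; rewrite /shift_op /opM /diag /shift2 !fctE.
have cc v : c (c v) = v - t (t v) by apply/eqP; rewrite eq_sym subr_eq addrC tc1.
by rewrite cc; case: n => [|[|n]] /=; vec; ring.
Qed.

End EvenOdd.

(** * The square roots of 1 - B^2, 1 - S^2 and 1 - t^2 *)

Section EvenOdd2.
Context {R : realType} {V : rhilb R} {t c : V -> V}.
Hypotheses (bt : bop t) (bc : bop c) (st : symm t) (sc : symm c).
Hypotheses (tc : forall v, t (c v) = c (t v)) (tc1 : forall v, t (t v) + c (c v) = v).
Hypotheses (cpos : forall v, 0 <= ip (c v) v) (cinj : forall v, c v = 0 -> v = 0).
Implicit Types f g : nat -> V.
Local Notation bl := (@blaschke R V t).
Local Notation bl2 := (@blaschke2 R V t).
Local Notation opE := (@shift_op R V t).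
Local Notation orb := (@damped_orbit R V t c).

Let tsq v := t (t v).
Let vn (_ : unit) (v : V) := nrm v.

Lemma nrm_complete1 (u : nat -> V) :
  (forall (i : unit) e, 0 < e -> exists N, forall p q, (N <= p)%N -> (N <= q)%N -> vn i (u p - u q) < e) ->
  exists l, forall i, (fun m => vn i (u m - l)) @ \oo --> (0 : R).
Proof. by move=> h; have [l hl] := rh_complete (h tt); exists l => -[]. Qed.

Lemma visser_bl : exists L, visser sn bl2 L.
Proof.
apply: visser_exists; [exact: snD|exact: snZ|exact: sn_complete|exact: sn_sep| |].
- by move=> a f g; rewrite /blaschke2 !(bl_lin bt).
- by move=> N f; apply: le_trans (bl_contr bt bc st sc tc tc1 _ _) (bl_contr bt bc st sc tc tc1 _ _).
Qed.

Lemma visser_shift : exists L, visser (@sn R V) shift2 L.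
Proof.
apply: visser_exists; [exact: snD|exact: snZ|exact: sn_complete|exact: sn_sep| |].
- by move=> a f g; rewrite /shift2 !shift_lin.
- by move=> N f; apply: le_trans (shift_contr _ _) (shift_contr _ _).
Qed.

Lemma visser_t : exists L, visser vn tsq L.
Proof.
apply: visser_exists.
- by move=> i; exact: nrmD.
- by move=> i; exact: nrmZ.
- exact: nrm_complete1.
- by move=> x /(_ tt) /nrm_eq0.
- by move=> a u v; rewrite /tsq !(bopL bt).
- by move=> i v; apply: le_trans (t_contr st sc tc1 _) (t_contr st sc tc1 _).
Qed.

Section Limits.
Context {LB LS : (nat -> V) -> nat -> V} {Lt : V -> V}.
Hypotheses (hB : visser sn bl2 LB) (hS : visser sn shift2 LS) (hT : visser vn tsq Lt).

Definition blaschke_root f : nat -> V := f - LB f.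
Definition shift_root f : nat -> V := f - LS f.

Let tcontr := t_contr st sc tc1.
Let ccontr := c_contr st sc tc1.

Lemma Lt_cv v : cv (fun m => visser_seq tsq m v) (Lt v).
Proof.
by apply: (visser_cvg (n := vn) _ _ _ tt hT) => // i; [exact: nrmD|exact: nrmZ].
Qed.

(** Uniqueness of the positive square root: P = 1 - Lt is positive as Lt is a contraction, it
    commutes with c, and P^2 = c^2. So (P + c) (P - c) v = 0, and positivity puts P v - c v in the
    kernel of c. *)
Lemma Lt_sqrt v : v - Lt v = c v.
Proof.
have Lc w : c (Lt w) = Lt (c w).
  apply: (vi_comm hT) => [a u x|i|x]; first by rewrite (bopL bc).
  - by exists i, 1 => x; rewrite mul1r; exact: ccontr.
  - by rewrite /tsq !tc.
pose P w := w - Lt w.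
have LtB w z : Lt (w - z) = Lt w - Lt z by rewrite addrC -scaleN1r (vi_lin hT) scaleN1r addrC.
have P2 w : P (P w) = c (c w).
  rewrite /P (visser_sq hT); apply/eqP; rewrite subr_eq addrC; apply/eqP.
  by rewrite tc1.
have Pc w : P (c w) = c (P w) by rewrite /P (bopB bc) Lc.
have PB w z : P (w - z) = P w - P z by rewrite /P LtB !opprD !opprK addrACA.
pose w := P v - c v.
have : P w + c w = 0 by rewrite /w PB (bopB bc) P2 Pc addrA subrK subrr.
move=> /(congr1 (ip^~ w)); rewrite ipDl ip0l => h.
have Pw : 0 <= ip (P w) w.
  rewrite /P ipBl subr_ge0; apply: le_trans (ip_le _ _) _; rewrite -nrm_sq expr2 ler_wpM2r ?nrm_ge0 //.
  exact: (vi_le hT tt).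
have cw := cpos w.
have /(pos_ker bc sc cpos) /cinj : ip (c w) w = 0 by lra.
by move/eqP; rewrite subr_eq0 => /eqP.
Qed.

Lemma LB_cv f n : cv (fun m => visser_seq bl2 m f n) (LB f n).
Proof.
apply: (cv_squeeze (f := fun m => sn n.+1 (visser_seq bl2 m f - LB f))) => [m|].
  exact: (sn_coord n (visser_seq bl2 m f - LB f)).
by apply: (visser_cvg _ _ _ _ hB); [exact: snD|exact: snZ].
Qed.

Lemma LS_cv f n : cv (fun m => visser_seq shift2 m f n) (LS f n).
Proof.
apply: (cv_squeeze (f := fun m => sn n.+1 (visser_seq shift2 m f - LS f))) => [m|].
  exact: (sn_coord n (visser_seq shift2 m f - LS f)).
by apply: (visser_cvg _ _ _ _ hS); [exact: snD|exact: snZ].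
Qed.

(** The Blaschke factor is lower triangular with t on the diagonal. This passes to polynomials and
    limits, so the square root of 1 - B^2 has (1 - t^2)^(1/2) = c on the diagonal. *)
Lemma bl_lead n f : (forall k, (k < n)%N -> f k = 0) ->
  (forall k, (k < n)%N -> bl f k = 0) /\ bl f n = t (f n).
Proof.
move=> h; have h0 k : (k < n)%N -> bl f k = 0.
  elim: k => [|k ih] kn /=; first by rewrite h // (bop0 bt).
  by rewrite ih ?(ltnW kn) // !h ?(ltnW kn) // (bop0 bt) subr0 addr0.
split=> //; case: n h h0 => [|n] h h0 //=.
by rewrite h0 // (h n) // (bop0 bt) subr0 add0r.
Qed.

Lemma visser_bl_lead m n f : (forall k, (k < n)%N -> f k = 0) ->
  (forall k, (k < n)%N -> visser_seq bl2 m f k = 0) /\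
  visser_seq bl2 m f n = visser_seq tsq m (f n).
Proof.
elim: m f => [|m ih] f h; first by split.
have [a1 b1] := bl_lead h; have [a2 b2] := bl_lead a1.
have [a3 b3] := ih _ h; have [a4 b4] := ih _ a3.
split=> [k kn|].
  by have := a4 k kn; rewrite /= !fctE => ->; rewrite [blaschke2 _ k]a2 // addr0 scaler0.
by move: b4; rewrite /= !fctE => ->; rewrite b3 [blaschke2 _ n]b2 b1.
Qed.

Lemma visser_shift_lead m n f : (forall k, (k < n)%N -> f k = 0) ->
  forall k, (k <= n)%N -> visser_seq shift2 m f k = 0.
Proof.
elim: m n f => [|m ih] n f h k kn //=; rewrite !fctE.
rewrite [visser_seq _ _ _ k](ih n _ _ k kn) => [|j jn]; last by apply: ih h j (ltnW jn).
case: k kn => [|[|k]] kn; rewrite /shift2 /= ?addr0 ?scaler0 //.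
by rewrite h ?addr0 ?scaler0 // (leq_trans _ kn).
Qed.

Lemma theta_lead n f : (forall k, (k < n)%N -> f k = 0) ->
  (forall k, (k < n)%N -> blaschke_root f k = 0) /\ blaschke_root f n = c (f n).
Proof.
move=> h; split=> [k kn|].
  rewrite /blaschke_root !fctE h // (_ : LB f k = 0) ?subr0 //.
  apply: cv_unique (LB_cv f k) _; under eq_fun => m do rewrite (visser_bl_lead m h).1 //.
  exact: cv_cst.
rewrite /blaschke_root !fctE (_ : LB f n = Lt (f n)) ?Lt_sqrt //.
apply: cv_unique (LB_cv f n) _; under eq_fun => m do rewrite (visser_bl_lead m h).2.
exact: Lt_cv.
Qed.

Lemma thetaS_lead n f : (forall k, (k < n)%N -> f k = 0) ->
  forall k, (k <= n)%N -> shift_root f k = f k.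
Proof.
move=> h k kn; rewrite /shift_root !fctE (_ : LS f k = 0) ?subr0 //.
apply: cv_unique (LS_cv f k) _; under eq_fun => m do rewrite (visser_shift_lead m h kn).
exact: cv_cst.
Qed.

Lemma theta_comm T : (forall a f g, T (a *: f + g) = a *: T f + T g) ->
  (forall i, exists j C, forall f, sn i (T f) <= C * sn j f) ->
  (forall f, T (bl2 f) = bl2 (T f)) -> forall f, T (blaschke_root f) = blaschke_root (T f).
Proof.
move=> TL TC TB f; rewrite /blaschke_root addrC -scaleN1r TL scaleN1r addrC.
by rewrite (vi_comm hB TL TC TB).
Qed.

Lemma thetaS_comm T : (forall a f g, T (a *: f + g) = a *: T f + T g) ->
  (forall i, exists j C, forall f, sn i (T f) <= C * sn j f) ->
  (forall f, T (shift2 f) = shift2 (T f)) -> forall f, T (shift_root f) = shift_root (T f).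
Proof.
move=> TL TC TB f; rewrite /shift_root addrC -scaleN1r TL scaleN1r addrC.
by rewrite (vi_comm hS TL TC TB).
Qed.

Lemma theta_lin a f g : blaschke_root (a *: f + g) = a *: blaschke_root f + blaschke_root g.
Proof. by rewrite /blaschke_root (vi_lin hB) opprD addrACA scalerBr. Qed.

Lemma thetaS_lin a f g : shift_root (a *: f + g) = a *: shift_root f + shift_root g.
Proof. by rewrite /shift_root (vi_lin hS) opprD addrACA scalerBr. Qed.

Lemma theta_bound N f : sn N (blaschke_root f) <= 2 * sn N f.
Proof.
rewrite /blaschke_root -scaleN1r; apply: le_trans (snD _ _ _) _.
by rewrite snZ normrN1 mul1r mulr2n mulrDl mul1r lerD // (vi_le hB).
Qed.

Lemma thetaS_bound N f : sn N (shift_root f) <= 2 * sn N f.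
Proof.
rewrite /shift_root -scaleN1r; apply: le_trans (snD _ _ _) _.
by rewrite snZ normrN1 mul1r mulr2n mulrDl mul1r lerD // (vi_le hS).
Qed.

Lemma opE_bl2 f : opE (bl2 f) = bl2 (opE f).
Proof.
have h g : opE (bl g) = bl (opE g).
  apply/esym/opE_comm => [a x y|x|x]; first exact: (bl_lin bt).
    by rewrite (bl_diag (t := t) x bt).
  exact: (bl_shift bt x).
by rewrite /blaschke2 !h.
Qed.

Lemma diag_bl2 A f : bop A -> (forall v, A (t v) = t (A v)) -> diag A (bl2 f) = bl2 (diag A f).
Proof. by move=> bA At; rewrite /blaschke2 !(bl_diag _ bA At). Qed.

Let con1 (T : (nat -> V) -> nat -> V) : (forall N f, sn N (T f) <= sn N f) ->
  forall i, exists j C, forall f, sn i (T f) <= C * sn j f.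
Proof. by move=> h i; exists i, 1 => f; rewrite mul1r h. Qed.

Lemma theta_E f : opE (blaschke_root f) = blaschke_root (opE f).
Proof.
apply: theta_comm => [a x y|i|x]; [exact: (opE_lin bt)| |exact: opE_bl2].
by exists i, 2 => x; apply: (opE_bound st sc tc1).
Qed.

Lemma theta_diag A f : bop A -> (forall v, nrm (A v) <= nrm v) -> (forall v, A (t v) = t (A v)) ->
  diag A (blaschke_root f) = blaschke_root (diag A f).
Proof.
move=> bA nA At; apply: theta_comm => [a x y||x]; first exact: diag_lin.
  by apply: con1 => N x; exact: diag_contr.
exact: diag_bl2.
Qed.

Lemma thetaS_diag A f : bop A -> (forall v, nrm (A v) <= nrm v) ->
  diag A (shift_root f) = shift_root (diag A f).
Proof.
move=> bA nA; apply: thetaS_comm => [a x y||x]; first exact: diag_lin.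
  by apply: con1 => N x; exact: diag_contr.
by apply/funext => -[|[|n]]; rewrite /diag /shift2 //= (bop0 bA).
Qed.

Lemma thetaS_E f : opE (shift_root f) = shift_root (opE f).
Proof.
apply: thetaS_comm => [a x y|i|x]; [exact: (opE_lin bt)| |].
  by exists i, 2 => x; apply: (opE_bound st sc tc1).
apply/funext => n; rewrite /shift_op /shift2 /diag !fctE.
by case: n => [|[|[|n]]]; rewrite /= ?(bop0 bt) ?subr0.
Qed.

Lemma thetaS_theta f : shift_root (blaschke_root f) = blaschke_root (shift_root f).
Proof.
apply: theta_comm => [a x y|i|x]; [exact: thetaS_lin| |].
  by exists i, 2 => x; exact: thetaS_bound.
apply/esym/thetaS_comm => [a y z||y].
- by rewrite /blaschke2 !(bl_lin bt).
- apply: con1 => N y.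
  by apply: le_trans (bl_contr bt bc st sc tc tc1 _ _) (bl_contr bt bc st sc tc tc1 _ _).
- by rewrite /shift2 /blaschke2 !(bl_shift bt).
Qed.

(* (1 - t S) (1 - B^2)^(1/2) = c (1 - S^2)^(1/2): the squares agree by [opE_main], the leading
   coefficients are c > 0. *)
Lemma theta_thetaS f : opE (blaschke_root f) = diag c (shift_root f).
Proof.
pose Q1 x := opE (blaschke_root x); pose Q2 x := diag c (shift_root x).
have Q1L a x y : Q1 (a *: x + y) = a *: Q1 x + Q1 y by rewrite /Q1 theta_lin (opE_lin bt).
have Q2L a x y : Q2 (a *: x + y) = a *: Q2 x + Q2 y by rewrite /Q2 thetaS_lin diag_lin.
have Q1B x y : Q1 (x - y) = Q1 x - Q1 y by rewrite addrC -scaleN1r Q1L scaleN1r addrC.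
have Q2B x y : Q2 (x - y) = Q2 x - Q2 y by rewrite addrC -scaleN1r Q2L scaleN1r addrC.
have Q11 x : Q1 (Q1 x) = diag c (diag c (x - shift2 x)).
  rewrite /Q1 -theta_E -(opE_main bt tc1); congr (opE (opE _)).
  exact: (visser_sq hB).
have Q22 x : Q2 (Q2 x) = diag c (diag c (x - shift2 x)).
  rewrite /Q2 -thetaS_diag //; congr (diag c (diag c _)).
  exact: (visser_sq hS).
have Q12 x : Q1 (Q2 x) = Q2 (Q1 x).
  rewrite /Q1 /Q2 -theta_diag // -thetaS_E -thetaS_theta.
  apply/esym/opE_comm => [a y z|y|y]; first exact: diag_lin.
    by apply/funext => n; rewrite /diag tc.
  by apply/funext => -[|n]; rewrite /diag //= (bop0 bc).
(* Q1 and Q2 commute and have the same square, so (Q1 + Q2) u = 0. As Q1 + Q2 is lower triangular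
   with the injective operator 2 c on the diagonal, u vanishes entry by entry. *)
pose u := Q1 f - Q2 f.
have hu : Q1 u + Q2 u = 0.
  by rewrite /u Q1B Q2B Q11 Q22 Q12 addrA subrK subrr.
suff u0 n : u n = 0.
  by apply/eqP; rewrite -subr_eq0; apply/eqP/funext => n; exact: (u0 n).
elim/ltn_ind: n => n ih.
have [_ h1] := theta_lead ih.
have h2 : Q1 u n = c (u n).
  rewrite /Q1 /shift_op !fctE /diag h1; case: n ih {h1} => [|n] ih /=; first by rewrite (bop0 bt) subr0.
  by rewrite (theta_lead ih).1 // (bop0 bt) subr0.
have h3 : Q2 u n = c (u n) by rewrite /Q2 /diag (thetaS_lead ih).
have : (Q1 u + Q2 u) n = 0 by rewrite hu.
rewrite fctE h2 h3 -mulr2n => /eqP; rewrite -scaler_nat scaler_eq0 pnatr_eq0 /= => /eqP.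
exact: cinj.
Qed.

End Limits.
End EvenOdd2.

(** * Pairing operators with sequences along the orbits of t *)

Section EvenOdd3.
Context {R : realType} {V : rhilb R} {t c : V -> V}.
Hypotheses (bt : bop t) (bc : bop c) (st : symm t) (sc : symm c).
Hypotheses (tc : forall v, t (c v) = c (t v)) (tc1 : forall v, t (t v) + c (c v) = v).
Hypotheses (cpos : forall v, 0 <= ip (c v) v) (cinj : forall v, c v = 0 -> v = 0).
Implicit Types (f g : nat -> V) (A B O Q : V -> V).
Local Notation bl := (@blaschke R V t).
Local Notation bl2 := (@blaschke2 R V t).
Local Notation opE := (@shift_op R V t).
Local Notation orb := (@damped_orbit R V t c).

Definition bdd f k : Prop := forall N, sn N f <= k.

Definition psum A x f M : R := \sum_(m < M) ip (A (orb x m)) (f m).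
(** The sum of <A c t^m x, f_m>. When f is an orbit, this is the form of the Stein solution
    ([pair_orb]); operations on A turn into operations on f. *)
Definition orbit_pair A x f : R := lim (psum A x f @ \oo).

Lemma bdd_lin a f g k j : bdd f k -> bdd g j -> bdd (a *: f + g) (`|a| * k + j).
Proof.
by move=> hf hg N; apply: le_trans (snD _ _ _) _; rewrite snZ lerD // ler_wpM2l.
Qed.

Lemma bddB f g k j : bdd f k -> bdd g j -> bdd (f - g) (k + j).
Proof.
move=> hf hg N; apply: le_trans (snD _ _ _) _.
by rewrite -(scaleN1r g) snZ normrN1 mul1r lerD.
Qed.

Lemma psum_bound A k x f j M : (forall v, nrm (A v) <= k * nrm v) -> 0 <= k -> bdd f j ->
  `|psum A x f M| <= k * nrm x * j.
Proof.
move=> hA k0 hf; apply: le_trans (sn_cs M (fun m => A (orb x m)) f) _.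
apply: ler_pM; rewrite ?sn_ge0 ?hf //.
apply: (@le_trans _ _ (sn M (k *: orb x))).
  apply: sn_le; apply: ler_sum => i _; rewrite -!nrm_sq ler_pXn2r ?nnegrE ?nrm_ge0 //.
  by rewrite fctE nrmZ ger0_norm.
by rewrite snZ ger0_norm // ler_wpM2l // (sn_orb st sc tc1).
Qed.

Lemma psumD A x f M N : psum A x f (M + N) =
  psum A x f M + psum A (iter M t x) (fun n => f (M + n)%N) N.
Proof.
rewrite /psum big_split_ord /=; congr (_ + _); apply: eq_bigr => i _ /=.
by rewrite /damped_orbit -iterD addnC.
Qed.

Lemma bdd_drop f k M : bdd f k -> bdd (fun n => f (M + n)%N) k.
Proof.
move=> hf N; apply: le_trans (hf (M + N)%N); apply: sn_le.
by rewrite big_split_ord /= lerDr sumr_ge0 // => i _; exact: ip_ge0.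
Qed.

Lemma pair_cvg A x f k : bop A -> bdd f k -> psum A x f @ \oo --> orbit_pair A x f.
Proof.
move=> /bop_bound [a a0 hA] hf; rewrite /orbit_pair.
suff [l hl] : exists l : R, psum A x f @ \oo --> l by rewrite (cvg_lim _ hl).
apply: real_cauchy => e e0.
have k0 : 0 <= k by apply: le_trans (hf 0%N); exact: sn_ge0.
have ak : 0 < a * k + 1 by rewrite ltr_wpDl // mulr_ge0 // ltW.
have /cvP /(_ (e / (a * k + 1))) := iter_t_cvg bt bc st sc tc tc1 cinj x.
case; first by rewrite divr_gt0.
move=> N hN; exists N.
have key p q : (N <= p)%N -> (p <= q)%N -> `|psum A x f q - psum A x f p| < e.
  move=> Np /subnKC <-; rewrite psumD addrC addKr.
  apply: le_lt_trans (psum_bound _ _ hA (ltW a0) (bdd_drop p hf)) _.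
  have := hN p Np; rewrite subr0 ltr_pdivlMr // => h; apply: le_lt_trans h.
  by rewrite mulrAC mulrC ler_wpM2l ?nrm_ge0 // lerDl.
move=> p q Np Nq; have [pq|qp] := leqP p q; last exact: key (ltnW qp).
by rewrite distrC key.
Qed.
Arguments pair_cvg {A} x {f k}.

Lemma pair_bound A k x f j : (forall v, nrm (A v) <= k * nrm v) -> 0 <= k -> bop A -> bdd f j ->
  `|orbit_pair A x f| <= k * nrm x * j.
Proof.
move=> hA k0 bA hf; have h := cvg_norm (pair_cvg x bA hf).
apply: (@rcv_le R 0 (fun M => `|psum A x f M|) (fun=> k * nrm x * j)).
- exact: h.
- exact: cvg_cst.
- by move=> M _; exact: psum_bound.
Qed.
Arguments pair_bound {A k} x {f j}.

Lemma pair_linl a A B x f k : bop A -> bop B -> bdd f k ->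
  orbit_pair (fun v => a *: A v + B v) x f = a * orbit_pair A x f + orbit_pair B x f.
Proof.
move=> bA bB hf; apply: cvgR_unique (pair_cvg x (bop_lin a bA bB) hf) _.
rewrite (_ : psum _ x f = fun M => a * psum A x f M + psum B x f M).
  by apply: rcvD; [apply: rcvZ|]; exact: (pair_cvg x _ hf).
apply/funext => M; rewrite /psum mulr_sumr -big_split; apply: eq_bigr => i _.
by rewrite ipDl ipZl.
Qed.
Arguments pair_linl a {A B} x {f k}.

Lemma pair_linr a A x f g k j : bop A -> bdd f k -> bdd g j ->
  orbit_pair A x (a *: f + g) = a * orbit_pair A x f + orbit_pair A x g.
Proof.
move=> bA hf hg; apply: cvgR_unique (pair_cvg x bA (bdd_lin a hf hg)) _.
rewrite (_ : psum A x _ = fun M => a * psum A x f M + psum A x g M).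
  by apply: rcvD; [apply: rcvZ; exact: (pair_cvg x bA hf)|exact: (pair_cvg x bA hg)].
apply/funext => M; rewrite /psum mulr_sumr -big_split; apply: eq_bigr => i _.
by rewrite !fctE ipDr ipZr.
Qed.
Arguments pair_linr a {A} x {f g k j}.

Lemma pair_linm a A x y f k : bop A -> bdd f k ->
  orbit_pair A (a *: x + y) f = a * orbit_pair A x f + orbit_pair A y f.
Proof.
move=> bA hf; apply: cvgR_unique (pair_cvg _ bA hf) _.
rewrite (_ : psum A _ f = fun M => a * psum A x f M + psum A y f M).
  by apply: rcvD; [apply: rcvZ|]; exact: (pair_cvg _ bA hf).
apply/funext => M; rewrite /psum mulr_sumr -big_split; apply: eq_bigr => i _.
by rewrite /damped_orbit (bopL (bop_iter _ bt)) (bopL bc) (bopL bA) ipDl ipZl.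
Qed.
Arguments pair_linm a {A} x y {f k}.

Lemma pairBl A B x f k : bop A -> bop B -> bdd f k ->
  orbit_pair (fun v => A v - B v) x f = orbit_pair A x f - orbit_pair B x f.
Proof.
move=> bA bB hf; have := pair_linl (-1) x bB bA hf; rewrite mulN1r addrC => <-.
by congr orbit_pair; apply/funext => v; rewrite scaleN1r addrC.
Qed.
Arguments pairBl {A B} x {f k}.

Lemma pairBr A x f g k j : bop A -> bdd f k -> bdd g j ->
  orbit_pair A x (f - g) = orbit_pair A x f - orbit_pair A x g.
Proof.
by move=> bA hf hg; have := pair_linr (-1) x bA hg hf; rewrite mulN1r scaleN1r addrC => ->; rewrite addrC.
Qed.
Arguments pairBr {A} x {f g k j}.

Lemma pairBm A x y f k : bop A -> bdd f k -> orbit_pair A (x - y) f = orbit_pair A x f - orbit_pair A y f.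
Proof.
by move=> bA hf; have := pair_linm (-1) y x bA hf; rewrite mulN1r scaleN1r addrC => ->; rewrite addrC.
Qed.
Arguments pairBm {A} x y {f k}.

(** Shifting the summation index moves t from x to a shift of f, so a function of t acting on x
    becomes the same function of S acting on f. *)
Lemma pair_shift A x f k : bop A -> bdd f k -> orbit_pair A (t x) f = orbit_pair A x (shift f).
Proof.
move=> bA hf; have hs : bdd (shift f) k by move=> N; apply: le_trans (shift_contr _ _) (hf N).
apply: cvgR_unique (pair_cvg (t x) bA hf) _.
rewrite (_ : psum A (t x) f = fun M => psum A x (shift f) M.+1).
  exact: rcv_shift (pair_cvg x bA hs).
apply/funext => M; rewrite /psum big_ord_recl /= ip0r add0r; apply: eq_bigr => i _.
by rewrite /damped_orbit -iterSr.
Qed.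
Arguments pair_shift {A} x {f k}.

Lemma pair_congr A B x y f g : (forall m, ip (A (orb x m)) (f m) = ip (B (orb y m)) (g m)) ->
  orbit_pair A x f = orbit_pair B y g.
Proof.
move=> h; rewrite /orbit_pair (_ : psum A x f = psum B y g) //.
by apply/funext => M; apply: eq_bigr => i _.
Qed.

Lemma pair_t A x f : orbit_pair (fun v => t (A (t v))) x f = orbit_pair A (t x) (diag t f).
Proof.
by apply: pair_congr => m; rewrite st /damped_orbit tc -iterSr iterS.
Qed.

Lemma pair_c A x f : orbit_pair (fun v => c (A (c v))) x f = orbit_pair A (c x) (diag c f).
Proof.
by apply: pair_congr => m; rewrite sc /damped_orbit (iter_c tc).
Qed.

Definition stein A O : Prop := bop O /\ forall v, O v - t (O (t v)) = c (A (c v)).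

(** Square-summable sequences that depend on x boundedly and compatibly with t: the orbits, and
    their images under functions of the Blaschke factor. Compatibility lets [pair_E] compute Stein
    differences in both arguments. *)
Definition adm (y : V -> nat -> V) : Prop :=
  (exists k, forall x, bdd (y x) (k * nrm x)) /\ forall x, y (t x) = diag t (y x).

Lemma pair_stein A O x f k : bop A -> stein A O -> bdd f k ->
  orbit_pair O x f - orbit_pair O (t x) (diag t f) = orbit_pair A (c x) (diag c f).
Proof.
move=> bA [bO h] hf; rewrite -pair_t -pair_c -(pairBl x bO (bop_comp bt (bop_comp bO bt)) hf).
by apply: pair_congr => m; rewrite /= h.
Qed.
Arguments pair_stein {A O} x {f k}.

Lemma bdd_diag B f k : (forall v, nrm (B v) <= nrm v) -> bdd f k -> bdd (diag B f) k.
Proof. by move=> hB hf N; apply: le_trans (diag_contr _ _ hB) (hf N). Qed.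

Let tcontr := t_contr st sc tc1.
Let ccontr := c_contr st sc tc1.

(** By [pair_shift] a Stein difference of the form is the operator 1 - t S on the sequence. *)
Lemma pair_E A x f k : bop A -> bdd f k ->
  orbit_pair A x f - orbit_pair A (t x) (diag t f) = orbit_pair A x (opE f).
Proof.
move=> bA hf; rewrite (pair_shift x bA (bdd_diag tcontr hf)).
have hs : bdd (shift (diag t f)) k.
  by move=> N; apply: le_trans (shift_contr _ _) (bdd_diag tcontr hf N).
rewrite -(pairBr x bA hf hs); congr orbit_pair.
by rewrite /shift_op; congr (_ - _); apply/funext => -[|n]; rewrite /diag //= (bop0 bt).
Qed.
Arguments pair_E {A} x {f k}.

Lemma bdd_E f k : bdd f k -> bdd (opE f) (2 * k).
Proof. by move=> hf N; apply: le_trans (opE_bound st sc tc1 _ _) _; rewrite ler_pM2l. Qed.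

Lemma bdd_bl2 f k : bdd f k -> bdd (bl2 f) k.
Proof.
move=> hf N; apply: le_trans (hf N).
by apply: le_trans (bl_contr bt bc st sc tc tc1 _ _) (bl_contr bt bc st sc tc tc1 _ _).
Qed.

Lemma cc_tt v : c (c v) = v - t (t v).
Proof. by apply/eqP; rewrite eq_sym subr_eq addrC tc1. Qed.

Lemma pair_cc A x f k : bop A -> bdd f k -> orbit_pair A (c (c x)) f = orbit_pair A x (f - shift2 f).
Proof.
move=> bA hf.
have hs : bdd (shift f) k by move=> N; apply: le_trans (shift_contr _ _) (hf N).
have hs2 : bdd (shift2 f) k by move=> N; apply: le_trans (shift_contr _ _) (hs N).
by rewrite cc_tt (pairBm _ _ bA hf) (pairBr _ bA hf hs2) (pair_shift _ bA hf) (pair_shift _ bA hs).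
Qed.
Arguments pair_cc {A} x {f k}.

Lemma form_bound A (y : V -> nat -> V) k : bop A -> (forall x : V, bdd (y x) (k * nrm x)) ->
  exists j, forall x z, `|orbit_pair A x (y z)| <= j * nrm x * nrm z.
Proof.
move=> bA hy; have [a a0 ha] := bop_bound bA; exists (a * k) => x z.
have := pair_bound x ha (ltW a0) bA (hy z); rewrite [leRHS]mulrA.
by rewrite [a * k * _]mulrAC.
Qed.

Lemma stein_uniq2 (D1 D2 : V -> V -> R) k1 k2 :
  (forall x y, `|D1 x y| <= k1 * nrm x * nrm y) -> (forall x y, `|D2 x y| <= k2 * nrm x * nrm y) ->
  (forall x y, (D1 x y - D1 (t x) (t y)) - (D1 (t x) (t y) - D1 (t (t x)) (t (t y))) =
               (D2 x y - D2 (t x) (t y)) - (D2 (t x) (t y) - D2 (t (t x)) (t (t y)))) ->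
  forall x y, D1 x y = D2 x y.
Proof.
move=> h1 h2 h; apply: (stein_uniq bt bc st sc tc tc1 cinj h1 h2).
have bd (D : V -> V -> R) k : (forall x y, `|D x y| <= k * nrm x * nrm y) ->
    forall x y, `|D x y - D (t x) (t y)| <= (`|k| + `|k|) * nrm x * nrm y.
  move=> hD x y; apply: le_trans (ler_normB _ _) _; rewrite !mulrDl.
  have kk (x' y' : V) : nrm x' <= nrm x -> nrm y' <= nrm y -> k * nrm x' * nrm y' <= `|k| * nrm x * nrm y.
    move=> hx hy; apply: (@le_trans _ _ (`|k| * nrm x' * nrm y')).
      by rewrite !ler_wpM2r ?nrm_ge0 ?ler_norm.
    by apply: ler_pM; rewrite ?mulr_ge0 ?nrm_ge0 // ler_wpM2l.
  apply: lerD; first exact: le_trans (hD x y) (kk x y (lexx _) (lexx _)).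
  exact: le_trans (hD _ _) (kk _ _ (tcontr x) (tcontr y)).
exact: (stein_uniq bt bc st sc tc tc1 cinj (bd _ _ h1) (bd _ _ h2)).
Qed.

(* With O = A'(A) and Q = A'(O) the iterates of the Stein solution map A', the operator
   1 - A'^2 acts on forms as the square of the Blaschke factor. *)
Lemma pair_step A O Q y : bop A -> stein A O -> stein O Q -> adm y ->
  forall x z, orbit_pair (fun v => A v - Q v) x (y z) = orbit_pair A x (bl2 (y z)).
Proof.
move=> bA hO hQ [[k hy] yt] x z.
have bO := hO.1; have bQ := hQ.1.
have hb w : bdd (bl2 (y w)) (k * nrm w) := bdd_bl2 (hy w).
have hyb w : bdd (y w - bl2 (y w)) (k * nrm w + k * nrm w) by apply: bddB.
rewrite (pairBl x bA bQ (hy z)).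
(* Both sides have the same second Stein difference: (1 - t S)^2 turns 1 - B^2 into c^2 (1 - S^2),
   and the Stein equations of Q and O lead from Q down to A, with c^2 on either side. *)
suff <- : orbit_pair A x (y z - bl2 (y z)) = orbit_pair Q x (y z).
  by rewrite (pairBr x bA (hy z) (hb z)); lra.
have hyb2 w : bdd (y w - bl2 (y w)) ((k + k) * nrm w) by rewrite mulrDl.
have [k1 hk1] := form_bound bA hyb2; have [k2 hk2] := form_bound bQ hy.
have yt2 w : y (t w) - bl2 (y (t w)) = diag t (y w - bl2 (y w)).
  rewrite yt -(diag_bl2 (y w) bt) //; apply/funext => n; rewrite /diag !fctE.
  by rewrite (bopB bt).
apply: (stein_uniq2 hk1 hk2) => {x z} x z.
rewrite !yt2 !yt (pair_E x bA (hyb z)) (pair_stein x bO hQ (hy z)).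
rewrite (pair_stein (t x) bO hQ (bdd_diag tcontr (hy z))).
rewrite (pair_E (t x) bA (bdd_diag tcontr (hyb z))).
have -> : opE (diag t (y z - bl2 (y z))) = diag t (opE (y z - bl2 (y z))).
  apply/esym/opE_comm => [a f g|//|f]; first exact: diag_lin.
  by apply/funext => -[|n]; rewrite /diag //= (bop0 bt).
rewrite (pair_E x bA (bdd_E (hyb z))) (opE_main bt tc1).
have -> : diag c (diag t (y z)) = diag t (diag c (y z)).
  by apply/funext => n; rewrite /diag tc.
rewrite -tc (pair_stein (c x) bA hO (bdd_diag ccontr (hy z))).
rewrite (pair_cc x bA (bdd_diag ccontr (bdd_diag ccontr (hy z)))); congr orbit_pair.
apply/funext => n; rewrite /diag !fctE !(bopB bc) /shift2.
by case: n => [|[|n]] //=; rewrite !(bop0 bc).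
Qed.

Lemma orb_adm : adm orb.
Proof.
split; last by move=> x; apply/funext => m; rewrite /damped_orbit /diag -iterSr iterS tc.
by exists 1 => x N; rewrite mul1r (sn_orb st sc tc1).
Qed.

(** The partial sums of sum t^m c A c t^m telescope by the Stein equation; the remainder <O t^M x,
    t^M z> tends to 0. *)
Lemma pair_orb A O x z : bop A -> stein A O -> orbit_pair A x (orb z) = ip (O x) z.
Proof.
move=> bA [bO hO]; have [[k hk] _] := orb_adm.
have e M : ip (O x) z - psum A x (orb z) M = ip (O (iter M t x)) (iter M t z).
  elim: M => [|M ih]; first by rewrite /psum big_ord0 subr0.
  rewrite /psum big_ord_recr /= opprD addrA -/(psum A x (orb z) M) ih.
  rewrite /damped_orbit -sc -hO ipBl -st; lra.
have [a a0 ha] := bop_bound bO.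
apply/esym/eqP; rewrite -subr_eq0 -normr_eq0 eq_le normr_ge0 andbT.
have h1 := cvg_norm (cvgB (cvg_cst (ip (O x) z)) (pair_cvg x bA (hk z))).
have h2 := rcvZ (c := a * nrm z) (iter_t_cvg bt bc st sc tc tc1 cinj x).
rewrite mulr0 in h2.
apply: (@rcv_le R 0 (fun M => `|ip (O x) z - psum A x (orb z) M|)
  (fun M => a * nrm z * nrm (iter M t x - 0))) => [| |M _]; [exact: h1|exact: h2|].
rewrite subr0 e; apply: le_trans (ip_cs _ _) _; rewrite mulrAC; apply: ler_pM; rewrite ?nrm_ge0 //.
exact: (iter_t_contr st sc tc1).
Qed.

End EvenOdd3.

(** * Even powers of the Stein solution map as limits of odd ones *)

Section EvenOdd4.
Context {R : realType} {V : rhilb R} {t c : V -> V}.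
Hypotheses (bt : bop t) (bc : bop c) (st : symm t) (sc : symm c).
Hypotheses (tc : forall v, t (c v) = c (t v)) (tc1 : forall v, t (t v) + c (c v) = v).
Hypotheses (cpos : forall v, 0 <= ip (c v) v) (cinj : forall v, c v = 0 -> v = 0).
Implicit Types (f g : nat -> V) (A B O Q : V -> V).
Local Notation bl := (@blaschke R V t).
Local Notation bl2 := (@blaschke2 R V t).
Local Notation opE := (@shift_op R V t).
Local Notation orb := (@damped_orbit R V t c).
Local Notation pair := (@orbit_pair R V t c).
Local Notation stein0 := (@stein R V t c).
Local Notation adm0 := (@adm R V t).
Let tcontr := t_contr st sc tc1.
Let ccontr := c_contr st sc tc1.
Let tsq v := t (t v).
Let vn (_ : unit) (v : V) := nrm v.

Let pair_cvg := pair_cvg bt bc st sc tc tc1 cinj.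
Let pairBr := pairBr bt bc st sc tc tc1 cinj.
Let pairBl := pairBl bt bc st sc tc tc1 cinj.
Let pairBm := pairBm bt bc st sc tc tc1 cinj.
Let pair_shift := pair_shift bt bc st sc tc tc1 cinj.
Let pair_bound := pair_bound bt bc st sc tc tc1 cinj.

Lemma bl2_contr N f : sn N (bl2 f) <= sn N f.
Proof. by apply: le_trans (bl_contr bt bc st sc tc tc1 _ _) (bl_contr bt bc st sc tc tc1 _ _). Qed.

Lemma adm_visser y m : adm0 y -> adm0 (fun x => visser_seq bl2 m (y x)).
Proof.
move=> [[k hk] yt]; split.
  exists k => x N; apply: le_trans (hk x N).
  by apply: visser_le; [exact: snD|exact: snZ|exact: bl2_contr].
move=> x; rewrite yt; apply/esym/visser_seq_comm => [a f g|f]; first exact: diag_lin.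
exact: diag_bl2.
Qed.

Section Limits.
Context {LB LS : (nat -> V) -> nat -> V} {Lt : V -> V}.
Hypotheses (hB : visser sn bl2 LB) (hS : visser sn shift2 LS) (hT : visser vn tsq Lt).
Local Notation theta := (@blaschke_root R V LB).
Local Notation thetaS := (@shift_root R V LS).

Lemma bdd_gap (H L : (nat -> V) -> nat -> V) f k m : visser sn H L -> bdd f k ->
  bdd (L f - visser_seq H m f) ((sqrt_coef_lim - sqrt_coef m) * k).
Proof.
move=> hL hf N; apply: le_trans (vi_err hL _ _ _) _.
by rewrite ler_wpM2l // subr_ge0 sqrt_coef_le_lim.
Qed.

Lemma pair_visser_cvg (H L : (nat -> V) -> nat -> V) A x f k : visser sn H L -> bop A -> bdd f k ->
  (forall m, bdd (visser_seq H m f) k) ->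
  (fun m => pair A x (visser_seq H m f)) @ \oo --> pair A x (L f).
Proof.
move=> hL bA hf hm; have [a a0 ha] := bop_bound bA.
have hLf : bdd (L f) k by move=> N; apply: le_trans (vi_le hL _ _) (hf N).
have g0 : (fun m => a * nrm x * k * (sqrt_coef_lim - sqrt_coef m)) @ \oo --> (0 : R).
  rewrite -(mulr0 (a * nrm x * k)); apply: rcvZ; rewrite -(subrr sqrt_coef_lim).
  by apply: rcvD; [exact: cvg_cst|apply: cvgN; exact: sqrt_coef_cvg].
apply/cvgrPdist_le => e e0; have /cvgrPdist_le /(_ e e0) := g0; apply: filterS => m /=.
rewrite sub0r normrN -(pairBr x bA hLf (hm m)) => h; apply: le_trans h.
have k0 : 0 <= k by apply: le_trans (hf 0%N); exact: sn_ge0.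
rewrite [leRHS]ger0_norm; last by rewrite !mulr_ge0 ?nrm_ge0 ?subr_ge0 ?sqrt_coef_le_lim // ltW.
apply: le_trans (pair_bound x ha (ltW a0) bA (bdd_gap m hL hf)) _.
by rewrite !mulrA mulrAC.
Qed.

Arguments pair_visser_cvg {H L A} x {f k}.

Definition delta0 (v : V) : nat -> V := fun n => if n is 0%N then v else 0.

Lemma bdd_delta0 v : bdd (delta0 v) (nrm v).
Proof.
move=> [|N]; first by apply: sn_le_const; rewrite ?nrm_ge0 // big_ord0 sqr_ge0.
apply: sn_le_const; rewrite ?nrm_ge0 // big_ord_recl big1 => [|i _]; last by rewrite ip0l.
by rewrite addr0 nrm_sq.
Qed.

Lemma pair_delta0 A x v : bop A -> pair A x (delta0 v) = ip (A (c x)) v.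
Proof.
move=> bA; apply: cvgR_unique (pair_cvg bA (bdd_delta0 v)) _.
apply/cvgrPdist_lt => e e0; exists 1%N => // -[|n] //= _.
rewrite /psum big_ord_recl big1 => [|i _]; last by rewrite ip0r.
by rewrite addr0 subrr normr0.
Qed.

(** The orbit is the geometric series of (1 - t S)^-1 on c v placed at index 0. *)
Lemma opE_orb v : opE (orb v) = delta0 (c v).
Proof.
apply/funext => -[|n]; rewrite /shift_op /diag !fctE /damped_orbit /= ?(bop0 bt) ?subr0 //.
by rewrite tc subrr.
Qed.

Lemma shift2_contr N f : sn N (shift2 f) <= sn N f.
Proof. by apply: le_trans (shift_contr _ _) (shift_contr _ _). Qed.

Lemma bdd_visser_shift m f k : bdd f k -> bdd (visser_seq shift2 m f) k.
Proof.
move=> hf N; apply: le_trans (hf N).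
by apply: visser_le; [exact: snD|exact: snZ|exact: shift2_contr].
Qed.

(** By [pair_shift] a polynomial in S^2 on f is the same polynomial in t^2 on x; in the limit (1 -
    S^2)^(1/2) becomes (1 - t^2)^(1/2) = c. *)
Lemma pair_thetaS A x f k : bop A -> bdd f k -> pair A x (thetaS f) = pair A (c x) f.
Proof.
move=> bA hf.
have hLf : bdd (LS f) k by move=> N; apply: le_trans (vi_le hS _ _) (hf N).
rewrite -(Lt_sqrt bc st sc tc tc1 cpos cinj hT x) (pairBm _ _ bA hf).
rewrite /shift_root (pairBr x bA hf hLf); congr (_ - _).
have h1 := pair_visser_cvg x hS bA hf (fun m => bdd_visser_shift m hf).
apply: cvgR_unique h1 _.
have -> : (fun m => pair A x (visser_seq shift2 m f)) = fun m => pair A (visser_seq tsq m x) f.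
  apply/funext => m; elim: m x f k {hLf} hf => [|m ih] x f k hf.
    by apply: pair_congr => m; rewrite ip0r /damped_orbit (bop0 (bop_iter m bt)) (bop0 bc) (bop0 bA) ip0l.
  have hs : bdd (shift2 f) k by move=> N; apply: le_trans (shift2_contr _ _) (hf N).
  have hm := bdd_visser_shift m hf; have hmm := bdd_visser_shift m hm.
  have e1 : pair A x (shift2 f) = pair A (tsq x) f.
    have h1 : bdd (shift f) k by move=> N; apply: le_trans (shift_contr _ _) (hf N).
    by rewrite /shift2 -(pair_shift x bA h1) -(pair_shift _ bA hf).
  rewrite /=.
  have h0 : bdd (0 : nat -> V) 0.
    by move=> N; apply: sn_le_const => //; rewrite big1 ?expr0n // => i _; rewrite ip0l.
  have := pair_linr bt bc st sc tc tc1 cinj 2^-1 x bA (bdd_lin 1 hs hmm) h0.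
  have p0 : pair A x 0 = 0 by apply/eqP; have := pairBr x bA h0 h0; rewrite subrr => ->; rewrite subrr.
  rewrite p0 !addr0 scale1r => ->.
  have := pair_linr bt bc st sc tc tc1 cinj 1 x bA hs hmm; rewrite scale1r mul1r => ->.
  rewrite e1 (ih x _ _ hm) (ih _ _ _ hf).
  have q0 : pair A 0 f = 0 by have := pairBm 0 0 bA hf; rewrite subrr => ->; rewrite subrr.
  have := pair_linm bt bc st sc tc tc1 cinj 2^-1 (tsq x + visser_seq tsq m (visser_seq tsq m x)) 0 bA hf.
  rewrite q0 !addr0 => ->.
  by have := pair_linm bt bc st sc tc tc1 cinj 1 (tsq x) (visser_seq tsq m (visser_seq tsq m x)) bA hf; rewrite scale1r mul1r => ->.
have [a a0 ha] := bop_bound bA.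
have := Lt_cv hT x; rewrite /cv => h.
have g0 := rcvZ (c := a * k) h; rewrite mulr0 in g0.
apply/cvgrPdist_le => e e0; have /cvgrPdist_le /(_ e e0) := g0; apply: filterS => m /=.
rewrite sub0r normrN -(pairBm _ _ bA hf) => h2; apply: le_trans h2.
have k0 : 0 <= k by apply: le_trans (hf 0%N); exact: sn_ge0.
rewrite [leRHS]ger0_norm; last by rewrite !mulr_ge0 ?nrm_ge0 // ltW.
by apply: le_trans (pair_bound _ ha (ltW a0) bA hf) _; rewrite nrmB mulrAC.
Qed.

Lemma adm_theta y : adm0 y -> adm0 (fun x => theta (y x)).
Proof.
move=> [[k hk] yt]; split.
  exists (2 * k) => x N; apply: le_trans (theta_bound hB _ _) _.
  rewrite -mulrA ler_pM2l //; exact: hk.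
by move=> x; rewrite yt (theta_diag hB _ bt) //; exact: tcontr.
Qed.

(** Pairing with [orb z] accounts for one Stein equation, and (1 - B^2)^(1/2) for the second one.
    This is verified on second differences: one factor 1 - t S reduces the orbit to c z at index 0,
    the other turns (1 - B^2)^(1/2) into c (1 - S^2)^(1/2). *)
Lemma pair_theta A O Q x z : bop A -> stein0 A O -> stein0 O Q ->
  pair A x (theta (orb z)) = ip (Q x) z.
Proof.
move=> bA [bO hO] [bQ hQ]; have [[k hk] yt] := adm_theta (orb_adm st sc tc tc1).
have [k1 hk1] := form_bound bt bc st sc tc tc1 cinj bA hk.
have [q q0 hq] := bop_bound bQ.
have hk2 u v : `|ip (Q u) v| <= q * nrm u * nrm v.
  by apply: le_trans (ip_cs _ _) _; rewrite ler_wpM2r ?nrm_ge0.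
apply: (stein_uniq2 bt bc st sc tc tc1 cinj hk1 hk2) => {x z} x z.
have pE := pair_E bt bc st sc tc tc1 cinj.
rewrite yt (pE _ x _ _ bA (hk z)).
have -> : theta (orb (t (t z))) = diag t (diag t (theta (orb z))) by rewrite !yt.
rewrite (pE _ (t x) _ _ bA (bdd_diag tcontr (hk z))).
have -> : opE (diag t (theta (orb z))) = diag t (opE (theta (orb z))).
  apply/esym/opE_comm => [a f g|//|f]; first exact: diag_lin.
  by apply/funext => -[|n]; rewrite /diag //= (bop0 bt).
rewrite (pE _ x _ _ bA (bdd_E st sc tc1 (hk z))).
have -> : opE (opE (theta (orb z))) = diag c (thetaS (delta0 (c z))).
  rewrite (theta_E bt st sc tc1 hB) opE_orb.
  exact: (theta_thetaS bt bc st sc tc tc1 cpos cinj hB hS hT).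
rewrite (thetaS_diag hS _ bc ccontr).
have -> : diag c (delta0 (c z)) = delta0 (c (c z)) by apply/funext => -[|n]; rewrite /diag //= (bop0 bc).
rewrite (pair_thetaS _ bA (bdd_delta0 _)) pair_delta0 //.
have e u v : ip (Q u) v - ip (Q (t u)) (t v) = ip (O (c u)) (c v).
  by rewrite -st -ipBl hQ sc.
by rewrite !e -!tc -st -ipBl hO sc.
Qed.

End Limits.

(* CC is stable under 1 - A'^2, where A' sends A to the solution of its Stein equation, so z commutes
   with every A'((1 - A'^2)^k A); since 1 - A'^2 is the square of the Blaschke factor, these
   operators determine A'^2 A. *)
Lemma even_odd (CC : (V -> V) -> Prop) (z : V -> V) : bop z ->
  (forall A, CC A -> bop A) -> CC (fun=> 0) ->
  (forall a A B, CC A -> CC B -> CC (fun v => a *: A v + B v)) ->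
  (forall A, CC A -> exists O Q, [/\ stein0 A O, stein0 O Q, CC Q & forall v, z (O v) = O (z v)]) ->
  forall A O Q, CC A -> stein0 A O -> stein0 O Q -> forall v, z (Q v) = Q (z v).
Proof.
move=> bz CB C0 CL CS A O Q CA hO hQ v.
have [LB hB] := visser_bl bt bc st sc tc tc1.
have [LS hS] := visser_shift (V := V).
have [Lt hT] := visser_t bt st sc tc1.
(* [B'] is the m-th Visser polynomial in 1 - A'^2 applied to B. Only even powers of A' occur, so it
   stays in CC. *)
have poly m B : CC B -> exists2 B', CC B' &
    forall y, adm0 y -> forall x w, pair B' x (y w) = pair B x (visser_seq bl2 m (y w)).
  elim: m B => [|m ih] B CB0.
    by exists (fun=> 0) => // y _ x w; apply: pair_congr => k; rewrite ip0l ip0r.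
  have [P1 [Q1 [h1 h2 CQ1 _]]] := CS _ CB0.
  have [B2 CB2 e2] := ih _ CB0; have [B3 CB3 e3] := ih _ CB2.
  pose B1 v := B v - Q1 v.
  have CB1 : CC B1.
    have := CL (-1) _ _ CQ1 CB0; rewrite (_ : (fun v => _) = B1) //.
    by apply/funext => u; rewrite scaleN1r addrC.
  exists (fun v => 2^-1 *: (fun v => 1 *: B1 v + B3 v) v + 0); first exact: (CL _ _ _ (CL _ _ _ CB1 CB3) C0).
  move=> y hy x w; have [[k hk] yt] := hy.
  have hm := adm_visser m hy; have [[k1 hk1] _] := hm; have [[k2 hk2] _] := adm_visser m hm.
  rewrite (pair_linl bt bc st sc tc tc1 cinj _ _ (CB _ (CL _ _ _ CB1 CB3)) (CB _ C0) (hk w)).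
  rewrite (pair_linl bt bc st sc tc tc1 cinj _ _ (CB _ CB1) (CB _ CB3) (hk w)).
  rewrite (pair_step bt bc st sc tc tc1 cinj (CB _ CB0) h1 h2 hy) (e3 _ hy) (e2 _ hm).
  have h0 : bdd (0 : nat -> V) 0.
    by move=> N; apply: sn_le_const => //; rewrite big1 ?expr0n // => i _; rewrite ip0l.
  have hb := bdd_bl2 bt bc st sc tc tc1 (hk w).
  have := pair_linr bt bc st sc tc tc1 cinj 2^-1 x (CB _ CB0) (bdd_lin 1 hb (hk2 w)) h0.
  have p0 : pair B x 0 = 0 by have := pairBr x (CB _ CB0) h0 h0; rewrite subrr => ->; rewrite subrr.
  have p1 : pair (fun=> 0) x (y w) = 0.
    by rewrite -p0; apply: pair_congr => i; rewrite ip0l ip0r.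
  rewrite p0 p1 !addr0 /= scale1r => ->; congr (_ * _).
  by have := pair_linr bt bc st sc tc tc1 cinj 1 x (CB _ CB0) hb (hk2 w); rewrite scale1r => ->.
have [zs bzs hz] := adj_exists bz.
have ho := orb_adm st sc tc tc1; have [[k hk] yt] := ho.
(* Om = A' (A - p_m A), with p_m the polynomial in 1 - A'^2 from [poly]. Its argument lies in CC, so
   z commutes with it. *)
have hOm m : exists Om, (forall u, z (Om u) = Om (z u)) /\
    forall x w, ip (Om x) w = pair A x (orb w) - pair A x (visser_seq bl2 m (orb w)).
  have [B CB0 hBm] := poly m _ CA.
  have CAB : CC (fun v => A v - B v).
    have := CL (-1) _ _ CB0 CA; congr CC.
    by apply/funext => u; rewrite scaleN1r addrC.
  have [Xm [Qm [h1 _ _ zO]]] := CS _ CAB; exists Xm; split=> // x w.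
  rewrite -(pair_orb bt bc st sc tc tc1 cinj x w (CB _ CAB) h1).
  by rewrite (pairBl x (CB _ CA) (CB _ CB0) (hk w)) (hBm _ ho).
have [Xm hOm'] := choice hOm.
(* The Visser polynomials in B^2 tend to 1 - (1 - B^2)^(1/2), so these operators tend weakly to A'^2
   A = Q. *)
have lim x w : (fun m => ip (Xm m x) w) @ \oo --> ip (Q x) w.
  rewrite -(pair_theta hB hS hT x w (CB _ CA) hO hQ) /blaschke_root.
  have hLf : bdd (LB (orb w)) (k * nrm w) by move=> N; apply: le_trans (vi_le hB _ _) (hk w N).
  rewrite (pairBr x (CB _ CA) (hk w) hLf).
  under eq_fun do rewrite (hOm' _).2.
  have hm m : bdd (visser_seq bl2 m (orb w)) (k * nrm w).
    move=> N; apply: le_trans (hk w N).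
    by apply: visser_le; [exact: snD|exact: snZ|exact: bl2_contr].
  have h := @pair_visser_cvg _ _ _ x _ _ hB (CB _ CA) (hk w) hm.
  by apply: rcvD; [exact: cvg_cst|exact: cvgN h].
apply: ip_ext => w; rewrite hz.
apply: cvgR_unique (lim v (zs w)) _.
by under eq_fun => m do rewrite -hz (hOm' m).1; exact: lim.
Qed.

End EvenOdd4.

(** * Modular pairs and Tomita's theorem *)

Section ModularPair.
Context {R : realType} {V : rhilb R}.
Implicit Types (N : (V -> V) -> V -> Prop) (G : V -> V -> Prop).

Definition adjpairs N : set (prodH V V) :=
  [set p | exists A B, [/\ N A p.1, N B p.2 & isadj A B]].

(* N0 and N1 are the left and the right bounded elements with their vectors, G0 and G1 the
   graphs of S = J D^(1/2) and F = J D^(-1/2), and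
   T = (1 + D)^-1, T' = D (1 + D)^-1, C = D^(1/2) (1 + D)^-1. *)
Record modular_pair N0 N1 G0 G1 (T T' C J : V -> V) : Prop := ModularPair {
  mp_full0 : forall X x, N0 X x <-> bop X /\ forall Y y, N1 Y y -> X y = Y x;
  mp_full1 : forall Y y, N1 Y y <-> bop Y /\ forall X x, N0 X x -> X y = Y x;
  mp_com : forall X x Y y, N0 X x -> N1 Y y -> forall v, X (Y v) = Y (X v);
  mp_comA : forall X x Y y Y', N0 X x -> N1 Y y -> isadj Y Y' -> forall v, X (Y' v) = Y' (X v);
  mp_adj0 : forall a b, G0 a b <-> forall u w, G1 u w -> ip b u = ip a w;
  mp_adj1 : forall u w, G1 u w <-> forall a b, G0 a b -> ip b u = ip a w;
  mp_core0 : forall a b, G0 a b -> clos (adjpairs N0) (a, b);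
  mp_core1 : forall a b, G1 a b -> clos (adjpairs N1) (a, b);
  mp_nd0 : forall v, (forall X x, N0 X x -> X v = 0) -> v = 0;
  mp_nd1 : forall v, (forall Y y, N1 Y y -> Y v = 0) -> v = 0;
  mp_bT : bop T; mp_bT' : bop T'; mp_bC : bop C; mp_bJ : bop J;
  mp_sT : symm T; mp_sT' : symm T'; mp_sC : symm C; mp_sJ : symm J;
  mp_sum : forall v, T v + T' v = v;
  mp_JJ : forall v, J (J v) = v;
  mp_JT : forall v, J (T v) = T' (J v);
  mp_JC : forall v, J (C v) = C (J v);
  mp_TC : forall v, T (C v) = C (T v);
  mp_CC : forall v, C (C v) = T (T' v);
  mp_Cpos : forall v, 0 <= ip (C v) v;
  mp_Cinj : forall v, C v = 0 -> v = 0;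
  mp_g0 : forall v, G0 (T v) (J (C v));
  mp_g0' : forall v, G0 (C v) (J (T' v));
  mp_g1 : forall v, G1 (T' v) (J (C v));
  mp_g1' : forall v, G1 (C v) (J (T v)) }.

Section Theory.
Context {N0 N1 : (V -> V) -> V -> Prop} {G0 G1 : V -> V -> Prop} {T T' C J : V -> V}.
Hypothesis M : modular_pair N0 N1 G0 G1 T T' C J.

Lemma mp_T'E v : T' v = v - T v.
Proof. by apply/eqP; rewrite eq_sym subr_eq addrC (mp_sum M). Qed.

Lemma mp_TT' v : T (T' v) = T' (T v).
Proof. by rewrite !mp_T'E (bopB (mp_bT M)). Qed.

Lemma mp_T'C v : T' (C v) = C (T' v).
Proof. by rewrite !mp_T'E (bopB (mp_bC M)) (mp_TC M). Qed.

Lemma mp_JT' v : J (T' v) = T (J v).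
Proof. by rewrite -[T (J v)](mp_JJ M) (mp_JT M) (mp_JJ M). Qed.

Lemma mp_swap : modular_pair N1 N0 G1 G0 T' T C J.
Proof.
have [] := M => f0 f1 cm cA a0 a1 k0 k1 n0 n1 bT bT' bC bJ sT sT' sC sJ su JJ JT JC TC CC Cp Ci g0 g0' g1 g1'.
split=> //.
- by move=> X x; rewrite f1; split=> -[bX h]; split=> // Y y /h.
- by move=> X x; rewrite f0; split=> -[bX h]; split=> // Y y /h.
- by move=> X x Y y hX hY v; rewrite (cm _ _ _ _ hY hX).
- move=> X x Y y Y' hX hY YY' v; have [bX _] := (f1 _ _).1 hX.
  have [X' bX' XX'] := adj_exists bX.
  by apply: ip_ext => w; rewrite XX' !(isadjC YY') (cA _ _ _ _ _ hY hX XX') XX'.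
- move=> a b; rewrite a1; split=> h u w /h; by rewrite ipC => ->; rewrite ipC.
- move=> a b; rewrite a0; split=> h u w /h; by rewrite ipC => ->; rewrite ipC.
- by move=> v; rewrite addrC.
- exact: mp_JT'.
- exact: mp_T'C.
- by move=> v; rewrite CC mp_TT'.
Qed.

Lemma mp_dense0 v : clos [set x | exists X, N0 X x] v.
Proof.
apply: clos_idem; apply: clos_mono (symm_dense_range (mp_bC M) (mp_sC M) (mp_Cinj M) v) => _ [u _ <-].
move=> e e0; have /clos_prod /(_ e e0) [[x y] [[X [Y [hX _ _]]] h _]] := mp_core0 M (mp_g0' M u).
by exists x => //; exists X.
Qed.

Lemma mp_op0 X x : N0 X x -> bop X. Proof. by move/(mp_full0 M) => []. Qed.
Lemma mp_rel X x Y y : N0 X x -> N1 Y y -> X y = Y x.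
Proof. by move/(mp_full0 M) => [_ h] /h. Qed.

Lemma mp_left B X x : bop B -> (forall Y y, N1 Y y -> forall v, B (Y v) = Y (B v)) ->
  N0 X x -> N0 (B \o X) (B x).
Proof.
move=> bB hB hX; apply/(mp_full0 M); split; first exact: bop_comp bB (mp_op0 hX).
by move=> Y y hY /=; rewrite (mp_rel hX hY) (hB _ _ hY).
Qed.

Lemma mp_scale a X x : N0 X x -> N0 (fun v => a *: X v) (a *: x).
Proof.
move=> hX; apply/(mp_full0 M); split; first exact: bop_scale (mp_op0 hX).
by move=> Y y hY; rewrite (mp_rel hX hY) (bopZ ((mp_full1 M Y y).1 hY).1).
Qed.

Lemma mp_lin a X x Y y : N0 X x -> N0 Y y -> N0 (fun v => a *: X v + Y v) (a *: x + y).
Proof.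
move=> hX hY; apply/(mp_full0 M); split; first exact: bop_lin (mp_op0 hX) (mp_op0 hY).
by move=> Z z hZ; rewrite (mp_rel hX hZ) (mp_rel hY hZ) (bopL ((mp_full1 M Z z).1 hZ).1).
Qed.

Lemma mp_zero : N0 (fun=> 0) 0.
Proof.
apply/(mp_full0 M); split; first exact: bop_cst0.
by move=> Z z hZ; rewrite (bop0 ((mp_full1 M Z z).1 hZ).1).
Qed.

(** In the algebra, S sends y^* z to z^* y. Membership in G0 is tested against F on its core of
    adjoint pairs, where left and right multiplications can be exchanged. *)
Lemma mp_prod Y y Z z Y' Z' : N0 Y y -> N0 Z z -> isadj Y Y' -> isadj Z Z' -> G0 (Y' z) (Z' y).
Proof.
move=> hY hZ YY' ZZ'; apply/(mp_adj0 M) => u w huw.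
have /clos_seq [p hp /cv_pair [/= c1 c2]] := mp_core1 M huw.
have h1 := cv_ip (w := Z' y) c1; have h2 := cv_ip (w := Y' z) c2.
rewrite !(ipC _ u) !(ipC _ w); apply: cvgR_unique h1 _.
rewrite (_ : (fun n => ip (p n).1 (Z' y)) = fun n => ip (p n).2 (Y' z)) //.
apply/funext => n; have [A [B [hA hB AB]]] := hp n.
rewrite -ZZ' (mp_rel hZ hA) AB -YY' (mp_rel hY hB).
by rewrite ipC.
Qed.

End Theory.

End ModularPair.

Section Truncation.
Context {R : realType} {V : rhilb R}.

(* [xi] and [sigma] define formally adjoint operators [y |-> Y xi] and [y |-> Y sigma] on the
   vectors y of N1; a, c, Y, Z are the bounded transforms of the closure of the first one. *)
Lemma truncation (N1 : (V -> V) -> V -> Prop) (xi sigma : V) :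
  (forall Y y, N1 Y y -> bop Y) ->
  N1 (fun=> 0) 0 ->
  (forall a X x Y y, N1 X x -> N1 Y y -> N1 (fun v => a *: X v + Y v) (a *: x + y)) ->
  (forall X x Y y, N1 X x -> N1 Y y -> ip (X xi) y = ip x (Y sigma)) ->
  exists G a c Y Z, [/\ lsub G, clos G `<=` G, @gdec R V G a c Y Z,
    (forall X x, N1 X x -> G (x, X xi)) &
    (forall P P', bop P -> bop P' -> (forall X x, N1 X x -> N1 (P \o X) (P x)) ->
       (forall X x, N1 X x -> N1 (P' \o X) (P' x)) -> isadj P P' ->
       [/\ forall v, a (P v) = P (a v), forall v, Y (P v) = P (Y v),
           forall v, Z (P v) = P (Z v) & forall v, c (P v) = P (c v)]) /\
    (forall X x, N1 X x -> Y x = c (X xi) /\ Z x = a (X sigma)) /\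
    ((forall v, clos [set x | exists X, N1 X x] v) ->
       (forall v, a v = 0 -> v = 0) /\ forall y, G (0, y) -> y = 0)].
Proof.
move=> N1b N10 N1l fa.
pose G0 : set (prodH V V) := [set p | exists X, N1 X p.1 /\ p.2 = X xi].
have hG0 : lsub G0.
  split; first by exists (fun=> 0).
  move=> a [x1 y1] [x2 y2] [X [hX /= ->]] [Y [hY /= ->]].
  by exists (fun v => a *: X v + Y v); split=> //; exact: N1l.
have hG := lsub_clos hG0; have cG := @clos_idem _ _ G0.
have [a [c [Y [Z D]]]] := gdec_exists hG cG.
have inG X x : N1 X x -> clos G0 (x, X xi) by move=> h; apply: sub_clos; exists X.
have adjG X x (g : prodH V V) : N1 X x -> clos G0 g -> ip g.2 x = ip g.1 (X sigma).
  move=> hX /clos_seq [u hu /cv_pair [c1 c2]].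
  apply: cvgR_unique (cv_ip (w := x) c2) _.
  rewrite (_ : (fun n => ip (u n).2 x) = fun n => ip (u n).1 (X sigma)); first exact: cv_ip c1.
  by apply/funext => n; have [P [hP ->]] := hu n; exact: fa.
exists (clos G0), a, c, Y, Z; split=> //; split; last split.
- move=> P P' bP bP' hP hP' PP'.
  have st (Q : V -> V) : bop Q -> (forall X x, N1 X x -> N1 (Q \o X) (Q x)) ->
      forall g : prodH V V, clos G0 g -> clos G0 (Q g.1, Q g.2).
    move=> bQ hQ g /clos_seq [u hu /cv_pair [c1 c2]]; apply/clos_seq.
    exists (fun n => (Q (u n).1, Q (u n).2)).
      by move=> n; have [X [hX ->]] := hu n; exists (Q \o X); split=> //; exact: hQ.
    by apply/cv_pair; split; exact: bop_cv.
  have sP := st _ bP hP; have sP' := st _ bP' hP'.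
  by split=> v; [have [->] := gd_comm hG D bP PP' sP sP' v|have [_ ->] := gd_comm hG D bP PP' sP sP' v
    |have [->] := gd_comm_Z hG D bP PP' sP sP' v|have [_ ->] := gd_comm_Z hG D bP PP' sP sP' v].
- move=> X x hX; split; first exact: (gd_graph D (inG _ _ hX)).
  by apply: (gd_adjgraph D) => g hg; exact: adjG.
- move=> dn.
  have sv y : clos G0 (0, y) -> y = 0.
    move=> h; apply: (orth_dense dn) => x [X hX].
    by have := adjG _ _ _ hX h; rewrite /= ip0l.
  split=> // v av.
  have Yv : Y v = 0 by apply: sv; have := gd_in1 D v; rewrite av.
  apply: (orth_dense dn) => x [X hX].
  by have := gd_orth1 D v (inG _ _ hX); rewrite av Yv subr0 ip0l.
Qed.

End Truncation.

(** * T maps right bounded vectors to left bounded ones *)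

Section TLemma.
Context {R : realType} {V : rhilb R}.
Context {N0 N1 : (V -> V) -> V -> Prop} {G0 G1 : V -> V -> Prop} {T T' C J : V -> V}.
Hypothesis M : modular_pair N0 N1 G0 G1 T T' C J.

Lemma iter_comm (f g : V -> V) m v : (forall v, f (g v) = g (f v)) -> iter m f (g v) = g (iter m f v).
Proof. by move=> h; elim: m => //= m ->. Qed.

Lemma iter_symm (f : V -> V) m : symm f -> symm (iter m f).
Proof. by move=> sf; elim: m => // m ih v w; rewrite iterS sf ih -iterSr. Qed.

(** Split eta as T eta + T' eta; as T' eta = F (J C eta), the second part is moved from a to b = S
    a. *)
Lemma mp_key eta a b : G0 a b -> ip eta a = ip (T eta) a + ip b (J (C eta)).
Proof.
move=> hab; have := (mp_adj1 M _ _).1 (mp_g1' M (J eta)) _ _ hab.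
rewrite (mp_JC M) (mp_JT M) (mp_JJ M) => ->.
by rewrite ipC [ip (T eta) a]ipC -ipDr (mp_sum M).
Qed.

(** The operator L sending a right bounded y to Y (T eta) is at first only closable. It is bounded
    as soon as q = 1 - a, which is L^* L (1 + L^* L)^-1, has norm below 1. [mp_key] gives decay by
    the factor 1/4 along a sequence of left bounded vectors, and log-convexity spreads the bound 1/4
    to all of V. *)
Lemma left_bounded_unit Q eta : N1 Q eta -> (forall v, nrm (Q v) <= nrm v) ->
  exists X X', [/\ N0 X (T eta), N0 X' (J (C eta)) & isadj X X'].
Proof.
move=> hQ nQ; have M1 := mp_swap M.
set xi := T eta; set sg := J (C eta).
have op1 Y y : N1 Y y -> bop Y := @mp_op0 _ _ _ _ _ _ _ _ _ _ M1 Y y.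
have fa X x Y y : N1 X x -> N1 Y y -> ip (X xi) y = ip x (Y sg).
  move=> hX hY; have [X' _ XX'] := adj_exists (op1 _ _ hX).
  have [Y' _ YY'] := adj_exists (op1 _ _ hY).
  have h := mp_prod M1 hY hX YY' XX'.
  have := (mp_adj1 M _ _).1 h _ _ (mp_g0 M eta).
  by rewrite -/xi -/sg -(isadjC (isadjC YY')) -XX' ipC => ->; rewrite ipC.
have [G [a [c [Y [Z [hG cG D inG [hcom [hrel hinj]]]]]]]] :=
  truncation op1 (mp_zero M1) (fun k => @mp_lin _ _ _ _ _ _ _ _ _ _ M1 k) fa.
have [ainj G0y] := hinj (mp_dense0 M1).
have ba := gd_bop_a hG D; have bY := gd_bop_Y hG D; have YZ := gd_adj D.
have bZ := gd_bop_Z hG D; have bc := gd_bop_c D; have sa := gd_sym_a D; have sc := gd_sym_c D.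
have cm1 W w : N1 W w -> [/\ forall v, a (W v) = W (a v), forall v, Y (W v) = W (Y v),
    forall v, Z (W v) = W (Z v) & forall v, c (W v) = W (c v)].
  move=> hW; have bW := op1 _ _ hW; have [W' bW' WW'] := adj_exists bW.
  apply: (hcom W W') => // X x hX; apply: (mp_left M1) => // P p hP v.
    by rewrite (mp_com M hP hW).
  by rewrite (mp_comA M hP hW WW').
have hY : N0 Y (c xi).
  by apply/(mp_full0 M); split=> // W w hW; rewrite (hrel _ _ hW).1; case: (cm1 _ _ hW).
have hZ : N0 Z (a sg).
  by apply/(mp_full0 M); split=> // W w hW; rewrite (hrel _ _ hW).2; case: (cm1 _ _ hW).
pose q v := v - a v; pose p v := v - c v.
have bq : bop q by exact: bop_sub (bop_id V) ba.
have bp : bop p by exact: bop_sub (bop_id V) bc.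
have sq : symm q by move=> u v; rewrite /q ipBl ipBr sa.
have sp : symm p by move=> u v; rewrite /p ipBl ipBr sc.
have ZY v : Z (Y v) = a (q v) := gd_ZY D v.
have YZ' v : Y (Z v) = c (p v) := gd_YZ D v.
have aq v : a (q v) = q (a v) by rewrite /q (bopB ba).
have cp v : c (p v) = p (c v) by rewrite /p (bopB bc).
have Yq v : Y (q v) = p (Y v) by rewrite /q (bopB bY) (gd_Ya D).
have Zp v : Z (p v) = q (Z v) by rewrite /p (bopB bZ) (gd_Zc D).
have q1 W w : N1 W w -> forall v, q (W v) = W (q v).
  by move=> hW v; rewrite /q (bopB (op1 _ _ hW)); have [-> _ _ _] := cm1 _ _ hW.
have qpos v : 0 <= ip (q v) v.
  have := gd_nrm D v; rewrite /q ipBl (ipC (a v) v); have := ip_ge0 (a v - v); rewrite !ipE (ipC v (a v)).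
  by have := ip_ge0 (Y v); lra.
have cle v : ip (c v) v <= ip v v.
  have := gd_orth2 D v (gd_in2 D v); rewrite /= ipBr => h.
  have := ip_ge0 (Z v); have := ip_ge0 (c v - v); rewrite !ipE (ipC v (c v)); lra.
(* [l m] is the vector of the left multiplication q^m Z Y, which makes it available to [mp_prod]. *)
pose l0 := Z (c xi); pose l m := iter m q l0.
have bqm m : bop (iter m q) := bop_iter m bq.
have sqm m : symm (iter m q) := iter_symm m sq.
have qm1 m W w : N1 W w -> forall v, iter m q (W v) = W (iter m q v).
  by move=> hW v; apply: iter_comm; exact: q1 hW.
have hl m : N0 (iter m q \o (Z \o Y)) (l m).
  apply: (mp_left M (bqm m)) => [W w hW v|]; first exact: qm1 hW v.
  by apply: (mp_left M bZ) => // W w hW v; case: (cm1 _ _ hW).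
have hqZ m : N0 (iter m q \o Z) (iter m q (a sg)).
  by apply: (mp_left M (bqm m)) => // W w hW v; exact: qm1 hW v.
have Yqm m v : Y (iter m q v) = iter m p (Y v) by elim: m => //= m ih; rewrite Yq ih.
have lE m : l m = Z (iter m p (c xi)) by rewrite /l /l0; elim: m => //= m ->; rewrite Zp.
(* With the x and y below, [mp_key] reads <Q y, l m> = |x|^2 + |y|^2. As Q is a contraction, |x|^2
   <= |y| |l m| - |y|^2 <= |l m|^2 / 4. *)
have est m : ip (q (l m)) (l m) <= 4^-1 * ip (l m) (l m).
  pose x := iter m.+1 p (c xi); pose y := iter m.+1 q (a sg).
  have adj1 : isadj (iter m.+1 q \o Z) (Y \o iter m.+1 q).
    exact: adj_comp (sqm _) (isadjC YZ).
  have adj2 : isadj (iter m q \o (Z \o Y)) ((Z \o Y) \o iter m q).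
    exact: adj_comp (sqm _) (adj_comp (isadjC YZ) YZ).
  have := mp_key eta (mp_prod M (hqZ m.+1) (hl m) adj1 adj2).
  rewrite -/xi -/sg -/y [(Y \o _) _]/=.
  have -> : ip eta (Y (iter m.+1 q (l m))) = ip (Q y) (l m).
    by rewrite -[iter m.+1 q (l m)]/((iter m.+1 q) (l m)) -/(_ (l m)) -(adj1 eta (l m)) (mp_rel M (hqZ m.+1) hQ).
  have -> : ip xi (Y (iter m.+1 q (l m))) = ip x x.
    have qZ k w : iter k q (Z w) = Z (iter k p w) by elim: k => //= k ->; rewrite Zp.
    rewrite lE qZ YZ' -sc /x (iter_symm m.+1 sp); congr ip.
    by rewrite [in RHS](iterS m p) (@iter_comm p p m.+1).
  have -> : ip ((Z \o Y \o iter m q) y) sg = ip y y.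
    by rewrite /= ZY sa -[q (iter m q y)]/(iter m.+1 q y) (iter_symm m.+1 sq).
  move=> e.
  have h1 : ip (Q y) (l m) <= nrm y * nrm (l m).
    by apply: le_trans (ip_le _ _) _; rewrite ler_wpM2r ?nrm_ge0.
  have h2 : ip (q (l m)) (l m) <= ip x x.
    rewrite lE -Zp (isadjC YZ) YZ' -[p _]/x.
    by rewrite ipC cle.
  apply: le_trans h2 _; move: h1; rewrite e -!nrm_sq.
  have := sqr_ge0 (2 * nrm y - nrm (l m)); lra.
(* Cauchy-Schwarz for the form of q, with the estimate at both m and m + 1. *)
have step m : nrm (l m.+1) <= 4^-1 * nrm (l m).
  have h := pos_cs bq sq qpos (l m) (l m.+1); rewrite -[q (l m)]/(l m.+1) in h.
  have e1 := est m; have e2 := est m.+1; rewrite -[q (l m)]/(l m.+1) in e1.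
  rewrite -!nrm_sq in h e1 e2.
  have p0 : 0 <= ip (q (l m.+1)) (l m.+1) by exact: qpos.
  have p1 : 0 <= ip (l m.+1) (l m) by exact: (qpos (l m)).
  have : nrm (l m.+1) ^+ 2 ^+ 2 <= (4^-1 * nrm (l m) * nrm (l m.+1)) ^+ 2.
    apply: le_trans h _; apply: le_trans (ler_pM p1 p0 e1 e2) _.
    by rewrite !exprMn; lra.
  rewrite ler_pXn2r ?nnegrE ?mulr_ge0 ?sqr_ge0 ?nrm_ge0 ?invr_ge0 // => h2.
  by apply: sq_le_mul h2; rewrite ?mulr_ge0 ?nrm_ge0 ?invr_ge0.
have bound m : nrm (l m) <= nrm l0 * 4^-1 ^+ m.
  elim: m => [|m ih]; first by rewrite expr0 mulr1.
  by apply: le_trans (step m) _; rewrite exprS mulrCA ler_wpM2l ?invr_ge0.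
(* For x1 with right multiplication W, q^(j+1) a x1 = W (l j) decays like 4^-j, so log-convexity
   bounds the first step. The vectors a x1 are dense. *)
have q4 v : nrm (q v) <= 4^-1 * nrm v.
  have da : forall v, clos (range a) v := symm_dense_range ba sa ainj.
  have /clos_seq [u hu cu] := clos_image ba (mp_dense0 M1) da v.
  have hl' n : nrm (q (u n)) <= 4^-1 * nrm (u n).
    have [x1 [W hW] <-] := hu n; have bW := op1 _ _ hW; have [k k0 hk] := bop_bound bW.
    have qW j : iter j.+1 q (a x1) = W (l j).
      have [_ _ ZW cW] := cm1 _ _ hW.
      by rewrite /l /l0 -(qm1 _ _ _ hW) -ZW -cW -(hrel _ _ hW).1 ZY iterSr aq.
    apply: (@logconvex_symm _ _ _ _ (4 * k * nrm l0 + nrm (a x1))) => // -[|j].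
      by rewrite expr0 mulr1 lerDr !mulr_ge0 ?nrm_ge0 // ltW.
    rewrite qW; apply: le_trans (hk _) _.
    apply: (@le_trans _ _ (k * (nrm l0 * 4^-1 ^+ j))); first by rewrite ler_wpM2l ?bound // ltW.
    have e0 : (0 : R) <= 4^-1 ^+ j by rewrite exprn_ge0.
    rewrite exprS mulrDl; apply: ler_wpDr; last by move: (4^-1 ^+ j) (nrm l0) => x0 y0; lra.
    by rewrite !mulr_ge0 ?nrm_ge0.
  have h1 := cv_nrm (bop_cv bq cu); have h2 := rcvZ (c := 4^-1) (cv_nrm cu).
  exact: (ler_cvg_to h1 h2 (nearW _ hl')).
(* Now a = 1 - q is bounded below, so L, which sends a v to Y v, extends boundedly to all of V. *)
have a34 v : nrm v <= 4 / 3 * nrm (a v).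
  have := nrmD (a v) (q v); rewrite /q addrC subrK => h.
  have := q4 v; rewrite /q; lra.
pose S : set (prodH V V) := [set p | exists v, p = (a v, Y v)].
have [X [bX _ hX cX]] : exists X : V -> V, [/\ bop X, (forall v, nrm (X v) <= 4 / 3 * nrm v),
    (forall p : prodH V V, S p -> X p.1 = p.2) & forall v, clos S (v, X v)].
  apply: bop_extend => //.
  - split; first by exists 0; rewrite (bop0 ba) (bop0 bY).
    by move=> k _ _ [v ->] [w ->]; exists (k *: v + w); rewrite (bopL ba) (bopL bY).
  - by move=> _ [v ->]; apply: le_trans (gd_contrY D v) (a34 v).
  - move=> v; apply: clos_mono (symm_dense_range ba sa ainj v) => _ [w _ <-].
    by exists (a w, Y w) => //; exists w.
have XG v : G (v, X v).
  by apply: cG; apply: clos_mono (cX v) => _ [w ->]; exact: (gd_in1 D).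
have X1 W w : N1 W w -> X w = W xi.
  move=> hW; apply/eqP; rewrite -subr_eq0; apply/eqP/G0y.
  by have := lsubB hG (XG w) (inG _ _ hW); rewrite -[_ - _]/(_, _) subrr.
have hXn : N0 X xi by apply/(mp_full0 M); split=> // W w /X1.
have [X' bX' XX'] := adj_exists bX.
exists X, X'; split=> //; apply/(mp_full0 M); split=> // W w hW.
apply/eqP; rewrite -subr_eq0; apply/eqP; apply: orth_dense (mp_dense0 M1) _ => z [P hP].
by rewrite ipBl (isadjC XX') (X1 _ _ hP) ipC (fa _ _ _ _ hP hW) ipC subrr.
Qed.

End TLemma.

(** * From Takesaki's equation to commutation *)

Section Tomita.
Context {R : realType} {V : rhilb R}.

Section LeftBounded.
Context {N0 N1 : (V -> V) -> V -> Prop} {G0 G1 : V -> V -> Prop} {T T' C J : V -> V}.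
Hypothesis M : modular_pair N0 N1 G0 G1 T T' C J.

Lemma left_bounded Q eta : N1 Q eta ->
  exists X X', [/\ N0 X (T eta), N0 X' (J (C eta)) & isadj X X'].
Proof.
move=> hQ; have M1 := mp_swap M; have [k k0 hk] := bop_bound (mp_op0 M1 hQ).
have [|v|X [X' [h1 h2 h3]]] := @left_bounded_unit _ _ _ _ _ _ _ _ _ _ M (fun v => k^-1 *: Q v) (k^-1 *: eta).
- exact: mp_scale M1 _ _ _ hQ.
- by rewrite nrmZ gtr0_norm ?invr_gt0 // mulrC ler_pdivrMr // mulrC hk.
exists (fun v => k *: X v), (fun v => k *: X' v).
have kk (v : V) : k *: (k^-1 *: v) = v by rewrite scalerA mulfV ?gt_eqF // scale1r.
split.
- by have := mp_scale M k h1; rewrite (bopZ (mp_bT M)) kk.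
- by have := mp_scale M k h2; rewrite (bopZ (mp_bC M)) (bopZ (mp_bJ M)) kk.
- by move=> v w; rewrite ipZl ipZr h3.
Qed.

End LeftBounded.

Section Equation.
Context {N0 N1 : (V -> V) -> V -> Prop} {G0 G1 : V -> V -> Prop} {T T' C J : V -> V}.
Hypothesis M : modular_pair N0 N1 G0 G1 T T' C J.
Let M1 := mp_swap M.

(* Takesaki's equation relating the right multiplication by eta to the left multiplication by T eta. *)
Lemma modular_equation Q Q' eta : N1 Q eta -> isadj Q Q' ->
  exists X X', [/\ N0 X (T eta), N0 X' (J (C eta)), isadj X X' &
    forall v, C (Q' (C v)) = T' (J (X (J (T v)))) + T (J (X (J (T' v))))].
Proof.
move=> hQ QQ'; have [X [X' [hX hX' XX']]] := left_bounded M hQ; exists X, X'; split=> //.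
have bQ := mp_op0 M1 hQ; have bQ' := adj_bop bQ QQ'; have bX := mp_op0 M hX.
have bC := mp_bC M; have bT := mp_bT M; have bT' := mp_bT' M; have bJ := mp_bJ M.
have sC := mp_sC M; have sT := mp_sT M; have sT' := mp_sT' M; have sJ := mp_sJ M.
have dC : forall v, clos (C @` [set x | exists X, N0 X x]) v.
  exact: clos_image bC (mp_dense0 M) (symm_dense_range bC sC (mp_Cinj M)).
(* Crossing to right bounded vectors and back multiplies the vector by T T' = C^2. *)
have lift A x : N0 A x -> exists L L', [/\ N0 L (C (C x)), N0 L' (J (T' (C x))) & isadj L L'].
  move=> hA; have [Y [Y' [hY _ _]]] := left_bounded M1 hA.
  have [L [L' [hL hL' LL']]] := left_bounded M hY; exists L, L'.
  by rewrite (mp_CC M) (mp_T'C M).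
(* With v = C x and w = C y, both C v and C w are left bounded. [mp_key] for a product of their
   multiplications has two terms, which F identifies with the two terms on the right. *)
have key A x B y : N0 A x -> N0 B y ->
    ip (C (Q' (C (C x)))) (C y) = ip (T' (J (X (J (T (C x))))) + T (J (X (J (T' (C x)))))) (C y).
  move=> hA hB; have [K [K' [hK hK' KK']]] := lift _ _ hA; have [L [L' [hL hL' LL']]] := lift _ _ hB.
  set v := C x in hK hK' *; set w := C y in hL hL' *.
  have g1 u : G1 (J (T u)) (C u) by have := mp_g1 M (J u); rewrite -(mp_JT M) -(mp_JC M) (mp_JJ M).
  have e1 := (mp_adj0 M _ _).1 (mp_prod M hL' hX (isadjC LL') XX') _ _ (g1 v).
  have e2 := (mp_adj0 M _ _).1 (mp_prod M hK' hX' (isadjC KK') (isadjC XX')) _ _ (g1 w).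
  rewrite sC (isadjC QQ') -(mp_rel M hL hQ) [LHS]ipC LL'.
  rewrite (mp_key M eta (mp_prod M hL hK LL' KK')) -LL' -e1 (isadjC KK') [ip (C w) _]ipC -e2.
  by rewrite (isadjC XX') ipDl sT' sT !sJ [ip (T' w) _]ipC sJ.
apply: (bop_eq_dense _ _ dC); last first.
  move=> _ [x [A hA] <-]; apply/eqP; rewrite -subr_eq0; apply/eqP; apply: orth_dense dC _.
  by move=> _ [y [B hB] <-]; rewrite ipBl (key _ _ _ _ hA hB) subrr.
- apply: bop_add.
    exact: (bop_comp bT' (bop_comp bJ (bop_comp bX (bop_comp bJ bT)))).
  exact: (bop_comp bT (bop_comp bJ (bop_comp bX (bop_comp bJ bT')))).
- exact: (bop_comp bC (bop_comp bQ' bC)).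
Qed.

End Equation.

Context {N0 N1 : (V -> V) -> V -> Prop} {G0 G1 : V -> V -> Prop} {T T' C J : V -> V}.
Hypothesis M : modular_pair N0 N1 G0 G1 T T' C J.
Let M1 := mp_swap M.

Let tau v := T v - T' v.
Let gam v := 2 *: C v.
(** The right multiplications whose adjoint is again one; [even_odd] is applied on this space. *)
Let CC A := exists eta eta' A', [/\ N1 A eta, N1 A' eta' & isadj A A'].

Lemma bop_tau : bop tau. Proof. exact: bop_sub (mp_bT M) (mp_bT' M). Qed.
Lemma bop_gam : bop gam. Proof. exact: bop_scale (mp_bC M). Qed.

(** Expand B = (T + T') B (T + T') and tau B tau: the terms T B T and T' B T' cancel. *)
Lemma tau_stein v (B : V -> V) : bop B ->
  2 *: B v - tau (2 *: B (tau v)) = 4 *: (T' (B (T v)) + T (B (T' v))).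
Proof.
move=> bB; have bT := mp_bT M; have bT' := mp_bT' M; apply: ip_ext => w.
have e : B v = T (B (T v)) + T' (B (T v)) + (T (B (T' v)) + T' (B (T' v))).
  by rewrite !(mp_sum M) -(bopD bB) (mp_sum M).
rewrite {1}e /tau !(bopZ bT) !(bopZ bT') (bopB bB) (bopB bT) (bopB bT') !ipE; ring.
Qed.

Lemma CC_lin a A B : CC A -> CC B -> CC (fun v => a *: A v + B v).
Proof.
move=> [x [x' [A' [h1 h2 h3]]]] [y [y' [B' [k1 k2 k3]]]].
exists (a *: x + y), (a *: x' + y'), (fun v => a *: A' v + B' v); split.
- exact: mp_lin M1 _ _ _ _ _ h1 k1.
- exact: mp_lin M1 _ _ _ _ _ h2 k2.
- by move=> v w; rewrite !ipE h3 k3.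
Qed.

Lemma CC_zero : CC (fun=> 0).
Proof.
exists 0, 0, (fun=> 0); split; [exact: mp_zero M1|exact: mp_zero M1|].
by move=> v w; rewrite ip0l ip0r.
Qed.

(** Takesaki's equation, used once as it stands and once with left and right exchanged: the first
    Stein step turns a right multiplication into J X J with X a left one, the second step returns to
    a right multiplication. *)
Lemma CC_stein A eta eta' A' : N1 A eta -> N1 A' eta' -> isadj A A' ->
  exists X x Q Q', [/\ N0 X x, @stein R V tau gam A (fun v => 2 *: J (X (J v))),
    @stein R V tau gam (fun v => 2 *: J (X (J v))) (fun v => 4 *: Q v) &
    [/\ N1 Q (J (T (C eta'))), N1 Q' (C (C eta')) & isadj Q Q']].
Proof.
move=> hA hA' AA'; have bJ := mp_bJ M; have bC := mp_bC M.
have [X [X' [hX hX' XX' eq1]]] := modular_equation M hA' (isadjC AA').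
have [Q [Q' [hQ hQ' QQ' eq2]]] := modular_equation M1 hX' (isadjC XX').
have bX := mp_op0 M hX; have bQ := mp_op0 M1 hQ.
have bJX : bop (J \o (X \o J)) := bop_comp bJ (bop_comp bX bJ).
exists X, (T eta'), Q, Q'; split=> //.
- split=> [|v]; first exact: bop_scale bJX.
  rewrite (tau_stein v bJX) /= -eq1 /gam (bopZ (mp_op0 M1 hA)) (bopZ bC) scalerA.
  by congr (_ *: _); ring.
- split=> [|v]; first exact: bop_scale.
  have e (w : V) : 4 *: w = 2 *: (2 *: w) by rewrite scalerA; congr (_ *: _); ring.
  have eq3 : C (J (X (J (C v)))) = T' (Q (T v)) + T (Q (T' v)).
    have := congr1 J (eq2 (J v)).
    rewrite (mp_JC M (X _)) -(mp_JC M v) => ->.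
    by rewrite (bopD bJ) (mp_JT M (J (Q _))) (mp_JT' M (J (Q _))) -(mp_JT M v) -(mp_JT' M v) !(mp_JJ M).
  have := tau_stein v (bop_scale 2 bQ); rewrite -!e => ->.
  rewrite (bopZ (mp_bT M)) (bopZ (mp_bT' M)) -scalerDr -eq3.
  by rewrite /gam (bopZ bJ) (bopZ bX) (bopZ bJ) !(bopZ bC) !scalerA; congr (_ *: _); ring.
split=> //.
  by move: hQ; rewrite -(mp_JT M) (mp_TC M) -(mp_TC M).
by move: hQ'; rewrite (mp_JC M) (mp_JJ M).
Qed.

(** The odd Stein iterates are multiples of operators J X J, with which z commutes by hypothesis;
    [even_odd] then covers the second iterate 4 Q. *)
Lemma stein_commute z : bop z -> (forall X x, N0 X x -> forall v, z (J (X (J v))) = J (X (J (z v)))) ->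
  forall eta, (exists A A' eta', [/\ N1 A eta, N1 A' eta' & isadj A A']) ->
  exists Q Q', [/\ N1 Q (J (T (C eta))), N1 Q' (C (C eta)), isadj Q Q' & forall v, z (Q v) = Q (z v)].
Proof.
move=> bz hz eta [A [A' [eta' [hA hA' AA']]]].
have [X [x [Q [Q' [hX s1 s2 [hQ hQ' QQ']]]]]] := CC_stein hA' hA (isadjC AA').
exists Q, Q'; split=> // v.
have k4 (u w : V) : 4 *: u = 4 *: w -> u = w.
  by move/(congr1 (fun w => 4^-1 *: w)); rewrite !scalerA mulVf ?scale1r // pnatr_eq0.
apply: k4; rewrite -(bopZ bz).
pose O v := 2 *: J (X (J v)).
apply: (@even_odd _ _ tau gam bop_tau bop_gam _ _ _ _ _ _ CC z bz _ CC_zero CC_lin _ A' O (fun v => 4 *: Q v)) => //.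
- by move=> u w; rewrite ipBl ipBr (mp_sT M) (mp_sT' M).
- by move=> u w; rewrite ipZl ipZr (mp_sC M).
- move=> u; rewrite /tau /gam (bopZ (mp_bT M)) (bopZ (mp_bT' M)) (bopB (mp_bC M)) scalerBr.
  by rewrite -(mp_T'C M) (mp_TC M).
- move=> u; rewrite /gam (bopZ (mp_bC M)) (mp_CC M).
  have e : u = T (T u) + T' (T u) + (T (T' u) + T' (T' u)).
    by rewrite !(mp_sum M).
  apply: ip_ext => w; have := congr1 (fun x => ip x w) e.
  by rewrite /tau (bopB (mp_bT M)) (bopB (mp_bT' M)) (mp_TT' M) !ipE => ->; ring.
- by move=> u; rewrite /gam ipZl mulr_ge0 ?(mp_Cpos M).
- move=> u; rewrite /gam => h; apply: (mp_Cinj M); have := congr1 (fun w => 2^-1 *: w) h.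
  by rewrite scalerA mulVf ?pnatr_eq0 // scale1r scaler0.
- by move=> B [y [y' [B' [/(mp_op0 M1) hB _ _]]]].
- move=> B [y [y' [B' [hB hB' BB']]]].
  have [X1 [x1 [Q1 [Q1' [hX1 t1 t2 [hQ1 hQ1' QQ1]]]]]] := CC_stein hB hB' BB'.
  exists (fun v => 2 *: J (X1 (J v))), (fun v => 4 *: Q1 v); split=> //.
    exists (4 *: J (T (C y'))), (4 *: C (C y')), (fun v => 4 *: Q1' v); split.
    + exact: mp_scale M1 _ _ _ hQ1.
    + exact: mp_scale M1 _ _ _ hQ1'.
    + by move=> u w; rewrite ipZl ipZr QQ1.
  by move=> u; rewrite (bopZ bz) (hz _ _ hX1).
by exists eta', eta, A; split=> //; exact: isadjC.
Qed.

(** The coefficients of W between left bounded vectors depend only on om, or only on om', and do so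
    continuously. Moreover (om', om) is a limit of pairs (C C eta, J T C eta), whose right
    multiplications commute with z by [stein_commute]. *)
Lemma adjpairs_commute z : bop z -> (forall X x, N0 X x -> forall v, z (J (X (J v))) = J (X (J (z v)))) ->
  forall W W' om om', N1 W om -> N1 W' om' -> isadj W W' -> G1 om' om ->
  forall v, z (W v) = W (z v).
Proof.
move=> bz hz W W' om om' hW hW' WW' G1o.
pose S : set (prodH V V) := [set p | exists eta, p = (C (C eta), J (T (C eta))) /\
  exists A A' eta', [/\ N1 A eta, N1 A' eta' & isadj A A']].
have bT := mp_bT M; have bC := mp_bC M; have bJ := mp_bJ M.
have dS : clos S (om', om).
  pose S1 : set (prodH V V) := [set p | exists v, p = (C v, J (T v))].
  have S1S : S1 `<=` clos S.
    move=> _ [v ->].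
    pose D := [set eta | exists A A' eta', [/\ N1 A eta, N1 A' eta' & isadj A A']].
    have dD w : clos D w.
      apply: clos_idem; apply: clos_mono (symm_dense_range bC (mp_sC M) (mp_Cinj M) w) => _ [u _ <-].
      move=> e e0; have /clos_prod /(_ e e0) [[x y] [[A [B [hA hB AB]]] h _]] := mp_core1 M (mp_g1' M u).
      by exists x => //; exists A, B, y.
    have /clos_seq [u hu cu] := clos_image bC dD (symm_dense_range bC (mp_sC M) (mp_Cinj M)) v.
    apply/clos_seq; exists (fun n => (C (u n), J (T (u n)))) => [n|].
      by have [eta heta <-] := hu n; exists eta.
    by apply/cv_pair; split; [exact: (bop_cv bC cu)|exact: (bop_cv bJ (bop_cv bT cu))].
  have lS1 : lsub S1.
    split; first by exists 0; rewrite (bop0 bC) (bop0 bT) (bop0 bJ).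
    by move=> a _ _ [u ->] [w ->]; exists (a *: u + w); rewrite (bopL bC) (bopL bT) (bopL bJ).
  apply: clos_idem; apply: clos_mono S1S _ _.
  have [p hp hq] := projection (lsub_clos lS1) (@clos_idem _ _ S1) ((om', om) : prodH V V).
  have G1p : G1 p.1 p.2.
    apply/(mp_adj1 M) => a b hab; have /clos_seq [u hu /cv_pair [c1 c2]] := hp.
    have k1 := cv_ip (w := b) c1; have k2 := cv_ip (w := a) c2.
    rewrite ipC [RHS]ipC; apply: cvgR_unique k1 _.
    rewrite (_ : (fun n => _) = fun n => ip (u n).2 a) //; apply/funext => n.
    by have [v ->] := hu n; rewrite /= ipC ((mp_adj1 M _ _).1 (mp_g1' M v) _ _ hab) ipC.
  suff -> : (om', om) = p :> prodH V V by [].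
  (* The vectors (C v, J T v) are dense in the graph of F: for d in the graph and orthogonal to
     them, orthogonality gives T J d.2 = - C d.1, the graph gives T' J d.2 = C d.1, and T + T' = 1
     kills J d.2. *)
  pose d : prodH V V := (om' - p.1, om - p.2).
  have [d1 d2] : T (J d.2) = - C d.1 /\ C (J d.1) = T d.2.
    split; apply: ip_ext => v.
      have := hq _ (sub_clos (ex_intro _ v erefl) : clos S1 (C v, J (T v))).
      rewrite prodHE /= => h; rewrite (mp_sT M) (mp_sJ M) ipNl (mp_sC M).
      rewrite /= in h *. lra.
    rewrite (mp_sC M) (mp_sJ M) (mp_sT M) !ipBl.
    rewrite ![ip _ (J (C v))]ipC ((mp_adj1 M _ _).1 G1o _ _ (mp_g0 M v)).
    by rewrite ((mp_adj1 M _ _).1 G1p _ _ (mp_g0 M v)) ![ip (T v) _]ipC.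
  have d3 : C d.1 = T' (J d.2) by rewrite -(mp_JT M) -d2 (mp_JC M) (mp_JJ M).
  have d20 : J d.2 = 0 by rewrite -(mp_sum M (J d.2)) d1 d3 addNr.
  have e1 : om' - p.1 = 0 by apply: (mp_Cinj M); rewrite -[_ - _]/d.1 d3 d20 (bop0 (mp_bT' M)).
  have e2 : om - p.2 = 0 by rewrite -[_ - _]/d.2 -(mp_JJ M d.2) d20 (bop0 bJ).
  by case: p e1 e2 {hp hq G1p d d1 d2 d3 d20} => p1 p2 /= /eqP; rewrite subr_eq0 => /eqP -> /eqP; rewrite subr_eq0 => /eqP ->.
have /clos_seq [u hu /cv_pair [c1 c2]] := dS.
have bW := mp_op0 M1 hW.
apply: (bop_eq_dense (bop_comp bz bW) (bop_comp bW bz) (mp_dense0 M)) => x [X hX] /=.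
apply/eqP; rewrite -subr_eq0; apply/eqP; apply: orth_dense (mp_dense0 M) _ => y [Y hY].
rewrite ipBl; apply/eqP; rewrite subr_eq0; apply/eqP.
have [z' bz' zz'] := adj_exists bz; have [bX bY] := (mp_op0 M hX, mp_op0 M hY).
rewrite zz' [RHS]WW' -(mp_rel M hX hW) -(mp_rel M hY hW').
have k1 := cv_ip (w := z' y) (bop_cv bX c2); have k2 := cv_ip (w := z x) (bop_cv bY c1).
apply: cvgR_unique k1 _; rewrite ipC.
rewrite (_ : (fun n => _) = fun n => ip (Y (u n).1) (z x)) //; apply/funext => n.
have [eta [-> heta]] := hu n; have [Q [Q' [hQ hQ' QQ' zQ]]] := stein_commute bz hz heta.
by rewrite /= (mp_rel M hX hQ) (mp_rel M hY hQ') -zz' zQ QQ' ipC.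
Qed.

(** For right multiplications P and Q, the operator P^* y Q is a right multiplication with adjoint
    Q^* y^* P, so [adjpairs_commute] applies to it. P and Q are then stripped off, because right
    multiplications have no common kernel. *)
Theorem modular_pair_commute z y y' : bop z -> bop y -> isadj y y' ->
  (forall X x, N0 X x -> forall v, z (J (X (J v))) = J (X (J (z v)))) ->
  (forall X x, N0 X x -> forall v, y (X v) = X (y v)) ->
  (forall X x, N0 X x -> forall v, y' (X v) = X (y' v)) ->
  forall v, z (y v) = y (z v).
Proof.
move=> bz by_ yy' hz hy hy'; have by' := adj_bop by_ yy'.
have sand (f f' : V -> V) P p Q q : bop f -> bop f' -> isadj f f' ->
    (forall X x, N0 X x -> forall v, f (X v) = X (f v)) ->
    (forall X x, N0 X x -> forall v, f' (X v) = X (f' v)) ->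
    N1 P p -> N1 Q q -> forall P', isadj P P' ->
    (exists w, N1 (fun v => P' (f (Q v))) w) /\ forall v, z (P' (f (Q v))) = P' (f (Q (z v))).
  move=> bf bf' ff' hf hf' hP hQ P' PP'.
  have bP' := adj_bop (mp_op0 M1 hP) PP'; have [Q' bQ' QQ'] := adj_exists (mp_op0 M1 hQ).
  have h1 := mp_left M1 bf hf hQ; have h2 := mp_left M1 bf' hf' hP.
  have h3 : N1 (P' \o (f \o Q)) (P' (f q)).
    by apply: (mp_left M1 bP' _ h1) => X x hX v; rewrite (mp_comA M hX hP PP').
  have h4 : N1 (Q' \o (f' \o P)) (Q' (f' p)).
    by apply: (mp_left M1 bQ' _ h2) => X x hX v; rewrite (mp_comA M hX hQ QQ').
  have a1 : isadj (P' \o (f \o Q)) (Q' \o (f' \o P)).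
    exact: adj_comp (isadjC PP') (adj_comp ff' QQ').
  split; first by exists (P' (f q)).
  apply: (adjpairs_commute bz hz h3 h4 a1).
  exact: (mp_prod M1 hQ h2 QQ' (adj_comp (isadjC ff') PP')).
have idc : forall X x, N0 X x -> forall v : V, @id V (X v) = X (@id V v) by [].
have iid : isadj (@id V) (@id V) by [].
have PPz P p P' : N1 P p -> isadj P P' -> (exists w, N1 (fun v => P' (P v)) w) /\
    forall v, z (P' (P v)) = P' (P (z v)).
  by move=> hP PP'; exact: (sand _ _ _ _ _ _ (bop_id V) (bop_id V) iid idc idc hP hP _ PP').
have nd (P P' : V -> V) : isadj P P' -> forall v, P' (P v) = 0 -> P v = 0.
  by move=> PP' v h; apply: ip_eq0; rewrite PP' h ip0r.
have bd : bop (fun v => z (y v) - y (z v)).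
  by apply: bop_sub; exact: bop_comp.
have [d' bd' dd'] := adj_exists bd.
move=> v; apply/eqP; rewrite -subr_eq0; apply/eqP; apply: (mp_nd1 M) => P p hP.
have [P' bP' PP'] := adj_exists (mp_op0 M1 hP); apply: (nd _ _ PP').
have [[w hPP] zPP] := PPz _ _ _ hP PP'.
have sPP : symm (fun v => P' (P v)) by move=> a b; rewrite (isadjC PP') PP'.
suff h : forall v, d' (P' (P v)) = 0.
  by apply: ip_ext => u; rewrite sPP dd' h ip0l ip0r.
move=> {}v; apply: (mp_nd1 M) => Q q hQ.
have [Q' bQ' QQ'] := adj_exists (mp_op0 M1 hQ); apply: (nd _ _ QQ').
have [[w2 hQQ] zQQ] := PPz _ _ _ hQ QQ'.
have sQQ : symm (fun v => Q' (Q v)) by move=> a b; rewrite (isadjC QQ') QQ'.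
have [_ hz2] := sand _ _ _ _ _ _ by_ by' yy' hy hy' hPP hQQ _ sPP.
apply: ip_ext => u; rewrite sQQ (isadjC dd') sPP ip0l.
have bP := mp_op0 M1 hPP; rewrite [X in ip _ X](_ : _ = 0) ?ip0r //.
by rewrite (bopB bP) -zPP hz2 zQQ subrr.
Qed.

End Tomita.

(** * Complex Hilbert spaces as real ones *)

Local Open Scope complex_scope.

Notation cRe := complex.Re.
Notation cIm := complex.Im.

Section Realify.
Context {R : realType}.
Implicit Type K : hilbert R.

Section Dot.
Context {K : hilbert R}.
Implicit Types u v w : K.

Lemma dotDl u v w : dot K (u + v) w = dot K u w + dot K v w.
Proof. exact: linearDl. Qed.

Lemma dotZl a u w : dot K (a *: u) w = a * dot K u w.
Proof. exact: linearZl_LR. Qed.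

Lemma dotC u v : dot K u v = (dot K v u)^*.
Proof. by rewrite [LHS]hermC expr0 mul1r. Qed.

Lemma dotZr a u v : dot K u (a *: v) = a^* * dot K u v.
Proof. exact: linearZr_LR. Qed.

End Dot.

(** A new name for the carrier, so that the real scalar action does not clash with the complex
    one. *)
Definition realvec K : Type := hilbert_car K.
HB.instance Definition _ K := GRing.Zmodule.on (realvec K).

Section Lmod.
Context (K : hilbert R).
Let sc (r : R) (v : realvec K) : realvec K := r%:C *: (v : K).
Let scA a b v : sc a (sc b v) = sc (a * b) v.
Proof. by rewrite /sc scalerA rmorphM. Qed.
Let sc1 : left_id 1 sc.
Proof. by move=> v; rewrite /sc scale1r. Qed.
Let scDr : right_distributive sc +%R.
Proof. by move=> a u v; rewrite /sc scalerDr. Qed.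
Let scDl v : {morph sc^~ v : a b / a + b}.
Proof. by move=> a b; rewrite /sc rmorphD scalerDl. Qed.
HB.instance Definition _ := GRing.Zmodule_isLmodule.Build R (realvec K) scA sc1 scDr scDl.
End Lmod.

Lemma ReM (a : R) (z : R[i]) : cRe (a%:C * z) = a * cRe z.
Proof. by case: z => x y /=; rewrite mul0r subr0. Qed.

Lemma ReD (z w : R[i]) : cRe (z + w) = cRe z + cRe w.
Proof. by case: z; case: w. Qed.

Lemma ReJ (z : R[i]) : cRe z^* = cRe z.
Proof. by case: z. Qed.

Lemma posC (e : R[i]) : 0 < e -> e = (cRe e)%:C /\ 0 < cRe e.
Proof. by case: e => x y; rewrite ltcE /= => /andP [/eqP -> ->]. Qed.

Section Hilb.
Context (K : hilbert R).
Let rip (u v : realvec K) : R := cRe (dot K u v).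

Lemma norm_real (v : K) : `|v| = (cRe `|v|)%:C.
Proof. by have := normr_ge0 v; case: `|v| => x y; rewrite lecE /= => /andP [/eqP -> _]. Qed.

Lemma norm_sq (v : K) : cRe `|v| ^+ 2 = cRe (dot K v v).
Proof. by rewrite dot_norm [in RHS]norm_real -rmorphXn. Qed.

Lemma Re_norm_ge0 (v : K) : 0 <= cRe `|v|.
Proof. by have := normr_ge0 v; rewrite norm_real lecR. Qed.

Let rip_complete (u : nat -> realvec K) :
  (forall e, 0 < e -> exists N, forall m n, (N <= m)%N -> (N <= n)%N ->
     rip (u m - u n) (u m - u n) < e) ->
  exists l, (fun n => rip (u n - l) (u n - l)) @ \oo --> (0 : R).
Proof.
move=> h; pose v : nat -> K := u.
have : cvg (v @ \oo).
  apply/cauchy_cvgP/cauchy_ballP => e e0.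
  have [er e1] := posC e0.
  have [|N hN] := h (cRe e ^+ 2); first by rewrite exprn_gt0.
  pose S : set K := [set x | exists2 n, (N <= n)%N & x = v n].
  exists (S, S); first by split; exists N => // n hn; exists n.
  move=> [_ _] [/= [m hm ->] [n hn ->]]; rewrite -ball_normE /ball_ /= er norm_real ltcR.
  by rewrite -(ltr_pXn2r (n := 2)) ?nnegrE ?Re_norm_ge0 ?ltW // norm_sq hN.
move=> /cvg_ex [l hl]; exists l; apply/cvgrPdist_lt => e e0.
have e1 : 0 < (Num.sqrt e)%:C :> R[i] by rewrite ltcR sqrtr_gt0.
have /cvgrPdist_lt /(_ _ e1) [N _ hN] := hl; exists N => // n /hN.
rewrite norm_real ltcR distrC => hh; rewrite sub0r normrN /rip -norm_sq ger0_norm ?sqr_ge0 //.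
by rewrite -[e in _ < e]sqr_sqrtr ?ltW // ltr_pXn2r ?nnegrE ?Re_norm_ge0 ?sqrtr_ge0.
Qed.

Definition rh : rhilb R.
refine (@RHilb R (realvec K) rip _ _ _ _ _ rip_complete).
- by move=> u v w; rewrite /rip dotDl ReD.
- by move=> a u w; rewrite /rip dotZl ReM.
- by move=> u v; rewrite /rip dotC ReJ.
- by move=> u; rewrite /rip -norm_sq sqr_ge0.
- move=> u h; apply/eqP; rewrite -normr_eq0; rewrite norm_real.
  have : cRe `|u : K| ^+ 2 == 0 by rewrite norm_sq; apply/eqP.
  by rewrite sqrf_eq0 => /eqP ->.
Defined.

Lemma rh_ip (u v : rh) : ip u v = cRe (dot K u v). Proof. by []. Qed.

Lemma rh_nrm (v : rh) : nrm v = cRe `|v : K|.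
Proof. by rewrite /nrm rh_ip -norm_sq sqrtr_sqr ger0_norm ?Re_norm_ge0. Qed.

Lemma rh_scale (a : R) (v : rh) : a *: v = a%:C *: (v : K). Proof. by []. Qed.

Lemma rh_norm (v : K) : `|v| = (nrm (v : rh))%:C.
Proof. by rewrite rh_nrm -norm_real. Qed.

Definition imul (v : rh) : rh := 'i *: (v : K).

Lemma scale_re_im (a : R[i]) (v : K) : a *: v = cRe a *: (v : rh) + cIm a *: imul v.
Proof.
rewrite {1}[a]complexE scalerDl; congr (_ + _).
by rewrite mulrC -scalerA.
Qed.

Lemma imulK (v : rh) : imul (imul v) = - v.
Proof. by rewrite /imul scalerA -expr2 sqr_i scaleN1r. Qed.

Lemma ip_imul (u v : rh) : ip (imul u) v = - ip u (imul v).
Proof.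
rewrite !rh_ip dotZl dotZr; case: (dot K u v) => x y /=; ring.
Qed.

Lemma dot_ip (u v : K) : dot K u v = (ip (u : rh) v) +i* (ip (u : rh) (imul v)).
Proof. by rewrite !rh_ip dotZr; case: (dot K u v) => x y /=; congr (_ +i* _); ring. Qed.

Lemma bop_imul : bop imul.
Proof.
split=> [a u v|]; first by rewrite /imul scalerDr !rh_scale !scalerA mulrC.
by exists 1 => v; rewrite mul1r /nrm ip_imul imulK ipNr opprK.
Qed.

Lemma closureE (S : set K) : closure S = clos (S : set rh).
Proof.
apply/seteqP; split=> v.
  move=> h e e0; have e1 : 0 < e%:C :> R[i] by rewrite ltcR.
  have [s [Ss]] := h _ (nbhsx_ballx v e%:C e1); rewrite -ball_normE /ball_ /= rh_norm ltcR => hs.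
  by exists s.
move=> h B /nbhs_ballP [e e0 hB]; have [er e1] := posC e0.
have [s Ss hs] := h _ e1; exists s; split=> //; apply: hB.
by rewrite -ball_normE /ball_ /= er rh_norm ltcR.
Qed.

Lemma denseE (S : set K) : dense S <-> forall v, clos (S : set rh) v.
Proof.
rewrite -closureE; split=> [h v B Bv|h O [v Ov] oO].
  have [|w [Bw Sw]] := h B^° _ (open_interior B); first by exists v.
  by exists w; split=> //; exact: interior_subset.
by have [w [Sw Ow]] := h v O (open_nbhs_nbhs (conj oO Ov)); exists w.
Qed.

Lemma closure2E (S : set (K * K)) : closure S = clos (S : set (prodH rh rh)).
Proof.
apply/seteqP; split=> v.
  move=> h; apply/clos_prod => e e0; have e1 : 0 < e%:C :> R[i] by rewrite ltcR.
  have [s [Ss [/= h1 h2]]] := h _ (nbhsx_ballx v e%:C e1).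
  by exists s; split=> //; move: h1 h2; rewrite -!ball_normE /ball_ /= !rh_norm !ltcR.
move=> /clos_prod h B /nbhs_ballP [e e0 hB]; have [er e1] := posC e0.
have [s [Ss h1 h2]] := h _ e1; exists s; split=> //; apply: hB.
by split; rewrite -ball_normE /ball_ /= er rh_norm ltcR.
Qed.

Lemma separable_seq : exists d : nat -> rh, forall v, clos (range d) v.
Proof.
have [D [cD dD]] := hilbert_separable K.
have /countable_injP [f fi] := cD.
(* Indices not reached by f get the default 0; only the density of the range matters. *)
pose d n : K := xget 0 [set v | D v /\ f v = n].
exists d => v; apply: clos_mono (((denseE D).1 dD) v) => w Dw; exists (f w) => //; rewrite /d.
have [Dx fx] := xgetI 0 (conj Dw erefl : [set v | D v /\ f v = f w] w).
by apply: fi; rewrite ?inE.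
Qed.

End Hilb.

Section Bounded.
Context {H K : hilbert R}.

Lemma bounded_bop (x : H -> K) : linear x /\ continuous x <->
  bop (x : rh H -> rh K) /\ forall v : rh H, x (imul v) = imul (x v).
Proof.
split=> [[lx cx]|[bx ix]].
  have Z a v : x (a *: v) = a *: x v.
    have x0 : x 0 = 0 by have := lx 1 0 0; rewrite scaler0 addr0 scale1r => /eqP; rewrite -subr_eq0 opprD addNKr oppr_eq0 => /eqP.
    by have := lx a v 0; rewrite !addr0 x0 addr0.
  split; last by move=> v; exact: Z.
  split=> [a u v|]; first exact: (lx a%:C).
  have x0 : x 0 = 0 by have := Z 0 0; rewrite !scale0r.
  have /cvgrPdist_lt /(_ _ ltr01) /nbhs_ballP [e e0 he] := cx 0.
  have [er e1] := posC e0; set k := cRe e in er e1.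
  exists (2 / k) => v; have [/nrm_eq0 ->|v0] := eqVneq (nrm (v : rh H)) 0.
    by rewrite x0 !nrm0 mulr0.
  have vp : 0 < nrm (v : rh H) by rewrite lt_def v0 nrm_ge0.
  have p : 0 < k / (2 * nrm (v : rh H)) by rewrite divr_gt0 // mulr_gt0.
  have := he ((k / (2 * nrm (v : rh H)))%:C *: v); rewrite -ball_normE /ball_ /= x0 !sub0r !normrN er.
  rewrite Z !rh_norm !ltcR -!rh_scale !nrmZ gtr0_norm // => h.
  have h1 : k / (2 * nrm (v : rh H)) * nrm (v : rh H) < k.
    by rewrite invfM mulrA mulfVK //; move: e1; lra.
  have {h h1} := h h1; rewrite mulrC -ltr_pdivlMr // mul1r invf_div => /ltW /le_trans; apply.
  by rewrite mulrAC.
split=> [a u v|].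
  by rewrite !(scale_re_im a) (bopD bx) (bopD bx) !(bopZ bx) ix.
have [c c0 hc] := bop_bound bx; move=> v; apply/cvgrPdist_lt => e e0.
have [er e1] := posC e0; apply/nbhs_ballP; exists ((cRe e / c)%:C).
  by rewrite /= ltcR divr_gt0.
move=> w; rewrite -ball_normE /ball_ /= er !rh_norm !ltcR ltr_pdivlMr // => h.
by apply: le_lt_trans h; rewrite -[x v - x w](bopB bx) mulrC.
Qed.

End Bounded.
End Realify.
Arguments rh : simpl never.
Arguments ip {R r} : simpl never.

(** * Complex linear operators among the real ones *)

Section BoundedOps.
Context {R : realType}.
Implicit Types H K L : hilbert R.

Definition cop H K (x : H -> K) : Prop :=
  bop (x : rh H -> rh K) /\ forall v : rh H, x (imul v) = imul (x v).

Lemma cop_bop H K (x : H -> K) : cop x -> bop (x : rh H -> rh K). Proof. by case. Qed.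

Lemma copE H K (x : H -> K) : linear x /\ continuous x <-> cop x.
Proof. exact: bounded_bop. Qed.

Lemma copL H K (x : H -> K) (a : R[i]) (u v : H) : cop x -> x (a *: u + v) = a *: x u + x v.
Proof. by move=> /copE [h _]; exact: h. Qed.

Lemma cop_id H : cop (@id H). Proof. by split=> //; exact: bop_id. Qed.

Lemma cop_comp H K L (x : K -> L) (y : H -> K) : cop x -> cop y -> cop (x \o y).
Proof.
move=> [bx ix] [by_ iy]; split=> [|v]; first exact: bop_comp bx by_.
by rewrite /= iy ix.
Qed.

Lemma cop_scale H (a : R[i]) : cop (fun v : H => a *: v).
Proof.
have e : (fun v : H => a *: v) = fun v : rh H => cRe a *: v + cIm a *: imul v.
  by apply/funext => v; rewrite scale_re_im.
split; first by rewrite e; apply: bop_lin; [exact: bop_id|apply: bop_scale; exact: bop_imul].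
by move=> v; rewrite /imul !scalerA mulrC.
Qed.

Lemma cop_lin H K (a : R[i]) (x y : H -> K) : cop x -> cop y -> cop (fun v => a *: x v + y v).
Proof.
move=> hx hy; have [bax iax] := cop_comp (cop_scale K a) hx; have [by_ iy] := hy.
split=> [|v]; first exact: bop_add bax by_.
by have := iax v; rewrite /= => ->; rewrite iy (bopD (bop_imul K)).
Qed.

Lemma cop_adj H K (x : H -> K) (y : K -> H) : cop x -> isadj (x : rh H -> rh K) y -> cop y.
Proof.
move=> [bx ix] xy; split=> [|v]; first exact: (adj_bop bx xy).
apply: (@ip_ext _ (rh H)) => w; have yx := isadjC xy.
by rewrite yx ip_imul -ix -yx -ip_imul.
Qed.

Lemma cop_adj_exists H K (x : H -> K) : cop x -> exists2 y, cop y & isadj (x : rh H -> rh K) y.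
Proof.
by move=> hx; have [y _ xy] := adj_exists (cop_bop hx); exists y => //; exact: cop_adj hx xy.
Qed.

(** For complex linear maps the real part of the inner product determines all of it, so the real and
    the complex adjoint agree. *)
Lemma isadj_dot H K (x : H -> K) (y : K -> H) : cop x ->
  isadj (x : rh H -> rh K) y <-> forall v w, dot K (x v) w = dot H v (y w).
Proof.
move=> hx; split=> h v w; last by rewrite !rh_ip h.
rewrite !dot_ip h; congr (_ +i* _); have [_ iy] := cop_adj hx h.
by rewrite h iy.
Qed.

Section OneSpace.
Context {H : hilbert R}.
Implicit Types x y s t : H -> H.

Lemma bounded_opsE x : bounded_ops x <-> cop x.
Proof. exact: copE. Qed.

Lemma adjP x : cop x -> cop (adj x) /\ isadj (x : rh H -> rh H) (adj x).
Proof.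
move=> hx; have [y hy xy] := cop_adj_exists hx.
have h : [set y | bounded_ops y /\ forall v w, dot H (x v) w = dot H v (y w)] y.
  by split; [apply/bounded_opsE|apply/isadj_dot].
have [/bounded_opsE h1 h2] := xgetI (fun=> 0) h.
by split=> //; apply/(isadj_dot _ hx).
Qed.

Lemma adj_eq x y : cop x -> isadj (x : rh H -> rh H) y -> adj x = y.
Proof. by move=> hx xy; have [_ h] := adjP hx; exact: adj_unique h xy. Qed.

(** Symmetry comes from the vanishing of <x u, i u>, polarized at u = v - i w. *)
Lemma positive_opE x :
  positive_op x <-> [/\ cop x, symm (x : rh H -> rh H) & forall v : rh H, 0 <= ip (x v : rh H) v].
Proof.
split=> [[/bounded_opsE hx hp]|[hx sx px]]; last first.
  split=> [|v]; first exact/bounded_opsE.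
  rewrite dot_ip lecE /= px andbT; apply/eqP.
  have [_ ix] := hx; have e1 := ip_imul (v : rh H) (x v : rh H); have e2 := sx v (imul (v : rh H)).
  by rewrite ix in e2; rewrite ipC in e1; move: e1 e2; lra.
have h0 v : 0 <= ip (x v : rh H) v /\ ip (x v : rh H) (imul v) = 0.
  by have := hp v; rewrite dot_ip lecE /= => /andP [/eqP -> ->].
split=> // [v w|v]; last by case: (h0 v).
have [bx ix] := hx.
have [_ h3] := h0 (v - imul w); have [_ h1] := h0 v; have [_ h2] := h0 (imul w).
rewrite !(bopB bx) (bopB (bop_imul H)) !ipE h1 h2 imulK ix ip_imul imulK !ipE in h3.
by rewrite (ipC v); move: h3; lra.
Qed.

Lemma le_opP x y : le_op x y -> forall v : rh H, ip (x v : rh H) v <= ip (y v : rh H) v.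
Proof. by move=> /positive_opE [_ _ h] v; have := h v; rewrite ipBl subr_ge0. Qed.

Lemma cop_sub x y : cop x -> cop y -> cop (y \- x).
Proof.
move=> hx hy; have := cop_lin (-1) hx hy; rewrite (_ : (fun v => _) = y \- x) //.
by apply/funext => v; rewrite scaleN1r addrC.
Qed.

Lemma le_opI x y : cop x -> cop y -> symm (x : rh H -> rh H) -> symm (y : rh H -> rh H) ->
  (forall v : rh H, ip (x v : rh H) v <= ip (y v : rh H) v) -> le_op x y.
Proof.
move=> hx hy sx sy h; apply/positive_opE; split; first exact: cop_sub.
  by move=> v w; rewrite ipBl ipBr sx sy.
by move=> v; rewrite ipBl subr_ge0.
Qed.

Lemma le_op_anti x y : le_op x y -> le_op y x -> x = y.
Proof.
move=> /positive_opE [[bx _] sx px] h2; apply/funext => v; apply/eqP; rewrite eq_sym -subr_eq0.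
apply/eqP; apply: (pos_ker bx sx px); apply/eqP; rewrite eq_le px andbT ipBl subr_le0.
exact: le_opP.
Qed.

Lemma lub_op_positive D s : (forall x, D x -> positive_op x) -> D !=set0 -> lub_ops D s -> positive_op s.
Proof.
move=> hD [x Dx] [hs _]; have /positive_opE [hx sx px] := hD _ Dx.
have /positive_opE [hsx ssx psx] := hs _ Dx.
have e : s = fun v => 1 *: (s \- x) v + x v by apply/funext => v; rewrite scale1r subrK.
apply/positive_opE; rewrite e; split.
- exact: cop_lin.
- by move=> v w; rewrite !scale1r ipDl ipDr; congr (_ + _); [exact: ssx|exact: sx].
- by move=> v; rewrite scale1r ipDl addr_ge0.
Qed.

End OneSpace.

(** For a difference P of two terms P^2 <= c P, which turns convergence of the quadratic forms into
    strong convergence. *)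
Lemma vigier (V : rhilb R) (x : nat -> V -> V) c : 0 <= c -> (forall n, bop (x n)) ->
  (forall n, symm (x n)) -> (forall n v, ip (x n v) v <= ip (x n.+1 v) v) ->
  (forall v, 0 <= ip (x 0%N v) v) -> (forall n v, ip (x n v) v <= c * ip v v) ->
  exists l, [/\ bop l, symm l & forall v, cv (fun n => x n v) (l v)].
Proof.
move=> c0 bx sx incr pos bnd.
have mono m n v : (m <= n)%N -> ip (x m v) v <= ip (x n v) v.
  by move=> /subnK <-; elim: (n - m)%N => // k ih; apply: le_trans ih _; rewrite addSn.
have ex v : exists l, cv (fun n => x n v) l.
  have ub : has_ubound (range (fun n => ip (x n v) v)).
    by exists (c * ip v v) => _ [n _ <-].
  have cvr := nondecreasing_cvgn (fun m n h => mono m n v h) ub.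
  apply: rh_complete => e e0.
  have e1 : 0 < e ^+ 2 / (c + 1) / 2 by rewrite !divr_gt0 ?exprn_gt0 // ltr_wpDl.
  have /cvgrPdist_lt /(_ _ e1) [N _ hN] := cvr; exists N.
  have main m n : (N <= m)%N -> (m <= n)%N -> nrm (x n v - x m v) < e.
    move=> hm hn; have hD : bop (fun w => x n w - x m w) := bop_sub (bx n) (bx m).
    have hp w : 0 <= ip (x n w - x m w) w by rewrite ipBl subr_ge0 mono.
    have := pos_nrm c0 hD _ hp _ v.
    have k1 : symm (fun w => x n w - x m w) by move=> a b; rewrite ipBl ipBr !sx.
    have k2 w : ip (x n w - x m w) w <= c * ip w w.
      rewrite ipBl; have := bnd n w; have := mono 0%N m w (leq0n m); have := pos w; lra.
    move=> /(_ k1 k2); rewrite -nrm_sq ipBl => h.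
    have h1 := hN m hm; have h2 := hN n (leq_trans hm hn).
    rewrite -(ltr_pXn2r (n := 2)) ?nnegrE ?nrm_ge0 ?ltW //; apply: le_lt_trans h _.
    move: h1 h2 (mono m n v hn); move: (sup _) => S.
    move: (ip (x n v) v) (ip (x m v) v) => a b /=; rewrite !ltr_norml => /andP [h1 h2] /andP [h3 h4] h5.
    have h6 : a - b < e ^+ 2 / (c + 1) by move: e1 h1 h2 h3 h4; move: (e ^+ 2 / (c + 1)) => k; lra.
    move: h6; rewrite ltr_pdivlMr ?ltr_wpDl // => h6; apply: le_lt_trans h6.
    by rewrite mulrC ler_wpM2l ?subr_ge0 // lerDl.
  move=> m n hm hn; have [h|h] := leqP m n; first by rewrite nrmB main.
  by apply: main => //; exact: ltnW.
have [l hl] := choice ex.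
have b0 n : (fun v => ip (x n v) v) = fun v => ip (x n v) v by [].
have nb n v : nrm (x n v) <= c * nrm v.
  apply: sq_le_mul; rewrite ?nrm_ge0 ?mulr_ge0 ?nrm_ge0 //.
  have hp w : 0 <= ip (x n w) w by apply: le_trans (pos w) (mono 0%N n w _).
  rewrite nrm_sq; apply: le_trans (pos_nrm c0 (bx n) (sx n) hp (bnd n) v) _.
  rewrite -mulrA ler_wpM2l // mulrC; exact: ip_le.
exists l; split=> //; first exact: lim_bop bx nb hl.
move=> v w; have h1 := cv_ip (w := w) (hl v); have h2 := cv_ip (w := v) (hl w).
apply: cvgR_unique h1 _; rewrite ipC.
by rewrite (_ : (fun n => _) = fun n => ip (x n w) v) //; apply/funext => n; rewrite sx ipC.
Qed.

End BoundedOps.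

(** * Least upper bounds as strong limits of sequences *)

Section Order.
Context {R : realType} {H : hilbert R}.
Implicit Types x y s t : H -> H.
Implicit Types D : set (H -> H).

Lemma quad_dense (x y : H -> H) (S : set (rh H)) : bop (x : rh H -> rh H) -> bop (y : rh H -> rh H) ->
  (forall v, clos S v) -> (forall v, S v -> ip (x v : rh H) v <= ip (y v : rh H) v) ->
  forall v : rh H, ip (x v : rh H) v <= ip (y v : rh H) v.
Proof.
move=> bx by_ dS h v; have /clos_seq [u hu cu] := dS v.
have lim z : bop (z : rh H -> rh H) -> (fun n => ip (z (u n) : rh H) (u n)) @ \oo --> ip (z v : rh H) v.
  move=> bz; have [c c0 hc] := bop_bound bz.
  have h1 := cv_ip (w := v) (bop_cv bz cu).
  have h2 : (fun n => c * (nrm (u n) * nrm (u n - v))) @ \oo --> c * (nrm v * 0).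
    by apply: rcvZ; apply: rcvM; [exact: cv_nrm|exact: cu].
  rewrite !mulr0 in h2; apply/cvgrPdist_lt => e e0; have e2 : 0 < e / 2 by lra.
  have /cvgrPdist_lt /(_ _ e2) [N1 _ hN1] := h1; have /cvgrPdist_lt /(_ _ e2) [N2 _ hN2] := h2.
  exists (maxn N1 N2) => // n /= hn.
  have k1 := hN1 n (leq_trans (leq_maxl _ _) hn); have k2 := hN2 n (leq_trans (leq_maxr _ _) hn).
  rewrite /= in k1; rewrite /= sub0r normrN in k2; have k3 := ip_cs (z (u n) : rh H) (u n - v).
  have k4 : nrm (z (u n) : rh H) * nrm (u n - v) <= c * (nrm (u n) * nrm (u n - v)).
    by rewrite mulrA ler_wpM2r ?nrm_ge0.
  rewrite ipBr in k3; move: k1 k2 k3 k4.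
  move: (ip (z v : rh H) v) (ip (z (u n) : rh H) v) (ip (z (u n) : rh H) (u n)) (c * _) (_ * nrm (u n - v)).
  move=> a b d f g; rewrite !ltr_norml !ler_norml => /andP [? ?] /andP [? ?] /andP [? ?] ?.
  by apply/andP; split; lra.
by apply: (rcv_le (N := 0)) (lim _ bx) (lim _ by_) _ => n _; exact: h.
Qed.

Lemma seq_lub (x : nat -> H -> H) s : (forall n, positive_op (x n)) ->
  (forall n, le_op (x n) (x n.+1)) -> cop s -> (forall v : rh H, cv (fun n => x n v : rh H) (s v)) ->
  directed_ops (range x) /\ lub_ops (range x) s.
Proof.
move=> px ix cs lx.
have hx n : cop (x n) by have /positive_opE [] := px n.
have sx n : symm (x n : rh H -> rh H) by have /positive_opE [] := px n.
have mono m n v : (m <= n)%N -> ip (x m v : rh H) v <= ip (x n v : rh H) v.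
  by move=> /subnK <-; elim: (n - m)%N => // k ih; apply: le_trans ih _; rewrite addSn; exact: le_opP.
have ss : symm (s : rh H -> rh H).
  move=> v w; have h1 := cv_ip (w := w) (lx v); have h2 := cv_ip (w := v) (lx w).
  apply: cvgR_unique h1 _; rewrite ipC.
  by rewrite (_ : (fun n => _) = fun n => ip (x n w : rh H) v) //; apply/funext => n; rewrite sx ipC.
have les m n : (m <= n)%N -> le_op (x m) (x n).
  by move=> h; apply: le_opI => // v; exact: mono.
split; [split; first by exists (x 0%N), 0%N|split].
- move=> _ _ [m _ <-] [n _ <-]; exists (x (maxn m n)); split; first by exists (maxn m n).
    exact: les (leq_maxl _ _).
  exact: les (leq_maxr _ _).
- move=> _ [m _ <-]; apply: le_opI => // v.
  by apply: (rcv_le (N := m)) (cvg_cst _) (cv_ip (w := v) (lx v)) _ => n; exact: mono.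
move=> t ht.
have ct : cop t.
  have /positive_opE [h _ _] := ht _ (ex_intro2 _ _ 0%N I erefl).
  have := cop_lin 1 h (hx 0%N); rewrite (_ : (fun v => _) = t) //.
  by apply/funext => v; rewrite scale1r subrK.
have st : symm (t : rh H -> rh H).
  have /positive_opE [_ h _] := ht _ (ex_intro2 _ _ 0%N I erefl).
  by move=> v w; have := h v w; rewrite ipBl ipBr sx => /addIr.
apply: le_opI => // v; apply: (rcv_le (N := 0)) (cv_ip (w := v) (lx v)) (cvg_cst _) _ => n _.
by apply: le_opP; apply: ht; exists n.
Qed.

(** Separability reduces normality to sequences. On the points d 0, ..., d n of a dense sequence,
    the form of x (n + 1) is chosen within 1 / (n + 1) of the supremum over D; the strong limit then
    dominates D on a dense set, and equals s. *)
Lemma lub_seq D s : (forall x, D x -> positive_op x) -> directed_ops D -> lub_ops D s ->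
  exists x : nat -> H -> H, [/\ forall n, D (x n), forall n, le_op (x n) (x n.+1) &
    forall v : rh H, cv (fun n => x n v : rh H) (s v)].
Proof.
move=> pD [[x0 Dx0] dD] lD.
have ps := lub_op_positive pD (ex_intro _ _ Dx0) lD; have /positive_opE [cs ss spos] := ps.
have [d dd] := separable_seq H.
pose q x k := ip (x (d k) : rh H) (d k).
have qs x k : D x -> q x k <= q s k by move=> Dx; apply: le_opP; exact: lD.1.
have one e k : 0 < e -> exists2 z, D z & forall x, D x -> q x k <= q z k + e.
  move=> e0; have hs : has_sup [set q x k | x in D].
    by split; [exists (q x0 k), x0|exists (q s k) => _ [x Dx <-]; exact: qs].
  have [_ [z Dz <-] hz] := sup_adherent e0 hs; exists z => // x Dx.
  have : q x k <= sup [set q x k | x in D] by apply: sup_upper_bound => //; exists x.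
  move: hz; move: (sup _) => S; lra.
have good e n : 0 < e -> exists2 z, D z & forall k, (k <= n)%N -> forall x, D x -> q x k <= q z k + e.
  move=> e0; elim: n => [|n [z Dz hz]].
    by have [z Dz hz] := one e 0%N e0; exists z => // k; rewrite leqn0 => /eqP ->.
  have [y Dy hy] := one e n.+1 e0; have [w [Dw zw yw]] := dD _ _ Dz Dy; exists w => // k.
  rewrite leq_eqVlt => /orP [/eqP ->|hk] x Dx.
    by apply: le_trans (hy _ Dx) _; rewrite lerD2r; exact: le_opP.
  by apply: le_trans (hz k _ _ Dx) _ => //; rewrite lerD2r; exact: le_opP.
have step (p : nat * (H -> H)) : exists z, D p.2 -> [/\ D z, le_op p.2 z &
    forall k, (k <= p.1)%N -> forall x, D x -> q x k <= q z k + p.1.+1%:R^-1].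
  case: p => n x; have [Dx|nDx] := pselect (D x); last by exists x.
  have [|z Dz hz] := good n.+1%:R^-1 n; first by rewrite invr_gt0.
  have [w [Dw xw zw]] := dD _ _ Dx Dz; exists w => _; split=> //= k hk y Dy.
  by apply: le_trans (hz k hk y Dy) _; rewrite lerD2r; exact: le_opP.
have [F hF] := choice step.
pose x := fix x n := if n is n'.+1 then F (n', x n') else x0.
have Dx n : D (x n) by elim: n => // n ih; have [] := hF (n, x n) ih.
have ix n : le_op (x n) (x n.+1) by have [] := hF (n, x n) (Dx n).
have gx n k y : (k <= n)%N -> D y -> q y k <= q (x n.+1) k + n.+1%:R^-1.
  by move=> hk Dy; have [_ _ h] := hF (n, x n) (Dx n); exact: h.
have px n : positive_op (x n) := pD _ (Dx n).
have hx n : cop (x n) by have /positive_opE [] := px n.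
have [c c0 hc] := bop_bound cs.1.
have [l [bl sl hl]] : exists l : rh H -> rh H, [/\ bop l, symm l & forall v, cv (fun n => x n v : rh H) (l v)].
  apply: (@vigier _ _ _ c) => [|n|n|n v|v|n v].
  - exact: ltW.
  - by have [] := hx n.
  - by have /positive_opE [] := px n.
  - exact: le_opP.
  - by have /positive_opE [_ _] := pD _ Dx0; exact.
  - apply: le_trans (le_opP (lD.1 _ (Dx n)) v) _; apply: le_trans (ip_le _ _) _.
    by rewrite -nrm_sq expr2 mulrA ler_wpM2r ?nrm_ge0.
have cl : cop (l : H -> H).
  split=> // v; have h1 := bop_cv (bop_imul H) (hl v); have h2 := hl (imul v).
  apply: cv_unique h2 _; rewrite (_ : (fun n => _) = fun n => imul (x n v : rh H)) //.
  by apply/funext => n; have [_ ->] := hx n.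
have [_ [ub lub]] := seq_lub px ix cl hl.
have ls : le_op l s by apply: lub => _ [n _ <-]; exact: lD.1.
have sl' : le_op s l.
  apply: lD.2 => y Dy; have /positive_opE [cy sy _] := pD _ Dy; apply: le_opI => //.
  apply: (quad_dense cy.1 bl dd) => _ [k _ <-].
  have h1 := cv_ip (w := d k) (hl (d k)); have h2 : (fun n => n.+1%:R^-1 : R) @ \oo --> (0 : R) := invS_cvg0.
  have h3 := rcvD (rcv_shift h1) h2; rewrite addr0 in h3.
  by apply: (rcv_le (N := k)) (cvg_cst _) h3 _ => n hn; exact: gx.
by exists x; split=> // v; rewrite (le_op_anti sl' ls).
Qed.

End Order.

(** * Stability of a von Neumann algebra under algebra and limits *)

Section VonNeumann.
Context {R : realType} {H : hilbert R} {A : set (H -> H)} (vA : von_neumann_algebra A).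
Implicit Types x y s t : H -> H.

Lemma vn_cop x : A x -> cop x.
Proof. by move=> Ax; apply/bounded_opsE; case: vA => h _ _; exact: h. Qed.

Lemma vn_adj x : A x -> A (adj x). Proof. by case: vA => _ h _; exact: h. Qed.

Lemma vn_adjP x : A x -> isadj (x : rh H -> rh H) (adj x).
Proof. by move=> /vn_cop /adjP []. Qed.

Lemma commutant_cop (S : set (H -> H)) x : commutant S x -> cop x.
Proof. by move=> [/bounded_opsE]. Qed.

Lemma commutantE (S : set (H -> H)) x y v : commutant S x -> S y -> x (y v) = y (x v).
Proof. by move=> [_ h] /h /(congr1 (@^~ v)). Qed.

Lemma commutantI (S : set (H -> H)) x : cop x -> (forall y, S y -> forall v, x (y v) = y (x v)) ->
  commutant S x.
Proof. by move=> hx h; split=> [|y Sy]; [exact/bounded_opsE|apply/funext => v; exact: h]. Qed.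

Lemma vn_mem x : cop x -> (forall t, commutant A t -> forall v, x (t v) = t (x v)) -> A x.
Proof. by move=> hx h; case: vA => _ _ <-; exact: commutantI. Qed.

Lemma commutant_adj (S : set (H -> H)) t t' : (forall x, S x -> cop x /\ S (adj x)) ->
  commutant S t -> isadj (t : rh H -> rh H) t' -> commutant S t'.
Proof.
move=> hS ht tt'; apply: commutantI; first exact: cop_adj (commutant_cop ht) tt'.
move=> y Sy v; have [cy Sy'] := hS _ Sy; have [_ yy'] := adjP cy.
apply: (@ip_ext _ (rh H)) => w.
by rewrite (isadjC tt') yy' -(commutantE _ ht Sy') yy' (isadjC tt').
Qed.

Lemma vn_commutant_adj t t' : commutant A t -> isadj (t : rh H -> rh H) t' -> commutant A t'.
Proof. by apply: commutant_adj => x Ax; split; [exact: vn_cop|exact: vn_adj]. Qed.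

Lemma vn_id : A id. Proof. by apply: vn_mem => //; exact: cop_id. Qed.

Lemma vn_comp x y : A x -> A y -> A (x \o y).
Proof.
move=> Ax Ay; apply: vn_mem; first by apply: cop_comp; exact: vn_cop.
by move=> t ht v /=; rewrite -(commutantE _ ht Ay) -(commutantE _ ht Ax).
Qed.

Lemma vn_lin (a : R[i]) x y : A x -> A y -> A (fun v => a *: x v + y v).
Proof.
move=> Ax Ay; apply: vn_mem; first by apply: cop_lin; exact: vn_cop.
move=> t ht v /=; rewrite (copL _ _ _ (commutant_cop ht)).
by rewrite (commutantE _ ht Ax) (commutantE _ ht Ay).
Qed.

Lemma vn_limit (x : nat -> H -> H) s : (forall n, A (x n)) -> bop (s : rh H -> rh H) ->
  (forall v : rh H, cv (fun n => x n v : rh H) (s v)) -> A s.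
Proof.
move=> Ax bs lx; have com t : cop t -> (forall n v, x n (t v) = t (x n v)) -> forall v, s (t v) = t (s v).
  move=> ct h v; have h1 := lx (t v); have h2 := bop_cv ct.1 (lx v).
  by apply: cv_unique h1 _; under eq_fun do rewrite h.
apply: vn_mem => [|t ht]; last first.
  by apply: com => [|n v]; [exact: commutant_cop ht|rewrite (commutantE _ ht (Ax n))].
split=> // v; rewrite /imul; apply: (com (fun v => 'i *: v)) => [|n w]; first exact: cop_scale.
by have [_] := vn_cop (Ax n); exact.
Qed.

End VonNeumann.

(** * The GNS representation of a weight *)

Section GNS.
Context {R : realType} {H K : hilbert R} {M : set (H -> H)} {phi : (H -> H) -> \bar R}
  {Lambda : (H -> H) -> K} {rho : (H -> H) -> K -> K}.
Hypothesis vM : von_neumann_algebra M.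
Hypothesis wphi : nsf_weight M phi.
Hypothesis gnsM : gns M phi Lambda rho.
Implicit Types x y z : H -> H.

Notation N := (square_finite M phi).
Notation Lm x := (Lambda x : rh K).

Lemma psd_sq x : M x -> positive_part M (adj x \o x).
Proof.
move=> Mx; have hx := vn_cop vM Mx; have xx := vn_adjP vM Mx; have Mx' := vn_adj vM Mx.
split; first exact: vn_comp.
apply/positive_opE; split; first by apply: cop_comp => //; exact: vn_cop vM _ Mx'.
  by move=> v w; rewrite /= (isadjC xx) xx.
by move=> v; rewrite /= (isadjC xx) ip_ge0.
Qed.

Lemma sq_quad x (v : rh H) : M x -> ip (adj x (x v) : rh H) v = ip (x v : rh H) (x v).
Proof. by move=> Mx; rewrite (isadjC (vn_adjP vM Mx)). Qed.

Lemma phi_ge0 x : positive_part M x -> (0 <= phi x)%E.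
Proof. by have [[h _ _] _ _ _] := wphi; exact: h. Qed.

Lemma phi_add x y : positive_part M x -> positive_part M y -> phi (x \+ y) = (phi x + phi y)%E.
Proof. by have [[_ h _] _ _ _] := wphi; exact: h. Qed.

Lemma phi_scale (a : R) x : 0 <= a -> positive_part M x -> phi (a%:C \*: x) = (a%:E * phi x)%E.
Proof. by have [[_ _ h] _ _ _] := wphi; exact: h. Qed.

Lemma pp_add x y : positive_part M x -> positive_part M y -> positive_part M (x \+ y).
Proof.
move=> [Mx /positive_opE [cx sx px]] [My /positive_opE [cy sy py]].
have e : x \+ y = fun v => 1 *: x v + y v by apply/funext => v; rewrite scale1r.
split; first by rewrite e; exact: vn_lin.
apply/positive_opE; split; first by rewrite e; exact: cop_lin.
  by move=> v w; rewrite ipDl ipDr; congr (_ + _); [exact: sx|exact: sy].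
by move=> v; rewrite ipDl addr_ge0.
Qed.

Lemma rscaleE (a : R) x v : (a%:C \*: x) v = a *: (x v : rh H). Proof. by []. Qed.

Lemma pp_scale (a : R) x : 0 <= a -> positive_part M x -> positive_part M (a%:C \*: x).
Proof.
move=> a0 [Mx /positive_opE [cx sx px]].
have e : a%:C \*: x = fun v => (a%:C - 1) *: x v + x v.
  by apply/funext => v; rewrite scalerBl scale1r subrK.
split; first by rewrite e; exact: vn_lin.
apply/positive_opE; split; first by rewrite e; exact: cop_lin.
  by move=> v w; rewrite !rscaleE ipZl ipZr; congr (_ * _); exact: sx.
by move=> v; rewrite rscaleE ipZl mulr_ge0.
Qed.

Lemma phi_mono x y : positive_part M x -> positive_part M y ->
  (forall v : rh H, ip (x v : rh H) v <= ip (y v : rh H) v) -> (phi x <= phi y)%E.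
Proof.
move=> px py h; have [Mx /positive_opE [cx sx _]] := px; have [My /positive_opE [cy sy _]] := py.
have pd : positive_part M (y \- x).
  split; last exact: le_opI.
  have := vn_lin vM (-1) Mx My; rewrite (_ : (fun v => _) = y \- x) //.
  by apply/funext => v; rewrite scaleN1r addrC.
have e : y = (y \- x) \+ x by apply/funext => v; rewrite /= subrK.
by rewrite e phi_add // leeDr // phi_ge0.
Qed.

Lemma N_dom x P : M x -> positive_part M P -> (phi P < +oo)%E ->
  (forall v : rh H, ip (x v : rh H) (x v) <= ip (P v : rh H) v) -> N x.
Proof.
move=> Mx pP fP h; split=> //; apply: le_lt_trans fP; apply: phi_mono => //; first exact: psd_sq.
by move=> v; rewrite /= sq_quad.
Qed.

Lemma N_M x : N x -> M x. Proof. by case. Qed.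

Lemma N_cop x : N x -> cop x. Proof. by move=> /N_M; exact: vn_cop. Qed.

Lemma N_fin x : N x -> phi (adj x \o x) \is a fin_num.
Proof. by move=> [Mx h]; rewrite ge0_fin_numE ?phi_ge0 //; exact: psd_sq. Qed.

Lemma nrm_cscale L (a : R[i]) (v : hilbert_car L) :
  ip (a *: v : rh L) (a *: v) = (cRe a ^+ 2 + cIm a ^+ 2) * ip (v : rh L) v.
Proof.
rewrite scale_re_im !ipE; have e := ip_imul (v : rh L) (v : rh L).
rewrite [ip (imul _) (imul _)]ip_imul imulK ipNr opprK; move: e; rewrite ipC.
move=> e; have -> : ip (v : rh L) (imul (v : rh L)) = 0 by lra.
by rewrite !mulr0 addr0 add0r; ring.
Qed.

Lemma N_lin (a : R[i]) x y : N x -> N y -> N (fun v => a *: x v + y v).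
Proof.
move=> hx hy; have [Mx fx] := hx; have [My fy] := hy.
pose k : R := cRe a ^+ 2 + cIm a ^+ 2.
have k0 : 0 <= k by rewrite addr_ge0 ?sqr_ge0.
pose P := ((2 * k)%:C \*: (adj x \o x)) \+ ((2 : R)%:C \*: (adj y \o y)).
have k2 : 0 <= 2 * k by rewrite mulr_ge0.
have p1 := pp_scale k2 (psd_sq Mx); have p2 := pp_scale (ler0n R 2) (psd_sq My).
apply: (@N_dom _ P); first exact: vn_lin.
- exact: pp_add.
- have -> : phi P = ((2 * k)%:E * phi (adj x \o x) + 2%:E * phi (adj y \o y))%E.
    by rewrite phi_add // phi_scale ?phi_scale //; exact: psd_sq.
  by rewrite ltey_eq fin_numD !fin_numM ?N_fin.
move=> v.
have -> : ip (P v : rh H) v = 2 * k * ip (adj x (x v) : rh H) v + 2 * ip (adj y (y v) : rh H) v.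
  by rewrite -!ipZl -ipDl.
rewrite !sq_quad // -mulrA -nrm_cscale.
have := ip_ge0 (a *: x v - y v : rh H); rewrite !ipE (ipC (y v : rh H)).
set A := ip _ _; lra.
Qed.

Lemma N_left x y : M x -> N y -> N (x \o y).
Proof.
move=> Mx hy; have [My fy] := hy; have [c c0 hc] := bop_bound (vn_cop vM Mx).1.
have c2 : 0 <= c ^+ 2 by rewrite sqr_ge0.
apply: (@N_dom _ ((c ^+ 2)%:C \*: (adj y \o y))); first exact: vn_comp.
- exact: pp_scale c2 (psd_sq My).
- have -> : phi ((c ^+ 2)%:C \*: (adj y \o y)) = ((c ^+ 2)%:E * phi (adj y \o y))%E.
    by rewrite phi_scale //; exact: psd_sq.
  by rewrite ltey_eq fin_numM ?N_fin.
move=> v.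
have -> : ip (((c ^+ 2)%:C \*: (adj y \o y)) v : rh H) v = c ^+ 2 * ip (adj y (y v) : rh H) v.
  by rewrite -ipZl.
rewrite sq_quad // -!nrm_sq -exprMn ler_pXn2r ?nnegrE ?mulr_ge0 ?nrm_ge0 ?(ltW c0) //.
exact: hc.
Qed.

Lemma Lambda_lin (a : R[i]) x y : N x -> N y -> Lambda (fun v => a *: x v + y v) = a *: Lambda x + Lambda y.
Proof. by have [h _ _ _] := gnsM; exact: h. Qed.

Lemma Lambda_nrm x : N x -> ip (Lm x) (Lm x) = fine (phi (adj x \o x)).
Proof.
move=> hx; have [_ h _ _] := gnsM; have := h _ hx; rewrite rh_norm -rmorphXn nrm_sq.
by move/(congr1 (@complex.Re R)).
Qed.

Lemma Lambda_dense v : clos ((Lambda @` N) : set (rh K)) v.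
Proof. by have [_ _ h _] := gnsM; exact: ((denseE _).1 h). Qed.

Lemma rho_cop x : M x -> cop (rho x).
Proof. by have [_ _ _ h] := gnsM; move=> /h [/bounded_opsE]. Qed.

Lemma rho_Lambda x y : M x -> N y -> rho x (Lambda y) = Lambda (x \o y).
Proof. by have [_ _ _ h] := gnsM; move=> /h [_]; exact. Qed.

Lemma Lambda_mono x y : N x -> N y ->
  (forall v : rh H, ip (x v : rh H) (x v) <= ip (y v : rh H) (y v)) -> ip (Lm x) (Lm x) <= ip (Lm y) (Lm y).
Proof.
move=> hx hy h; rewrite !Lambda_nrm // fine_le ?N_fin //; have [[Mx _] [My _]] := (hx, hy).
by apply: phi_mono; [exact: psd_sq|exact: psd_sq|move=> v; rewrite /= !sq_quad].
Qed.

Lemma pp_eq x y : positive_part M x -> positive_part M y ->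
  (forall v : rh H, ip (x v : rh H) v = ip (y v : rh H) v) -> x = y.
Proof.
move=> [Mx /positive_opE [cx sx _]] [My /positive_opE [cy sy _]] h.
by apply: le_op_anti; apply: le_opI => // v; rewrite h.
Qed.

(** Additivity of the weight transports identities between sums of squares. Fed with polarized
    squares, this replaces a formula for inner products, as [gns] only provides norms. *)
Lemma Lambda_quad x y z t : N x -> N y -> N z -> N t ->
  (forall v : rh H, ip (x v : rh H) (x v) + ip (y v : rh H) (y v) =
                    ip (z v : rh H) (z v) + ip (t v : rh H) (t v)) ->
  ip (Lm x) (Lm x) + ip (Lm y) (Lm y) = ip (Lm z) (Lm z) + ip (Lm t) (Lm t).
Proof.
move=> hx hy hz ht h; rewrite !Lambda_nrm // -!fineD ?N_fin //.
have [[Mx _] [My _]] := (hx, hy); have [[Mz _] [Mt _]] := (hz, ht).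
rewrite -!phi_add; try exact: psd_sq.
congr (fine (phi _)); apply: pp_eq; try by apply: pp_add; exact: psd_sq.
by move=> v; rewrite /= !ipDl !sq_quad.
Qed.

Lemma Lambda_D x y : N x -> N y -> (Lm (fun v => x v + y v)) = (Lm x) + (Lm y).
Proof.
move=> hx hy; rewrite -[in RHS](scale1r (Lambda x)) -Lambda_lin //.
by congr Lambda; apply/funext => v; rewrite scale1r.
Qed.

Lemma N_D x y : N x -> N y -> N (fun v => x v + y v).
Proof.
move=> hx hy; have := N_lin 1 hx hy; rewrite (_ : (fun v => _) = fun v => x v + y v) //.
by apply/funext => v; rewrite scale1r.
Qed.

Lemma N_B x y : N x -> N y -> N (fun v => x v - y v).
Proof.
move=> hx hy; have := N_lin (-1) hy hx; rewrite (_ : (fun v => _) = fun v => x v - y v) //.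
by apply/funext => v; rewrite scaleN1r addrC.
Qed.

Lemma Lambda_B x y : N x -> N y -> (Lm (fun v => x v - y v)) = (Lm x) - (Lm y).
Proof.
move=> hx hy; rewrite -[- (Lm y)](scaleN1r (Lambda y)) addrC -Lambda_lin //.
by congr Lambda; apply/funext => v; rewrite scaleN1r addrC.
Qed.

(** Polarization: |x y + z|^2 + |y - x^* z|^2 = |x y - z|^2 + |y + x^* z|^2 holds for vectors of H,
    and [Lambda_quad] carries it to K. *)
Lemma rho_adj x : M x -> isadj (rho x : rh K -> rh K) (rho (adj x)).
Proof.
move=> Mx; have Mx' := vn_adj vM Mx; have xx := vn_adjP vM Mx.
have key y z : N y -> N z -> ip (rho x (Lambda y) : rh K) (Lm z) = ip (Lm y) (rho (adj x) (Lambda z)).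
  move=> hy hz; rewrite !rho_Lambda //.
  have hxy := N_left Mx hy; have hxz := N_left Mx' hz.
  have := Lambda_quad (N_D hxy hz) (N_B hy hxz) (N_B hxy hz) (N_D hy hxz).
  rewrite !Lambda_B // !Lambda_D //.
  have e (v : rh H) : ip (x (y v) : rh H) (z v) = ip (y v : rh H) (adj x (z v)) by rewrite xx.
  move=> h; have {h} : ip (Lm (x \o y) + Lm z) (Lm (x \o y) + Lm z) +
      ip (Lm y - Lm (adj x \o z)) (Lm y - Lm (adj x \o z)) =
      ip (Lm (x \o y) - Lm z) (Lm (x \o y) - Lm z) +
      ip (Lm y + Lm (adj x \o z)) (Lm y + Lm (adj x \o z)).
    apply: h => v; rewrite !ipE /= (ipC (z v : rh H)) e (ipC (adj x (z v) : rh H)); ring.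
  by rewrite !ipE (ipC (Lm z)) (ipC (Lm (adj x \o z))); lra.
have [bx _] := rho_cop Mx; have [bx' _] := rho_cop Mx'.
have [r br xr] := adj_exists bx.
suff -> : (rho (adj x) : rh K -> rh K) = r by [].
apply/funext; apply: (bop_eq_dense bx' br Lambda_dense) => _ [z hz <-].
apply/eqP; rewrite -subr_eq0; apply/eqP; apply: (orth_dense Lambda_dense) => _ [y hy <-].
by rewrite ipBl ipC -key // xr [ip (r _) _]ipC subrr.
Qed.

Lemma rho_ext x (f : rh K -> rh K) : M x -> bop f ->
  (forall y, N y -> f (Lambda y) = Lambda (x \o y)) -> rho x = f.
Proof.
move=> Mx bf h; have [bx _] := rho_cop Mx.
apply/funext; apply: (bop_eq_dense bx bf Lambda_dense) => _ [z hz <-].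
by rewrite h // rho_Lambda.
Qed.

Lemma rho_comp x y : M x -> M y -> rho (x \o y) = rho x \o rho y.
Proof.
move=> Mx My; apply: rho_ext; first exact: vn_comp.
  exact: (bop_comp (cop_bop (rho_cop Mx)) (cop_bop (rho_cop My))).
by move=> z hz; rewrite /= !rho_Lambda //; exact: N_left.
Qed.

Lemma rho_id : rho id = id.
Proof. by apply: rho_ext => //; [exact: vn_id|exact: bop_id]. Qed.

Lemma rho_lin (a : R[i]) x y : M x -> M y ->
  rho (fun v => a *: x v + y v) = fun v => a *: rho x v + rho y v.
Proof.
move=> Mx My; apply: rho_ext; first exact: vn_lin.
  exact: (cop_bop (cop_lin a (rho_cop Mx) (rho_cop My))).
move=> z hz; rewrite !rho_Lambda // -Lambda_lin //; exact: N_left.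
Qed.

Lemma rho_pos x : positive_part M x -> positive_op (rho x).
Proof.
move=> [Mx /positive_opE [cx sx px]]; have cr := rho_cop Mx.
have sr : symm (rho x : rh K -> rh K).
  by have := rho_adj Mx; rewrite (adj_eq cx sx).
apply/positive_opE; split=> // v.
have b0 : bop (fun _ : rh K => 0 : rh K) := bop_cst0 _ _.
rewrite -[leLHS](ip0l v) -[in leLHS]/((fun _ : rh K => 0 : rh K) v); move: v.
apply: (quad_dense b0 (cop_bop cr) Lambda_dense) => _ [y hy <-].
rewrite ip0l rho_Lambda //; have hxy := N_left Mx hy.
have := Lambda_mono (N_B hxy hy) (N_D hxy hy).
rewrite Lambda_B // Lambda_D // => h.
have : ip (Lm (x \o y) - Lm y) (Lm (x \o y) - Lm y) <= ip (Lm (x \o y) + Lm y) (Lm (x \o y) + Lm y).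
  by apply: h => v; rewrite !ipE /= (ipC (y v : rh H)); have := px (y v); lra.
by rewrite !ipE (ipC (Lm y)); lra.
Qed.

Lemma rho_mono x y : M x -> M y -> le_op x y -> le_op (rho x) (rho y).
Proof.
move=> Mx My h; have p : positive_part M (fun v => -1 *: x v + y v).
  split; first exact: vn_lin.
  by rewrite (_ : (fun v => _) = y \- x) //; apply/funext => v; rewrite scaleN1r addrC.
have := rho_pos p; rewrite rho_lin // /le_op (_ : (fun v => _) = rho y \- rho x) //.
by apply/funext => v; rewrite scaleN1r addrC.
Qed.

Lemma compress_pp x y : positive_part M x -> M y -> positive_part M (adj y \o (x \o y)).
Proof.
move=> [Mx /positive_opE [cx sx px]] My; have yy := vn_adjP vM My; have My' := vn_adj vM My.
split; first by apply: vn_comp => //; exact: vn_comp.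
apply/positive_opE; split.
- by apply: cop_comp; [exact: vn_cop My'|apply: cop_comp => //; exact: vn_cop My].
- by move=> v w; rewrite /= (isadjC yy) sx yy.
- by move=> v; rewrite /= (isadjC yy).
Qed.

(** With p = x y + y and m = x y - y one has p^* p = m^* m + 4 y^* x y, as x is self-adjoint. *)
Lemma phi_compress x y : positive_part M x -> N y ->
  (phi (adj y \o (x \o y)) < +oo)%E /\
  fine (phi (adj y \o (x \o y))) = ip (rho x (Lambda y) : rh K) (Lm y).
Proof.
move=> px hy; have [My fy] := hy; have [Mx /positive_opE [cx sx pox]] := px.
have pc := compress_pp px My; have yy := vn_adjP vM My.
have hxy := N_left Mx hy; have hp := N_D hxy hy; have hm := N_B hxy hy.
pose p : H -> H := fun v => (x \o y) v + y v; pose m : H -> H := fun v => (x \o y) v - y v.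
have [Mp Mm] := (N_M hp : M p, N_M hm : M m).
have qc (v : rh H) : ip ((adj y \o (x \o y)) v : rh H) v = ip (x (y v) : rh H) (y v).
  by rewrite /= (isadjC yy).
have fc : (phi (adj y \o (x \o y)) < +oo)%E.
  apply: le_lt_trans (hp.2); apply: phi_mono => //; first exact: psd_sq.
  move=> v; rewrite qc [leRHS]sq_quad // !ipE /= (ipC (y v : rh H)); have := pox (y v).
  have := ip_ge0 (x (y v) : rh H); have := ip_ge0 (y v : rh H); lra.
split=> //.
have e : phi (adj p \o p) = (phi (adj m \o m) + 4%:E * phi (adj y \o (x \o y)))%E.
  have p4 := pp_scale (ler0n R 4) pc.
  rewrite -phi_scale // -phi_add //; last exact: psd_sq.
  congr phi; apply: pp_eq; [exact: psd_sq|apply: pp_add => //; exact: psd_sq|move=> v].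
  have -> : ip (((adj m \o m) \+ (4%:C \*: (adj y \o (x \o y)))) v : rh H) v =
    ip (adj m (m v) : rh H) v + 4 * ip ((adj y \o (x \o y)) v : rh H) v by rewrite -ipZl -ipDl.
  rewrite qc [LHS]sq_quad // sq_quad // !ipE /= (ipC (y v : rh H)); ring.
have := congr1 fine e; rewrite fineD ?fineM ?fin_numM ?N_fin //; last 2 first.
- by rewrite ge0_fin_numE // phi_ge0.
- by rewrite ge0_fin_numE // phi_ge0.
rewrite -!Lambda_nrm // Lambda_B // Lambda_D // rho_Lambda // !ipE (ipC (Lm y)) /=; lra.
Qed.

(** By [phi_compress] the form of rho (x n) at Lambda y is phi (y^* (x n) y), to which the normality
    of phi applies. The strong limit given by [vigier] is thus identified on a dense set. *)
Lemma rho_normal (x : nat -> H -> H) s : (forall n, positive_part M (x n)) ->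
  (forall n, le_op (x n) (x n.+1)) -> M s -> (forall v : rh H, cv (fun n => x n v : rh H) (s v)) ->
  forall v : rh K, cv (fun n => rho (x n) v : rh K) (rho s v).
Proof.
move=> px ix Ms lx.
have Mx n : M (x n) by case: (px n).
have cs := vn_cop vM Ms.
have [_ [ub _]] := seq_lub (fun n => (px n).2) ix cs lx.
have prx n := rho_pos (px n).
have crx n : cop (rho (x n)) := rho_cop (Mx n).
have lers n : le_op (rho (x n)) (rho s).
  by apply: rho_mono => //; apply: ub; exists n.
have pps : positive_part M s.
  split=> //; have /positive_opE [_ sd pd] := ub _ (ex_intro2 _ _ 0%N I erefl).
  have /positive_opE [c0 s0 p0] := (px 0%N).2.
  apply/positive_opE; split=> //.
    by move=> v w; have := sd v w; rewrite ipBl ipBr s0 => /addIr.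
  by move=> v; have := pd v; rewrite ipBl; have := p0 v; lra.
have /positive_opE [crs srs _] := rho_pos pps.
have [c c0 hc] := bop_bound crs.1.
have [l [bl sl hl]] : exists l : rh K -> rh K, [/\ bop l, symm l & forall v, cv (fun n => rho (x n) v : rh K) (l v)].
  apply: (@vigier _ _ _ c) => [|n|n|n v|v|n v].
  - exact: ltW.
  - by have [] := crx n.
  - by have /positive_opE [] := prx n.
  - by apply: le_opP; exact: rho_mono.
  - by have /positive_opE [_ _] := prx 0%N; exact.
  - apply: le_trans (le_opP (lers n) v) _; apply: le_trans (ip_le _ _) _.
    by rewrite -nrm_sq expr2 mulrA ler_wpM2r ?nrm_ge0.
suff e : rho s = l by rewrite e.
have q y : N y -> ip (l (Lambda y)) (Lm y) = ip (rho s (Lambda y) : rh K) (Lm y).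
  move=> hy; have My := N_M hy; have yy := vn_adjP vM My.
  pose w n := adj y \o (x n \o y).
  have pw n : positive_part M (w n) := compress_pp (px n) My.
  have cw : cop (adj y \o (s \o y)).
    by apply: cop_comp; [exact: vn_cop vM _ (vn_adj vM My)|apply: cop_comp => //; exact: N_cop].
  have iw n : le_op (w n) (w n.+1).
    have /positive_opE [c1 s1 _] := (pw n).2; have /positive_opE [c2 s2 _] := (pw n.+1).2.
    by apply: le_opI => // v; rewrite /w /= !(isadjC yy); exact: le_opP.
  have lw (v : rh H) : cv (fun n => w n v : rh H) ((adj y \o (s \o y)) v).
    exact: (bop_cv (cop_bop (vn_cop vM (vn_adj vM My))) (lx (y v))).
  have [dw lubw] := seq_lub (fun n => (pw n).2) iw cw lw.
  have [_ _ nphi _] := wphi.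
  have := nphi _ _ _ dw lubw; rewrite image_comp => hsup.
  have hs := phi_compress pps hy.
  have h1 := cv_ip (w := Lm y) (hl (Lm y)).
  apply: cvgR_unique h1 _.
  have e1 : (fun n => ip (rho (x n) (Lm y) : rh K) (Lm y)) = fine \o (phi \o w).
    by apply/funext => n; rewrite -(phi_compress (px n) hy).2.
  rewrite e1 -hs.2; apply: fine_cvg; rewrite fineK; last by rewrite ge0_fin_numE ?phi_ge0 // ; [exact: hs.1|exact: compress_pp].
  rewrite hsup; last by move=> _ [n _ <-].
  apply: ereal_nondecreasing_cvgn => m n hmn; apply: phi_mono => // v.
  move: hmn => /subnK <-; elim: (n - m)%N => // k ih; apply: le_trans ih _; rewrite addSn.
  exact: le_opP.
have cl : cop (l : K -> K).
  split=> // v; have h1 := bop_cv (bop_imul K) (hl v); have h2 := hl (imul v).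
  apply: cv_unique h2 _; rewrite (_ : (fun n => _) = fun n => imul (rho (x n) v : rh K)) //.
  by apply/funext => n; have [_ ->] := crx n.
by apply: le_op_anti; apply: le_opI => //; apply: (quad_dense _ _ Lambda_dense) => //;
  try exact: cop_bop crs; move=> _ [y hy <-]; rewrite q.
Qed.

End GNS.

(** * Intertwiners of a factor with its GNS representation *)

Section Resolvents.
Context {R : realType} {H : hilbert R} {M : set (H -> H)} (vM : von_neumann_algebra M).
Implicit Types x y z : H -> H.

Lemma resolvent (S : rh H -> rh H) : M S -> symm S -> (forall v, 0 <= ip (S v) v) ->
  exists r : rh H -> rh H, [/\ M r, symm r, (forall v, r v + S (r v) = v), (forall v, 0 <= ip (r v) v) &
    forall v, ip v v - ip (S v) v <= ip (r v) v <= ip v v].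
Proof.
move=> MS sS pS; have [bS iS] := vn_cop vM MS.
have [r [br r1 r2]] := inv_one_add bS sS pS; exists r.
have com (t : rh H -> rh H) : bop t -> (forall v, t (S v) = S (t v)) -> forall v, r (t v) = t (r v).
  by move=> bt tS v; rewrite -{1}(r1 v) (bopD bt) tS r2.
split=> //.
- apply: (vn_mem vM); last first.
    move=> t ht v; have [bt _] := commutant_cop ht; apply: (com t bt) => w.
    exact: commutantE ht MS.
  by split=> // v; apply: (com _ (bop_imul H)) => w; rewrite iS.
- by move=> v w; rewrite -[in LHS](r1 w) -[in RHS](r1 v) ipDr ipDl sS.
- by move=> v; move: (r v) (r1 v) => u <-; rewrite ipDr addr_ge0 ?ip_ge0 // ipC.
move=> v; move: (r v) (r1 v) => u <-; rewrite (bopD bS) !ipE.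
have := pS u; have := pS (S u); have := ip_ge0 (S u).
rewrite (ipC u (S u)) (sS (S u) u); move=> h1 h2 h3; apply/andP; split; lra.
Qed.

(** With u = r v and u' = r' v, it follows from positivity of 1 + S at u - u' and from S <= S' at
    u'. *)
Lemma resolvent_mono (S S' r r' : rh H -> rh H) : symm S -> bop S ->
  (forall v, ip (S v) v <= ip (S' v) v) -> (forall v, 0 <= ip (S v) v) ->
  (forall v, r v + S (r v) = v) -> (forall v, r' v + S' (r' v) = v) ->
  forall v, ip (r' v) v <= ip (r v) v.
Proof.
move=> sS bS SS' pS h h' v; move: (r v) (r' v) (h v) (h' v) => u u' hu hu'.
have e1 : ip u v = ip u u + ip (S u) u by rewrite -hu ipDr (ipC u (S u)).
have e2 : ip u' v = ip u u' + ip (S u) u' by rewrite -hu ipDr !(ipC u').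
have e3 : ip u' v = ip u' u' + ip (S' u') u' by rewrite -hu' ipDr (ipC u' (S' u')).
have h4 := SS' u'; have := pS (u - u'); have := ip_ge0 (u - u').
rewrite (bopB bS) !ipE (ipC u' u) (sS u' u) (ipC u' (S u)); move: e1 e2 e3 h4; lra.
Qed.

(** [w m] plays the role of (1 + sum_(k >= m) b_k^2)^-1: the series may diverge, but the resolvents
    of its partial sums decrease to a limit. Smallness of the tails at the dense points d j makes
    [w m] increase to 1, and keeping the single term b_m^2 gives the upper bound [r m]. *)
Lemma resolvent_seq (b : nat -> H -> H) (d : nat -> rh H) :
  (forall k, M (b k)) -> (forall k, symm (b k : rh H -> rh H)) -> (forall v, clos (range d) v) ->
  (forall j k, (j <= k)%N -> ip (b k (d j) : rh H) (b k (d j)) <= 2^-1 ^+ k) ->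
  exists w r : nat -> H -> H, [/\ forall m, positive_part M (w m), forall m, le_op (w m) (w m.+1),
    forall v : rh H, cv (fun m => w m v : rh H) v &
    forall m, [/\ M (r m), le_op (w m) (r m) & forall v : rh H, (r m v : rh H) + b m (b m (r m v)) = v]].
Proof.
move=> Mb sb dd hb.
have bb k : bop (b k : rh H -> rh H) := cop_bop (vn_cop vM (Mb k)).
pose T m k : rh H -> rh H := fun v => if (m <= k)%N then b k (b k v) else 0.
pose S := fix S (m n : nat) : rh H -> rh H := if n is n'.+1 then fun v => S m n' v + T m n' v else fun=> 0.
have pT m k v : 0 <= ip (T m k v) v by rewrite /T; case: ifP => _; rewrite ?ip0l // sb ip_ge0.
have MZ : M (fun v : rh H => 0 : rh H).
  have := vn_lin vM (-1) (vn_id vM) (vn_id vM); rewrite (_ : (fun v => _) = fun v : rh H => 0 : rh H) //.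
  by apply/funext => v; rewrite scaleN1r addNr.
have MT m k : M (T m k).
  rewrite /T; case: (m <= k)%N => //; exact: (vn_comp vM (Mb k) (Mb k)).
have MS m n : M (S m n).
  elim: n => // n ih; have := vn_lin vM 1 ih (MT m n); rewrite (_ : (fun v => _) = S m n.+1) //.
  by apply/funext => v; rewrite scale1r.
have sS m n : symm (S m n).
  elim: n => [|n ih] v w /=; first by rewrite ip0l ip0r.
  rewrite ipDl ipDr ih /T; case: ifP => _; last by rewrite ip0l ip0r.
  by rewrite !sb.
have pS m n v : 0 <= ip (S m n v) v.
  by elim: n => [|n ih] /=; rewrite ?ip0l // ipDl addr_ge0.
have bS m n : bop (S m n) := cop_bop (vn_cop vM (MS m n)).
have mono1 m n v : ip (S m n v) v <= ip (S m n.+1 v) v by rewrite /= ipDl lerDl.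
have mono2 m n v : ip (S m.+1 n v) v <= ip (S m n v) v.
  elim: n => // n ih; rewrite /= !ipDl lerD // /T.
  case: ifP => h1; first by rewrite (ltnW h1).
  by rewrite ip0l; case: ifP => _; rewrite ?ip0l // sb ip_ge0.
have [rr hrr] := choice (fun p : nat * nat => resolvent (MS p.1 p.2) (@sS p.1 p.2) (pS p.1 p.2)).
pose r m n := rr (m, n).
have Mr m n : M (r m n) by have [] := hrr (m, n).
have sr m n : symm (r m n) by have [] := hrr (m, n).
have rE m n v : r m n v + S m n (r m n v) = v by have [_ _ h _ _] := hrr (m, n); exact: h.
have pr m n v : 0 <= ip (r m n v) v by have [_ _ _ h _] := hrr (m, n); exact: h.
have rb m n v : ip v v - ip (S m n v) v <= ip (r m n v) v <= ip v v by have [_ _ _ _ h] := hrr (m, n); exact: h.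
have br m n : bop (r m n) := cop_bop (vn_cop vM (Mr m n)).
have dec m n v : ip (r m n.+1 v) v <= ip (r m n v) v.
  exact: (resolvent_mono (@sS m n) (bS m n) (mono1 m n) (pS m n) (rE m n) (rE m n.+1)).
have inc m n v : ip (r m n v) v <= ip (r m.+1 n v) v.
  exact: (resolvent_mono (@sS m.+1 n) (bS m.+1 n) (mono2 m n) (pS m.+1 n) (rE m.+1 n) (rE m n)).
have lim m : exists l : rh H -> rh H, [/\ bop l, symm l & forall v, cv (fun n => r m n v) (l v)].
  have [|n|n|n v|v|n v|l [bl sl hl]] := @vigier _ (rh H) (fun n v => v - r m n v) 1.
  - by [].
  - exact: bop_sub (bop_id _) (br m n).
  - by move=> v w; rewrite ipBl ipBr sr.
  - by rewrite !ipBl lerD2l lerN2.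
  - by rewrite ipBl subr_ge0; have /andP [] := rb m 0%N v.
  - by rewrite ipBl mul1r lerBlDr lerDl.
  exists (fun v => v - l v); split; first exact: bop_sub (bop_id _) bl.
    by move=> v w; rewrite ipBl ipBr sl.
  move=> v; have := cvB (cv_cst v) (hl v).
  by under [fun n => _]eq_fun do rewrite subKr.
have [w hw] := choice lim.
have lw m v : cv (fun n => r m n v) (w m v) by have [_ _] := hw m; exact.
have bw m : bop (w m) by have [] := hw m.
have sw m : symm (w m) by have [] := hw m.
have Mw m : M (w m) := vn_limit vM (Mr m) (bw m) (lw m).
have cw m := vn_cop vM (Mw m).
have wpos m v : 0 <= ip (w m v) v.
  by apply: (rcv_le (N := 0)) (cvg_cst _) (cv_ip (w := v) (lw m v)) _ => n _; exact: pr.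
have w1 m v : ip (w m v) v <= ip v v.
  apply: (rcv_le (N := 0)) (cv_ip (w := v) (lw m v)) (cvg_cst _) _ => n _.
  by have /andP [] := rb m n v.
have winc m v : ip (w m v) v <= ip (w m.+1 v) v.
  by apply: (rcv_le (N := 0)) (cv_ip (w := v) (lw m v)) (cv_ip (w := v) (lw m.+1 v)) _ => n _; exact: inc.
have wr m n v : ip (w m v) v <= ip (r m n v) v.
  apply: (rcv_le (N := n)) (cv_ip (w := v) (lw m v)) (cvg_cst _) _ => k hk.
  by move: hk => /subnK <-; elim: (k - n)%N => // i ih; apply: le_trans ih; rewrite addSn.
have Sd m n j : (j <= m)%N -> ip (S m n (d j)) (d j) <= 2 * 2^-1 ^+ m.
  move=> jm; have e0 k : (0 : R) <= 2^-1 ^+ k by rewrite exprn_ge0.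
  suff : ip (S m n (d j)) (d j) <= if (m <= n)%N then 2 * 2^-1 ^+ m - 2 * 2^-1 ^+ n else 0.
    by move/le_trans; apply; case: ifP => _; have := e0 n; have := e0 m; lra.
  elim: n => [|n ih].
    by rewrite /= ip0l; case: ifP => //; rewrite leqn0 => /eqP ->; rewrite subrr.
  rewrite /= ipDl /T; have [h|h] := leqP m n.
    rewrite h in ih; rewrite leqW // sb.
    have := hb _ _ (leq_trans jm h); rewrite exprS; move: ih; lra.
  rewrite leqNgt h /= in ih; rewrite ip0l addr0; apply: le_trans ih _; case: ifP => // h2.
  by have -> : m = n.+1 by [apply/eqP; rewrite eqn_leq h2]; rewrite subrr.
exists w, (fun m => r m m.+1); split=> //.
- by move=> m; split=> //; apply/positive_opE; split.
- by move=> m; apply: le_opI => //; exact: winc.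
- have [|m|m|m v|v|m v|l [bl sl hl]] := @vigier _ (rh H) w 1 => //.
    by rewrite mul1r.
  suff e : (l : H -> H) = id by move=> v; have := hl v; rewrite e.
  have cl : cop (l : H -> H) by exact: (vn_cop vM (vn_limit vM Mw bl hl)).
  apply: le_op_anti; apply: le_opI => //; try exact: cop_id.
    by move=> v; apply: (rcv_le (N := 0)) (cv_ip (w := v) (hl v)) (cvg_cst _) _ => n _.
  apply: (quad_dense (bop_id _) bl dd) => _ [j _ <-].
  have h2 : (fun n => ip (d j) (d j) - 2 * 2^-1 ^+ n) @ \oo --> ip (d j) (d j) - 2 * 0.
    apply: cvgB; first exact: cvg_cst.
    by apply: rcvZ; apply: cvg_expr; rewrite ger0_norm ?invr_ge0 // invf_lt1 // ltr1n.
  rewrite mulr0 subr0 in h2.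
  apply: (rcv_le (N := j)) h2 (cv_ip (w := d j) (hl (d j))) _ => n hn.
  apply: (rcv_le (N := 0)) (cvg_cst _) (cv_ip (w := d j) (lw n (d j))) _ => k _.
  by have /andP [h3 _] := rb n k (d j); apply: le_trans h3; rewrite lerD2l lerN2 Sd.
move=> m; split=> //; first by apply: le_opI => //; exact: (vn_cop vM (Mr m m.+1)).
move=> v; have := rE m m.+1 v; have S0 k : (k <= m)%N -> S m k = fun=> 0.
  elim: k => // k ih hk; apply/funext => u; rewrite /= ih ?(ltnW hk) // /T leqNgt hk addr0 //.
by rewrite /= S0 // /T leqnn add0r.
Qed.

End Resolvents.

(** * Invariant subspaces, intertwiners, induced operators *)

Section Projections.
Context {R : realType}.
Implicit Types V W : rhilb R.

Lemma projection_op V (S : set V) : lsub S -> clos S `<=` S ->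
  exists P : V -> V, [/\ bop P, symm P, forall v, S (P v), forall v, S v -> P v = v &
    forall v s, S s -> ip (v - P v) s = 0].
Proof.
move=> hS cS; have ex v : exists p, S p /\ forall s, S s -> ip (v - p) s = 0.
  by have [p h1 h2] := projection hS cS v; exists p.
have [P hP] := choice ex.
have SP v : S (P v) by case: (hP v).
have oP v s : S s -> ip (v - P v) s = 0 by case: (hP v) => _; exact.
have uniq v p : S p -> (forall s, S s -> ip (v - p) s = 0) -> P v = p.
  move=> Sp op; apply/eqP; rewrite -subr_eq0; apply/eqP/ip_eq0.
  have Sd : S (P v - p) by apply: lsubB.
  have := oP v _ Sd; have := op _ Sd; rewrite !ipBl; lra.
exists P; split=> //.
- split=> [a u v|].
    apply: uniq => [|s Ss]; first exact: hS.2.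
    have h1 := oP u _ Ss; have h2 := oP v _ Ss; rewrite opprD addrACA -scalerBr ipDl ipZl h1 h2.
    by rewrite mulr0 addr0.
  exists 1 => v; rewrite mul1r; apply: sq_le_mul; rewrite ?nrm_ge0 // nrm_sq.
  have := oP v _ (SP v); rewrite ipBl => h; apply: le_trans (ip_le v (P v)); lra.
- move=> v w; have := oP v _ (SP w); have := oP w _ (SP v); rewrite !ipBl (ipC w) (ipC (P w)); lra.
- by move=> v Sv; apply: uniq => // s Ss; rewrite subrr ip0l.
Qed.

Lemma projection_comm V (S : set V) (P T T' : V -> V) : lsub S -> bop T -> isadj T T' ->
  (forall v, S (P v)) -> (forall v s, S s -> ip (v - P v) s = 0) ->
  (forall v, S v -> S (T v)) -> (forall v, S v -> S (T' v)) -> forall v, P (T v) = T (P v).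
Proof.
move=> hS bT TT' SP oP ST ST' v; apply/eqP; rewrite -subr_eq0; apply/eqP/ip_eq0.
have Sd : S (P (T v) - T (P v)) by apply: lsubB => //; exact: ST.
have h1 := oP (T v) _ Sd; have h2 := oP v _ (ST' _ Sd).
by rewrite -TT' (bopB bT) in h2; move: h1 h2; rewrite !ipBl; lra.
Qed.

Lemma orth_lsub V (S : set V) : lsub [set v : V | forall s, S s -> ip v s = 0].
Proof.
split=> [s _|a u v hu hv s Ss]; first exact: ip0l.
by rewrite ipDl ipZl hu // hv // mulr0 addr0.
Qed.

Lemma orth_closed V (S : set V) : clos [set v : V | forall s, S s -> ip v s = 0] `<=`
  [set v : V | forall s, S s -> ip v s = 0].
Proof.
move=> v /clos_seq [u hu cu] s Ss; apply: cvgR_unique (cv_ip (w := s) cu) _.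
by under eq_fun do rewrite hu //; exact: cvg_cst.
Qed.

(* If (0, zeta) were not in the closure of the diagonal orbit of (eta, zeta), a corner of the
   projection onto this closure would be an intertwiner that does not kill zeta. *)
Lemma intertwiner_density V1 V2 (X : Type) (D1 : X -> V1 -> V1) (D2 : X -> V2 -> V2) st e eta zeta :
  (forall s, bop (D1 s)) -> (forall s, bop (D2 s)) ->
  (forall s, isadj (D1 s) (D1 (st s))) -> (forall s, isadj (D2 s) (D2 (st s))) ->
  D1 e eta = eta -> D2 e zeta = zeta ->
  let L : set (prodH V1 V2) := [set p | exists s, p = (D1 s eta, D2 s zeta)] in
  lsub L -> (forall s p, L p -> L (D1 s p.1, D2 s p.2)) ->
  (forall v : V2 -> V1, bop v -> (forall s k, v (D2 s k) = D1 s (v k)) -> v zeta = 0) ->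
  clos L (0, zeta).
Proof.
move=> b1 b2 a1 a2 e1 e2 L hL iL kill.
have hS := lsub_clos hL; have cS := @clos_idem _ _ L.
have [P [bP sP SP fP oP]] := projection_op hS cS.
pose D s : prodH V1 V2 -> prodH V1 V2 := fun p => (D1 s p.1, D2 s p.2).
have bD s : bop (D s).
  split=> [a u v|]; first by rewrite /D /= (bopL (b1 s)) (bopL (b2 s)).
  have [c c0 hc] := bop_bound (b1 s); have [d d0 hd] := bop_bound (b2 s).
  exists (c + d) => v; apply: le_trans (nrm_prod _) _; rewrite mulrDl; apply: lerD.
    by apply: le_trans (hc _) _; rewrite ler_pM2l // nrm_fst.
  by apply: le_trans (hd _) _; rewrite ler_pM2l // nrm_snd.
have aD s : isadj (D s) (D (st s)) by move=> u v; rewrite !prodHE /= a1 a2.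
have cD s p : clos L p -> clos L (D s p).
  move=> /clos_seq [u hu cu]; apply/clos_seq; exists (fun n => D s (u n)); last exact: bop_cv.
  by move=> n; exact: iL.
have PD s p : P (D s p) = D s (P p).
  by apply: (projection_comm hS (bD s) (aD s) SP oP) => q; exact: cD.
have D0 s p q : D s (p, q) = (D1 s p, D2 s q) by [].
pose i2 (k : V2) : prodH V1 V2 := (0, k); pose i1 (k : V1) : prodH V1 V2 := (k, 0).
have bi2 : bop i2.
  split=> [a u v|].
    by transitivity ((a *: 0 + 0, a *: u + v) : prodH V1 V2); first by rewrite scaler0 addr0.
  by exists 1 => v; rewrite mul1r; apply: le_nrm; rewrite prodHE /= ip0l add0r.
have Di2 s k : D s (i2 k) = i2 (D2 s k) by rewrite /i2 D0 (bop0 (b1 s)).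
have bf : bop (fun p : prodH V1 V2 => p.1) by split=> //; exists 1 => p; rewrite mul1r nrm_fst.
have bs : bop (fun p : prodH V1 V2 => p.2) by split=> //; exists 1 => p; rewrite mul1r nrm_snd.
pose v k := (P (i2 k)).1; pose t k := (P (i2 k)).2.
have bv : bop v := bop_comp bf (bop_comp bP bi2).
have bt : bop t := bop_comp bs (bop_comp bP bi2).
have vD s k : v (D2 s k) = D1 s (v k) by rewrite /v -Di2 PD.
have tD s k : t (D2 s k) = D2 s (t k) by rewrite /t -Di2 PD.
have v0 : v zeta = 0 := kill v bv vD.
have vt0 : v (t zeta) = 0.
  by apply: (kill (v \o t) (bop_comp bv bt)) => s k /=; rewrite tD vD.
have Lz : clos L (eta, zeta) by apply: sub_clos; exists e; rewrite e1 e2.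
have split_ : (eta, zeta) = i1 eta + i2 zeta :> prodH V1 V2 by transitivity ((eta + 0, 0 + zeta) : prodH V1 V2); first by rewrite addr0 add0r.
have e3 : zeta = (P (i1 eta)).2 + t zeta.
  by have := fP _ Lz; rewrite {1}split_ (bopD bP) => /(congr1 snd).
set y := (P (i1 eta)).2 in e3.
have vy : v y = 0 by have := v0; rewrite e3 (bopD bv) vt0 addr0.
(* Symmetry of P gives |y|^2 = <i1 eta, P (i2 y)> = <eta, v y> = 0. *)
have y0 : y = 0.
  apply: ip_eq0; have := sP (i1 eta) (i2 y); rewrite !prodHE /= ip0r add0r => ->.
  by rewrite -/(v y) vy ip0r ip0l addr0.
have e4 : P (i2 zeta) = i2 zeta.
  by rewrite [LHS]surjective_pairing -/(v zeta) -/(t zeta) v0 [in RHS]e3 y0 add0r.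
by have := SP (i2 zeta); rewrite e4.
Qed.

(* The vectors sum_i w_i (A xi_i), as functions of A. *)
Inductive formal_sum V W (F : (V -> W) -> Prop) : ((V -> V) -> W) -> Prop :=
| formal_zero : formal_sum F (fun=> 0)
| formal_lin a f w xi : F w -> formal_sum F f -> formal_sum F (fun A => f A + a *: w (A xi)).

Definition total V W (F : (V -> W) -> Prop) : Prop :=
  forall u, (forall w v, F w -> ip u (w v) = 0) -> u = 0.

Lemma total_eq V W (F : (V -> W) -> Prop) (f g : W -> W) : total F -> bop f -> bop g ->
  (forall w v, F w -> f (w v) = g (w v)) -> forall u, f u = g u.
Proof.
move=> tF bf bg h u; have bd := bop_sub bf bg; have [d' _ dd'] := adj_exists bd.
have d0 z : d' z = 0.
  by apply: tF => w v Fw; rewrite ipC -dd' h // subrr ip0l.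
by apply/eqP; rewrite -subr_eq0; apply/eqP/ip_eq0; rewrite dd' d0 ip0r.
Qed.

Lemma formal_add V W (F : (V -> W) -> Prop) f g a : formal_sum F f -> formal_sum F g ->
  formal_sum F (fun A => a *: f A + g A).
Proof.
move=> hf; elim: hf g => [g hg|b f' w xi Fw _ ih g hg].
  by rewrite (_ : (fun A => _) = g) //; apply/funext => A; rewrite scaler0 add0r.
have := formal_lin (a * b) xi Fw (ih _ hg); congr (formal_sum F).
by apply/funext => A; rewrite scalerDr scalerA addrAC.
Qed.

(** On formal sums f the operator x has to send f id to f T. Since T^* T is symmetric for the form
    <f A, f B> and its iterates grow at most like c^(2 n), log-convexity yields |f T| <= c |f id|;
    this makes x well defined and bounded at once. *)
Lemma induced_op V W (F : (V -> W) -> Prop) (T : V -> V) c : total F -> (forall w, F w -> bop w) ->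
  bop T -> 0 < c -> (forall v, nrm (T v) <= c * nrm v) -> (forall w1 w2 w1', F w1 -> F w2 -> isadj w1 w1' ->
    forall v, T (w1' (w2 v)) = w1' (w2 (T v))) ->
  exists x : W -> W, [/\ bop x, forall v, nrm (x v) <= c * nrm v & forall w v, F w -> x (w v) = w (T v)].
Proof.
move=> tF bF bT c0 hc hT; have [T' bT' TT'] := adj_exists bT.
have hT' w1 w2 w1' : F w1 -> F w2 -> isadj w1 w1' -> forall v, T' (w1' (w2 v)) = w1' (w2 (T' v)).
  move=> F1 F2 a1 v; have [w2' _ a2] := adj_exists (bF _ F2).
  apply: ip_ext => z; rewrite (isadjC TT') !(isadjC a1) !a2 (isadjC TT').
  by rewrite (hT _ _ _ F2 F1 a2).
(* Commutation with w1^* w2 is what lets T pass from one formal sum to T^* on the other. *)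
have move_ f g A B : formal_sum F f -> formal_sum F g -> ip (f (T \o A)) (g B) = ip (f A) (g (T' \o B)).
  move=> hf hg; elim: hf => [|a f' w xi Fw _ ih]; first by rewrite !ip0l.
  rewrite !ipDl ih !ipZl; congr (_ + _ * _); elim: hg => [|b g' w' xi' Fw' _ ih']; first by rewrite !ip0r.
  rewrite !ipDr ih' !ipZr; congr (_ + _ * _); have [w1 _ a1] := adj_exists (bF _ Fw).
  by rewrite /= !a1 TT' (hT' _ _ _ Fw Fw' a1).
have hc' := adj_bound (ltW c0) hc TT'.
pose Q := T' \o T.
have hQ v : nrm (Q v) <= c ^+ 2 * nrm v.
  by apply: le_trans (hc' _) _; rewrite expr2 -mulrA ler_pM2l.
have bound f : formal_sum F f -> exists C, forall n, nrm (f (iter n Q)) <= C * (c ^+ 2) ^+ n.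
  elim=> [|a f' w xi Fw _ [C hC]]; first by exists 0 => n; rewrite nrm0 mul0r.
  have [d d0 hd] := bop_bound (bF _ Fw); exists (C + `|a| * (d * nrm xi)) => n.
  apply: le_trans (nrmD _ _) _; rewrite mulrDl; apply: lerD => //; rewrite nrmZ -mulrA ler_wpM2l //.
  apply: le_trans (hd _) _; rewrite -mulrA ler_pM2l //; elim: n => [|n ih]; first by rewrite mulr1.
  by rewrite iterS exprS mulrCA; apply: le_trans (hQ _) _; rewrite ler_wpM2l // sqr_ge0.
have main f : formal_sum F f -> nrm (f T) <= c * nrm (f id).
  move=> hf; have [C hC] := bound f hf.
  have sQ A B : ip (f (Q \o A)) (f B) = ip (f A) (f (Q \o B)).
    have -> : ip (f (Q \o A)) (f B) = ip (f (T \o A)) (f (T \o B)).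
      by rewrite ipC [RHS]ipC (move_ f f B (T \o A)).
    by rewrite (move_ f f A (T \o B)).
  have := @logconvex_growth _ (fun n => nrm (f (iter n Q))) C (c ^+ 2) (sqr_ge0 c) _ _ hC.
  have l1 n : 0 <= nrm (f (iter n Q)) by exact: nrm_ge0.
  have l2 n : nrm (f (iter n.+1 Q)) ^+ 2 <= nrm (f (iter n Q)) * nrm (f (iter n.+2 Q)).
    rewrite nrm_sq; have := sQ (iter n Q) (iter n.+1 Q); rewrite -[Q \o iter n Q]/(iter n.+1 Q) => ->.
    exact: ip_le.
  move=> /(_ l1 l2) h; rewrite -(ler_pXn2r (n := 2)) ?nnegrE ?mulr_ge0 ?nrm_ge0 ?(ltW c0) //.
  rewrite nrm_sq; have := move_ f f id T hf hf; rewrite -[T \o id]/T -[T' \o T]/(iter 1 Q) => ->.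
  apply: le_trans (ip_le _ _) _; rewrite exprMn mulrC expr2 [nrm (f id) ^+ 2]expr2 mulrA.
  by rewrite ler_wpM2r ?nrm_ge0.
pose S : set (prodH W W) := [set p | exists f, formal_sum F f /\ p = (f id, f T)].
have [|||x [bx cx hx _]] := @bop_extend _ W W S c (ltW c0).
- split; first by exists (fun=> 0); split=> //; exact: formal_zero.
  by move=> a _ _ [f [hf ->]] [g [hg ->]]; exists (fun A => a *: f A + g A); split=> //; exact: formal_add.
- by move=> _ [f [hf ->]]; exact: main.
- apply: dense_orth.
    split; first by exists (0, 0) => //; exists (fun=> 0); split=> //; exact: formal_zero.
    move=> a _ _ [_ [f [hf ->]] <-] [_ [g [hg ->]] <-].
    by exists (a *: f id + g id, a *: f T + g T) => //; exists (fun A => a *: f A + g A); split=> //; exact: formal_add.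
  move=> u h; apply: tF => w v Fw; apply: h; exists (w v, w (T v)) => //.
  exists (fun A => 0 + 1 *: w (A v)); split; first exact: formal_lin Fw (formal_zero _).
  by rewrite !add0r !scale1r.
exists x; split=> // w v Fw; have := hx (w v, w (T v)); apply.
exists (fun A => 0 + 1 *: w (A v)); split; first exact: formal_lin Fw (formal_zero _).
by rewrite !add0r !scale1r.
Qed.

End Projections.

Lemma eq_pairP (A B : Type) (p q : A * B) : p.1 = q.1 -> p.2 = q.2 -> p = q.
Proof. by case: p q => [a b] [a' b'] /= -> ->. Qed.

Section Families.
Context {R : realType}.
Implicit Types V W : rhilb R.

Lemma bop_fam n V (x : V -> V) : bop x ->
  bop ((fun f => [ffun j => x (f j)]) : famH n V -> famH n V).
Proof.
move=> bx; split=> [a u v|].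
  by apply/ffunP => j; rewrite !ffunE (bopL bx).
have [c c0 hc] := bop_bound bx; exists c => f.
rewrite -(ler_pXn2r (n := 2)) ?nnegrE ?mulr_ge0 ?nrm_ge0 ?(ltW c0) //.
rewrite exprMn !nrm_sq !famHE mulr_sumr; apply: ler_sum => j _; rewrite ffunE -!nrm_sq -exprMn.
by rewrite ler_pXn2r ?nnegrE ?mulr_ge0 ?nrm_ge0 ?(ltW c0).
Qed.

Lemma isadj_fam n V (x y : V -> V) : isadj x y ->
  isadj ((fun f => [ffun j => x (f j)]) : famH n V -> famH n V) (fun f => [ffun j => y (f j)]).
Proof. by move=> xy f g; rewrite !famHE; apply: eq_bigr => j _; rewrite !ffunE xy. Qed.

Lemma bop_pair V W (x : V -> V) (y : W -> W) : bop x -> bop y ->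
  bop ((fun p => (x p.1, y p.2)) : prodH V W -> prodH V W).
Proof.
move=> bx by_; split=> [a u v|]; first by rewrite /= (bopL bx) (bopL by_).
have [c c0 hc] := bop_bound bx; have [d d0 hd] := bop_bound by_.
exists (c + d) => v; apply: le_trans (nrm_prod _) _; rewrite mulrDl; apply: lerD.
  by apply: le_trans (hc _) _; rewrite ler_pM2l // nrm_fst.
by apply: le_trans (hd _) _; rewrite ler_pM2l // nrm_snd.
Qed.

Lemma isadj_pair V W (x x' : V -> V) (y y' : W -> W) : isadj x x' -> isadj y y' ->
  isadj ((fun p => (x p.1, y p.2)) : prodH V W -> prodH V W) (fun p => (x' p.1, y' p.2)).
Proof. by move=> xx yy p q; rewrite !prodHE /= xx yy. Qed.

End Families.

(** * Separation by intertwiners and the bicommutant of rho(M) *)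

Section Intertwiners.
Context {R : realType} {H K : hilbert R} {M : set (H -> H)} {phi : (H -> H) -> \bar R}
  {Lambda : (H -> H) -> K} {rho : (H -> H) -> K -> K}.
Hypothesis fM : von_neumann_factor M.
Hypothesis wphi : nsf_weight M phi.
Hypothesis gnsM : gns M phi Lambda rho.
Let vM : von_neumann_algebra M := fM.1.
Implicit Types x y z : H -> H.

Definition intertwiner (v : K -> H) : Prop := cop v /\ forall x, M x -> forall k, v (rho x k) = x (v k).

Let E : set (rh K) := [set k | forall v, intertwiner v -> v k = 0].

Lemma scalar_mem (a : R[i]) : M (fun v => a *: v).
Proof.
have := vn_lin vM (a - 1) (vn_id vM) (vn_id vM); rewrite (_ : (fun v => _) = fun v => a *: v) //.
by apply/funext => v; rewrite scalerBl scale1r subrK.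
Qed.

Lemma rho_scalar (a : R[i]) : rho (fun v => a *: v) = fun k => a *: k.
Proof.
have := rho_lin vM wphi gnsM (a - 1) (vn_id vM) (vn_id vM).
rewrite (rho_id vM gnsM) (_ : (fun v : H => _) = fun v => a *: v).
  by move=> ->; apply/funext => k; rewrite scalerBl scale1r subrK.
by apply/funext => v; rewrite scalerBl scale1r subrK.
Qed.

Lemma annihilated_lsub : lsub E.
Proof.
split=> [v [[bv _] _]|a u w hu hw v hv]; first exact: (bop0 bv).
by have [[bv _] _] := hv; rewrite (bopL bv) hu // hw // scaler0 addr0.
Qed.

Lemma annihilated_closed : clos E `<=` E.
Proof.
move=> k /clos_seq [u hu cu] v hv; have [[bv _] _] := hv.
by have := bop_cv bv cu; under eq_fun do rewrite hu //; move/(cv_unique (cv_cst _)).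
Qed.

Lemma annihilated_rho x k : M x -> E k -> E (rho x k).
Proof.
by move=> Mx hk v hv; rewrite hv.2 // hk //; have [bx _] := vn_cop vM Mx; exact: (bop0 bx).
Qed.

Let V1 n := prodH (famH n (rh H)) (famH n (rh H)).
Let V2 := prodH (rh K) (rh K).
Let X := {x | M x}.
Let D1 n (x : X) : V1 n -> V1 n := fun p => ([ffun j => sval x (p.1 j)], [ffun j => sval x (p.2 j)]).
Let D2 (x : X) : V2 -> V2 := fun p => (rho (sval x) p.1, rho (sval x) p.2).

(** The matrix entries of v are intertwiners from K to H. They are a priori only real linear;
    commuting with the scalars in M makes them complex linear. *)
Lemma annihilated_kill n (v : V2 -> V1 n) k h : E k -> E h -> bop v ->
  (forall s p, v (D2 s p) = D1 s (v p)) -> v (k, h) = 0.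
Proof.
move=> Ek Eh bv vD.
have it (pi : V1 n -> rh H) (io : rh K -> V2) : bop pi -> bop io ->
    (forall s p, pi (D1 s p) = sval s (pi p)) -> (forall s q, io (rho (sval s) q) = D2 s (io q)) ->
    intertwiner (pi \o v \o io).
  move=> bp bi hp hi; have key x q : M x -> pi (v (io (rho x q))) = x (pi (v (io q))).
    by move=> Mx; have := hi (exist _ _ Mx) q => /= ->; rewrite vD hp.
  split=> [|x Mx q]; last exact: key.
  split=> [|q]; first exact: bop_comp (bop_comp bp bv) bi.
  by rewrite /= /imul -key; [rewrite rho_scalar|exact: scalar_mem].
have bi1 : bop ((fun q => (q, 0)) : rh K -> V2).
  split=> [a u w|].
    by transitivity ((a *: u + w, a *: 0 + 0) : V2); first by rewrite scaler0 addr0.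
  by exists 1 => w; rewrite mul1r; apply: le_nrm; rewrite prodHE /= ip0l addr0.
have bi2 : bop ((fun q => (0, q)) : rh K -> V2).
  split=> [a u w|].
    by transitivity ((a *: 0 + 0, a *: u + w) : V2); first by rewrite scaler0 addr0.
  by exists 1 => w; rewrite mul1r; apply: le_nrm; rewrite prodHE /= ip0l add0r.
have br (s : X) : bop (rho (sval s) : rh K -> rh K) := cop_bop (rho_cop gnsM (svalP s)).
have i1D (s : X) (q : rh K) : ((rho (sval s) q, 0) : V2) = D2 s (q, 0).
  by rewrite /D2 /= (bop0 (br s)).
have i2D (s : X) (q : rh K) : ((0, rho (sval s) q) : V2) = D2 s (0, q).
  by rewrite /D2 /= (bop0 (br s)).
have bp1 j : bop ((fun p => p.1 j) : V1 n -> rh H).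
  split=> [a u w|]; first by rewrite !ffunE.
  by exists 1 => p; rewrite mul1r; apply: le_trans (nrm_fam _ j) (nrm_fst _).
have bp2 j : bop ((fun p => p.2 j) : V1 n -> rh H).
  split=> [a u w|]; first by rewrite !ffunE.
  by exists 1 => p; rewrite mul1r; apply: le_trans (nrm_fam _ j) (nrm_snd _).
have p1D j s (p : V1 n) : (D1 s p).1 j = sval s (p.1 j) by rewrite ffunE.
have p2D j s (p : V1 n) : (D1 s p).2 j = sval s (p.2 j) by rewrite ffunE.
have -> : (k, h) = ((k, 0) : V2) + (0, h).
  by transitivity ((k + 0, 0 + h) : V2); first by rewrite addr0 add0r.
rewrite (bopD bv); set u := v _ + _.
have u1 : u.1 = 0.
  apply/ffunP => j; rewrite !ffunE.
  have h1 := Ek _ (it _ _ (bp1 j) bi1 (p1D j) i1D); have h2 := Eh _ (it _ _ (bp1 j) bi2 (p1D j) i2D).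
  by rewrite /= in h1 h2; rewrite h1 h2 addr0.
have u2 : u.2 = 0.
  apply/ffunP => j; rewrite !ffunE.
  have h1 := Ek _ (it _ _ (bp2 j) bi1 (p2D j) i1D); have h2 := Eh _ (it _ _ (bp2 j) bi2 (p2D j) i2D).
  by rewrite /= in h1 h2; rewrite h1 h2 addr0.
by rewrite [u]surjective_pairing u1 u2.
Qed.

(** Intertwiners kill (k, h), so [intertwiner_density] approximates (0, (k, h)) along the orbit of
    M. The second data g and h serve [annihilated_sa], where a functional and its adjoint are
    evaluated together. *)
Lemma annihilated_density n (f g : famH n (rh H)) k h e : E k -> E h -> 0 < e ->
  exists x, [/\ M x, forall j, nrm (x (f j) : rh H) < e /\ nrm (x (g j) : rh H) < e,
    nrm (k - rho x k) < e & nrm (h - rho x h) < e].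
Proof.
move=> Ek Eh e0.
have bx (s : X) : bop (sval s : rh H -> rh H) := cop_bop (vn_cop vM (svalP s)).
have br (s : X) : bop (rho (sval s) : rh K -> rh K) := cop_bop (rho_cop gnsM (svalP s)).
pose st (s : X) : X := exist _ _ (vn_adj vM (svalP s)).
pose i1 : X := exist _ _ (vn_id vM).
pose mul (s r : X) : X := exist _ _ (vn_comp vM (svalP s) (svalP r)).
pose lin (a : R) (s r : X) : X := exist _ _ (vn_lin vM a%:C (svalP s) (svalP r)).
pose L : set (prodH (V1 n) V2) := [set p | exists s : X, p = (D1 s (f, g), D2 s (k, h))].
have hcl : clos L (0, (k, h)).
  apply: (@intertwiner_density _ (V1 n) V2 X (@D1 n) D2 st i1 (f, g) (k, h)).
  - by move=> s; exact: (bop_pair (bop_fam n (bx s)) (bop_fam n (bx s))).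
  - by move=> s; exact: (bop_pair (br s) (br s)).
  - by move=> s; have h1 := isadj_fam (n := n) (vn_adjP vM (svalP s)); exact: (isadj_pair h1 h1).
  - by move=> s; have h1 := rho_adj vM wphi gnsM (svalP s); exact: (isadj_pair h1 h1).
  - by apply: eq_pairP; apply/ffunP => j; rewrite ffunE.
  - by rewrite /D2 /= (rho_id vM gnsM).
  - split.
      exists (lin (-1) i1 i1); rewrite /D1 /D2 /=; have e1 := rho_lin vM wphi gnsM (-1)%:C (vn_id vM) (vn_id vM).
      have z (U : hilbert R) (u : U) : (-1)%:C *: u + u = 0 by rewrite rmorphN1 scaleN1r addNr.
      rewrite e1 (rho_id vM gnsM) !z.
      have zf (f' : famH n (rh H)) : [ffun j => (-1)%:C *: (f' j : H) + (f' j : H)] = 0 :> famH n (rh H).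
        by apply/ffunP => j; rewrite !ffunE z.
      by rewrite !zf.
    move=> a _ _ [s ->] [r ->]; exists (lin a s r); rewrite /D1 /D2 /= (rho_lin vM wphi gnsM _ (svalP s) (svalP r)).
    by apply: eq_pairP => //; apply: eq_pairP; apply/ffunP => j; rewrite !ffunE.
  - move=> s _ [r ->]; exists (mul s r); rewrite /D1 /D2 /= (rho_comp vM wphi gnsM (svalP s) (svalP r)).
    by apply: eq_pairP => //; apply: eq_pairP; apply/ffunP => j; rewrite !ffunE.
  - by move=> v bv vD; exact: (annihilated_kill Ek Eh bv vD).
have [_ [s ->] hs] := hcl e e0; exists (sval s); split; first exact: svalP.
- move=> j; have h0 := nrm_fst ((0, (k, h)) - (D1 s (f, g), D2 s (k, h)) : prodH (V1 n) V2).
  have {}h0 := le_lt_trans h0 hs; rewrite /= sub0r nrmN in h0; split.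
    have := le_lt_trans (nrm_fst (D1 s (f, g) : V1 n)) h0 => /(le_lt_trans (nrm_fam _ j)).
    by rewrite ffunE.
  have := le_lt_trans (nrm_snd (D1 s (f, g) : V1 n)) h0 => /(le_lt_trans (nrm_fam _ j)).
  by rewrite ffunE.
- have h0 := nrm_snd ((0, (k, h)) - (D1 s (f, g), D2 s (k, h)) : prodH (V1 n) V2).
  have {}h0 := le_lt_trans h0 hs; rewrite /= in h0.
  exact: (le_lt_trans (nrm_fst ((k, h) - D2 s (k, h) : V2)) h0).
have h0 := nrm_snd ((0, (k, h)) - (D1 s (f, g), D2 s (k, h)) : prodH (V1 n) V2).
have {}h0 := le_lt_trans h0 hs; rewrite /= in h0.
exact: (le_lt_trans (nrm_snd ((k, h) - D2 s (k, h) : V2)) h0).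
Qed.

Let sa (b : H -> H) := M b /\ symm (b : rh H -> rh H).

Lemma adj_sa b : sa b -> adj b = b.
Proof. by move=> [Mb sb]; exact: (adj_eq (vn_cop vM Mb) sb). Qed.

(* Density in the self-adjoint part: a vector orthogonal to it would give a hermitian functional
   vanishing on M. *)
Lemma annihilated_sa n (f : famH n (rh H)) k e : E k -> 0 < e ->
  exists b, [/\ sa b, forall j, nrm (b (f j) : rh H) < e & nrm (k - rho b k) < e].
Proof.
move=> Ek e0.
pose L : set (prodH (famH n (rh H)) (rh K)) :=
  [set p | exists b, sa b /\ p = ([ffun j => b (f j)], rho b k)].
have sa_lin (a : R) b b' : sa b -> sa b' -> sa (fun v => a%:C *: b v + b' v).
  move=> [Mb sb] [Mb' sb']; split; first exact: vn_lin.
  by move=> v w; rewrite -!rh_scale ipDl ipDr ipZl ipZr sb sb'.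
have lin1 (a : R) b b' : sa b -> sa b' ->
    ([ffun j => a%:C *: b (f j) + b' (f j)], rho (fun v => a%:C *: b v + b' v) k) =
    a *: (([ffun j => b (f j)], rho b k) : prodH (famH n (rh H)) (rh K)) + ([ffun j => b' (f j)], rho b' k).
  move=> [Mb _] [Mb' _]; rewrite (rho_lin vM wphi gnsM _ Mb Mb'); apply: eq_pairP => //.
  by apply/ffunP => j; rewrite !ffunE.
have sid : sa id by split; [exact: vn_id|].
have hL : lsub L.
  split=> [|a _ _ [b [hb ->]] [b' [hb' ->]]]; last first.
    by exists (fun v => a%:C *: b v + b' v); split; [exact: sa_lin|rewrite lin1].
  exists (fun v => (-1)%:C *: v + v); split; first exact: (sa_lin (-1) id id).
  by rewrite (lin1 (-1) id id) // scaleN1r addNr.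
suff h : clos L (0, k).
  have [_ [b [sb ->]] hs] := h e e0; exists b; split=> //.
    move=> j; have h0 := nrm_fst ((0, k) - ([ffun j => b (f j)], rho b k) : prodH (famH n (rh H)) (rh K)).
    have {}h0 := le_lt_trans h0 hs; rewrite /= sub0r nrmN in h0.
    by have := le_lt_trans (nrm_fam _ j) h0; rewrite ffunE.
  have h0 := nrm_snd ((0, k) - ([ffun j => b (f j)], rho b k) : prodH (famH n (rh H)) (rh K)).
  exact: le_lt_trans h0 hs.
have [p hp op] := projection (lsub_clos hL) (@clos_idem _ _ L) ((0, k) : prodH (famH n (rh H)) (rh K)).
pose d : prodH (famH n (rh H)) (rh K) := (0, k) - p.
have {}op : forall s, clos L s -> ip d s = 0 := op.
suff d0 : d = 0 by move/eqP: d0; rewrite subr_eq0 => /eqP ->.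
apply: (@ip_eq0 _ (prodH (famH n (rh H)) (rh K))); have -> : ip d d = ip d (0, k) by rewrite {2}/d ipBr (op _ hp) subr0.
rewrite prodHE /= ip0r add0r.
have [P [bP sP SP fP oP]] := projection_op annihilated_lsub annihilated_closed.
set g := d.1; set h := P d.2.
have dh q : E q -> ip d.2 q = ip h q.
  by move=> hq; have := oP d.2 _ hq; rewrite ipBl => /eqP; rewrite subr_eq0 => /eqP.
rewrite dh //.
have Eh : E h by exact: SP.
(* Orthogonality of d to the self-adjoint element x + x^*, with x^* moved across, is a condition on
   x alone. *)
have key x : M x -> \sum_j (ip (g j) (x (f j) : rh H) + ip (x (g j) : rh H) (f j)) +
    (ip h (rho x k : rh K) + ip (rho x h : rh K) k) = 0.
  move=> Mx; have Mx' := vn_adj vM Mx; have xx := vn_adjP vM Mx; have rr := rho_adj vM wphi gnsM Mx.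
  pose b : H -> H := fun v => 1%:C *: x v + adj x v.
  have sb : sa b.
    split; first exact: vn_lin.
    by move=> v w; rewrite /b -!rh_scale !scale1r ipDl ipDr xx (isadjC xx) addrC.
  have Lb : L ([ffun j => b (f j)], rho b k) by exists b.
  have := op _ (sub_clos Lb).
  rewrite prodHE /= famHE dh; last by apply: annihilated_rho => //; exact: sb.1.
  rewrite (rho_lin vM wphi gnsM _ Mx Mx') -rh_scale scale1r ipDr rr => h0.
  apply: etrans h0; congr (_ + _); apply: eq_bigr => j _.
  by rewrite [X in _ = ip _ X]ffunE /b -rh_scale scale1r ipDr xx.
(* The elements x m tend to 0 at f and g while rho (x m) fixes k and h in the limit, so the
   condition becomes <k, h> + <h, k> = 0; and <h, k> equals <d, d>. *)
have hseq m : exists x, [/\ M x, forall j, nrm (x (f j) : rh H) < m.+1%:R^-1 /\ nrm (x (g j) : rh H) < m.+1%:R^-1,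
    nrm (k - rho x k) < m.+1%:R^-1 & nrm (h - rho x h) < m.+1%:R^-1].
  by apply: annihilated_density => //; rewrite invr_gt0.
have [x hx] := choice hseq.
have cvx L' (u : nat -> rh L') l : (forall m, nrm (l - u m) < m.+1%:R^-1) -> cv u l.
  move=> hu; apply: (cv_squeeze (f := fun m => m.+1%:R^-1)) => [m|]; last exact: invS_cvg0.
  by rewrite nrmB; exact: ltW.
have c1 j : cv (fun m => x m (f j) : rh H) 0.
  by apply: cvx => m; rewrite sub0r nrmN; have [_ /(_ j) []] := hx m.
have c2 j : cv (fun m => x m (g j) : rh H) 0.
  by apply: cvx => m; rewrite sub0r nrmN; have [_ /(_ j) []] := hx m.
have c3 : cv (fun m => rho (x m) k : rh K) k by apply: cvx => m; have [] := hx m.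
have c4 : cv (fun m => rho (x m) h : rh K) h by apply: cvx => m; have [] := hx m.
have c5 := rcvD (rcv_sum (r := index_enum 'I_n) (fun j => rcvD (cv_ip (w := g j) (c1 j)) (cv_ip (w := f j) (c2 j))))
  (rcvD (cv_ip (w := h) c3) (cv_ip (w := k) c4)).
have : \sum_(j <- index_enum 'I_n) (ip 0 (g j) + ip 0 (f j)) + (ip k h + ip h k) = 0.
  apply: cvgR_unique c5 _; rewrite (_ : (fun n => _) = fun=> 0); first exact: cvg_cst.
  apply/funext => m; have [Mx _ _ _] := hx m; rewrite -[RHS](key _ Mx); congr (_ + (_ + _)); last by rewrite ipC.
  by apply: eq_bigr => j _; rewrite [ip (g j) _]ipC.
rewrite big1 => [|j _]; last by rewrite !ip0l addr0.
rewrite (ipC k); lra.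
Qed.

Theorem intertwiner_separate k : (forall v, intertwiner v -> v k = 0) -> k = 0.
Proof.
move=> Ek; apply/eqP; apply/negPn/negP => kn0.
have np : 0 < nrm (k : rh K).
  rewrite lt_def nrm_ge0 andbT; apply: contra kn0 => /eqP h.
  by apply/eqP; exact: (@nrm_eq0 _ (rh K) _ h).
have [d dd] := separable_seq H.
(* The bound 2^-n is for [resolvent_seq]; the bound |k| / 4 keeps rho (b n) k close to k uniformly
   in n. *)
pose e n : R := Num.min (2^-1 ^+ n) (nrm (k : rh K) / 4).
have ep n : 0 < e n by rewrite lt_min exprn_gt0 ?invr_gt0 ?divr_gt0.
have ex n : exists b, [/\ sa b, forall j : 'I_n.+1, nrm (b (([ffun i => d (val i)] : famH n.+1 (rh H)) j) : rh H) < e n &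
    nrm ((k : rh K) - rho b k) < e n] := annihilated_sa _ Ek (ep n).
have [b hb] := choice ex.
have Mb n : M (b n) by have [[]] := hb n.
have sb n : symm (b n : rh H -> rh H) by have [[]] := hb n.
have bd j n : (j <= n)%N -> ip (b n (d j) : rh H) (b n (d j)) <= 2^-1 ^+ n.
  move=> hj; have [_ /(_ (inord j)) + _] := hb n; rewrite ffunE /= inordK ?ltnS // => h.
  have h1 : nrm (b n (d j) : rh H) <= 2^-1 ^+ n by apply/ltW/(lt_le_trans h); rewrite ge_min lexx.
  have h2 : (2^-1 ^+ n : R) <= 1 by rewrite exprn_ile1 ?invr_ge0 // invf_le1 // ler1n.
  rewrite -nrm_sq expr2; apply: le_trans (ler_pM (nrm_ge0 _) (nrm_ge0 _) h1 h1) _.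
  by rewrite ler_piMr // exprn_ge0 // invr_ge0.
have [w [r [pw iw lw hr]]] := resolvent_seq vM Mb sb dd bd.
have := rho_normal vM wphi gnsM pw iw (vn_id vM) lw k; rewrite (rho_id vM gnsM) => lim.
(* Put t = (1 + B^2)^-1 z and B z = z - de with |de| <= |z| / 4. Adding |t - (z + de) / 2|^2 >= 0
   and |B t - z / 2|^2 >= 0 gives <t, z> <= (|z + de|^2 + |z|^2) / 4, and 41 / 64 = ((5 / 4)^2 + 1)
   / 4. Being below 1, it contradicts rho (w m) k tending to k. *)
have bnd m : ip (rho (w m) k : rh K) k <= 41 / 64 * ip (k : rh K) k.
  have [Mr wr re] := hr m; have Mw : M (w m) by case: (pw m).
  apply: le_trans (le_opP (rho_mono vM wphi gnsM Mw Mr wr) k) _.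
  pose B := rho (b m); pose t : rh K := rho (r m) k; pose z : rh K := k; pose de : rh K := z - B z.
  have hB : symm (B : rh K -> rh K) by have := rho_adj vM wphi gnsM (Mb m); rewrite adj_sa.
  have et : t + B (B t) = z.
    have -> : z = rho id k by rewrite (rho_id vM gnsM).
    have -> : id = fun v : H => 1 *: r m v + (b m \o (b m \o r m)) v.
      by apply/funext => v; rewrite scale1r /= re.
    have M1 := vn_comp vM (Mb m) Mr; have M2 := vn_comp vM (Mb m) M1.
    rewrite (rho_lin vM wphi gnsM _ Mr M2) (rho_comp vM wphi gnsM (Mb m) M1) (rho_comp vM wphi gnsM (Mb m) Mr).
    by rewrite scale1r.
  have -> : ip (rho (r m) k : rh K) k = ip t z by [].
  have hde : nrm de <= nrm z / 4.
    by have [_ _ h] := hb m; apply/ltW/(lt_le_trans h); rewrite ge_min lexx orbT.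
  have a1 : ip t z = ip t t + ip (B t : rh K) (B t) by rewrite -{1}et ipDr -hB.
  have a2 : ip (B t : rh K) z = ip t z - ip t de by rewrite hB /de ipBr opprB addrC subrK.
  clearbody de t.
  have a3 := ip_ge0 (t - 2^-1 *: (z + de)); have a4 := ip_ge0 ((B t : rh K) - 2^-1 *: z).
  have a5 : nrm de ^+ 2 <= nrm z ^+ 2 / 16.
    apply: le_trans (ler_pM (nrm_ge0 _) (nrm_ge0 _) hde hde) _; by rewrite (_ : nrm z / 4 * (nrm z / 4) = nrm z ^+ 2 / 16) //; field.
  have a6 : ip z de <= ip z z / 4.
    apply: le_trans (ip_le _ _) _; rewrite -nrm_sq expr2 -mulrA ler_wpM2l ?nrm_ge0 //.
  rewrite !nrm_sq in a5.
  move: a1 a2 a3 a4 a5 a6; rewrite !ipE (ipC z t) (ipC de t) (ipC de z) (ipC z (B t)).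
  lra.
have h1 := cv_ip (w := (k : rh K)) lim.
have h2 : ip (k : rh K) k <= 41 / 64 * ip (k : rh K) k.
  by apply: (rcv_le (N := 0)) h1 (cvg_cst _) _ => n _; exact: bnd.
have : 0 < ip (k : rh K) k by rewrite -nrm_sq exprn_gt0.
lra.
Qed.

Hypothesis K0 : exists k : K, k != 0.

Lemma central_scalar (P : rh H -> rh H) : M P -> commutant M P -> exists a : R[i], forall v : H, P v = a *: v.
Proof.
move=> MP cP; have [_ e] := fM; have : (M `&` commutant M) P by [].
by rewrite e => -[a _ <-]; exists a.
Qed.

Lemma intertwiner_commutant t v : commutant M t -> intertwiner v -> intertwiner (t \o v).
Proof.
move=> ht [cv_ iv]; split=> [|x Mx k /=]; first exact: cop_comp (commutant_cop ht) cv_.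
by rewrite iv // (commutantE _ ht Mx).
Qed.

(** The ranges of the intertwiners are stable under M and its commutant, so the projection P onto
    their orthogonal complement is central, hence scalar; P = 1 would make all intertwiners vanish,
    against [intertwiner_separate]. *)
Lemma intertwiner_total : @total R (rh K) (rh H) (fun v => intertwiner v).
Proof.
pose S : set (rh H) := [set s | exists v k, intertwiner v /\ s = v k].
pose L : set (rh H) := [set u | forall s, S s -> ip u s = 0].
have [P [bP sP SP fP oP]] := projection_op (orth_lsub S) (@orth_closed _ _ S).
have comm (x x' : rh H -> rh H) : bop x -> isadj x x' -> (forall s, S s -> S (x s)) ->
    (forall s, S s -> S (x' s)) -> forall v, P (x v) = x (P v).
  move=> bx xx hx hx'; apply: (projection_comm (orth_lsub S) bx xx SP oP) => u hu s Ss.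
    by rewrite xx; apply: hu; exact: hx'.
  by rewrite (isadjC xx); apply: hu; exact: hx.
have SM x : M x -> forall s, S s -> S (x s).
  by move=> Mx _ [v [k [hv ->]]]; exists v, (rho x k); split=> //; rewrite hv.2.
have SM' t : commutant M t -> forall s, S s -> S (t s).
  by move=> ht _ [v [k [hv ->]]]; exists (t \o v), k; split=> //; exact: intertwiner_commutant.
have PM x : M x -> forall v, P (x v) = x (P v).
  move=> Mx; apply: (comm x (adj x)); [exact: (cop_bop (vn_cop vM Mx))|exact: (vn_adjP vM Mx)|exact: SM Mx|].
  by apply: SM; exact: (vn_adj vM Mx).
have PM' t : commutant M t -> forall v, P (t v) = t (P v).
  move=> ht; have [t' ct' tt'] := cop_adj_exists (commutant_cop ht).
  apply: (comm t t'); [exact: (cop_bop (commutant_cop ht))|exact: tt'|exact: SM' ht|].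
  by apply: SM'; exact: (vn_commutant_adj vM ht tt').
have cP : cop (P : H -> H).
  by split=> // v; rewrite /imul; exact: (PM _ (scalar_mem 'i)).
have MP : M P by apply: (vn_mem vM cP).
have [a ha] : exists a : R[i], forall v : H, P v = a *: v.
  by apply: central_scalar => //; apply: commutantI.
move=> u hu; have Lu : L u by move=> _ [v [k [hv ->]]]; exact: hu.
have e1 : (a - 1) *: (u : H) = 0.
  by rewrite scalerBl scale1r; apply/eqP; rewrite subr_eq0; apply/eqP; rewrite -ha; exact: fP.
move/eqP: e1; rewrite scaler_eq0 => /orP [|/eqP //]; rewrite subr_eq0 => /eqP a1.
have [k kn0] := K0; exfalso; move/negP: kn0; apply; apply/eqP; apply: intertwiner_separate => v hv.
apply: (@ip_eq0 _ (rh H)); have := SP (v k); rewrite ha a1 scale1r; apply.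
by exists v, k.
Qed.

Lemma rho_inj x : M x -> (forall k, rho x k = 0) -> forall v, x v = 0.
Proof.
move=> Mx h v; apply: (total_eq intertwiner_total (cop_bop (vn_cop vM Mx)) (bop_cst0 _ _)) => w k hw.
by rewrite /= -hw.2 // h; have [[bw _] _] := hw; exact: (bop0 bw).
Qed.

Lemma intertwiner_adj_mul w1 w2 w1' : intertwiner w1 -> intertwiner w2 ->
  isadj (w1 : rh K -> rh H) w1' -> commutant (rho @` M) (w1' \o w2).
Proof.
move=> [c1 i1] [c2 i2] a1; apply: commutantI; first by apply: cop_comp => //; exact: cop_adj c1 a1.
move=> _ [x Mx <-] k /=; have Mx' := vn_adj vM Mx; apply: (@ip_ext _ (rh K)) => z.
rewrite (isadjC a1) i2 // (vn_adjP vM Mx) -i1 // -(isadjC a1).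
by rewrite (rho_adj vM wphi gnsM Mx).
Qed.

(** T commutes with the products w1^* w2, so it induces x on H with x w = w T. For t in the
    commutant of M, t w is again an intertwiner, hence x commutes with t. *)
Theorem rho_bicommutant (T : K -> K) : cop T ->
  (forall t, commutant (rho @` M) t -> forall k, T (t k) = t (T k)) -> exists2 x, M x & rho x = T.
Proof.
move=> [bT iT] hT; have [c c0 hc] := bop_bound bT.
have [x [bx _ hx]] : exists x : rh H -> rh H, [/\ bop x, forall v, nrm (x v) <= c * nrm v &
    forall (w : rh K -> rh H) v, intertwiner w -> x (w v) = w (T v)].
  apply: (induced_op intertwiner_total) => // [w [[]] //|w1 w2 w1' h1 h2 a1 v].
  exact: (hT _ (intertwiner_adj_mul h1 h2 a1)).
have cx : cop (x : H -> H).
  split=> // v; have bi := bop_imul H.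
  apply: (total_eq intertwiner_total (bop_comp bx bi) (bop_comp bi bx)) => w k hw /=.
  by have [[_ iw] _] := hw; rewrite -iw hx // iT iw hx.
have Mx : M x.
  apply: (vn_mem vM cx) => t ht v; have [bt _] := commutant_cop ht.
  apply: (total_eq intertwiner_total (bop_comp bx bt) (bop_comp bt bx)) => w k hw /=.
  by rewrite hx // (hx (t \o w)) //; exact: intertwiner_commutant.
exists x => //; apply/funext => k; apply/eqP; rewrite -subr_eq0; apply/eqP.
apply: intertwiner_separate => w hw; have [[bw _] iw] := hw.
by rewrite (bopB bw) iw // hx // subrr.
Qed.

Lemma rho_center (T : K -> K) : (rho @` M) T -> commutant (rho @` M) T -> exists a : R[i], forall k, T k = a *: k.
Proof.
move=> [x Mx <-] hc; have xc y : M y -> forall v, x (y v) = y (x v).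
  move=> My v; apply/eqP; rewrite -subr_eq0; apply/eqP.
  have Mxy := vn_comp vM Mx My; have Myx := vn_comp vM My Mx.
  pose d : H -> H := fun v => (-1) *: (y \o x) v + (x \o y) v.
  have Md : M d := vn_lin vM (-1) Myx Mxy.
  have rd k : rho d k = 0.
    rewrite (rho_lin vM wphi gnsM (-1) Myx Mxy) (rho_comp vM wphi gnsM My Mx) (rho_comp vM wphi gnsM Mx My).
    have ry : (rho @` M) (rho y) by exists y.
    by rewrite /= (commutantE k hc ry) scaleN1r addNr.
  by have := rho_inj Md rd v; rewrite /d /= scaleN1r addrC.
have [a ha] : exists a : R[i], forall v : H, x v = a *: v.
  by apply: central_scalar => //; apply: commutantI => //; exact: vn_cop vM _ Mx.
exists a => k; have -> : x = fun v => a *: v by apply/funext => v; exact: ha.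
by rewrite rho_scalar.
Qed.

End Intertwiners.

(** * Tomita's theorem for the GNS representation *)

Section ModularData.
Context {R : realType} {H K : hilbert R} {M : set (H -> H)} {phi : (H -> H) -> \bar R}
  {Lambda : (H -> H) -> K} {rho : (H -> H) -> K -> K} {J : K -> K}.
Hypothesis fM : von_neumann_factor M.
Hypothesis wphi : nsf_weight M phi.
Hypothesis gnsM : gns M phi Lambda rho.
Hypothesis mcJ : modular_conjugation M phi Lambda J.
Hypothesis K0 : exists k : K, k != 0.
Let vM : von_neumann_algebra M := fM.1.
Implicit Types m : H -> H.

Notation N := (square_finite M phi).
Notation Lm x := (Lambda x : rh K).
Let V := rh K.

Lemma conj_facts : [/\ bop (J : V -> V), symm (J : V -> V), (forall v : V, J (J v) = v) &
  forall v : V, J (imul v) = - imul (J v : V)].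
Proof.
have [[lJ nJ JJ] _] := mcJ.
have bJ : bop (J : V -> V).
  split=> [a u v|]; first by apply: etrans (lJ a%:C u v) _; apply: (congr1 (fun z : R[i] => z *: J u + J v)); exact: conjc_real.
  exists 1 => v; rewrite mul1r; have := nJ v; rewrite !rh_norm => /(congr1 (@complex.Re R)) /= ->.
  exact: lexx.
have iJ (u v : V) : ip (J u : V) (J v : V) = ip u v.
  have n1 (w : V) : ip (J w : V) (J w : V) = ip w w.
    by have := nJ w; rewrite !rh_norm -!nrm_sq => /(congr1 (@complex.Re R)) /= ->.
  by have := n1 (u + v); rewrite (bopD bJ) !ipE !n1 (ipC v u) (ipC (J v : V)); lra.
split=> // [u v|v]; first by rewrite -{1}[v]JJ iJ.
have h := lJ 'i v 0; have J0 : J 0 = 0 := bop0 bJ; rewrite !addr0 J0 addr0 in h.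
have e : conjc 'i = - 'i :> R[i] by apply/eqP; rewrite eq_complex /= oppr0 !eqxx.
by apply: etrans h _; apply: etrans (congr1 (fun z : R[i] => z *: J v) e) _; rewrite scaleNr.
Qed.

Let bJ : bop (J : V -> V). Proof. by case: conj_facts. Qed.
Let sJ : symm (J : V -> V). Proof. by case: conj_facts. Qed.
Let JJ : forall v : V, J (J v) = v. Proof. by case: conj_facts. Qed.

Let S0 : set (prodH V V) := [set p | exists x, [/\ N x, N (adj x) & p = (Lambda x, Lambda (adj x))]].
Let G0 (a b : V) : Prop := clos S0 (a, b).
Let G1 (u w : V) : Prop := forall a b, G0 a b -> ip b u = ip a w.

Lemma adj_adj x : M x -> adj (adj x) = x.
Proof.
by move=> Mx; apply: adj_eq; [exact: vn_cop vM _ (vn_adj vM Mx)|exact: (isadjC (vn_adjP vM Mx))].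
Qed.

Lemma tomita_swap a b : G0 a b -> G0 b a.
Proof.
move=> /clos_seq [u hu /cv_pair [c1 c2]]; apply/clos_seq; exists (fun n => ((u n).2, (u n).1)).
  move=> n; have [x [h1 h2 ->]] := hu n; exists (adj x); split=> //.
    by rewrite adj_adj //; exact: (N_M h1).
  by rewrite adj_adj //; exact: (N_M h1).
exact/cv_pair.
Qed.

(** The graph of Delta^(1/2) is stable under complex scalars, so it is self-adjoint for the real
    inner product too: imaginary parts are real parts after multiplication by i. *)
Lemma delta_exists : exists G : set (prodH V V), [/\ lsub G, clos G `<=` G,
  [/\ (forall p, G p -> 0 <= ip p.2 p.1), (forall p q, G p -> G q -> ip p.2 q.1 = ip p.1 q.2),
      (forall q : prodH V V, (forall p, G p -> ip p.2 q.1 = ip p.1 q.2) -> G q) &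
      forall v, clos [set p.1 | p in G] v] &
  forall a b, G0 a b <-> G (a, J b)].
Proof.
have [_ [G [[dG sG pG] tG]]] := mcJ.
have e0 a b : G0 a b <-> G (a, J b).
  have e1 : tomita_graph M phi Lambda = clos S0 by rewrite /tomita_graph closure2E.
  rewrite /G0 -e1 tG; split=> [[[p q] /= hp [<- <-]]|h]; first by rewrite JJ.
  by exists (a, J b) => //=; rewrite JJ.
have scG (z : R[i]) p : G p -> G (z *: p.1, z *: p.2).
  move=> hp; rewrite sG => q hq /=; rewrite !dotZr; congr (_ * _).
  by move: hp; rewrite {1}sG; apply.
have symG p q : G p -> G q -> ip (p.2 : V) q.1 = ip (p.1 : V) q.2.
  by move=> hp hq; move: hq; rewrite {1}sG => /(_ p hp) /(congr1 (@complex.Re R)).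
have saG (q : prodH V V) : (forall p, G p -> ip (p.2 : V) q.1 = ip (p.1 : V) q.2) -> G q.
  move=> h; rewrite sG => p hp; rewrite !dot_ip h //; congr (_ +i* _).
  have := h _ (scG 'i p hp); rewrite /= -!/(imul _) !ip_imul => h2.
  by apply: oppr_inj.
have lG : lsub (G : set (prodH V V)).
  split=> [|a u v hu hv]; apply: saG => p hp; first by rewrite !ip0r.
  by rewrite /= !ipDr !ipZr !symG.
exists G; split=> //.
- move=> q /clos_seq [u hu /cv_pair [c1 c2]]; apply: saG => p hp.
  have h1 := cv_ip (w := (p.2 : V)) c1; have h2 := cv_ip (w := (p.1 : V)) c2.
  rewrite ipC [RHS]ipC; apply: cvgR_unique h1 _.
  by rewrite (_ : (fun n => _) = fun n => ip (u n).2 (p.1 : V)) //; apply/funext => n; rewrite ipC symG // ipC.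
- split=> //; last exact: ((denseE _).1 dG).
  by move=> p /pG; rewrite dot_ip lecE /= => /andP [].
Qed.

Definition tau_pair (T C : V -> V) : Prop :=
  [/\ [/\ bop T, bop C, symm T & symm C],
    [/\ (forall v, J (T v) = (J v : V) - T (J v)), (forall v, J (C v) = C (J v)), (forall v, T (C v) = C (T v)) &
        (forall v, C (C v) = T (v - T v))],
    [/\ (forall v, 0 <= ip (C v) v) & (forall v, C v = 0 -> v = 0)] &
    [/\ (forall v, G0 (T v) (J (C v))), (forall v, G0 (C v) (J (v - T v))),
        (forall v, G1 (v - T v) (J (C v))) & (forall v, G1 (C v) (J (T v)))]].

(** For the graph of D^(1/2), self-adjointness identifies the bounded transforms: c = a = (1 + D)^-1
    and Z = Y = D^(1/2) (1 + D)^-1. As S is its own inverse, J D^(1/2) J = D^(-1/2), and uniqueness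
    of the decomposition gives the relations with J. *)
Lemma tau_pair_exists : exists T C, tau_pair T C.
Proof.
have [G [lG cG [pG symG saG dG] eG]] := delta_exists.
have JG (a b : V) : G (a, b) -> G (J b, J a).
  by move=> h; have /eG : G0 a (J b) by [apply/eG; rewrite JJ]; move=> h2; apply/eG/tomita_swap/eG; rewrite JJ.
have [a [c [Y [Z D]]]] := gdec_exists lG cG.
have ca v : c v = a v /\ Z v = Y v.
  apply: (gd_uniq lG D).
    by apply: saG => p hp /=; have := gd_orth2 D v hp; rewrite !(ipC p.2) !(ipC p.1).
  by move=> g hg; have /= := symG _ _ (gd_in2 D v) hg.
have jv v : J (Y v) = Y (J v) /\ J (v - a v) = a (J v).
  have [||e1 e2] := gd_uniq2 lG D (w := (J v : V)) (x := J (Y v)) (y := J (v - a v)).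
  - by rewrite -(bopB bJ) subKr; exact: JG (gd_in1 D v).
  - move=> g hg; rewrite !sJ.
    have hg' : G (J g.2, J g.1) by apply: JG; case: g hg.
    by have := gd_orth1 D v hg'.
  by rewrite e1 e2; have [-> ->] := ca (J v).
have ba := gd_bop_a lG D; have bY := gd_bop_Y lG D; have sa := gd_sym_a D.
have YZ w : Y (Y w) = a (w - a w).
  by have := gd_YZ D w; have [-> _] := ca w; have [_ ->] := ca w; have [-> _] := ca (w - a w).
exists a, Y; split.
- split=> // v w; have := gd_adj D v w; by have [_ ->] := ca w.
- split=> // v; [|by case: (jv v)|].
    by have [_ h] := jv v; rewrite -h (bopB bJ) subKr.
  by rewrite (gd_Ya D) ; have [-> _] := ca (Y v).
- split=> v.
    have h1 := pG _ (gd_in1 D v); have h2 := pG _ (gd_in2 D v).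
    have [e1 e2] := ca v; rewrite /= e1 e2 in h1 h2.
    by move: h1 h2; rewrite ipBl (ipC v) (ipC (a v)); lra.
  move=> Yv; have [e1 e2] := ca v.
  have h1 := gd_in1 D v; have h2 := gd_in2 D v; rewrite e1 e2 Yv in h1 h2.
  have sv (w : V) : G (0, w) -> w = 0.
    move=> hw; apply: (orth_dense dG) => _ [p hp <-].
    by have := symG _ _ hw hp; rewrite /= ip0l.
  have av : a v = 0 by have := JG _ _ h1; rewrite (bop0 bJ) => /sv h; rewrite -[a v]JJ h (bop0 bJ).
  by have := sv _ h2; rewrite av subr0.
split=> v.
- by apply/eG; rewrite JJ; exact: gd_in1 D v.
- by apply/eG; rewrite JJ; have := gd_in2 D v; have [-> ->] := ca v.
- move=> p q /eG h; have /= := gd_orth2 D (J v) h; have [-> ->] := ca (J v); have [<- <-] := jv v.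
  by rewrite [ip p _]ipC => ->; rewrite sJ JJ ipC.
- move=> p q /eG h; have /= := gd_orth1 D (J v) h; have [<- e] := jv v.
  have -> : (J v : V) - a (J v) = J (a v) by rewrite -e -(bopB bJ) subKr.
  by rewrite [ip p _]ipC => ->; rewrite !sJ JJ ipC.
Qed.

Lemma N_zero : N (fun=> 0).
Proof.
have M0 : M (fun=> 0).
  have := vn_lin vM (-1) (vn_id vM) (vn_id vM); rewrite (_ : (fun v : H => _) = fun=> 0) //.
  by apply/funext => v; rewrite scaleN1r addNr.
have p0 := pp_scale vM (lexx (0 : R)) (psd_sq vM M0).
have e : (0 : R)%:C \*: (adj (fun=> 0) \o (fun=> 0)) = (fun=> 0) :> (H -> H).
  by apply/funext => v; rewrite /= scale0r.
have f0 : phi (fun=> 0) = 0%E.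
  by rewrite -e (phi_scale wphi (lexx 0) (psd_sq vM M0)) mul0e.
apply: (N_dom vM wphi M0 p0); first by rewrite e f0.
by move=> v; rewrite e !ip0l.
Qed.

Lemma Lambda_zero : Lm (fun=> 0) = 0.
Proof.
have := Lambda_D gnsM N_zero N_zero.
have -> : (fun _ : H => 0 + 0 : H) = fun=> 0 by apply/funext => v; rewrite addr0.
by move=> h; apply: (@addrI V (Lm (fun=> 0))); rewrite addr0 -h.
Qed.

Lemma psd_N x : positive_part M x -> (phi x < +oo)%E -> N x.
Proof.
move=> px fx; have [Mx /positive_opE [cx sx pox]] := px.
have [c c0 hc] := bop_bound cx.1; have pc := pp_scale vM (ltW c0) px.
apply: (N_dom vM wphi Mx pc).
  rewrite (phi_scale wphi (ltW c0) px) ltey_eq fin_numM // ge0_fin_numE //.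
  exact: (phi_ge0 wphi px).
move=> v; have -> : ip ((c%:C \*: x) v : rh H) v = c * ip (x v : rh H) v by rewrite -ipZl.
apply: pos_nrm (ltW c0) cx.1 sx pox _ v => w; apply: le_trans (ip_le _ _) _.
by rewrite -nrm_sq expr2 mulrA ler_wpM2r ?nrm_ge0.
Qed.

(* The common kernel of the elements of finite weight is a central projection. *)
Lemma finite_nondegenerate (eta : rh H) : (forall x, N x -> x eta = 0) -> eta = 0.
Proof.
move=> hN; pose F := [set x | positive_part M x /\ (phi x < +oo)%E].
have [_ _ _ sf] := wphi; rewrite /semifinite_weight -/F in sf.
pose S : set (rh H) := [set s | exists x v, F x /\ s = x v].
have Fc x : F x -> [/\ M x, cop x & symm (x : rh H -> rh H)].
  by move=> [[Mx /positive_opE [cx sx _]] _].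
pose L : set (rh H) := [set u | forall s, S s -> ip u s = 0].
have [P [bP sP SP fP oP]] := projection_op (orth_lsub S) (@orth_closed _ _ S).
have Fadj x : F x -> cop x /\ F (adj x).
  by move=> Fx; have [Mx cx sx] := Fc _ Fx; rewrite (adj_eq cx sx).
have Lx x u : F x -> L u -> x u = 0.
  move=> Fx hu; have [_ _ sx] := Fc _ Fx; apply: (@ip_eq0 _ (rh H)); rewrite sx; apply: hu.
  by exists x, (x u).
have Pt t : commutant F t -> forall v, P (t v) = t (P v).
  move=> ht; have ct := commutant_cop ht; have [t' ct' tt'] := cop_adj_exists ct.
  have ht' := commutant_adj Fadj ht tt'.
  apply: (projection_comm (orth_lsub S) ct.1 tt' SP oP) => u hu _ [x [v [Fx ->]]].
    by rewrite tt' (commutantE _ ht' Fx); apply: hu; exists x, (t' v).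
  by rewrite (isadjC tt') (commutantE _ ht Fx); apply: hu; exists x, (t v).
have xP x v : F x -> x (P v) = 0 by move=> Fx; exact: (Lx _ _ Fx (SP v)).
have Px x v : F x -> P (x v) = 0.
  move=> Fx; have [_ _ sx] := Fc _ Fx; apply: (@ip_eq0 _ (rh H)).
  by rewrite sP sx xP // ip0r.
have cP : cop (P : H -> H).
  split=> // v; rewrite /imul; apply: (Pt (fun v : H => 'i *: v)).
  apply: commutantI; first exact: cop_scale.
  by move=> x Fx w; have [_ [_ ix] _] := Fc _ Fx; exact: (esym (ix w)).
have PF : commutant F P.
  by apply: (commutantI cP) => x Fx v; rewrite Px // xP.
have MP : M P.
  by rewrite -sf; apply: (commutantI cP) => t ht v; exact: (Pt t ht v).
have PM : commutant M P.
  by apply: (commutantI cP) => x; rewrite -{1}sf => hx v; rewrite (commutantE _ hx PF).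
have [a ha] := central_scalar fM MP PM.
have Le : L eta.
  by move=> _ [x [v [Fx ->]]]; have [_ _ sx] := Fc _ Fx; rewrite -sx (hN _ (psd_N Fx.1 Fx.2)) ip0l.
have e1 : (a - 1) *: (eta : H) = 0.
  by rewrite scalerBl scale1r; apply/eqP; rewrite subr_eq0; apply/eqP; rewrite -ha; exact: fP.
move/eqP: e1; rewrite scaler_eq0 => /orP [|/eqP //]; rewrite subr_eq0 => /eqP a1.
have [k /eqP kn0] := K0; exfalso; apply: kn0.
have F0 x v : F x -> x v = 0 by move=> Fx; rewrite -(scale1r v) -a1 -ha xP.
apply: (orth_dense (Lambda_dense gnsM)) => _ [x hx <-].
have Fx : F (adj x \o x) by split; [exact: psd_sq (N_M hx)|exact: hx.2].
have xx (v : rh H) : ip (x v : rh H) (x v) = 0.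
  by rewrite -(sq_quad vM v (N_M hx)); have /= -> := F0 _ v Fx; rewrite ip0l.
have : ip (Lm x) (Lm x) <= 0.
  apply: le_trans (Lambda_mono vM wphi gnsM hx N_zero _) _; last by rewrite Lambda_zero ip0l.
  by move=> v; rewrite xx ip0l.
move=> h; have /eqP : ip (Lm x) (Lm x) == 0 by rewrite eq_le h ip_ge0.
by move=> /(@ip_eq0 _ V) ->; rewrite ip0r.
Qed.

Lemma rho_nondegenerate (k : V) : (forall x, N x -> rho x k = 0) -> k = 0.
Proof.
move=> h; apply: (intertwiner_separate fM wphi gnsM) => w hw; apply: finite_nondegenerate => x hx.
have [[bw _] iw] := hw; rewrite -iw; last exact: (N_M hx).
by rewrite h // (bop0 bw).
Qed.

Let N1 (Y : V -> V) (y : V) : Prop := bop Y /\ forall x, N x -> Y (Lambda x) = rho x y.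
Let N0 (X : V -> V) (x : V) : Prop := bop X /\ forall Y y, N1 Y y -> X y = Y x.
Let Np (X : V -> V) (x : V) : Prop := exists m, [/\ N m, X = rho m & x = Lambda m].

Lemma rho_bop x : M x -> bop (rho x : V -> V).
Proof. by move=> Mx; exact: (cop_bop (rho_cop gnsM Mx)). Qed.

Lemma N1_rho Y y x : N1 Y y -> M x -> forall v, Y (rho x v) = rho x (Y v).
Proof.
move=> [bY hY] Mx; apply: (bop_eq_dense (bop_comp bY (rho_bop Mx)) (bop_comp (rho_bop Mx) bY) (Lambda_dense gnsM)).
move=> _ [z hz <-] /=; rewrite (rho_Lambda gnsM Mx hz) hY; last exact: N_left.
by rewrite (rho_comp vM wphi gnsM Mx (N_M hz)) /= hY.
Qed.

Lemma N1_left (t : V -> V) Y y : bop t -> (forall x, M x -> forall v, t (rho x v) = rho x (t v)) ->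
  N1 Y y -> N1 (t \o Y) (t y).
Proof.
move=> bt ht [bY hY]; split=> [|x hx]; first exact: bop_comp.
by rewrite /= hY // ht //; exact: N_M hx.
Qed.

Lemma N1_scale s Y y : N1 Y y -> N1 (fun v => s *: Y v) (s *: y).
Proof. by move=> h; exact: (N1_left (bop_scale s (bop_id V)) (fun x Mx v => esym (bopZ (rho_bop Mx) s v)) h). Qed.

(** For small s the bounded transforms Y and Z of the operator sending Lambda x to rho x (s u) are
    adjoint right multiplications, with vectors c (s u) and a (s w). Divided by s, the vectors are c
    u and a w, which tend to u and w with s. *)
Lemma core1 u w : G1 u w -> clos (adjpairs N1) (u, w).
Proof.
move=> huw; apply/clos_prod => e e0.
have Np_b Y y : Np Y y -> bop Y by move=> [m [hm -> _]]; exact: rho_bop (N_M hm).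
have Np0 : Np (fun=> 0) 0.
  exists (fun=> 0); have h0 := N_zero; split=> //; last by rewrite Lambda_zero.
  apply: esym; apply: (rho_ext gnsM (N_M h0) (bop_cst0 V V)) => z _.
  by rewrite -[LHS]Lambda_zero.
have Npl (a : R) X x Y y : Np X x -> Np Y y -> Np (fun v => a *: X v + Y v) (a *: x + y).
  move=> [m [hm -> ->]] [n [hn -> ->]]; exists (fun v => a%:C *: m v + n v); split.
  - exact: N_lin.
  - by rewrite (rho_lin vM wphi gnsM a%:C (N_M hm) (N_M hn)).
  - by rewrite (Lambda_lin gnsM a%:C hm hn).
have fa s X x Y y : Np X x -> Np Y y -> ip (X (s *: u)) y = ip x (Y (s *: w)).
  move=> [m [hm -> ->]] [n [hn -> ->]]; have [Mm Mn] := (N_M hm, N_M hn).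
  have [Mm' Mn'] := (vn_adj vM Mm, vn_adj vM Mn).
  rewrite (rho_adj vM wphi gnsM Mm) -(isadjC (rho_adj vM wphi gnsM Mn)).
  rewrite (rho_Lambda gnsM Mm' hn) (rho_Lambda gnsM Mn' hm) ipZl ipZr; congr (_ * _).
  have aa : adj (adj n \o m) = adj m \o n.
    apply: adj_eq; first by apply: cop_comp; [exact: vn_cop vM _ Mn'|exact: vn_cop vM _ Mm].
    exact: adj_comp (isadjC (vn_adjP vM Mn)) (vn_adjP vM Mm).
  rewrite ipC; apply: huw; apply: sub_clos; exists (adj n \o m); rewrite aa.
  by split=> //; exact: N_left.
have [x1 [y1 hy1 ex1] k1] := (Lambda_dense gnsM) u (e / 4) ltac:(lra).
have [x2 [y2 hy2 ex2] k2] := (Lambda_dense gnsM) w (e / 4) ltac:(lra).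
pose B := nrm (rho y1 w : V) + nrm (rho y2 u : V) + 1.
have B0 : 0 < B by rewrite ltr_wpDl // addr_ge0 ?nrm_ge0.
(* On y = Lambda y1 the defect y - c y is Y (rho y1 (s w)), of norm at most s |rho y1 w|; likewise
   for a with y2 and u. B dominates both norms. *)
pose s := e / 4 / B; have s0 : 0 < s by rewrite !divr_gt0.
have [G [a [c [Y [Z [lG cG D inG [hcom [hrel hinj]]]]]]]] := truncation Np_b Np0 Npl (fa s).
have [ainj G0y] : (forall v, a v = 0 -> v = 0) /\ forall y, G (0, y) -> y = 0.
  apply: hinj => v; apply: clos_mono (Lambda_dense gnsM v) => _ [m hm <-].
  by exists (rho m), m.
have comm m : M m -> [/\ forall v, a (rho m v) = rho m (a v), forall v, Y (rho m v) = rho m (Y v),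
     forall v, Z (rho m v) = rho m (Z v) & forall v, c (rho m v) = rho m (c v)].
  move=> Mm; have st n : M n -> forall X x, Np X x -> Np (rho n \o X) (rho n x).
    move=> Mn X x [z [hz -> ->]]; exists (n \o z); split; first exact: N_left.
      by rewrite (rho_comp vM wphi gnsM Mn (N_M hz)).
    by rewrite (rho_Lambda gnsM Mn hz).
  have Mm' := vn_adj vM Mm.
  exact: (hcom _ _ (rho_bop Mm) (rho_bop Mm') (st _ Mm) (st _ Mm') (rho_adj vM wphi gnsM Mm)).
have ba := gd_bop_a lG D; have bc := gd_bop_c D; have bY := gd_bop_Y lG D; have bZ := gd_bop_Z lG D.
have rel x : N x -> Y (Lambda x) = c (rho x (s *: u)) /\ Z (Lambda x) = a (rho x (s *: w)).
  by move=> hx; apply: hrel; exists x.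
have NY : N1 Y (c (s *: u)).
  by split=> // x hx; rewrite (rel _ hx).1; have [_ _ _ ->] := comm _ (N_M hx).
have NZ : N1 Z (a (s *: w)).
  by split=> // x hx; rewrite (rel _ hx).2; have [-> _ _ _] := comm _ (N_M hx).
have ss (v : V) : s^-1 *: (s *: v) = v by rewrite scalerA mulVf ?gt_eqF // scale1r.
exists (c u, a w); split.
- exists (fun v => s^-1 *: Y v), (fun v => s^-1 *: Z v); split.
  + by have := N1_scale s^-1 NY; rewrite (bopZ bc) ss.
  + by have := N1_scale s^-1 NZ; rewrite (bopZ ba) ss.
  + by move=> v z; rewrite ipZl ipZr (gd_adj D).
- have ec : nrm (Lm y1 - c (Lm y1)) < e / 4.
    have -> : Lm y1 - c (Lm y1) = Y (rho y1 (s *: w)).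
      apply/eqP; rewrite -subr_eq0; apply/eqP/G0y.
      have := lsubB lG (gd_in2 D (Lm y1)) (gd_in1 D (rho y1 (s *: w))).
      by rewrite -[_ - _]/(_, _) /= (rel _ hy1).2 subrr.
    apply: le_lt_trans (gd_contrY D _) _; rewrite (bopZ (rho_bop (N_M hy1))) nrmZ gtr0_norm //.
    rewrite /s mulrAC ltr_pdivrMr // ltr_pM2l ?divr_gt0 // /B.
    by have := nrm_ge0 (rho y2 u : V); lra.
  have ctr v : nrm (c v) <= nrm v.
    apply: sq_le_mul; rewrite ?nrm_ge0 // nrm_sq; apply: le_trans (ip_le v (c v)).
    have := gd_orth2 D v (gd_in2 D v); rewrite /= ipBr (ipC v) => h; have := ip_ge0 (Z v); lra.
  rewrite -ex1 in k1; have k3 := ctr (Lm y1 - u); rewrite (bopB bc) nrmB in k3.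
  have := nrm_tri u (Lm y1) (c u); have := nrm_tri (Lm y1) (c (Lm y1)) (c u).
  rewrite (nrmB (c (Lm y1))) /=; rewrite (nrmB (Lm y1) u) in k3; move: k1 ec k3; lra.
have ea : nrm (Lm y2 - a (Lm y2)) < e / 4.
  have -> : Lm y2 - a (Lm y2) = Z (rho y2 (s *: u)).
    apply/eqP; rewrite -subr_eq0; apply/eqP; apply: (orth_dense (Lambda_dense gnsM)) => _ [m hm <-].
    have Gm : G (Lm m, rho m (s *: u)) by apply: inG; exists m.
    by rewrite ipBl (gd_orth1 D (Lm y2) Gm) (gd_orth2 D (rho y2 (s *: u)) Gm) /= (rel _ hy2).1 subrr.
  have Zc v : nrm (Z v) <= 1 * nrm v.
    by apply: (adj_bound _ _ (gd_adj D)) => // z; rewrite mul1r; exact: gd_contrY D z.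
  apply: le_lt_trans (Zc _) _; rewrite mul1r (bopZ (rho_bop (N_M hy2))) nrmZ gtr0_norm //.
  rewrite /s mulrAC ltr_pdivrMr // ltr_pM2l ?divr_gt0 // /B.
  by have := nrm_ge0 (rho y1 w : V); lra.
have k3 := gd_contr D (Lm y2 - w); rewrite (bopB ba) nrmB in k3.
rewrite -ex2 in k2; have := nrm_tri w (Lm y2) (a w); have := nrm_tri (Lm y2) (a (Lm y2)) (a w).
rewrite (nrmB (a (Lm y2))) /=; rewrite (nrmB (Lm y2) w) in k3; move: k2 ea k3; lra.
Qed.

(** If d is the part of (a, b) orthogonal to the closed graph of S, then (d.2, - d.1) is in the
    graph of F; the hypothesis makes d orthogonal to (a, b), hence zero. *)
Lemma adj_tomita a b : (forall u w, G1 u w -> ip b u = ip a w) -> G0 a b.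
Proof.
move=> h; have lS0 : lsub S0.
  split; first by exists (fun=> 0); rewrite (adj_eq (y := fun=> 0)) ?Lambda_zero;
    [split=> //; exact: N_zero|exact: vn_cop vM _ (N_M N_zero)|move=> v w; rewrite ip0l ip0r].
  move=> r _ _ [m [hm hm' ->]] [n [hn hn' ->]].
  have e : adj (fun v => r%:C *: m v + n v) = fun v => r%:C *: adj m v + adj n v.
    apply: adj_eq; first exact: cop_lin (N_cop vM hm) (N_cop vM hn).
    move=> v w; rewrite -!rh_scale ipDl ipDr ipZl ipZr.
    by rewrite (vn_adjP vM (N_M hm)) (vn_adjP vM (N_M hn)).
  exists (fun v => r%:C *: m v + n v); rewrite e; split; try exact: N_lin.
  by rewrite !(Lambda_lin gnsM).
have lG := lsub_clos lS0; have cG := @clos_idem _ _ S0.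
have [p hp op] := projection lG cG ((a, b) : prodH V V).
pose d : prodH V V := (a - p.1, b - p.2).
have od q : clos S0 q -> ip d.1 q.1 + ip d.2 q.2 = 0 by move=> hq; exact: (op q hq).
have G1d : G1 d.2 (- d.1).
  by move=> x y hxy; have := od _ hxy; rewrite /= ipNr (ipC y) (ipC x); lra.
have h1 := h _ _ G1d; have h2 := od _ hp.
have e1 := ipBl a p.1 d.1; have e2 := ipBl b p.2 d.2; have s1 := ip_ge0 d.1; have s2 := ip_ge0 d.2.
rewrite ipNr in h1; rewrite (ipC d.1) (ipC d.2) in h2.
have [z1 z2] : ip d.1 d.1 = 0 /\ ip d.2 d.2 = 0.
  by rewrite -[a - p.1]/d.1 in e1; rewrite -[b - p.2]/d.2 in e2; split; lra.
have f1 : a = p.1 by apply/eqP; rewrite -subr_eq0; apply/eqP/ip_eq0.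
have f2 : b = p.2 by apply/eqP; rewrite -subr_eq0; apply/eqP/ip_eq0.
by rewrite /G0 f1 f2 -surjective_pairing.
Qed.

Lemma N0_rho m : N m -> N0 (rho m) (Lambda m).
Proof. by move=> hm; split=> [|Y y [_ hY]]; [exact: rho_bop (N_M hm)|rewrite hY]. Qed.

Lemma dense1 (T C : V -> V) : tau_pair T C -> forall v, clos [set y | exists Y Y' y', [/\ N1 Y y, N1 Y' y' & isadj Y Y']] v.
Proof.
move=> [[bT bC sT sC] _ [_ iC] [_ _ _ g1]] v.
apply: clos_idem; apply: clos_mono (symm_dense_range bC sC iC v) => _ [u _ <-] e e0.
have /clos_prod /(_ e e0) [[x y] [[A [B [hA hB AB]]] h _]] := core1 (g1 u).
by exists x => //; exists A, B, y.
Qed.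

(** By [N1_left], X (t y) = t (Y x) = t (X y) for the vectors y of right multiplications Y, and
    these are dense. *)
Lemma N0_commutant (T C : V -> V) : tau_pair T C -> forall X x (t : V -> V), N0 X x -> bop t ->
  (forall m, M m -> forall v, t (rho m v) = rho m (t v)) -> forall v, X (t v) = t (X v).
Proof.
move=> tp X x t [bX hX] bt ht; apply: (bop_eq_dense (bop_comp bX bt) (bop_comp bt bX) (dense1 tp)).
move=> y [Y [_ [_ [hY _ _]]]] /=; rewrite (hX _ _ hY) (hX (t \o Y)) //.
exact: N1_left bt ht hY.
Qed.

Lemma N1_adj_rho Y y Y' : N1 Y y -> isadj Y Y' -> forall m, M m -> forall v, Y' (rho m v) = rho m (Y' v).
Proof.
move=> hY YY' m Mm v; have rr := rho_adj vM wphi gnsM Mm; apply: ip_ext => z.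
by rewrite (isadjC YY') rr -(N1_rho hY (vn_adj vM Mm)) rr (isadjC YY').
Qed.

Lemma modular_pair_exists : exists T T' C, modular_pair N0 N1 G0 G1 T T' C J.
Proof.
have [T [C tp]] := tau_pair_exists; exists T, (fun v => v - T v), C.
have [[bT bC sT sC] [JT JC TC CC] [pC iC] [g0 g0' g1 g1']] := tp.
split=> //.
- move=> Y y; split=> [hY|[bY hY]].
    by split=> [|X x [bX hX]]; [case: hY|exact: (hX _ _ hY)].
  by split=> // m hm; rewrite (hY _ _ (N0_rho hm)).
- move=> X x Y y hX hY v; have [bY _] := hY; apply: (N0_commutant tp hX bY) => m Mm w.
  exact: N1_rho hY Mm w.
- move=> X x Y y Y' hX hY YY' v; have [bY _] := hY.
  by apply: (N0_commutant tp hX (adj_bop bY YY')); exact: N1_adj_rho hY YY'.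
- by move=> a b; split=> [h u w h1|]; [exact: h1|exact: adj_tomita].
- by move=> a b; apply: clos_mono => _ [m [hm hm' ->]]; exists (rho m), (rho (adj m)); split;
    [exact: N0_rho|exact: N0_rho|exact: rho_adj vM wphi gnsM _ (N_M hm)].
- exact: core1.
- move=> v hv; apply: rho_nondegenerate => m hm; exact: hv (N0_rho hm).
- move=> v hv; apply: (orth_dense (dense1 tp)) => y [Y [Y' [y' [hY hY' YY']]]].
  (* It suffices that y lies in the closure of rho(N) y, because <rho m y, v> = <Lambda m, Y^* v> =
     0. The component of y orthogonal to this closure is killed by rho(N), hence zero. *)
  pose L : set V := [set q | exists m, N m /\ q = rho m y].
  have lL : lsub L.
    split.
      exists (fun=> 0); split; first exact: N_zero.
      by have [_ h] := hY; rewrite -h ?Lambda_zero; [rewrite (bop0 hY.1)|exact: N_zero].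
    move=> r _ _ [m [hm ->]] [n [hn ->]]; exists (fun u => r%:C *: m u + n u); split; first exact: N_lin.
    by rewrite (rho_lin vM wphi gnsM _ (N_M hm) (N_M hn)).
  have [P [bP sP SP fP oP]] := projection_op (lsub_clos lL) (@clos_idem _ _ L).
  have st m : M m -> forall u, clos L u -> clos L (rho m u).
    move=> Mm u /clos_seq [q hq cq]; apply/clos_seq; exists (fun n => rho m (q n)).
      move=> n; have [z [hz ->]] := hq n; exists (m \o z); split; first exact: N_left.
      by rewrite (rho_comp vM wphi gnsM Mm (N_M hz)).
    exact: (bop_cv (rho_bop Mm) cq).
  have Pr m u : M m -> P (rho m u) = rho m (P u).
    move=> Mm; apply: (projection_comm (lsub_clos lL) (rho_bop Mm) (rho_adj vM wphi gnsM Mm) SP oP).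
      exact: st.
    by apply: st; exact: vn_adj.
  have yL : y = P y.
    apply/eqP; rewrite -subr_eq0; apply/eqP; apply: rho_nondegenerate => m hm.
    have Mm := N_M hm; rewrite (bopB (rho_bop Mm)) -Pr // fP ?subrr //.
    by apply: sub_clos; exists m.
  have := SP y; rewrite -yL => /clos_seq [q hq cq]; rewrite ipC.
  apply: cvgR_unique (cv_ip (w := v) cq) _; rewrite (_ : (fun n => _) = fun=> 0); first exact: cvg_cst.
  apply/funext => n; have [m [hm ->]] := hq n; have [_ h] := hY.
  by rewrite -h // YY' (hv _ _ hY') ip0r.
- exact: bop_sub (bop_id V) bT.
- by move=> v w; rewrite ipBl ipBr sT.
- by move=> v; rewrite addrC subrK.
Qed.

Lemma conj_cop (t : K -> K) : cop t -> cop (J \o t \o J).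
Proof.
move=> [bt it]; have [_ _ _ iJ] := conj_facts.
split=> [|v]; first exact: bop_comp (bop_comp bJ bt) bJ.
by rewrite /= iJ (bopN bt) it (bopN bJ) iJ opprK.
Qed.

Lemma isadj_conj (t t' : V -> V) : isadj t t' -> isadj (J \o t \o J : V -> V) (J \o t' \o J).
Proof. by move=> tt v w; rewrite /= sJ tt sJ. Qed.

Lemma rho_adj_image x : (rho @` M) x -> cop x /\ (rho @` M) (adj x).
Proof.
move=> [m Mm <-]; split; first exact: (rho_cop gnsM Mm).
rewrite (adj_eq (rho_cop gnsM Mm) (rho_adj vM wphi gnsM Mm)); exists (adj m) => //; exact: vn_adj.
Qed.

(** For s in the commutant, [modular_pair_commute] with z = J t J and y = s shows that J t J
    commutes with s; the bicommutant theorem for rho then applies. *)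
Theorem conj_commutant t : commutant (rho @` M) t -> exists2 m, M m & rho m = J \o t \o J.
Proof.
move=> ht; have ct := commutant_cop ht; have [T [T' [C mp]]] := modular_pair_exists.
have [T0 [C0 tp]] := tau_pair_exists.
have comm s : commutant (rho @` M) s -> forall m, M m -> forall v : V, s (rho m v) = rho m (s v).
  by move=> hs m Mm v; apply: (commutantE _ hs); exists m.
apply: (rho_bicommutant fM wphi gnsM K0 (conj_cop ct)) => s hs.
have cs := commutant_cop hs; have [s' cs' ss'] := cop_adj_exists cs.
have hs' := commutant_adj rho_adj_image hs ss'.
apply: (modular_pair_commute mp (bop_comp (bop_comp bJ ct.1) bJ) cs.1 ss').
- move=> X x hX v; rewrite /= !JJ; congr J; apply: esym.
  exact: (N0_commutant tp hX ct.1 (comm _ ht)).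
- by move=> X x hX v; apply: esym; exact: (N0_commutant tp hX cs.1 (comm _ hs)).
- by move=> X x hX v; apply: esym; exact: (N0_commutant tp hX cs'.1 (comm _ hs')).
Qed.

(** The same commutation result, for the modular pair with left and right exchanged. *)
Theorem conj_rho m : M m -> commutant (rho @` M) (J \o rho m \o J).
Proof.
move=> Mm; have cm := rho_cop gnsM Mm; have [T [T' [C mp]]] := modular_pair_exists.
apply: (commutantI (conj_cop cm)) => _ [n Mn <-].
apply: (modular_pair_commute (mp_swap mp) (bop_comp (bop_comp bJ (rho_bop Mm)) bJ) (rho_bop Mn) (rho_adj vM wphi gnsM Mn)).
- by move=> X x hX v; rewrite /= !JJ (N1_rho hX Mm).
- by move=> X x hX v; rewrite (N1_rho hX Mn).
- by move=> X x hX v; rewrite (N1_rho hX (vn_adj vM Mn)).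
Qed.

End ModularData.

(** * The modular extension *)

Section Extension.
Context {R : realType} {H K : hilbert R} {M : set (H -> H)} {phi : (H -> H) -> \bar R}
  {Lambda : (H -> H) -> K} {rho : (H -> H) -> K -> K} {J : K -> K}
  {theta : (H -> H) -> (H -> H)} {u : K -> K}.
Hypothesis fM : von_neumann_factor M.
Hypothesis wphi : nsf_weight M phi.
Hypothesis gnsM : gns M phi Lambda rho.
Hypothesis mcJ : modular_conjugation M phi Lambda J.
Hypothesis K0 : exists k : K, k != 0.
Hypothesis eth : normal_endomorphism M theta.
Hypothesis phi_theta : forall x, positive_part M x -> phi (theta x) = phi x.
Hypothesis cu : cop u.
Hypothesis uiso : forall v : K, `|u v| = `|v|.
Hypothesis uL : forall x, square_finite M phi x -> u (Lambda x) = Lambda (theta x).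
Hypothesis uJ : u \o J = J \o u.
Let gens := (theta @` M) `|` (M `&` commutant (theta @` M)).
Hypothesis genM : bicommutant gens = M.
Let vM : von_neumann_algebra M := fM.1.
Let V := rh K.
Implicit Types (x y m : H -> H) (w t : K -> K).

Let th_M x : M x -> M (theta x). Proof. by case: eth => h _ _ _ _; exact: h. Qed.
Let th_comp x y : M x -> M y -> theta (x \o y) = theta x \o theta y.
Proof. by case: eth => _ _ h _ _; exact: h. Qed.
Let th_adj x : M x -> theta (adj x) = adj (theta x).
Proof. by case: eth => _ _ _ h _; exact: h. Qed.
Let bJ : bop (J : V -> V). Proof. by case: (conj_facts mcJ). Qed.
Let JJ : forall v : V, J (J v) = v. Proof. by case: (conj_facts mcJ). Qed.

Lemma theta_square_finite x : square_finite M phi x -> square_finite M phi (theta x).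
Proof.
move=> [Mx fx]; split; first exact: th_M.
by rewrite -th_adj // -th_comp //; [rewrite phi_theta //; exact: psd_sq|exact: vn_adj].
Qed.

Definition modular_intertwiner w : Prop :=
  [/\ cop w, forall x, M x -> forall k, w (rho x k) = rho (theta x) (w k) &
    forall x, M x -> forall k, w (J (rho x (J k))) = J (rho (theta x) (J (w k)))].

Lemma isometry_intertwiner : modular_intertwiner u.
Proof.
have ur x : M x -> forall k : V, u (rho x k) = rho (theta x) (u k).
  move=> Mx; have br := rho_bop gnsM Mx; have br' := rho_bop gnsM (th_M Mx).
  apply: (bop_eq_dense (bop_comp cu.1 br) (bop_comp br' cu.1) (Lambda_dense gnsM)) => _ [y hy <-] /=.
  have hxy := N_left vM wphi Mx hy.
  rewrite (rho_Lambda gnsM Mx hy) !uL // (rho_Lambda gnsM (th_M Mx) (theta_square_finite hy)).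
  by rewrite th_comp //; exact: N_M hy.
have uj k : u (J k) = J (u k) by have := congr1 (@^~ k) uJ.
split=> // x Mx k.
by rewrite uj (ur x Mx) uj.
Qed.

(* Tomita's theorem makes Jrho(M)J the commutant of rho(M). *)
Lemma bimodule_scalar t : cop t -> (forall x, M x -> forall k, t (rho x k) = rho x (t k)) ->
  (forall x, M x -> forall k, t (J (rho x (J k))) = J (rho x (J (t k)))) -> exists a : R[i], forall k, t k = a *: k.
Proof.
move=> ct h1 h2; apply: (rho_center fM wphi gnsM K0); last first.
  by apply: (commutantI ct) => _ [x Mx <-] k; exact: h1.
have [x Mx <-] : exists2 x, M x & rho x = t; last by exists x.
apply: (rho_bicommutant fM wphi gnsM K0 ct) => s hs k.
have [m Mm em] := conj_commutant fM wphi gnsM mcJ K0 hs.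
have es q : s q = J (rho m (J q)) by rewrite em /= !JJ.
by rewrite !es h2.
Qed.

Lemma rho_adj_eq x w w' : M x -> modular_intertwiner w -> isadj (w : V -> V) w' ->
  (forall k, w' (rho (theta x) k) = rho x (w' k)) /\
  (forall k, w' (J (rho (theta x) (J k))) = J (rho x (J (w' k)))).
Proof.
move=> Mx [cw w1 w2] ww'; have Mx' := vn_adj vM Mx; have [_ sJ _ _] := conj_facts mcJ.
have r1 := rho_adj vM wphi gnsM Mx; have r2 := rho_adj vM wphi gnsM (th_M Mx); rewrite -th_adj // in r2.
split=> k; apply: (@ip_ext _ V) => z.
  by rewrite (isadjC ww') r2 r1 (isadjC ww') w1.
by rewrite (isadjC ww') !sJ r2 r1 !sJ (isadjC ww') w2.
Qed.

Lemma modular_intertwiner_scalar w1 w2 w1' : modular_intertwiner w1 -> modular_intertwiner w2 ->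
  isadj (w1 : V -> V) w1' -> exists a : R[i], forall k, w1' (w2 k) = a *: k.
Proof.
move=> h1 h2 a1; have [c1 _ _] := h1; have [c2 i2 j2] := h2.
apply: (bimodule_scalar (cop_comp (cop_adj c1 a1) c2)) => x Mx k /=.
  by rewrite i2 //; have [e _] := rho_adj_eq Mx h1 a1.
by rewrite j2 //; have [_ e] := rho_adj_eq Mx h1 a1.
Qed.

(** The bicommutant of the generators is taken on H, while Q acts on K. For intertwiners w1 and w2
    the operator w1 Q w2^* on H commutes with the generators, hence with x; as intertwiners separate
    K, w1 and w2 can be removed. *)
Lemma generators_commute (Q : V -> V) : cop (Q : K -> K) -> (forall g, gens g -> forall k, Q (rho g k) = rho g (Q k)) ->
  forall x, M x -> forall k, Q (rho x k) = rho x (Q k).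
Proof.
move=> cQ hQ x Mx.
have gM g : gens g -> M g by move=> [[y My <-]|[//]]; exact: th_M.
have bd : bop (fun k : V => Q (rho x k) - rho x (Q k)).
  by apply: bop_sub; [exact: bop_comp cQ.1 (rho_bop gnsM Mx)|exact: bop_comp (rho_bop gnsM Mx) cQ.1].
have [d' bd' dd'] := adj_exists bd.
have iadj (w2 : V -> rh H) (w2' : rh H -> V) y : intertwiner (M := M) (rho := rho) w2 -> isadj w2 w2' -> M y -> forall h, w2' (y h) = rho y (w2' h).
  move=> [cw iw] ww' My h; apply: ip_ext => z; have My' := vn_adj vM My.
  by rewrite (isadjC ww') (vn_adjP vM My) (rho_adj vM wphi gnsM My) (isadjC ww') iw.
have key (w1 w2 : V -> rh H) (w2' : rh H -> V) : intertwiner (M := M) (rho := rho) w1 -> intertwiner (M := M) (rho := rho) w2 ->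
    isadj w2 w2' -> forall h, w1 (Q (rho x (w2' h)) - rho x (Q (w2' h))) = 0.
  move=> h1 h2 a2 h; have [c1 i1] := h1.
  have cB : cop (w1 \o Q \o w2' : H -> H) by apply: cop_comp (cop_adj h2.1 a2); exact: cop_comp.
  have hB : commutant gens (w1 \o Q \o w2' : H -> H).
    apply: (commutantI cB) => g Gg v; have Mg := gM _ Gg.
    by rewrite /= (iadj _ _ _ h2 a2 Mg) hQ // i1.
  have gx : bicommutant gens x by rewrite genM.
  have /= e := commutantE h gx hB; rewrite (bopB c1.1) -(iadj _ _ _ h2 a2 Mx) -e i1 //.
  by rewrite subrr.
have d0 k : d' k = 0.
  apply: (intertwiner_separate fM wphi gnsM) => w2 h2; have [[b2 _] _] := h2.
  have [w2' _ a2] := adj_exists b2; apply: (@ip_ext _ (rh H)) => h.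
  rewrite ip0l a2 (isadjC dd') (_ : _ - _ = 0) ?ip0r //.
  by apply: (intertwiner_separate fM wphi gnsM) => w1 h1; exact: key h1 h2 a2 h.
move=> k; apply/eqP; rewrite -subr_eq0; apply/eqP; apply: (@ip_ext _ V) => z.
by rewrite dd' d0 ip0r ip0l.
Qed.

Lemma modular_intertwiner_total : @total R V V modular_intertwiner.
Proof.
pose S : set V := [set s | exists w k, modular_intertwiner w /\ s = w k].
pose L : set V := [set q | forall s, S s -> ip q s = 0].
have [P [bP sP SP fP oP]] := projection_op (orth_lsub S) (@orth_closed _ _ S).
have comm (t t' : V -> V) : bop t -> isadj t t' -> (forall s, S s -> S (t s)) ->
    (forall s, S s -> S (t' s)) -> forall v, P (t v) = t (P v).
  move=> bt tt ht ht'; apply: (projection_comm (orth_lsub S) bt tt SP oP) => q hq s Ss.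
    by rewrite tt; apply: hq; exact: ht'.
  by rewrite (isadjC tt); apply: hq; exact: ht.
have [_ sJ _ _] := conj_facts mcJ.
have th_img x : M x -> (theta @` M) (theta x) by move=> Mx; exists x.
have fix_ t : cop t -> (forall x, M x -> forall k, t (rho (theta x) k) = rho (theta x) (t k)) ->
    (forall x, M x -> forall k, t (J (rho (theta x) (J k))) = J (rho (theta x) (J (t k)))) ->
    forall s, S s -> S (t s).
  move=> ct h1 h2 _ [w [k [[cw i1 i2] ->]]]; exists (t \o w), k; split=> //; split.
  - exact: cop_comp.
  - by move=> x Mx q /=; rewrite i1 // h1.
  - by move=> x Mx q /=; rewrite i2 // h2.
have cP : cop (P : K -> K).
  split=> // v; apply: (comm (@imul _ K) (fun v => - imul v) (bop_imul K)).
  - by move=> a b; rewrite ip_imul ipNr.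
  - by move=> _ [w [k [hw ->]]]; exists w, (imul (k : V)); split=> //; case: hw => [[_ ->]].
  - move=> _ [w [k [hw ->]]]; exists w, (- imul (k : V)); split=> //.
    by case: hw => [[bw iw] _ _]; rewrite (bopN bw) iw.
have rho_com x y : M x -> M y -> (forall v, x (y v) = y (x v)) -> forall k, rho x (rho y k) = rho y (rho x k).
  move=> Mx My h k; have := rho_comp vM wphi gnsM Mx My; have := rho_comp vM wphi gnsM My Mx.
  by rewrite (_ : x \o y = y \o x) => [-> /(congr1 (@^~ k))|]; last by apply/funext.
have Jr x y : M x -> M y -> forall k, rho x (J (rho y (J k))) = J (rho y (J (rho x k))).
  move=> Mx My k; have rx : (rho @` M) (rho x) by exists x.
  by have /= := commutantE k (conj_rho fM wphi gnsM mcJ K0 My) rx.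
have gM g : gens g -> M g by move=> [[y My <-]|[//]]; exact: th_M.
(* For g = theta x, rho g (w k) = w (rho x k). For g in the relative commutant, rho g w is itself a
   modular intertwiner. The same holds for J rho(g) J. *)
have fixg g : gens g -> (forall s, S s -> S (rho g s)) /\ (forall s, S s -> S (J (rho g (J s)))).
  case=> [[x Mx <-]|[Mg cg]].
    split=> _ [w [k [hw ->]]]; have [cw i1 i2] := hw.
      by exists w, (rho x k); rewrite i1.
    by exists w, (J (rho x (J k))); rewrite i2.
  have gx x : M x -> forall v, g (theta x v) = theta x (g v).
    by move=> Mx v; rewrite (commutantE _ cg (th_img _ Mx)).
  split; apply: fix_ => [|x Mx k|x Mx k].
  - exact: (rho_cop gnsM Mg).
  - by apply: rho_com => //; [exact: th_M|exact: gx].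
  - by apply: Jr => //; exact: th_M.
  - exact: (conj_cop mcJ (rho_cop gnsM Mg)).
  - by rewrite Jr //; exact: th_M.
  - by rewrite !JJ (rho_com g (theta x)) //; [exact: th_M|exact: gx].
have gadj g : gens g -> gens (adj g).
  case=> [[x Mx <-]|[Mg cg]]; first by left; exists (adj x); [exact: vn_adj|exact: th_adj].
  right; split; first exact: vn_adj.
  apply: (commutant_adj _ cg (vn_adjP vM Mg)) => _ [x Mx <-].
  split; first exact: vn_cop vM _ (th_M Mx).
  by exists (adj x); [exact: vn_adj|exact: th_adj].
have Pg g : gens g -> forall k, P (rho g k) = rho g (P k).
  move=> Gg; have Mg := gM _ Gg; apply: (comm _ _ (rho_bop gnsM Mg) (rho_adj vM wphi gnsM Mg)).
    by have [] := fixg _ Gg.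
  by have [] := fixg _ (gadj _ Gg).
have PJg g : gens g -> forall k, P (J (rho g (J k))) = J (rho g (J (P k))).
  move=> Gg; have Mg := gM _ Gg.
  apply: (comm _ _ (bop_comp (bop_comp bJ (rho_bop gnsM Mg)) bJ) (isadj_conj mcJ (rho_adj vM wphi gnsM Mg))).
    by have [] := fixg _ Gg.
  by have [] := fixg _ (gadj _ Gg).
have PM := generators_commute cP Pg.
have PJM x k : M x -> J (P (J (rho x k))) = rho x (J (P (J k))).
  move=> Mx; apply: (generators_commute (Q := J \o P \o J) (conj_cop mcJ cP)) => // g Gg q /=.
  by rewrite -{1}[q]JJ PJg // !JJ.
have [a ha] : exists a : R[i], forall k, P k = a *: k.
  apply: (bimodule_scalar cP) => x Mx k; first exact: PM.
  by have := PJM x (J k) Mx; rewrite !JJ => h; rewrite -[LHS]JJ h.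
move=> q hq; have Lq : L q by move=> _ [w [k [hw ->]]]; exact: hq.
have e1 : (a - 1) *: (q : K) = 0.
  by rewrite scalerBl scale1r; apply/eqP; rewrite subr_eq0; apply/eqP; rewrite -ha; exact: fP.
move/eqP: e1; rewrite scaler_eq0 => /orP [|/eqP //]; rewrite subr_eq0 => /eqP a1.
(* P = 1 would annihilate the range of the isometry u. *)
have [k /eqP kn0] := K0; exfalso; apply: kn0; apply/eqP; rewrite -normr_eq0 -uiso normr_eq0; apply/eqP.
apply: (@ip_eq0 _ V); have := SP (u k); rewrite ha a1 scale1r; apply.
by exists u, k; split=> //; exact: isometry_intertwiner.
Qed.

Definition extension (t : K -> K) : K -> K :=
  xget (fun=> 0) [set x : K -> K | cop x /\ forall w k, modular_intertwiner w -> x (w k) = w (t k)].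

Lemma extension_exists t c : cop t -> 0 < c -> (forall v : V, nrm (t v : V) <= c * nrm v) ->
  exists x : V -> V, [/\ cop (x : K -> K), forall v, nrm (x v) <= c * nrm v &
    forall w k, modular_intertwiner w -> x (w k) = w (t k)].
Proof.
move=> [bt it] c0 hc.
have [x [bx cx hx]] : exists x : V -> V, [/\ bop x, forall v, nrm (x v) <= c * nrm v &
    forall w k, modular_intertwiner w -> x (w k) = w (t k)].
  apply: (induced_op modular_intertwiner_total _ bt c0 hc) => [w [[]] //|w1 w2 w1' h1 h2 a1 v].
  have [a ha] := modular_intertwiner_scalar h1 h2 a1.
  by rewrite !ha !scale_re_im (bopD bt) !(bopZ bt) it.
exists x; split=> //; split=> // v.
apply: (total_eq modular_intertwiner_total (bop_comp bx (bop_imul K)) (bop_comp (bop_imul K) bx)) => w k hw /=.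
by have [[_ iw] _ _] := hw; rewrite -iw !hx // it iw.
Qed.

Lemma extension_uniq t (x : K -> K) : cop x -> (forall w k, modular_intertwiner w -> x (w k) = w (t k)) ->
  extension t = x.
Proof.
move=> cx hx; have [[bz _] hz] := xgetI (fun=> 0) (conj cx hx :
  [set x : K -> K | cop x /\ forall w k, modular_intertwiner w -> x (w k) = w (t k)] x).
apply/funext; apply: (total_eq modular_intertwiner_total bz cx.1) => w k hw.
by rewrite hz // hx.
Qed.

Lemma extension_spec t : cop t -> cop (extension t) /\
  forall w k, modular_intertwiner w -> extension t (w k) = w (t k).
Proof.
move=> ct; have [c c0 hc] := bop_bound ct.1; have [x [cx _ hx]] := extension_exists ct c0 hc.
by rewrite (extension_uniq cx hx).
Qed.

Lemma extension_contract t c : cop t -> 0 < c -> (forall v : V, nrm (t v : V) <= c * nrm v) ->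
  forall v : V, nrm (extension t v : V) <= c * nrm v.
Proof.
by move=> ct c0 hc; have [x [cx bx hx]] := extension_exists ct c0 hc; rewrite (extension_uniq cx hx).
Qed.

Lemma extension_lin (a : R[i]) s t : cop s -> cop t ->
  extension (fun v => a *: s v + t v) = fun v => a *: extension s v + extension t v.
Proof.
move=> cs ct; have [c1 h1] := extension_spec cs; have [c2 h2] := extension_spec ct.
apply: extension_uniq => [|w k hw]; first exact: cop_lin.
by rewrite h1 // h2 //; have [cw _ _] := hw; rewrite copL.
Qed.

Lemma extension_id : extension id = id.
Proof. by apply: extension_uniq => //; exact: cop_id. Qed.

Lemma extension_comp s t : cop s -> cop t -> extension (s \o t) = extension s \o extension t.
Proof.
move=> cs ct; have [c1 h1] := extension_spec cs; have [c2 h2] := extension_spec ct.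
by apply: extension_uniq => [|w k hw]; [exact: cop_comp|rewrite /= h2 // h1].
Qed.

(** The products w^* w2 are scalars, and t commutes with scalars; so both sides agree on the total
    set of vectors w k. *)
Lemma extension_adj t t' : cop t -> isadj (t : V -> V) t' ->
  isadj (extension t : V -> V) (extension t').
Proof.
move=> ct tt'; have ct' := cop_adj ct tt'.
have [[bE _] h1] := extension_spec ct; have [[bE' _] h2] := extension_spec ct'.
have [r br Er] := adj_exists bE.
suff -> : (extension t' : V -> V) = r by [].
apply/funext; apply: (total_eq modular_intertwiner_total bE' br) => w k hw.
apply/eqP; rewrite -subr_eq0; apply/eqP; apply: modular_intertwiner_total => w2 k2 hw2.
have [[bw _] _ _] := hw; have [w' _ ww'] := adj_exists bw.
have [a ha] := modular_intertwiner_scalar hw hw2 ww'.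
rewrite ipBl (isadjC Er) h1 // h2 // !ww' !ha !scale_re_im !ipDr !ipZr.
have [_ it] := ct; rewrite -!it -!(isadjC tt').
by rewrite subrr.
Qed.

(** For 0 <= t <= c the operator 1 - t / c is a contraction, and so is its extension by
    [extension_contract]; the form of the extension of t is therefore nonnegative. *)
Lemma extension_pos t : positive_op t -> positive_op (extension t).
Proof.
move=> /positive_opE [ct st pt]; have [ce he] := extension_spec ct.
apply/positive_opE; split=> //; first exact: extension_adj ct st.
move=> v; have [c c0 hc] := bop_bound ct.1.
pose q : K -> K := fun k => (- c^-1)%:C *: t k + id k.
have cq : cop q := cop_lin _ ct (cop_id K).
have qc k : nrm (q k : V) <= 1 * nrm (k : V).
  rewrite mul1r -(ler_pXn2r (n := 2)) ?nnegrE ?nrm_ge0 // !nrm_sq.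
  have h1 : ip (t k : V) (t k) <= c * ip (t k : V) k.
    apply: pos_nrm (ltW c0) ct.1 st pt _ k => z; apply: le_trans (ip_le _ _) _.
    by rewrite -nrm_sq expr2 mulrA ler_wpM2r ?nrm_ge0.
  have -> : ip (q k : V) (q k) = c^-1 ^+ 2 * ip (t k : V) (t k) - 2 * c^-1 * ip (t k : V) k + ip (k : V) k.
    by rewrite /q -rh_scale ipDl !ipDr !ipZl !ipZr (ipC (k : V)); ring.
  have h2 : c^-1 ^+ 2 * ip (t k : V) (t k) <= c^-1 * ip (t k : V) k.
    have -> : c^-1 * ip (t k : V) k = c^-1 ^+ 2 * (c * ip (t k : V) k) by field; rewrite gt_eqF.
    by rewrite ler_wpM2l // sqr_ge0.
  have h3 : 0 <= c^-1 * ip (t k : V) k by rewrite mulr_ge0 ?pt // invr_ge0 ltW.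
  by move: h2 h3; move: (c^-1 ^+ 2 * _) => A; lra.
have := extension_contract cq ltr01 qc v; rewrite mul1r (extension_lin _ ct (cop_id K)) extension_id => h.
have h1 := ip_le (((- c^-1)%:C *: extension t v + id v) : V) v.
have h2 : nrm (((- c^-1)%:C *: extension t v + id v) : V) * nrm (v : V) <= ip v v.
  by rewrite -nrm_sq expr2 ler_wpM2r ?nrm_ge0.
have := le_trans h1 h2; rewrite -rh_scale ipDl ipZl mulNr => h3.
have : 0 <= c^-1 * ip (extension t v : V) v by lra.
by rewrite pmulr_rge0 // invr_gt0.
Qed.

Lemma extension_mono s t : cop s -> cop t -> le_op s t -> le_op (extension s) (extension t).
Proof.
move=> cs ct h; have e : t \- s = fun v => (-1) *: s v + t v.
  by apply/funext => v; rewrite scaleN1r addrC.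
have := extension_pos h; rewrite e extension_lin // /le_op.
by rewrite (_ : (fun v => _) = extension t \- extension s) //; apply/funext => v; rewrite scaleN1r addrC.
Qed.

Lemma extension_endomorphism : normal_endomorphism bounded_ops extension.
Proof.
split.
- by move=> t /bounded_opsE /extension_spec [h _]; apply/bounded_opsE.
- by move=> a s t /bounded_opsE cs /bounded_opsE ct; exact: extension_lin.
- by move=> s t /bounded_opsE cs /bounded_opsE ct; exact: extension_comp.
- move=> t /bounded_opsE ct; have [ca aa] := adjP ct; have [ce _] := extension_spec ct.
  by apply: esym; apply: adj_eq ce (extension_adj ct aa).
move=> D s hD dD lD.
have pD t : D t -> positive_op t by move=> /hD [].
(* Normality is checked along a sequence: its strong limit passes through each w, and this
   identifies the limit of the extensions on a total set. *)
have [x [Dx ix lx]] := lub_seq pD dD lD.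
have px n : positive_op (x n) := pD _ (Dx n).
have cx n : cop (x n) by have /positive_opE [] := px n.
have /positive_opE [cs ss ps] := lub_op_positive pD dD.1 lD.
have [ce he] := extension_spec cs.
have ub t : D t -> le_op (extension t) (extension s).
  by move=> Dt; apply: extension_mono => //; [have /positive_opE [] := pD _ Dt|exact: lD.1].
have pe n : positive_op (extension (x n)) := extension_pos (px n).
have ie n : le_op (extension (x n)) (extension (x n.+1)) by exact: extension_mono.
have [c c0 hc] := bop_bound ce.1.
have [l [bl sl hl]] : exists l : V -> V, [/\ bop l, symm l & forall v, cv (fun n => extension (x n) v : V) (l v)].
  apply: (@vigier _ _ _ c) => [|n|n|n v|v|n v].
  - exact: ltW.
  - by have /positive_opE [[]] := pe n.
  - by have /positive_opE [] := pe n.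
  - exact: le_opP.
  - by have /positive_opE [_ _] := pe 0%N; exact.
  - apply: le_trans (le_opP (ub _ (Dx n)) v) _; apply: le_trans (ip_le _ _) _.
    by rewrite -nrm_sq expr2 mulrA ler_wpM2r ?nrm_ge0.
have el v : l v = extension s v.
  apply: (total_eq modular_intertwiner_total bl ce.1) => w k hw.
  have h1 := hl (w k); have [[bw _] _ _] := hw; have h2 := bop_cv bw (lx k).
  rewrite he //; apply: cv_unique h1 _; rewrite (_ : (fun n => _) = fun n => w (x n k)) //.
  by apply/funext => n; have [_ hn] := extension_spec (cx n); rewrite hn.
have lim (v : V) : cv (fun n => extension (x n) v : V) (extension s v) by rewrite -el.
have [_ [_ lub]] := seq_lub pe ie ce lim.
split=> [_ [t Dt <-]|t ht]; first exact: ub.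
by apply: lub => _ [n _ <-]; apply: ht; exists (x n).
Qed.

Lemma extension_bimodule t : commutant (rho @` M) t -> exists y, [/\ M y, rho y = J \o t \o J &
  forall x, M x -> extension (rho x \o t) = rho (theta x) \o (J \o rho (theta y) \o J)].
Proof.
move=> ht; have [y My ey] := conj_commutant fM wphi gnsM mcJ K0 ht.
exists y; split=> // x Mx; have cth z : M z -> cop (rho (theta z)).
  by move=> Mz; exact: (rho_cop gnsM (th_M Mz)).
apply: extension_uniq; first by apply: cop_comp; [exact: cth|apply: (conj_cop mcJ); exact: cth].
move=> w k [cw i1 i2] /=; have -> : t k = J (rho y (J k)) by rewrite ey /= !JJ.
by rewrite i1 // i2.
Qed.

End Extension.

Theorem theorem3p8 (R : realType) (H : hilbert R) (M : set (H -> H))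
    (phi : (H -> H) -> \bar R) (theta : (H -> H) -> (H -> H))
    (M_factor : von_neumann_factor M) (phi_nsf : nsf_weight M phi)
    (theta_endo : normal_endomorphism M theta) (theta_unital : unital theta)
    (theta_equimodular : equimodular M phi theta)
    (M_generated :
      bicommutant ((theta @` M) `|` (M `&` commutant (theta @` M))) = M) :
  modularly_extendable M theta.
Proof.
have [phi_theta [K [Lambda [rho [J [u [gnsM mcJ [bu uiso] uL uJ]]]]]]] := theta_equimodular.
exists phi; split=> //; exists K, Lambda, rho, J.
have cu : cop u by apply/bounded_opsE.
(* On K = 0 any two maps agree, and the identity serves as the extension. *)
have [K0|K0] := pselect (exists k : K, k != 0); last first.
  have triv (k : K) : k = 0 by apply/eqP/negPn/negP => h; apply: K0; exists k.
  exists id; split=> //.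
    by split=> // D s _ _ h; rewrite image_id.
  move=> t _; exists id; split; first exact: vn_id M_factor.1.
    by apply/funext => k; rewrite [LHS]triv [RHS]triv.
  by move=> x _; apply/funext => k; rewrite [LHS]triv [RHS]triv.
exists (extension (M := M) (rho := rho) (J := J) (theta := theta)); split=> //.
  exact: (extension_endomorphism M_factor phi_nsf gnsM mcJ K0 theta_endo phi_theta cu uiso uL uJ M_generated).
exact: (extension_bimodule M_factor phi_nsf gnsM mcJ K0 theta_endo phi_theta cu uiso uL uJ M_generated).
Qed.
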